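(* Write $\omega=e^{2\pi i/3}$. Every point $x\in\mathbf{H}^2_{\mathbb{C}}$ whose isotropy group in $\Gamma_3$ has $x$ as an isolated fixed point is in the $\Gamma_3$-orbit of exactly one of the following four points $p$. Write $G$ for the isotropy group of $p$, $R_G$ for the subgroup of $G$ generated by complex reflections, and $(j_1,j_2)$ for the numbers of mirrors of complex reflections of $G$ that lie in the $\Gamma_3$-orbits of the mirrors polar to $(0,1,0)$, $(1,0,1)$ respectively. (1) $p=(1,0,-1)$: $G=R_G$ has order $12$, generated by the reflections with polar vectors $(0,1,0)$ and $(1,0,1)$, with braid length $2$; $(j_1,j_2)=(1,1)$. (2) $p=(1,0,\bar\omega)$: $G=R_G$ has order $72$, generated by the reflections with polar vectors $(0,1,0)$ and $(1,-1,-\omega)$, with braid length $4$; $(j_1,j_2)=(2,6)$. (3) $p$ is the fixed point in $\mathbf{H}^2_{\mathbb{C}}$ of $M=\begin{pmatrix}\omega&\omega&1\\1&-\omega&0\\1&0&0\end{pmatrix}$: $G$ is cyclic of order $3$, generated by $M$, and $R_G$ is trivial. (4) $p$ is the fixed point in $\mathbf{H}^2_{\mathbb{C}}$ of $M=\begin{pmatrix}\omega&-1&\omega+3\\1&1&-i\sqrt3\\1&0&-i\sqrt3\end{pmatrix}$: $G$ is cyclic of order $4$, generated by $M$, and $R_G$ has order $2$, generated by the reflection with polar vector $(1,1,-\omega)$; $(j_1,j_2)=(0,1)$. In cases (3) and (4), $p$ has no representative with coordinates in $\mathbb{Q}(i\sqrt3)$.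
   Context: On $\mathbb{C}^3$ let $\langle v,w\rangle=w^*Jv$ with $J=\begin{pmatrix}0&0&1\\0&1&0\\1&0&0\end{pmatrix}$, $U(J)=\{A\in GL_3(\mathbb{C}):A^*JA=J\}$, and let $\Gamma_d=PU(J,\mathcal{O}_d)$ be the image in $PU(J)$ of $U(J)\cap GL_3(\mathcal{O}_d)$, with $\mathcal{O}_d$ the ring of integers of $\mathbb{Q}(i\sqrt d)$ ($\mathcal{O}_3=\mathbb{Z}[e^{2\pi i/3}]$). It acts on $\mathbf{H}^2_{\mathbb{C}}=\{\mathbb{C}v:\langle v,v\rangle<0\}$; a vector $v$ stands for the point $\mathbb{C}v$, and matrices stand for their classes in $PU(J)$. For $\langle w,w\rangle>0$, the mirror polar to $w$ is $\{\mathbb{C}v\in\mathbf{H}^2_{\mathbb{C}}:\langle v,w\rangle=0\}$; a complex reflection is a nontrivial finite-order element fixing such a mirror pointwise. ''The reflection with polar vector $w$'' means the generator $v\mapsto v+(e^{2\pi i/k}-1)\frac{\langle v,w\rangle}{\langle w,w\rangle}w$ of the cyclic subgroup of $\Gamma_3$ fixing pointwise the mirror polar to $w$, where $k$ is the order of that subgroup ($k=6$ if $\langle w,w\rangle=1$, $k=2$ if $\langle w,w\rangle=2$ for the vectors above). The braid length of a pair $A,B$ is the smallest $n\ge2$ such that the alternating products $ABA\cdots$ and $BAB\cdots$ with $n$ factors are equal. *)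

(* Defs.v *)
From HB Require Import structures.
From mathcomp Require Import all_boot all_order all_algebra.
From mathcomp Require Import complex.
From mathcomp Require Import all_classical all_reals all_analysis.

Set Implicit Arguments.
Unset Strict Implicit.
Unset Printing Implicit Defensive.

Import Order.TTheory GRing.Theory Num.Theory.
Import numFieldNormedType.Exports.

Local Open Scope classical_set_scope.
Local Open Scope ring_scope.
Local Open Scope card_scope.
Local Open Scope quotient_scope.
Local Open Scope sesquilinear_scope.

Section AbstractGroups.
Variable gT : groupType.
Local Open Scope group_scope.
Implicit Types (S H : set gT) (a b : gT).

Definition is_subgroup H : Prop :=
  [/\ H 1, forall a b, H a -> H b -> H (a * b) & forall a, H a -> H a^-1].

Definition generated S : set gT := smallest is_subgroup S.

(* The alternating product a b a ... with n factors. *)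
Fixpoint alternating n a b : gT :=
  if n is n'.+1 then a * alternating n' b a else 1.

Definition has_braid_length a b (n : nat) : Prop :=
  [/\ (2 <= n)%N, alternating n a b = alternating n b a &
      forall m, (2 <= m)%N -> alternating m a b = alternating m b a -> (n <= m)%N].

End AbstractGroups.

Section Matrices.
Variable R : realType.
Local Notation C := (R[i]).

Definition mx3 (a b c d e f g h k : C) : 'M[C]_3 :=
  \matrix_(i, j) nth 0 (nth [::] [:: [:: a; b; c]; [:: d; e; f]; [:: g; h; k]] i) j.

Definition cv3 (a b c : C) : 'cV[C]_3 := \col_i nth 0 [:: a; b; c] i.

(* e^{it} *)
Definition cis (t : R) : C := Complex (cos t) (sin t).

Definition omega : C := cis (2 * pi / 3).

Definition i_sqrt (d : nat) : C := Complex 0 (Num.sqrt d%:R).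

Definition imag_quad_field (d : nat) : set C :=
  [set z | exists a b : rat, z = ratr a + ratr b * i_sqrt d].

Definition ring_of_integers (d : nat) : set C :=
  [set z | imag_quad_field d z /\ integralOver (intr : int -> C) z].

Definition GL3_over (S : set C) : set 'M[C]_3 :=
  [set A | [/\ A \in unitmx, forall i j, S (A i j) & forall i j, S (invmx A i j)]].

Definition J : 'M[C]_3 := mx3 0 0 1  0 1 0  1 0 0.

(* <v, w> *)
Definition herm (v w : 'cV[C]_3) : C := (w ^t* *m J *m v) 0 0.

Definition preserves_J (A : 'M[C]_3) : bool :=
  (A \in unitmx) && (A ^t* *m J *m A == J).

Record UJ := MkUJ { UJ_val :> 'M[C]_3; UJ_valP : preserves_J UJ_val }.

HB.instance Definition _ := [isSub for UJ_val].
HB.instance Definition _ := [Choice of UJ by <:].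

Fact preserves_J1 : preserves_J 1%:M.
Proof.
by rewrite /preserves_J unitmx1 mulmx1 trmx1 map_mx1 mul1mx eqxx.
Qed.

Fact preserves_JM A B : preserves_J A -> preserves_J B -> preserves_J (A *m B).
Proof.
case/andP=> uA /eqP JA /andP[uB /eqP JB]; rewrite /preserves_J unitmx_mul uA uB /=.
apply/eqP; rewrite trmx_mul map_mxM /= -[RHS]JB -[in RHS]JA.
by rewrite !mulmxA.
Qed.

Fact preserves_JV A : preserves_J A -> preserves_J (invmx A).
Proof.
case/andP=> uA /eqP JA; rewrite /preserves_J unitmx_inv uA /=.
apply/eqP; rewrite -{1}JA !mulmxA -map_mxM -trmx_mul mulmxV //.
by rewrite trmx1 map_mx1 mul1mx -mulmxA mulmxV // mulmx1.
Qed.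

Definition UJ_one := MkUJ preserves_J1.
Definition UJ_mul (A B : UJ) := MkUJ (preserves_JM (UJ_valP A) (UJ_valP B)).
Definition UJ_inv (A : UJ) := MkUJ (preserves_JV (UJ_valP A)).

Fact UJ_mulA : associative UJ_mul.
Proof. by move=> A B D; apply: val_inj; rewrite /= mulmxA. Qed.
Fact UJ_mul1 : left_id UJ_one UJ_mul.
Proof. by move=> A; apply: val_inj; rewrite /= mul1mx. Qed.
Fact UJ_mulr1 : right_id UJ_one UJ_mul.
Proof. by move=> A; apply: val_inj; rewrite /= mulmx1. Qed.
Fact UJ_mulV : left_inverse UJ_one UJ_inv UJ_mul.
Proof. by case=> A hA; apply: val_inj; rewrite /= mulVmx //; case/andP: hA. Qed.
Fact UJ_mulrV : right_inverse UJ_one UJ_inv UJ_mul.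
Proof. by case=> A hA; apply: val_inj; rewrite /= mulmxV //; case/andP: hA. Qed.

HB.instance Definition _ :=
  isGroup.Build UJ UJ_mulA UJ_mul1 UJ_mulr1 UJ_mulV UJ_mulrV.

Definition proportional (A B : UJ) : bool :=
  `[< exists2 c : C, c != 0 & UJ_val A = c *: UJ_val B >].

Fact proportional_refl : reflexive proportional.
Proof. by move=> A; apply/asboolP; exists 1; rewrite ?oner_eq0 ?scale1r. Qed.
Fact proportional_sym : symmetric proportional.
Proof.
suff H A B : proportional A B -> proportional B A by move=> A B; apply/idP/idP; apply: H.
move=> /asboolP[c c0 e]; apply/asboolP; exists c^-1; first by rewrite invr_eq0.
by rewrite e scalerA mulVf ?scale1r.
Qed.
Fact proportional_trans : transitive proportional.
Proof.
move=> B A D /asboolP[c c0 e] /asboolP[d d0 f]; apply/asboolP.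
by exists (c * d); rewrite ?mulf_neq0 // e f scalerA.
Qed.

Canonical proportional_equiv :=
  EquivRel proportional proportional_refl proportional_sym proportional_trans.

(* The group PU(J), as the quotient of U(J) by its scalar matrices. *)
Definition PU := {eq_quot proportional}.

HB.instance Definition _ := Choice.on PU.
HB.instance Definition _ := EqQuotient.on PU.

Definition PU_one : PU := \pi_PU UJ_one.
Definition PU_mul (g h : PU) : PU := \pi_PU (UJ_mul (repr g) (repr h)).
Definition PU_inv (g : PU) : PU := \pi_PU (UJ_inv (repr g)).

Fact proportionalP (A B : UJ) :
  reflect (exists2 c : C, c != 0 & UJ_val A = c *: UJ_val B) (\pi_PU A == \pi_PU B).
Proof. by rewrite (eqmodE proportional_equiv); exact: asboolP. Qed.

Fact repr_PU (A : UJ) :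
  exists2 c : C, c != 0 & UJ_val (repr (\pi_PU A)) = c *: UJ_val A.
Proof. by apply/proportionalP; rewrite reprK. Qed.

Fact pi_PU_mul (A B : UJ) : \pi_PU (A * B)%g = PU_mul (\pi_PU A) (\pi_PU B).
Proof.
have [c c0 eA] := repr_PU A; have [d d0 eB] := repr_PU B.
apply/esym/eqP/proportionalP; exists (c * d); first by rewrite mulf_neq0.
by rewrite /= eA eB -scalemxAl -scalemxAr scalerA.
Qed.

Fact pi_PU_inv (A : UJ) : \pi_PU (A^-1)%g = PU_inv (\pi_PU A).
Proof.
have [c c0 eA] := repr_PU A; apply/esym/eqP/proportionalP; exists c^-1.
  by rewrite invr_eq0.
have /andP[uA _] := UJ_valP A.
by rewrite /= eA invmxZ // unitmxZ // unitfE.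
Qed.

Fact PU_mulA : associative PU_mul.
Proof.
elim/quotW=> A; elim/quotW=> B; elim/quotW=> D.
by rewrite -(pi_PU_mul B D) -(pi_PU_mul A B) -(pi_PU_mul A) -(pi_PU_mul _ D) mulgA.
Qed.
Fact PU_mul1 : left_id PU_one PU_mul.
Proof. by elim/quotW=> A; rewrite -pi_PU_mul mul1g. Qed.
Fact PU_mulr1 : right_id PU_one PU_mul.
Proof. by elim/quotW=> A; rewrite -pi_PU_mul mulg1. Qed.
Fact PU_mulV : left_inverse PU_one PU_inv PU_mul.
Proof. by elim/quotW=> A; rewrite -pi_PU_inv -pi_PU_mul mulVg. Qed.
Fact PU_mulrV : right_inverse PU_one PU_inv PU_mul.
Proof. by elim/quotW=> A; rewrite -pi_PU_inv -pi_PU_mul mulgV. Qed.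

HB.instance Definition _ :=
  isGroup.Build PU PU_mulA PU_mul1 PU_mulr1 PU_mulV PU_mulrV.

Definition is_class_of (A : 'M[C]_3) (g : PU) : Prop :=
  exists2 U : UJ, UJ_val U = A & \pi_PU U = g.

(* Gamma_d = PU(J, O_d), the image of the U(J)-matrices in GL_3(O_d). *)
Definition Gamma (d : nat) : set PU :=
  [set \pi_PU A | A in [set A : UJ | GL3_over (ring_of_integers d) (UJ_val A)]].

(* Points of the projective plane: the lines Cv = <[v]>, as subspaces of C^3. *)
Definition cline := {vspace 'cV[C]_3}.

Definition H2 : set cline := [set <[v]>%VS | v in [set v | herm v v < 0]].

Definition PU_act (g : PU) (x : cline) : cline :=
  (linfun (mulmx (UJ_val (repr g))) @: x)%VS.

(* PU_act does not depend on the chosen representative. *)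
Fact PU_act_line (A : UJ) (v : 'cV[C]_3) :
  PU_act (\pi_PU A) <[v]>%VS = <[UJ_val A *m v]>%VS.
Proof.
have [c c0 e] := repr_PU A.
rewrite /PU_act limg_line lfunE /= e -scalemxAl.
apply/vspaceP=> u; apply/vlineP/vlineP=> -[k ->].
  by exists (k * c); rewrite scalerA.
by exists (k / c); rewrite scalerA divfK.
Qed.

Definition Gamma_orbit (d : nat) (x : cline) : set cline := [set PU_act g x | g in Gamma d].

Definition isotropy (d : nat) (x : cline) : set PU :=
  [set g | Gamma d g /\ PU_act g x = x].

Definition fixed_points (G : set PU) : set cline :=
  [set x | H2 x /\ forall g, G g -> PU_act g x = x].

(* The projection v |-> Cv is open, so the neighbourhoods of Cv are the images
   of the neighbourhoods of v. *)
Definition isolated_fixed_point (G : set PU) (x : cline) : Prop :=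
  fixed_points G x /\
  exists2 v : 'cV[C]_3, x = <[v]>%VS &
    \forall w \near (v : 'cV[(C : numFieldType)]_3),
      fixed_points G <[w]>%VS -> <[w]>%VS = x.

(* The mirror polar to w (meaningful when <w, w> > 0). *)
Definition mirror (w : 'cV[C]_3) : set cline :=
  [set <[v]>%VS | v in [set v | herm v v < 0 /\ herm v w = 0]].

Definition fixes_pointwise (g : PU) (m : set cline) : Prop :=
  forall x, m x -> PU_act g x = x.

Definition complex_reflection_in (m : set cline) : set PU :=
  [set g | [/\ g != 1%g, exists2 n, (0 < n)%N & (g ^+ n)%g = 1%g,
               exists2 w, 0 < herm w w & m = mirror w
             & fixes_pointwise g m]].

Definition complex_reflection : set PU :=
  [set g | exists m, complex_reflection_in m g].

Definition reflection_subgroup (G : set PU) : set PU :=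
  generated (G `&` complex_reflection).

Definition mirrors_of (G : set PU) : set (set cline) :=
  [set m | exists2 g, G g & complex_reflection_in m g].

Definition mirror_orbit (d : nat) (m : set cline) : set (set cline) :=
  [set PU_act g @` m | g in Gamma d].

Definition mirror_fixer (d : nat) (m : set cline) : set PU :=
  [set g | Gamma d g /\ fixes_pointwise g m].

Definition mirrors_in_orbit (d : nat) (G : set PU) (w : 'cV[C]_3) : set (set cline) :=
  mirrors_of G `&` mirror_orbit d (mirror w).

(* g is "the reflection with polar vector w" in Gamma_d, and k is the order of
   the cyclic subgroup of Gamma_d that it generates. *)
Definition polar_reflection (d : nat) (w : 'cV[C]_3) (k : nat) (g : PU) : Prop :=
  [/\ 0 < herm w w,
      mirror_fixer d (mirror w) #= `I_k,
      mirror_fixer d (mirror w) = generated [set g]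
    & exists2 A : 'M[C]_3, is_class_of A g &
        forall v, A *m v = v + ((cis (2 * pi / k%:R) - 1) * (herm v w / herm w w)) *: w].

Definition no_rational_representative (d : nat) (x : cline) : Prop :=
  ~ exists2 v : 'cV[C]_3, x = <[v]>%VS & forall i, imag_quad_field d (v i 0).

End Matrices.

Arguments i_sqrt {R} d.
Arguments omega {R}.

(* Main.v *)
Require Import Defs.
From mathcomp Require Import all_boot all_order all_algebra.
From mathcomp Require Import complex.
From mathcomp Require Import all_classical all_reals all_analysis.
From mathcomp Require Import ring lra zify.

Import Order.TTheory GRing.Theory Num.Theory.
Local Open Scope classical_set_scope.
Local Open Scope card_scope.
Local Open Scope ring_scope.

Set Implicit Arguments.
Unset Strict Implicit.
Unset Printing Implicit Defensive.
Local Arguments omega : simpl never.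
Local Arguments cis : simpl never.

(** If x = Cv is an isolated fixed point of its isotropy group, some integral
    unitary A has v as a simple eigenvector: a group of unitary matrices all of
    whose elements repeat the eigenvalue of v in the tangent space would fix a
    whole line.  The eigenvalues l, a, b of A are unimodular with trace and
    determinant in O = Z[omega], so the discriminant of the characteristic
    polynomial leaves finitely many of these; after replacing A by a unit
    multiple or a power, either l is in O, or l = +-i, or l^3 is a primitive
    cube root of unity.  In each case a short vector for the positive definite
    form q_v(z) = <z,z> - 2 |<z,v>|^2 / <v,v>, together with the action of A, gives a
    basis of O^3 in which the Hermitian form and the line of v are standard:
    this is an element of Gamma_3 taking x to one of the four points.

    The isotropy groups are computed from the finitely many integral vectors of
    small norm orthogonal to v in the first two cases, and from the field of
    definition of l in the last two.  Their orders 12, 72, 3, 4 differ, so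
    the four orbits do. *)

(** * Complex numbers over a real closed field *)

(** The field generated by the eigenvalue $l$ over $K=\mathbb{Q}(\omega)$ decides what can stand in
    for an integral representative of the point. If $l\in K$, the line of $v$ contains a primitive
    vector, and its norm $-n$ is bounded because $n$ divides $(1-a/l)(1-b/l)$, of modulus at most 4.
    If $l=\pm i$, only the third eigenline is defined over $K$; the lattice orthogonal to it is a
    module over $O[i]$, where division with remainder works. If $l$ has order 9, no invariant line
    is defined over $K$, and the only starting point is a shortest vector $y$ for $q_v$: Mordell's
    duality argument gives $q_v(y)\le 3/2$, which leaves few Gram matrices for $y, Ay, A^2y$.

    One constant governs all the divisions: every complex number is at squared distance at most
    $1/3$ from $O$. Since $\det J=-1$, the lattice orthogonal to a primitive vector has the norm of
    that vector, up to sign, as its Gram determinant; this ties short vectors to norms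
    throughout. *)

Section Complex.
Variable R : realType.
Local Notation Re := (@complex.Re R).
Local Notation Im := (@complex.Im R).
Implicit Types (z t : R[i]) (x y : R).

(** The squared modulus, with values in [R]: estimates then stay polynomial inequalities over the
    reals. *)
Definition nm z : R := Re z ^+ 2 + Im z ^+ 2.

Lemma conjcE x y : (Complex x y)^* = Complex x (- y).
Proof. by []. Qed.

Lemma cReJ z : Re z^* = Re z.
Proof. by case: z. Qed.

Lemma cImJ z : Im z^* = - Im z.
Proof. by case: z. Qed.

Lemma cReD z t : Re (z + t) = Re z + Re t.
Proof. by case: z t => [? ?] []. Qed.

Lemma cImD z t : Im (z + t) = Im z + Im t.
Proof. by case: z t => [? ?] []. Qed.

Lemma cReN z : Re (- z) = - Re z.
Proof. by case: z. Qed.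

Lemma cImN z : Im (- z) = - Im z.
Proof. by case: z. Qed.

Lemma cReM z t : Re (z * t) = Re z * Re t - Im z * Im t.
Proof. by case: z t => [? ?] []. Qed.

Lemma cImM z t : Im (z * t) = Re z * Im t + Im z * Re t.
Proof. by case: z t => [? ?] []. Qed.

Lemma cRe1 : Re 1 = 1. Proof. by []. Qed.
Lemma cIm1 : Im 1 = 0. Proof. by []. Qed.

Lemma cRen n : Re n%:R = n%:R.
Proof. by elim: n => [|n IH] //; rewrite !mulrS cReD IH. Qed.

Lemma cImn n : Im n%:R = 0.
Proof. by elim: n => [|n IH] //; rewrite !mulrS cImD IH addr0. Qed.

Lemma rcE x : real_complex R x = Complex x 0.
Proof. by []. Qed.

Lemma complexP z t : Re z = Re t -> Im z = Im t -> z = t.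
Proof. by case: z t => [? ?] [? ?] /= -> ->. Qed.

Lemma nmE z : z * z^* = real_complex R (nm z).
Proof. by apply: complexP; rewrite ?cReM ?cImM cReJ cImJ /nm /=; ring. Qed.

Lemma nm_ge0 z : 0 <= nm z.
Proof. by rewrite addr_ge0 ?sqr_ge0. Qed.

Lemma nm_eq0 z : (nm z == 0) = (z == 0).
Proof.
rewrite /nm paddr_eq0 ?sqr_ge0 // !sqrf_eq0.
by case: z => a b /=; rewrite eq_complex.
Qed.

Lemma nm0 : nm 0 = 0. Proof. by rewrite /nm /= expr0n addr0. Qed.
Lemma nm1 : nm 1 = 1. Proof. by rewrite /nm /= expr0n addr0 expr1n. Qed.

Lemma nm_gt0 z : (0 < nm z) = (z != 0).
Proof. by rewrite lt_def nm_ge0 andbT nm_eq0. Qed.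

Lemma nmM z t : nm (z * t) = nm z * nm t.
Proof. by rewrite /nm cReM cImM; ring. Qed.

Lemma nmN z : nm (- z) = nm z.
Proof. by rewrite /nm cReN cImN; ring. Qed.

Lemma nmJ z : nm z^* = nm z.
Proof. by rewrite /nm cReJ cImJ; ring. Qed.

Lemma nmX z n : nm (z ^+ n) = nm z ^+ n.
Proof. by elim: n => [|n IH]; rewrite ?expr0 ?nm1 // !exprS nmM IH. Qed.

Lemma nmV z : nm z^-1 = (nm z)^-1.
Proof.
have [->|z0] := eqVneq z 0; first by rewrite invr0 nm0 invr0.
have nz : nm z != 0 by rewrite nm_eq0.
by apply: (mulfI nz); rewrite -nmM !mulfV // nm1.
Qed.

Lemma rc_inj x y : real_complex R x = real_complex R y -> x = y.
Proof. by move=> []. Qed.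

Lemma conjC_rc x : (real_complex R x)^* = real_complex R x.
Proof. by rewrite rcE conjcE oppr0. Qed.

Lemma nm_rc x : nm (real_complex R x) = x ^+ 2.
Proof. by rewrite /nm /= expr0n addr0. Qed.

Lemma addJ z : z + z^* = real_complex R (2 * Re z).
Proof. by apply: complexP; rewrite ?cReD ?cImD ?cReJ ?cImJ /=; ring. Qed.

Lemma real_rc z : z^* = z -> z = real_complex R (Re z).
Proof.
move=> zr; apply: complexP => //=.
by have := cImJ z; rewrite zr => /eqP; rewrite -subr_eq0 opprK -mulr2n mulrn_eq0 /= => /eqP.
Qed.

Lemma nm_eq1 z : nm z = 1 -> z * z^* = 1.
Proof. by move=> h; rewrite nmE h. Qed.

Lemma nm1_inv z : nm z = 1 -> z^* = z^-1.
Proof.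
move=> h; have z0 : z != 0 by rewrite -nm_gt0 h.
by apply: (mulfI z0); rewrite nmE h mulfV.
Qed.

(** The triangle inequality without square roots: [x] and [y] stand for bounds on the moduli, and
    Cauchy-Schwarz in the plane controls the cross term. *)
Lemma nm_sum_le x y z t : 0 <= x -> 0 <= y -> nm z <= x ^+ 2 -> nm t <= y ^+ 2 ->
  nm (z + t) <= (x + y) ^+ 2.
Proof.
move=> x0 y0; rewrite /nm cReD cImD.
case: z t => a b [c d] /= h1 h2.
have h3 : (a * c + b * d) ^+ 2 <= (x * y) ^+ 2.
  have := sqr_ge0 (a * d - b * c).
  have : (a ^+ 2 + b ^+ 2) * (c ^+ 2 + d ^+ 2) <= x ^+ 2 * y ^+ 2.
    by apply: ler_pM => //; rewrite addr_ge0 ?sqr_ge0.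
  by nra.
have h4 : a * c + b * d <= x * y.
  by apply: le_trans (ler_norm _) _; rewrite -(ger0_norm (mulr_ge0 x0 y0)) -ler_sqr ?nnegrE // -!normrX !ger0_norm ?sqr_ge0.
by nra.
Qed.

Lemma cisD x y : cis (x + y) = cis x * cis y :> R[i].
Proof. by apply: complexP; rewrite ?cReM ?cImM /= ?cosD ?sinD; ring. Qed.

Lemma nm_cis x : nm (cis x) = 1.
Proof. by rewrite /nm /= cos2Dsin2. Qed.

Lemma cis_mulrn x n : cis (x *+ n) = cis x ^+ n.
Proof.
elim: n => [|n IH]; first by rewrite /cis mulr0n cos0 sin0.
by rewrite mulrS cisD IH exprS.
Qed.

Lemma cis_2pi : cis (2 * pi) = 1 :> R[i].
Proof. by rewrite /cis mulr2n mulrDl mul1r -mulr2n cos2pi sin2pi. Qed.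

Lemma cis_pi : cis pi = -1 :> R[i].
Proof. by rewrite /cis cospi sinpi; apply: complexP; rewrite //= oppr0. Qed.

Local Notation w := (omega : R[i]).

Lemma omega3 : w ^+ 3 = 1.
Proof.
rewrite /omega -cis_mulrn -[RHS]cis_2pi; congr cis.
by rewrite -mulr_natr; field.
Qed.

Lemma sin_2pi3 : 0 < sin (2 * pi / 3 : R).
Proof.
apply: sin_gt0_pi; have := pi_gt0 R => h.
by apply/andP; split; lra.
Qed.

Lemma omega2 : w ^+ 2 = - 1 - w.
Proof.
have w1 : w - 1 != 0.
  apply/eqP => /(congr1 (@complex.Im R)); rewrite /omega /cis /= subr0 => e.
  by have := sin_2pi3; rewrite e ltxx.
have e : w ^+ 2 + w + 1 = 0.
  apply: (mulfI w1); rewrite mulr0; transitivity (w ^+ 3 - 1); first by ring.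
  by rewrite omega3 subrr.
by apply/eqP; rewrite -subr_eq0; apply/eqP; rewrite -[RHS]e; ring.
Qed.

Lemma Re_omega : Re w = - 1 / 2.
Proof.
have := congr1 (@complex.Im R) omega2; rewrite expr2 cImM !cImD !cImN.
have := sin_2pi3; rewrite /omega /=.
set c := cos _; set s := sin _ => s0 h.
have : (2 * c + 1) * s = 0 by move: h; rewrite oppr0 sub0r; lra.
by move/eqP; rewrite mulf_eq0 (gt_eqF s0) orbF => /eqP h'; lra.
Qed.

Lemma Im_omega_sqr : Im w ^+ 2 = 3 / 4.
Proof.
have := nm_cis (2 * pi / 3); rewrite -/omega /nm Re_omega; lra.
Qed.

Lemma Im_omega_gt0 : 0 < Im w. Proof. exact: sin_2pi3. Qed.

Lemma Im_omega : Im w = Num.sqrt 3 / 2.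
Proof.
have h : 0 <= Num.sqrt (3 : R) / 2 by rewrite divr_ge0 ?sqrtr_ge0.
apply/eqP; rewrite -(@eqrXn2 _ 2) ?(ltW Im_omega_gt0) // Im_omega_sqr.
by rewrite expr_div_n sqr_sqrtr //; apply/eqP; field.
Qed.

Lemma conj_omega : w^* = - 1 - w.
Proof.
apply: complexP; rewrite ?cReJ ?cImJ ?cReD ?cImD ?cReN ?cImN ?Re_omega ?cIm1; last by ring.
by rewrite cRe1; field.
Qed.

Lemma i_sqrt3 : i_sqrt 3 = 1 + 2 * w.
Proof.
apply: complexP; rewrite ?cReD ?cImD ?cReM ?cImM ?cRen ?cImn ?cRe1 ?cIm1 ?Re_omega ?Im_omega /=.
  by field.
by field.
Qed.

Lemma nm_omega : nm w = 1. Proof. exact: nm_cis. Qed.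

Lemma omega_neq0 : w != 0. Proof. by rewrite -nm_gt0 nm_omega ltr01. Qed.

Lemma cis_2pi6 : cis (2 * pi / 6) = 1 + w.
Proof.
set z := cis _.
have e : z ^+ 2 = w.
  by rewrite -cis_mulrn /omega; congr cis; rewrite -mulr_natr; field.
have s0 : 0 < Im z.
  by apply: sin_gt0_pi; have := pi_gt0 R => h; apply/andP; split; lra.
have : (z - (1 + w)) * (z + (1 + w)) = 0.
  transitivity (z ^+ 2 - (1 + 2 * w + w ^+ 2)); first by ring.
  by rewrite e omega2; ring.
move/eqP; rewrite mulf_eq0 => /orP[|] /eqP h.
  by apply/eqP; rewrite -subr_eq0 h.
have h0 : Im z + Im w = 0.
  by have := congr1 (@complex.Im R) h; rewrite !cImD /= add0r.
by move: Im_omega_gt0 => h1; clear h e; exfalso; lra.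
Qed.

Lemma cis_2pi2 : cis (2 * pi / 2) = - 1 :> R[i].
Proof. by rewrite mulrAC mulfV // mul1r cis_pi. Qed.

Lemma rcD x y : real_complex R (x + y) = real_complex R x + real_complex R y.
Proof. exact: rmorphD. Qed.
Lemma rcM x y : real_complex R (x * y) = real_complex R x * real_complex R y.
Proof. exact: rmorphM. Qed.
Lemma rcN x : real_complex R (- x) = - real_complex R x.
Proof. exact: rmorphN. Qed.
Lemma rcV x : real_complex R x^-1 = (real_complex R x)^-1.
Proof. exact: fmorphV. Qed.
Lemma rcX x n : real_complex R (x ^+ n) = real_complex R x ^+ n.
Proof. exact: rmorphXn. Qed.
Lemma rc0 : real_complex R 0 = 0. Proof. by []. Qed.
Lemma rc1 : real_complex R 1 = 1. Proof. by []. Qed.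
Lemma rcn n : real_complex R n%:R = n%:R. Proof. exact: rmorph_nat. Qed.
Lemma rcz (m : int) : real_complex R m%:~R = m%:~R. Proof. exact: rmorph_int. Qed.
Definition rcEs := (rcD, rcM, rcN, rcV, rcX, rc0, rc1, rcn, rcz).

Lemma cjD z t : (z + t)^* = z^* + t^*. Proof. exact: rmorphD. Qed.
Lemma cjM z t : (z * t)^* = z^* * t^*. Proof. exact: rmorphM. Qed.
Lemma cjN z : (- z)^* = - z^*. Proof. exact: rmorphN. Qed.
Lemma cjX z n : (z ^+ n)^* = z^* ^+ n. Proof. exact: rmorphXn. Qed.
Lemma cjV z : (z^-1)^* = (z^*)^-1. Proof. exact: fmorphV. Qed.
Lemma cj0 : (0 : R[i])^* = 0. Proof. exact: rmorph0. Qed.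
Lemma cj1 : (1 : R[i])^* = 1. Proof. exact: rmorph1. Qed.
Lemma cjn n : (n%:R : R[i])^* = n%:R. Proof. exact: rmorph_nat. Qed.
Lemma cjK z : z^* ^* = z. Proof. exact: conjCK. Qed.
Definition cjE := (cjD, cjM, cjN, cjX, cjV, cj0, cj1, cjn, cjK, conjC_rc).

End Complex.

(** Gauss's lemma: with $q=n/d$, the primitive part of $dX-n$ divides the monic polynomial [p] over
    the integers, so its leading coefficient is a unit. *)
Lemma rat_integral_int (q : rat) :
  integralOver (intr : int -> rat) q -> exists n : int, q = n%:~R.
Proof.
move=> [p pm pq].
set d := denq q; set n := numq q.
have d0 : d%:~R != 0 :> rat by rewrite intr_eq0 denq_neq0.
set l : {poly int} := d *: 'X - n%:P.
have /dvdpP_int [r pE] : l %| p.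
  rewrite -dvdp_rat_int rmorphB /= map_polyZ /= map_polyX map_polyC /=.
  have -> : d%:~R *: 'X - (n%:~R)%:P = d%:~R *: ('X - q%:P).
    rewrite scalerBr; congr (_ - _); rewrite -mul_polyC -polyCM; congr polyC.
    by rewrite -[q]divq_num_den mulrC divfK.
  by rewrite dvdpZl // dvdp_XsubCl.
have l0 : l`_0 = - n by rewrite /l coefB coefZ coefX coefC /= mulr0 sub0r.
have l1 : l`_1 = d by rewrite /l coefB coefZ coefX coefC /= mulr1 subr0.
have sl : size l = 2%N.
  rewrite /l size_polyDl ?size_scale ?denq_neq0 // size_polyX // size_polyN.
  by rewrite (leq_ltn_trans (size_polyC_leq1 _)).
have lE := zpolyEprim l.
have c0 : zcontents l != 0 by rewrite zcontents_eq0 -size_poly_eq0 sl.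
have lz : lead_coef (zprimitive l) = (zprimitive l)`_1.
  by rewrite /lead_coef size_zprimitive sl.
have : (zprimitive l)`_1 \is a GRing.unit.
  have := congr1 lead_coef pE; rewrite lead_coefM (monicP pm) lz => /esym h.
  by apply/unitrPr; exists (lead_coef r).
set u := (zprimitive l)`_1 => uu.
exists (- (zprimitive l)`_0 * u).
have u2 : u * u = 1.
  have := uu; rewrite unfold_in /= => /orP[] /eqP ->; rewrite ?mul1r //.
have dE : d = zcontents l * u by rewrite -l1 [in LHS]lE coefZ.
have nE : n = - (zcontents l * (zprimitive l)`_0).
  by rewrite -[n]opprK -l0 {1}lE coefZ.
apply: (mulIf d0); rewrite -[in LHS](divq_num_den q) divfK //.
rewrite -intrM -/n nE dE; congr (intmul 1 _).
transitivity (- (zcontents l * (zprimitive l)`_0) * (u * u)); first by rewrite u2 mulr1.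
by ring.
Qed.

(** * Eisenstein integers *)

Section Eisenstein.
Variable R : realType.
Local Notation Re := (@complex.Re R).
Local Notation Im := (@complex.Im R).
Local Notation w := (omega : R[i]).
Local Notation C := R[i].
Implicit Types (z t : C) (x y : int).

Definition eis x y : C := x%:~R + y%:~R * w.
Definition Eis : set C := [set z | exists x y, z = eis x y].

Lemma eisD x y x' y' : eis x y + eis x' y' = eis (x + x') (y + y').
Proof. by rewrite /eis !intrD; ring. Qed.

Lemma eisN x y : - eis x y = eis (- x) (- y).
Proof. by rewrite /eis !mulrNz; ring. Qed.

Lemma eisM x y x' y' :
  eis x y * eis x' y' = eis (x * x' - y * y') (x * y' + y * x' - y * y').
Proof.
rewrite /eis !(intrB, intrD, intrM).
transitivity (x%:~R * x'%:~R + (x%:~R * y'%:~R + y%:~R * x'%:~R) * w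
   + y%:~R * y'%:~R * w ^+ 2 : C); first by ring.
by rewrite omega2; ring.
Qed.

Lemma eisJ x y : (eis x y)^* = eis (x - y) (- y).
Proof.
rewrite /eis rmorphD rmorphM /= !(rmorph_int Num.conj) conj_omega intrB mulrNz.
by ring.
Qed.

Lemma Re_int x : Re x%:~R = x%:~R.
Proof. by case: x => n; rewrite ?NegzE ?mulrNz ?cReN ?cRen. Qed.

Lemma Im_int x : Im x%:~R = 0.
Proof. by case: x => n; rewrite ?NegzE ?mulrNz ?cImN ?cImn ?oppr0. Qed.

Lemma Re_eis x y : Re (eis x y) = x%:~R - y%:~R / 2.
Proof. by rewrite /eis cReD cReM Re_int Re_omega Re_int Im_int; field. Qed.

Lemma Im_eis x y : Im (eis x y) = y%:~R * Im w.
Proof. by rewrite /eis cImD cImM Im_int Im_int Re_int; ring. Qed.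

Lemma eis_inj x y x' y' : eis x y = eis x' y' -> x = x' /\ y = y'.
Proof.
move=> e; have yy : y = y'.
  have := congr1 Im e; rewrite !Im_eis => /(mulIf (lt0r_neq0 (Im_omega_gt0 R))).
  exact: intr_inj.
split=> //; have := congr1 Re e; rewrite !Re_eis yy => /addIr; exact: intr_inj.
Qed.

Lemma nm_eis x y : nm (eis x y) = (x ^+ 2 - x * y + y ^+ 2)%:~R.
Proof.
rewrite /nm Re_eis Im_eis exprMn Im_omega_sqr !(intrD, intrB, rmorphXn, intrM) /=.
by field.
Qed.

Lemma Eis_eis x y : Eis (eis x y). Proof. by exists x, y. Qed.

Lemma EisD z t : Eis z -> Eis t -> Eis (z + t).
Proof. by move=> [x [y ->]] [x' [y' ->]]; rewrite eisD; apply: Eis_eis. Qed.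

Lemma EisN z : Eis z -> Eis (- z).
Proof. by move=> [x [y ->]]; rewrite eisN; apply: Eis_eis. Qed.

Lemma EisB z t : Eis z -> Eis t -> Eis (z - t).
Proof. by move=> hz ht; apply/EisD/EisN. Qed.

Lemma EisM z t : Eis z -> Eis t -> Eis (z * t).
Proof. by move=> [x [y ->]] [x' [y' ->]]; rewrite eisM; apply: Eis_eis. Qed.

Lemma EisJ z : Eis z -> Eis z^*.
Proof. by move=> [x [y ->]]; rewrite eisJ; apply: Eis_eis. Qed.

Lemma Eis_int x : Eis x%:~R.
Proof. by exists x, 0; rewrite /eis mul0r addr0. Qed.

Lemma Eis_nat n : Eis n%:R. Proof. exact: (Eis_int n). Qed.
Lemma Eis0 : Eis 0. Proof. exact: (Eis_int 0). Qed.
Lemma Eis1 : Eis 1. Proof. exact: (Eis_int 1). Qed.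
Lemma Eisw : Eis w. Proof. by exists 0, 1; rewrite /eis mul1r add0r. Qed.

Lemma EisX z n : Eis z -> Eis (z ^+ n).
Proof.
move=> hz; elim: n => [|n IH]; first by rewrite expr0; exact: Eis1.
by rewrite exprS; apply: EisM.
Qed.

Lemma Eis_sum I (r : seq I) (P : pred I) (F : I -> C) :
  (forall i, Eis (F i)) -> Eis (\sum_(i <- r | P i) F i).
Proof. by move=> h; apply: (big_ind Eis) => //; [exact: Eis0|exact: EisD]. Qed.

Lemma Eis_nm z : Eis z -> exists n : nat, nm z = n%:R.
Proof.
move=> [x [y ->]]; rewrite nm_eis.
have h : 0 <= x ^+ 2 - x * y + y ^+ 2 by nia.
exists (absz (x ^+ 2 - x * y + y ^+ 2)); rewrite -[in LHS](gez0_abs h).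
by [].
Qed.

Lemma Eis_nm_lt1 z : Eis z -> nm z < 1 -> z = 0.
Proof.
move=> /Eis_nm [n e]; rewrite e ltrn1 => n0.
by apply/eqP; rewrite -nm_eq0 e; case: n n0 {e}.
Qed.

Lemma Eis_nm_ge1 z : Eis z -> z != 0 -> 1 <= nm z.
Proof.
by move=> hz z0; rewrite leNgt; apply/negP => /(Eis_nm_lt1 hz) /eqP; apply/negP.
Qed.

Lemma Eis_real z : Eis z -> z^* = z -> exists x, z = x%:~R.
Proof.
move=> [x [y ->]]; rewrite eisJ => /eis_inj[h _].
have -> : y = 0 by lia.
by exists x; rewrite /eis mul0r addr0.
Qed.

(* Each complex number lies in one of the unit triangles spanned by O; its
   distances to the vertices, weighted by the barycentric coordinates, have
   mean square at most 1/3. *)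
Lemma Eis_near (z : C) : exists2 c, Eis c & nm (z - c) <= 1 / 3.
Proof.
have s0 := Im_omega_gt0 R; have s2 := Im_omega_sqr R.
pose Y := Im z / Im w; pose X := Re z + Y / 2.
have nmz x y : nm (z - eis x y) = (X - x%:~R) ^+ 2 - (X - x%:~R) * (Y - y%:~R) + (Y - y%:~R) ^+ 2.
  have -> : z - eis x y = Complex (X - x%:~R - (Y - y%:~R) / 2) ((Y - y%:~R) * Im w).
    apply: complexP; rewrite ?cReD ?cImD ?cReN ?cImN ?Re_eis ?Im_eis.
      by rewrite /= /X; field.
    by rewrite -[RHS]/((Y - y%:~R) * Im w) /Y; field; rewrite gt_eqF.
  by rewrite /nm /= exprMn s2; field.
pose m := Num.floor X; pose n := Num.floor Y.
pose p := X - m%:~R; pose q := Y - n%:~R.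
have p01 : 0 <= p < 1.
  by have := floor_itv X; rewrite intrD /p /m => /andP[? ?]; apply/andP; split; lra.
have q01 : 0 <= q < 1.
  by have := floor_itv Y; rewrite intrD /q /n => /andP[? ?]; apply/andP; split; lra.
have n00 : nm (z - eis m n) = p ^+ 2 - p * q + q ^+ 2 by rewrite nmz.
have n10 : nm (z - eis (m + 1) n) = (p - 1) ^+ 2 - (p - 1) * q + q ^+ 2.
  by rewrite nmz intrD /p /q; ring.
have n01 : nm (z - eis m (n + 1)) = p ^+ 2 - p * (q - 1) + (q - 1) ^+ 2.
  by rewrite nmz intrD /p /q; ring.
have n11 : nm (z - eis (m + 1) (n + 1)) = (p - 1) ^+ 2 - (p - 1) * (q - 1) + (q - 1) ^+ 2.
  by rewrite nmz !intrD /p /q; ring.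
have [h00|h00] := lerP (nm (z - eis m n)) (1 / 3); first by exists (eis m n) => //; exact: Eis_eis.
have [h11|h11] := lerP (nm (z - eis (m+1) (n+1))) (1 / 3); first by exists (eis (m+1) (n+1)) => //; exact: Eis_eis.
have [h10|h10] := lerP (nm (z - eis (m+1) n)) (1 / 3); first by exists (eis (m+1) n) => //; exact: Eis_eis.
have [h01|h01] := lerP (nm (z - eis m (n+1))) (1 / 3); first by exists (eis m (n+1)) => //; exact: Eis_eis.
exfalso; move: h00 h11 h10 h01; rewrite n00 n11 n10 n01.
clear n00 n10 n01 n11 nmz; move: p q p01 q01 => p q /andP[p0 p1] /andP[q0 q1].
move=> h00 h11 h10 h01.
(* The diagonal cuts the unit parallelogram into two triangles. The weights in [e] are the
   barycentric coordinates, and their pairwise products add up to at most $1/3$. *)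
have [pq|pq] := lerP q p.
  have e : (1 - p) * (p ^+ 2 - p * q + q ^+ 2) + (p - q) * ((p - 1) ^+ 2 - (p - 1) * q + q ^+ 2)
    + q * ((p - 1) ^+ 2 - (p - 1) * (q - 1) + (q - 1) ^+ 2) = (1 - p) * (p - q) + (1 - p) * q + (p - q) * q by ring.
  have := sqr_ge0 (1 - p - (p - q)); have := sqr_ge0 (1 - p - q); have := sqr_ge0 (p - q - q).
  by nra.
have e : (1 - q) * (p ^+ 2 - p * q + q ^+ 2) + (q - p) * (p ^+ 2 - p * (q - 1) + (q - 1) ^+ 2)
    + p * ((p - 1) ^+ 2 - (p - 1) * (q - 1) + (q - 1) ^+ 2) = (1 - q) * (q - p) + (1 - q) * p + (q - p) * p by ring.
have := sqr_ge0 (1 - q - (q - p)); have := sqr_ge0 (1 - q - p); have := sqr_ge0 (q - p - p).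
by nra.
Qed.

Lemma Eis_unit z : Eis z -> nm z = 1 ->
  exists2 k : nat, (k < 6)%N & z = (1 + w) ^+ k.
Proof.
move=> [x [y ->]]; rewrite nm_eis => /(@intr_inj _ _ 1) h.
have hx : (x = -1) \/ (x = 0) \/ (x = 1) by nia.
have hy : (y = -1) \/ (y = 0) \/ (y = 1) by nia.
have e : 1 + w = eis 1 1 by rewrite /eis mul1r.
have e0 : (1 + w) ^+ 0 = eis 1 0 by rewrite expr0 /eis mul0r addr0.
have e1 : (1 + w) ^+ 1 = eis 1 1 by rewrite e.
have e2 : (1 + w) ^+ 2 = eis 0 1 by rewrite exprS e1 e eisM.
have e3 : (1 + w) ^+ 3 = eis (-1) 0 by rewrite exprS e2 e eisM.
have e4 : (1 + w) ^+ 4 = eis (-1) (-1) by rewrite exprS e3 e eisM.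
have e5 : (1 + w) ^+ 5 = eis 0 (-1) by rewrite exprS e4 e eisM.
have [[]|[[]|[[]|[[]|[[]|[]]]]]] : (x = 1 /\ y = 0) \/ (x = 1 /\ y = 1) \/ (x = 0 /\ y = 1) \/
  (x = -1 /\ y = 0) \/ (x = -1 /\ y = -1) \/ (x = 0 /\ y = -1) by nia.
all: move=> -> ->.
- by exists 0%N.
- by exists 1%N.
- by exists 2%N.
- by exists 3%N.
- by exists 4%N.
by exists 5%N.
Qed.

Lemma Eis_1w : Eis (1 + w). Proof. exact: EisD (Eis1) Eisw. Qed.
Lemma w1_sqr : (1 + w) ^+ 2 = w.
Proof. by transitivity (1 + 2 * w + w ^+ 2); [ring|rewrite omega2; ring]. Qed.
Lemma w1_cube : (1 + w) ^+ 3 = -1.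
Proof. by rewrite exprS w1_sqr; transitivity (w + w ^+ 2); [ring|rewrite omega2; ring]. Qed.
Lemma w1_6 : (1 + w) ^+ 6 = 1.
Proof. by rewrite (exprM _ 3 2) w1_cube sqrrN expr1n. Qed.
Lemma nm_w1 : nm (1 + w) = 1.
Proof. by rewrite -cis_2pi6 nm_cis. Qed.

(** The prime 2 is inert in $O$. This helps to separate the mirrors with polar vectors of norms 1
    and 2, and it removes a value in the search for an isotropic vector. *)
Lemma Eis_nm_neq2 z : Eis z -> nm z <> 2.
Proof.
move=> [x [y ->]]; rewrite nm_eis => /(@intr_inj _ _ 2) h.
have hx : -1 <= x <= 1 by apply/andP; split; nia.
have hy : -1 <= y <= 1 by apply/andP; split; nia.
have {}hx : x = -1 \/ x = 0 \/ x = 1 by lia.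
by case: hx h => [->|[->|->]]; nia.
Qed.

Lemma int_div_mod (d x : int) : 0 < d -> exists q r, x = q * d + r /\ 0 <= r < d.
Proof.
move=> d0; exists (x %/ d)%Z, (x %% d)%Z; split; first exact: divz_eq.
by rewrite modz_ge0 ?ltz_pmod // gt_eqF.
Qed.

(* The four residues of O modulo 2 are 0 and the powers of omega. *)
Lemma Eis_mod2 z : Eis z -> (exists2 t, Eis t & z = 2 * t) \/
   exists u t, [/\ Eis u, nm u = 1, Eis t & z = u + 2 * t].
Proof.
move=> [x [y ->]].
have [q [r [-> hr]]] := int_div_mod x (isT : 0 < 2 :> int).
have [q' [r' [-> hr']]] := int_div_mod y (isT : 0 < 2 :> int).
have e : eis (q * 2 + r) (q' * 2 + r') = eis r r' + 2 * eis q q'.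
  by rewrite /eis !(intrD, intrM); ring.
have {}hr : r = 0 \/ r = 1 by lia.
have {}hr' : r' = 0 \/ r' = 1 by lia.
have [h0|h1] : (r = 0 /\ r' = 0) \/ (r ^+ 2 - r * r' + r' ^+ 2 = 1) by nia.
  left; exists (eis q q'); first exact: Eis_eis.
  by rewrite e; case: h0 => -> ->; rewrite /eis mul0r !add0r.
right; exists (eis r r'), (eis q q'); split; rewrite ?nm_eis ?h1 //; exact: Eis_eis.
Qed.

Lemma ratr_complex (q : rat) : ratr q = real_complex R (ratr q) :> C.
Proof. by rewrite /ratr rmorphM fmorphV /= !(rmorph_int (real_complex R)). Qed.

Lemma conj_ratr (q : rat) : (ratr q : C)^* = ratr q.
Proof. by rewrite ratr_complex; exact: conjC_rc. Qed.

Lemma integral_conj z : integralOver (intr : int -> C) z -> integralOver (intr : int -> C) z^*.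
Proof.
move=> [p pm pz]; exists p => //.
have -> : map_poly intr p = map_poly Num.conj (map_poly (intr : int -> C) p).
  by rewrite -map_poly_comp; apply: eq_map_poly => n /=; rewrite rmorph_int.
by rewrite fmorph_root.
Qed.

Lemma integral_ratr (q : rat) : integralOver (intr : int -> C) (ratr q) ->
  exists n : int, q = n%:~R.
Proof.
move=> [p pm pz]; apply: rat_integral_int; exists p => //.
rewrite -(fmorph_root (ratr : rat -> C)) -map_poly_comp.
by rewrite (eq_map_poly (_ : _ =1 intr)) // => n /=; rewrite ratr_int.
Qed.

Lemma integral_omega : integralOver (intr : int -> C) w.
Proof.
exists ('X^2 + 'X + 1%:P).
  apply/monicP; rewrite -addrA lead_coefDl ?lead_coefXn // size_polyXn.
  by rewrite size_polyDl size_polyX // size_polyC.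
rewrite /root !rmorphD /= rmorph1 map_polyXn map_polyX !hornerE omega2.
by apply/eqP; ring.
Qed.

(** Since $(3q)^2=3n$, the number $3q$ is an integer whose square is divisible by 3, hence is itself
    divisible by 3. *)
Lemma sqr_rat_int (q : rat) (n : int) : 3 * q ^+ 2 = n%:~R -> exists m : int, q = m%:~R.
Proof.
move=> h; suff : integralOver (intr : int -> rat) (3 * q).
  move/rat_integral_int => [m hm].
  have : (3 %| m)%Z.
    have e : m ^+ 2 = 3 * n.
      apply: (@intr_inj rat); rewrite rmorphXn /= -hm intrM -h; ring.
    have [k [r [mE hr]]] := int_div_mod m (isT : 0 < 3 :> int).
    have [r0|r0] : r = 0 \/ (r = 1 \/ r = 2) by lia.
      by rewrite mE r0 addr0 dvdz_mull.
    by exfalso; case: r0 mE => -> mE; rewrite mE in e; lia.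
  move=> /dvdzP [k kE]; exists k; have : 3 * q = 3 * k%:~R by rewrite hm kE intrM mulrC.
  by apply: mulfI.
exists ('X^2 - (3 * n)%:P).
  by apply/monicP; rewrite lead_coefDl ?lead_coefXn // size_polyXn size_polyN (leq_ltn_trans (size_polyC_leq1 _)).
rewrite /root rmorphB /= map_polyXn map_polyC !hornerE /= intrM -h.
by apply/eqP; ring.
Qed.

(** Trace $2a$ and norm $a^2+3b^2$ of $a+b\sqrt{-3}$ are rational algebraic integers, hence integers
    [m] and [n]. Then $k=2b$ is an integer as well, and $4n=m^2+3k^2$ forces [m] and [k] to have the
    same parity, which is membership in $O$. *)
Lemma ring_of_integersE : @ring_of_integers R 3 = Eis.
Proof.
apply/seteqP; split=> z; last first.
  move=> [x [y ->]]; split.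
    exists (x%:~R - y%:~R / 2), (y%:~R / 2).
    rewrite i_sqrt3 rmorphB fmorph_div /= !ratr_int rmorph_nat /eis.
    by field.
  apply: integral_add; first exact: (integral_id (intr : {rmorphism int -> C})).
  apply: integral_mul; first exact: (integral_id (intr : {rmorphism int -> C})).
  exact: integral_omega.
move=> [[a [b zE]] zi].
have zc : z^* = ratr a - ratr b * i_sqrt 3.
  rewrite zE cjD conj_ratr cjM conj_ratr i_sqrt3 !cjE.
  by rewrite conj_omega; ring.
have [m hm] : exists m : int, 2 * a = m%:~R.
  apply: integral_ratr; have := integral_add zi (integral_conj zi).
  rewrite zc zE rmorphM rmorph_nat /= => h.
  have -> : 2 * ratr a = ratr a + ratr b * i_sqrt 3 + (ratr a - ratr b * i_sqrt 3) :> C by ring.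
  exact: h.
have s3 : i_sqrt 3 ^+ 2 = - 3 :> C.
  rewrite i_sqrt3; transitivity (1 + 4 * w + 4 * w ^+ 2); first by ring.
  by rewrite omega2; ring.
have [n hn] : exists n : int, a ^+ 2 + 3 * b ^+ 2 = n%:~R.
  apply: integral_ratr; have := integral_mul zi (integral_conj zi).
  rewrite zc zE rmorphD rmorphM !rmorphXn rmorph_nat /= => h.
  suff <- : (ratr a + ratr b * i_sqrt 3) * (ratr a - ratr b * i_sqrt 3) =
     ratr a ^+ 2 + 3 * ratr b ^+ 2 :> C by exact: h.
  transitivity (ratr a ^+ 2 - ratr b ^+ 2 * i_sqrt 3 ^+ 2 : C); first by ring.
  by rewrite s3; ring.
have [k hk] : exists k : int, 2 * b = k%:~R.
  apply: (@sqr_rat_int _ (4 * n - m ^+ 2)).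
  rewrite intrB intrM rmorphXn /= -hn -hm; ring.
have e : 4 * n = m ^+ 2 + 3 * k ^+ 2.
  apply: (@intr_inj rat); rewrite intrD !intrM ?rmorphXn /= -hn -hm -hk; ring.
have [q [r [qE hr]]] := int_div_mod (m + k) (isT : 0 < 2 :> int).
have r0 : r = 0.
  have [//|r1] : r = 0 \/ r = 1 by lia.
  have mE : m = q * 2 + 1 - k by lia.
  by exfalso; rewrite mE in e; lia.
exists q, k; rewrite zE i_sqrt3 /eis.
have a2 : 2 * ratr a = m%:~R :> C by rewrite -(ratr_int _ m) -hm rmorphM rmorph_nat.
have b2 : 2 * ratr b = k%:~R :> C by rewrite -(ratr_int _ k) -hk rmorphM rmorph_nat.
have two : (2 : C) != 0 by rewrite pnatr_eq0.
have q2 : m%:~R + k%:~R = 2 * q%:~R :> C.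
  by rewrite -intrD qE r0 addr0 intrM mulrC.
apply: (mulfI two).
transitivity (2 * ratr a + 2 * ratr b + 2 * w * (2 * ratr b) : C); first by ring.
by rewrite a2 b2 q2; ring.
Qed.

Definition Krat : set C := @imag_quad_field R 3.

Lemma KratE z : Krat z <-> exists x y n : int, n != 0 /\ n%:~R * z = eis x y.
Proof.
split.
  move=> [a [b ->]]; exists (numq a * denq b + denq a * numq b), (2 * denq a * numq b), (denq a * denq b).
  split; first by rewrite mulf_neq0 ?denq_neq0.
  have da : ratr (denq a)%:~R * ratr a = ratr (numq a)%:~R :> C by rewrite -rmorphM /= mulrC numqE.
  have db : ratr (denq b)%:~R * ratr b = ratr (numq b)%:~R :> C by rewrite -rmorphM /= mulrC numqE.
  move: da db; rewrite !ratr_int => da db.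
  rewrite /eis !intrD !intrM i_sqrt3 -da -db; ring.
move=> [x [y [n [n0 e]]]]; exists (x%:~R / n%:~R - y%:~R / n%:~R / 2), (y%:~R / n%:~R / 2).
have n0' : n%:~R != 0 :> C by rewrite intr_eq0.
rewrite i_sqrt3 rmorphB !fmorph_div /= !ratr_int rmorph_nat.
by apply: (mulfI n0'); rewrite e /eis; field.
Qed.

End Eisenstein.

Ltac gen_atoms :=
  repeat match goal with H : context [@herm _ _ _] |- _ => revert H end;
  repeat match goal with |- context [@herm ?R ?a ?b] => generalize (@herm R a b); intro end;
  intros.
Ltac hring := gen_atoms; ring.
Ltac hfield := gen_atoms; field; try assumption.

(** * The Hermitian form *)

Section Hermitian.
Variable R : realType.
Local Notation Re := (@complex.Re R).
Local Notation C := R[i].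
Local Notation V := 'cV[C]_3.
Local Notation rc := (real_complex R).
Implicit Types (u v z t : V) (A B : 'M[C]_3) (c d : C).

Definition i0 : 'I_3 := @Ordinal 3 0 isT.
Definition i1 : 'I_3 := @Ordinal 3 1 isT.
Definition i2 : 'I_3 := @Ordinal 3 2 isT.

Lemma ord3P (P : 'I_3 -> Prop) : P i0 -> P i1 -> P i2 -> forall i, P i.
Proof.
move=> h0 h1 h2 [[|[|[|k]]] hk] //.
- by rewrite (_ : Ordinal hk = i0) //; apply: val_inj.
- by rewrite (_ : Ordinal hk = i1) //; apply: val_inj.
by rewrite (_ : Ordinal hk = i2) //; apply: val_inj.
Qed.

Lemma cv_eq u v : u i0 0 = v i0 0 -> u i1 0 = v i1 0 -> u i2 0 = v i2 0 -> u = v.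
Proof. by move=> h0 h1 h2; apply/matrixP => i j; rewrite (ord1 j); elim/ord3P: i. Qed.

Lemma sum3 (S : nmodType) (F : 'I_3 -> S) : \sum_i F i = F i0 + F i1 + F i2.
Proof.
rewrite !big_ord_recl big_ord0 addr0 addrA.
by congr (F _ + F _ + F _); apply: val_inj.
Qed.

Lemma cv3_0 a b c : cv3 a b c i0 0 = a :> C. Proof. by rewrite mxE. Qed.
Lemma cv3_1 a b c : cv3 a b c i1 0 = b :> C. Proof. by rewrite mxE. Qed.
Lemma cv3_2 a b c : cv3 a b c i2 0 = c :> C. Proof. by rewrite mxE. Qed.

Lemma mulmx3 A v i : (A *m v) i 0 = A i i0 * v i0 0 + A i i1 * v i1 0 + A i i2 * v i2 0.
Proof. by rewrite mxE sum3. Qed.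

Lemma hermE v u : herm v u = v i0 0 * (u i2 0)^* + v i1 0 * (u i1 0)^* + v i2 0 * (u i0 0)^*.
Proof.
rewrite /herm mxE sum3 !mxE !sum3 !mxE /=.
by ring.
Qed.

Definition vE := (cv3_0, cv3_1, cv3_2).

Lemma colD u v i : (u + v) i 0 = u i 0 + v i 0. Proof. by rewrite mxE. Qed.
Lemma colN u i : (- u) i 0 = - u i 0. Proof. by rewrite mxE. Qed.
Lemma colZ c u i : (c *: u) i 0 = c * u i 0. Proof. by rewrite mxE. Qed.
Lemma col0 i : (0 : V) i 0 = 0. Proof. by rewrite mxE. Qed.
Definition ccE := (colD, colN, colZ, col0, vE).

Lemma hermDl u v t : herm (u + v) t = herm u t + herm v t.
Proof. by rewrite !hermE !ccE; ring. Qed.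
Lemma hermDr u v t : herm t (u + v) = herm t u + herm t v.
Proof. by rewrite !hermE !ccE !cjE; ring. Qed.
Lemma hermZl c v t : herm (c *: v) t = c * herm v t.
Proof. by rewrite !hermE !ccE; ring. Qed.
Lemma hermZr c v t : herm t (c *: v) = c^* * herm t v.
Proof. by rewrite !hermE !ccE !cjE; ring. Qed.
Lemma hermNl v t : herm (- v) t = - herm v t.
Proof. by rewrite !hermE !ccE; ring. Qed.
Lemma hermNr v t : herm t (- v) = - herm t v.
Proof. by rewrite !hermE !ccE !cjE; ring. Qed.
Lemma herm0l t : herm 0 t = 0.
Proof. by rewrite !hermE !ccE; ring. Qed.
Lemma herm0r t : herm t 0 = 0.
Proof. by rewrite !hermE !ccE !cjE; ring. Qed.
Lemma herm_cj u v : (herm u v)^* = herm v u.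
Proof. by rewrite !hermE !cjE; ring. Qed.
Definition hE := (hermDl, hermDr, hermZl, hermZr, hermNl, hermNr, herm0l, herm0r).

Lemma herm_sym0 u v : herm u v = 0 -> herm v u = 0.
Proof. by move=> h; rewrite -herm_cj h cj0. Qed.

Definition hr v : R := Re (herm v v).

Lemma hrE v : herm v v = rc (hr v).
Proof. by apply: real_rc; rewrite herm_cj. Qed.

Lemma hrZ c v : hr (c *: v) = nm c * hr v.
Proof. by apply: rc_inj; rewrite -hrE rcM -nmE -hrE !hE; hring. Qed.

Lemma herm_lt0 v : (herm v v < 0) = (hr v < 0).
Proof. by rewrite hrE -ltcR. Qed.

Lemma herm_gt0 v : (0 < herm v v) = (0 < hr v).
Proof. by rewrite hrE -ltcR. Qed.

Lemma nm_herm v u : herm v u * herm u v = rc (nm (herm v u)).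
Proof. by rewrite -(herm_cj v u) nmE. Qed.

Lemma nm_hermC v u : nm (herm v u) = nm (herm u v).
Proof. by rewrite -(herm_cj u v) nmJ. Qed.

Definition preserving A := forall u v, herm (A *m u) (A *m v) = herm u v.

Lemma preserves_preserving A : preserves_J A -> preserving A.
Proof.
case/andP => _ /eqP JA u v; rewrite /herm -[in RHS]JA trmx_mul map_mxM /=.
suff E (a : 'rV[C]_3) (B : 'M[C]_3) : a *m B *m J R *m (A *m u) = a *m (B *m J R *m A) *m u.
  by rewrite E.
by rewrite -!mulmxA.
Qed.

Lemma preserving_hr A v : preserving A -> hr (A *m v) = hr v.
Proof. by move=> h; rewrite /hr h. Qed.

(** Determinant, cross product and trace are polynomials in the coordinates, so that [ring] decides
    the identities between them. *)
Definition det3 u v z : C :=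
  u i0 0 * (v i1 0 * z i2 0 - v i2 0 * z i1 0)
  - u i1 0 * (v i0 0 * z i2 0 - v i2 0 * z i0 0)
  + u i2 0 * (v i0 0 * z i1 0 - v i1 0 * z i0 0).

(** The Hermitian cross product: the conjugations are placed so that pairing a vector with it gives
    a determinant ([herm_cr]). It is therefore orthogonal to [u] and [v]. *)
Definition cr u v : V := cv3 (u i0 0 * v i1 0 - u i1 0 * v i0 0)^*
  (u i2 0 * v i0 0 - u i0 0 * v i2 0)^* (u i1 0 * v i2 0 - u i2 0 * v i1 0)^*.

Lemma herm_cr z u v : herm z (cr u v) = det3 z u v.
Proof. by rewrite hermE /cr /det3 !vE !cjE; ring. Qed.

Lemma cr_norm u v : herm (cr u v) (cr u v) =
  - (herm u u * herm v v - herm u v * herm v u).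
Proof. by rewrite !hermE /cr !vE !cjE; ring. Qed.

(** The Gram determinant is $|\det|^2\det J$, and the sign comes from $\det J=-1$. *)
Lemma gram3 u v z : det3 u v z * (det3 u v z)^* = -
  (herm u u * (herm v v * herm z z - herm v z * herm z v)
   - herm u v * (herm v u * herm z z - herm v z * herm z u)
   + herm u z * (herm v u * herm z v - herm v v * herm z u)).
Proof. by rewrite !hermE /det3 !cjE; ring. Qed.

Lemma cramer3 u v z t : det3 u v z *: t =
  det3 t v z *: u + det3 u t z *: v + det3 u v t *: z.
Proof. by apply: cv_eq; rewrite !ccE /det3; ring. Qed.

Lemma scaler_divK (D x : C) u : D != 0 -> D *: ((x / D) *: u) = x *: u.
Proof. by move=> D0; rewrite scalerA mulrC divfK. Qed.

Lemma basis3 u v z t : det3 u v z != 0 -> exists a b c, t = a *: u + b *: v + c *: z.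
Proof.
move=> h; exists (det3 t v z / det3 u v z), (det3 u t z / det3 u v z), (det3 u v t / det3 u v z).
apply: (scalerI h); rewrite cramer3 !scalerDr !scaler_divK //.
Qed.

Definition mxdet A : C := det3 (A *m cv3 1 0 0) (A *m cv3 0 1 0) (A *m cv3 0 0 1).
Definition mxtr A : C := A i0 i0 + A i1 i1 + A i2 i2.

Lemma det3_mul A u v z : det3 (A *m u) (A *m v) (A *m z) = mxdet A * det3 u v z.
Proof. by rewrite /mxdet /det3 !mulmx3 !vE; ring. Qed.

(** The linear term in $t$ of $\det(1+tA)$. On a frame of eigenvectors it identifies the trace with
    the sum of the eigenvalues. *)
Lemma det3_tr A u v z : mxtr A * det3 u v z =
  det3 (A *m u) v z + det3 u (A *m v) z + det3 u v (A *m z).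
Proof. by rewrite /mxtr /det3 !mulmx3; ring. Qed.

Lemma det3Z1 c u v z : det3 (c *: u) v z = c * det3 u v z.
Proof. by rewrite /det3 !ccE; ring. Qed.
Lemma det3Z2 c u v z : det3 u (c *: v) z = c * det3 u v z.
Proof. by rewrite /det3 !ccE; ring. Qed.
Lemma det3Z3 c u v z : det3 u v (c *: z) = c * det3 u v z.
Proof. by rewrite /det3 !ccE; ring. Qed.
Lemma det3D3 u v z t : det3 u v (z + t) = det3 u v z + det3 u v t.
Proof. by rewrite /det3 !ccE; ring. Qed.
Lemma det3D2 u v z t : det3 u (z + t) v = det3 u z v + det3 u t v.
Proof. by rewrite /det3 !ccE; ring. Qed.
Lemma det3D1 u v z t : det3 (z + t) u v = det3 z u v + det3 t u v.
Proof. by rewrite /det3 !ccE; ring. Qed.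
Lemma det3_12 u v : det3 u u v = 0. Proof. by rewrite /det3; ring. Qed.
Lemma det3_13 u v : det3 u v u = 0. Proof. by rewrite /det3; ring. Qed.
Lemma det3_23 u v : det3 u v v = 0. Proof. by rewrite /det3; ring. Qed.
Definition detE := (det3D1, det3D2, det3D3, det3Z1, det3Z2, det3Z3, det3_12, det3_13, det3_23).

(** Signature $(2,1)$ in explicit form: for [z] orthogonal to [v] the last two terms vanish, and
    what remains is a squared modulus minus $\langle v,v\rangle|z_2|^2$. *)
Lemma neg_perp_id v z : (v i2 0 * (v i2 0)^*) * herm z z =
  (v i2 0 * z i1 0 - v i1 0 * z i2 0) * (v i2 0 * z i1 0 - v i1 0 * z i2 0)^*
  - herm v v * (z i2 0 * (z i2 0)^*)
  + v i2 0 * (z i2 0)^* * herm z v + (v i2 0)^* * z i2 0 * herm v z.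
Proof. by rewrite !hermE !cjE; ring. Qed.

(** Where the last coordinate vanishes, the form reduces to the squared modulus of the middle one. A
    negative vector is thus never orthogonal to [E0]. *)
Lemma neg_last v : hr v < 0 -> v i2 0 != 0.
Proof.
move=> h; apply/eqP => e; move: h; apply/negP; rewrite -leNgt.
have -> : hr v = nm (v i1 0).
  by apply: rc_inj; rewrite -hrE hermE e -nmE cj0; ring.
exact: nm_ge0.
Qed.

Lemma perp_pos v z : hr v < 0 -> herm z v = 0 -> z != 0 -> 0 < hr z.
Proof.
move=> nv zv z0; have v2 := neg_last nv.
have e : nm (v i2 0) * hr z = nm (v i2 0 * z i1 0 - v i1 0 * z i2 0) + (- hr v) * nm (z i2 0).
  apply: rc_inj; rewrite rcD !rcM rcN -!nmE -!hrE neg_perp_id.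
  by rewrite zv (herm_sym0 zv); ring.
have v2' : 0 < nm (v i2 0) by rewrite nm_gt0.
rewrite -(pmulr_rgt0 _ v2') e.
have h1 := nm_ge0 (v i2 0 * z i1 0 - v i1 0 * z i2 0).
have h2 : 0 <= - hr v * nm (z i2 0) by rewrite mulr_ge0 ?nm_ge0 // oppr_ge0 ltW.
rewrite lt0r addr_ge0 // andbT; apply: contra z0 => /eqP h0.
have /eqP z2 : nm (z i2 0) == 0.
  have /eqP : - hr v * nm (z i2 0) = 0 by lra.
  by rewrite mulf_eq0 oppr_eq0 (lt_eqF nv).
have z1 : z i1 0 = 0.
  have /eqP : nm (v i2 0 * z i1 0 - v i1 0 * z i2 0) = 0 by rewrite z2 mulr0 addr0 in h0.
  move/eqP: z2; rewrite !nm_eq0 => /eqP ->; rewrite mulr0 subr0 mulf_eq0 (negPf v2) => /eqP //.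
move/eqP: z2; rewrite nm_eq0 => /eqP z2.
move: zv; rewrite hermE z1 z2 !mul0r !addr0 => /eqP.
rewrite mulf_eq0 conjC_eq0 (negPf v2) orbF => /eqP z00.
by apply/eqP/cv_eq; rewrite ?z00 ?z1 ?z2 mxE.
Qed.

Lemma perp_ge0 v z : hr v < 0 -> herm z v = 0 -> 0 <= hr z.
Proof.
move=> nv zv; have [->|z0] := eqVneq z 0; first by rewrite /hr herm0l.
exact: ltW (perp_pos nv zv z0).
Qed.

(** The form with its sign changed on the line of [v]: it agrees with [herm] on the orthogonal
    complement and takes the value $-\langle v,v\rangle$ at [v]. *)
Definition qf v z t : C := herm z t - 2 * herm z v * herm v t / herm v v.
Definition q v z : R := hr z - 2 * nm (herm z v) / hr v.

Lemma qE v z : qf v z z = rc (q v z).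
Proof.
by rewrite /qf /q rcD rcN rcM rcV rcM rcn -nm_herm -!hrE !mulrA.
Qed.

Lemma qfDl v z t u : qf v (z + t) u = qf v z u + qf v t u.
Proof. by rewrite /qf !hE; hring. Qed.
Lemma qfDr v z t u : qf v u (z + t) = qf v u z + qf v u t.
Proof. by rewrite /qf !hE; hring. Qed.
Lemma qfZl v c t u : qf v (c *: t) u = c * qf v t u.
Proof. by rewrite /qf !hE; hring. Qed.
Lemma qfZr v c t u : qf v u (c *: t) = c^* * qf v u t.
Proof. by rewrite /qf !hE; hring. Qed.
Lemma qfNl v t u : qf v (- t) u = - qf v t u.
Proof. by rewrite /qf !hE; hring. Qed.
Lemma qfNr v t u : qf v u (- t) = - qf v u t.
Proof. by rewrite /qf !hE; hring. Qed.
Lemma qfC v t u : (qf v t u)^* = qf v u t.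
Proof. by rewrite /qf -(herm_cj t u) -(herm_cj u v) -(herm_cj v t) -[X in _ / X](herm_cj v v); gen_atoms; rewrite !cjE; ring. Qed.
Definition qfE := (qfDl, qfDr, qfZl, qfZr, qfNl, qfNr).

Lemma qZ v c z : q v (c *: z) = nm c * q v z.
Proof. by apply: rc_inj; rewrite -qE rcM -nmE -qE !qfE mulrA. Qed.

Lemma qf_perp v z t : herm z v = 0 -> qf v z t = herm z t.
Proof. by rewrite /qf => ->; rewrite mulr0 !mul0r subr0. Qed.

Lemma q_perp v z : herm z v = 0 -> q v z = hr z.
Proof. by rewrite /q => ->; rewrite nm0 mulr0 mul0r subr0. Qed.

Lemma hr_neq0 v : hr v < 0 -> herm v v != 0.
Proof.
move=> h; apply/eqP => e; have := hrE v; rewrite e => /esym/eqP.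
rewrite -(rmorph0 rc) => /eqP /rc_inj e'; by rewrite e' ltxx in h.
Qed.

Lemma q_split v z : hr v < 0 -> let p := z - (herm z v / herm v v) *: v in
  herm p v = 0 /\ q v z = hr p - nm (herm z v) / hr v.
Proof.
move=> nv p; have v0 := hr_neq0 nv.
have pv : herm p v = 0 by rewrite /p !hE; hfield.
split=> //.
apply: rc_inj; rewrite -qE rcD rcN rcM rcV -nm_herm -!hrE /qf /p !hE.
rewrite !cjE herm_cj (_ : (herm v v)^* = herm v v) ?herm_cj //.
by hfield.
Qed.

Lemma q_gt0 v z : hr v < 0 -> z != 0 -> 0 < q v z.
Proof.
move=> nv z0; have [pv ->] := q_split z nv.
have [zv|zv] := eqVneq (herm z v) 0.
  rewrite zv nm0 !mul0r scale0r !subr0.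
  exact: (perp_pos nv).
have h := perp_ge0 nv pv.
rewrite ltr_wpDl // -mulrN -invrN divr_gt0 ?nm_gt0 //; lra.
Qed.

Lemma q_ge0 v z : hr v < 0 -> 0 <= q v z.
Proof.
move=> nv; have [->|z0] := eqVneq z 0; last exact: ltW (q_gt0 nv z0).
by rewrite /q /hr !herm0l nm0 mulr0 mul0r subr0.
Qed.

Lemma q_ge_hr v z : hr v < 0 -> `|hr z| <= q v z.
Proof.
move=> nv; have := q_split z nv => /= -[].
set p := z - _ => pv e.
have pp := perp_ge0 nv pv.
have k0 : 0 <= - nm (herm z v) / hr v.
  by rewrite mulNr -mulrN -invrN divr_ge0 ?nm_ge0 //; lra.
have e2 : q v z = hr z - 2 * nm (herm z v) / hr v by [].
move: k0 e e2; rewrite mulNr -mulrA; set k := nm _ / hr v => k0 e e2.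
by rewrite ler_norml; apply/andP; split; lra.
Qed.

(** The usual argument: [q v] is nonnegative at $q(t)z-q(z,t)t$, and this value has the positive
    factor $q(t)$. *)
Lemma q_CS v z t : hr v < 0 -> nm (qf v z t) <= q v z * q v t.
Proof.
move=> nv; have [->|t0] := eqVneq t 0.
  by rewrite /qf !herm0r mulr0 mul0r subr0 nm0 mulr_ge0 // q_ge0.
have tp := q_gt0 nv t0.
have := q_ge0 (rc (q v t) *: z - qf v z t *: t) nv.
suff -> : q v (rc (q v t) *: z - qf v z t *: t) = q v t * (q v z * q v t - nm (qf v z t)).
  by rewrite pmulr_rge0 // subr_ge0.
apply: rc_inj; rewrite -qE.
transitivity (rc (q v t) * (rc (q v z) * rc (q v t) - rc (nm (qf v z t)))); last first.
  by rewrite -rcM -rcN -rcD -rcM.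
rewrite -nmE !qfE -(qfC v z t) !qE.
by move: (qf v z t) (q v z) (q v t) => a b c; rewrite !cjE; ring.
Qed.

(** The reflection in [v] carries one form into the other, $\langle
    z,t\rangle=q(z,\mathrm{refl}\,t)$. This turns Cauchy-Schwarz for the definite form into a bound
    on [herm] itself. *)
Definition refl v z := z - (2 * herm z v / herm v v) *: v.

Lemma herm_qf v z t : hr v < 0 -> herm z t = qf v z (refl v t).
Proof.
move=> /hr_neq0 v0; rewrite /qf /refl !hE !cjE herm_cj (_ : (herm v v)^* = herm v v) ?herm_cj //.
by hfield.
Qed.

Lemma q_refl v t : hr v < 0 -> q v (refl v t) = q v t.
Proof.
move=> /hr_neq0 v0; apply: rc_inj; rewrite -!qE /qf /refl !hE !cjE !herm_cj.
by hfield.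
Qed.

Lemma herm_CS v z t : hr v < 0 -> nm (herm z t) <= q v z * q v t.
Proof. by move=> nv; rewrite (herm_qf z t nv) -(q_refl t nv); exact: q_CS. Qed.

Lemma eigen_unit A v c : preserving A -> A *m v = c *: v -> hr v != 0 -> nm c = 1.
Proof.
move=> hA e v0; have := preserving_hr v hA; rewrite e hrZ => /eqP.
by rewrite -subr_eq0 -{2}[hr v]mul1r -mulrBl mulf_eq0 (negPf v0) orbF subr_eq0 => /eqP.
Qed.

Lemma qf_inv A v c z t : preserving A -> A *m v = c *: v -> hr v < 0 ->
  qf v (A *m z) (A *m t) = qf v z t.
Proof.
move=> hA e nv; have v0 := hr_neq0 nv.
have c1 := eigen_unit hA e (ltr0_neq0 nv).
have c0 : c != 0 by rewrite -nm_gt0 c1 ltr01.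
have cc := nm_eq1 c1.
have cc0 : c^* != 0 by rewrite conjC_eq0.
rewrite /qf -(hA z v) -(hA v t) e !hE hA; congr (_ - _).
transitivity (2 * (c * c^*) * herm (A *m z) v * herm v (A *m t) / herm v v); last by hring.
by rewrite cc; hring.
Qed.

Lemma q_inv A v c z : preserving A -> A *m v = c *: v -> hr v < 0 ->
  q v (A *m z) = q v z.
Proof. by move=> hA e nv; apply: rc_inj; rewrite -!qE (qf_inv _ _ hA e). Qed.

Lemma eigen_perp A v c z : preserving A -> A *m v = c *: v -> c != 0 ->
  herm z v = 0 -> herm (A *m z) v = 0.
Proof.
move=> hA e c0 zv; have := hA z v; rewrite e hermZr zv => /eqP.
by rewrite mulf_eq0 conjC_eq0 (negPf c0) => /eqP.
Qed.

End Hermitian.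

(** * Unimodular bases and reduction *)

Section Lattice.
Variable R : realType.
Local Notation C := R[i].
Local Notation V := 'cV[C]_3.
Local Notation rc := (real_complex R).
Implicit Types (u v z t : V) (A B : 'M[C]_3) (c d : C).

Definition Ivec v := forall i, Eis (v i 0).
Definition Imx A := forall i j, Eis (A i j).

Lemma IvecD u v : Ivec u -> Ivec v -> Ivec (u + v).
Proof. by move=> hu hv i; rewrite mxE; apply: EisD. Qed.
Lemma IvecN u : Ivec u -> Ivec (- u).
Proof. by move=> hu i; rewrite mxE; apply: EisN. Qed.
Lemma IvecB u v : Ivec u -> Ivec v -> Ivec (u - v).
Proof. by move=> hu hv; apply/IvecD/IvecN. Qed.
Lemma IvecZ c u : Eis c -> Ivec u -> Ivec (c *: u).
Proof. by move=> hc hu i; rewrite mxE; apply: EisM. Qed.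

Lemma Ivec_mul A u : Imx A -> Ivec u -> Ivec (A *m u).
Proof. by move=> hA hu i; rewrite mulmx3; apply: EisD; [apply: EisD|]; apply: EisM. Qed.
Lemma Ivec_cv3 a b c : Eis a -> Eis b -> Eis c -> Ivec (cv3 a b c).
Proof. by move=> *; elim/ord3P; rewrite vE. Qed.
Lemma Eis_herm u v : Ivec u -> Ivec v -> Eis (herm u v).
Proof. by move=> hu hv; rewrite hermE; do 2?apply: EisD; apply: EisM => //; apply: EisJ. Qed.
Lemma Eis_det3 u v z : Ivec u -> Ivec v -> Ivec z -> Eis (det3 u v z).
Proof.
move=> hu hv hz; rewrite /det3.
by apply: EisD; [apply: EisB|]; apply: EisM => //; apply: EisB; apply: EisM.
Qed.

Definition E0 : V := cv3 1 0 0.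
Definition E1 : V := cv3 0 1 0.
Definition E2 : V := cv3 0 0 1.
Lemma IE0 : Ivec E0. Proof. by apply: Ivec_cv3; [exact: Eis1|exact: Eis0|exact: Eis0]. Qed.
Lemma IE1 : Ivec E1. Proof. by apply: Ivec_cv3; [exact: Eis0|exact: Eis1|exact: Eis0]. Qed.
Lemma IE2 : Ivec E2. Proof. by apply: Ivec_cv3; [exact: Eis0|exact: Eis0|exact: Eis1]. Qed.

Lemma herm_E0 z : herm z E0 = z i2 0.
Proof. by rewrite hermE !vE !cjE; ring. Qed.
Lemma herm_E1 z : herm z E1 = z i1 0.
Proof. by rewrite hermE !vE !cjE; ring. Qed.
Lemma herm_E2 z : herm z E2 = z i0 0.
Proof. by rewrite hermE !vE !cjE; ring. Qed.

Lemma Eis_mxdet A : Imx A -> Eis (mxdet A).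
Proof. by move=> hA; apply: Eis_det3; apply: Ivec_mul => //; [exact: IE0|exact: IE1|exact: IE2]. Qed.
Lemma Eis_mxtr A : Imx A -> Eis (mxtr A).
Proof. by move=> hA; rewrite /mxtr; do 2?apply: EisD. Qed.

Lemma herm_nondeg u : (forall z, Ivec z -> herm z u = 0) -> u = 0.
Proof.
move=> h; apply: cv_eq; rewrite mxE.
- by rewrite -herm_E2 -herm_cj h ?cj0 //; exact: IE2.
- by rewrite -herm_E1 -herm_cj h ?cj0 //; exact: IE1.
by rewrite -herm_E0 -herm_cj h ?cj0 //; exact: IE0.
Qed.

Lemma mxcol_eq A B : (forall u, Ivec u -> A *m u = B *m u) -> A = B.
Proof.
move=> h; have hc (M : 'M[C]_3) i : [/\ (M *m E0) i 0 = M i i0, (M *m E1) i 0 = M i i1 & (M *m E2) i 0 = M i i2].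
  by rewrite !mulmx3 !vE; split; ring.
apply/matrixP => i; elim/ord3P.
- by have [<- _ _] := hc A i; have [<- _ _] := hc B i; rewrite h //; exact: IE0.
- by have [_ <- _] := hc A i; have [_ <- _] := hc B i; rewrite h //; exact: IE1.
by have [_ _ <-] := hc A i; have [_ _ <-] := hc B i; rewrite h //; exact: IE2.
Qed.

Lemma min_nat (T : Type) (P : set T) (f : T -> R) :
  (forall p, P p -> exists n : nat, f p = n%:R) -> P !=set0 ->
  exists2 p, P p & forall s, P s -> f p <= f s.
Proof.
move=> hf [t0 Pt0].
have ex : exists n, `[< exists p, P p /\ f p = n%:R >].
  by have [n e] := hf _ Pt0; exists n; apply/asboolP; exists t0.
case: (ex_minnP ex) => m /asboolP [p [Pp fp]] hm.
exists p => // s Ps; have [n e] := hf _ Ps.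
by rewrite fp e ler_nat; apply: hm; apply/asboolP; exists s.
Qed.

(** For the unimodular form this is indivisibility in $O^3$. The vector [y] also serves as a probe:
    pairing $cv$ with it shows that [c] is integral as soon as $cv$ is. *)
Definition prim v := Ivec v /\ exists2 y, Ivec y & herm y v = 1.

Lemma prim_scale c v : prim v -> Ivec (c *: v) -> Eis c.
Proof.
move=> [_ [y hy e]] h; have := Eis_herm h hy.
by rewrite hermZl -herm_cj e cj1 mulr1.
Qed.

(** A nonzero value [d] of smallest norm among the pairings of integral vectors with [v] divides all
    of them, by division with remainder. Dividing [v] by $\bar d$ then makes the value 1 occur and
    keeps the coordinates integral. *)
Lemma prim_multiple v : Ivec v -> v != 0 -> exists c, [/\ c != 0, Eis c^-1 & prim (c *: v)].
Proof.
move=> hv v0.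
have [] := @min_nat V [set y | Ivec y /\ herm y v != 0] (fun y => nm (herm y v)).
- by move=> y [hy _]; apply/Eis_nm/Eis_herm.
- apply: contrapT => h; move/eqP: v0; apply; apply: herm_nondeg => z hz.
  by apply/eqP; apply: contrapT => h'; apply: h; exists z; split=> //; apply/negP.
move=> y [hy d0] hmin; set d := herm y v in d0 hmin.
have hd : Eis d by apply: Eis_herm.
have div z : Ivec z -> exists2 c, Eis c & herm z v = c * d.
  move=> hz; have [c hc near] := Eis_near (herm z v / d).
  exists c => //; apply/eqP; rewrite -subr_eq0; apply/eqP.
  have hz' : Ivec (z - c *: y) by apply: IvecB => //; apply: IvecZ.
  have e : herm (z - c *: y) v = herm z v - c * d by rewrite !hE.
  have e2 : herm z v - c * d = (herm z v / d - c) * d by rewrite mulrBl divfK.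
  apply: contrapT => /eqP h; have := hmin (z - c *: y); rewrite /= e => /(_ (conj hz' h)).
  rewrite e2 nmM => h2; have d1 : 0 < nm d by rewrite nm_gt0.
  by move: h2 near d1; set a := nm _; set b := nm d; nra.
have dj0 : d^* != 0 by rewrite conjC_eq0.
have co z : Ivec z -> exists2 c, Eis c & herm ((d^*)^-1 *: v) z = c.
  move=> hz; have [c hc e] := div _ hz; exists c^*; first exact: EisJ.
  by rewrite hermZl -herm_cj e cjM mulrCA mulVf // mulr1.
exists (d^*)^-1; split; rewrite ?invr_eq0 ?invrK //; first exact: EisJ.
split; last by exists y => //; rewrite hermZr cjV cjK -/d mulVf.
elim/ord3P.
- by have [c hc e] := co _ IE2; rewrite -herm_E2 e.
- by have [c hc e] := co _ IE1; rewrite -herm_E1 e.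
by have [c hc e] := co _ IE0; rewrite -herm_E0 e.
Qed.

Lemma Krat_multiple v : (forall i, Krat (v i 0)) -> exists2 c, c != 0 & Ivec (c *: v).
Proof.
move=> h; have [x0 [y0 [n0 [hn0 e0]]]] := (KratE _).1 (h i0).
have [x1 [y1 [n1 [hn1 e1]]]] := (KratE _).1 (h i1).
have [x2 [y2 [n2 [hn2 e2]]]] := (KratE _).1 (h i2).
exists (n0%:~R * n1%:~R * n2%:~R); first by rewrite !mulf_neq0 // intr_eq0.
elim/ord3P; rewrite colZ.
- have -> : n0%:~R * n1%:~R * n2%:~R * v i0 0 = n1%:~R * n2%:~R * (n0%:~R * v i0 0) by ring.
  by rewrite e0; apply: EisM; [apply: EisM; exact: Eis_int|exact: Eis_eis].
- have -> : n0%:~R * n1%:~R * n2%:~R * v i1 0 = n0%:~R * n2%:~R * (n1%:~R * v i1 0) by ring.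
  by rewrite e1; apply: EisM; [apply: EisM; exact: Eis_int|exact: Eis_eis].
have -> : n0%:~R * n1%:~R * n2%:~R * v i2 0 = n0%:~R * n1%:~R * (n2%:~R * v i2 0) by ring.
by rewrite e2; apply: EisM; [apply: EisM; exact: Eis_int|exact: Eis_eis].
Qed.

(** From $4(x^2-xy+y^2)\ge 3x^2$ and its analogue for $y$, both coordinates lie between $\pm(2B+1)$;
    the shift by $2B+1$ places them in a finite type, over which a minimum can be taken. *)
Lemma Eis_bounded (B : nat) c : Eis c -> nm c <= B%:R ->
  exists x y : 'I_(4 * B + 4), c = eis R (x%:Z - (2 * B + 1)%:Z) (y%:Z - (2 * B + 1)%:Z).
Proof.
move=> [x [y ->]]; rewrite nm_eis => h.
have {}h : x ^+ 2 - x * y + y ^+ 2 <= B%:Z by rewrite -(ler_int R).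
have bound (k : int) : 3 * k ^+ 2 <= 4 * B%:Z -> - (2 * B + 1)%:Z <= k /\ k <= (2 * B + 1)%:Z.
  by move=> hk; split; rewrite leNgt; apply/negP => hk'; nia.
have [hx1 hx2] : - (2 * B + 1)%:Z <= x /\ x <= (2 * B + 1)%:Z.
  by apply: bound; have := sqr_ge0 (x - 2 * y); lia.
have [hy1 hy2] : - (2 * B + 1)%:Z <= y /\ y <= (2 * B + 1)%:Z.
  by apply: bound; have := sqr_ge0 (y - 2 * x); lia.
have bx : (absz (x + (2 * B + 1)%:Z)%R < 4 * B + 4)%N by lia.
have by_ : (absz (y + (2 * B + 1)%:Z)%R < 4 * B + 4)%N by lia.
by exists (Ordinal bx), (Ordinal by_) => /=; congr eis; lia.
Qed.

(** Coordinates are pairings with [E0], [E1], [E2], so [herm_CS] bounds them in terms of [q v].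
    Below any level there are only finitely many integral vectors. *)
Lemma q_min v (S : set V) : hr v < 0 -> S `<=` Ivec -> S !=set0 ->
  exists2 z, S z & forall t, S t -> q v z <= q v t.
Proof.
move=> nv SI [z0 Sz0].
pose K := q v E0 + q v E1 + q v E2.
have [B hB] : exists B : nat, q v z0 * K <= B%:R.
  exists (Num.truncn (q v z0 * K)).+1; exact/ltW/truncnS_gt.
pose T := ('I_(4 * B + 4) * 'I_(4 * B + 4))%type.
pose s (a : 'I_(4 * B + 4)) : int := a%:Z - (2 * B + 1)%:Z.
pose g (a : T * T * T) : V := cv3 (eis R (s a.1.1.1) (s a.1.1.2)) (eis R (s a.1.2.1) (s a.1.2.2))
  (eis R (s a.2.1) (s a.2.2)).
have small t : S t -> q v t <= q v z0 -> exists a, t = g a.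
  move=> St qt; have It := SI _ St.
  have bd e : q v e <= K -> nm (herm t e) <= B%:R.
    move=> he; apply: le_trans (herm_CS t e nv) _; apply: le_trans hB.
    by apply: ler_pM => //; apply: q_ge0.
  have g0 := q_ge0 E0 nv; have g1 := q_ge0 E1 nv; have g2 := q_ge0 E2 nv.
  have [k0 k1 k2] : [/\ q v E0 <= K, q v E1 <= K & q v E2 <= K].
    rewrite /K; move: (q v E0) (q v E1) (q v E2) g0 g1 g2 => a b c g0 g1 g2.
    by clear -g0 g1 g2; split; lra.
  have b0 : nm (t i0 0) <= B%:R by rewrite -herm_E2; apply: bd.
  have b1 : nm (t i1 0) <= B%:R by rewrite -herm_E1; apply: bd.
  have b2 : nm (t i2 0) <= B%:R by rewrite -herm_E0; apply: bd.
  have [x0 [y0 e0]] := Eis_bounded (It i0) b0.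
  have [x1 [y1 e1]] := Eis_bounded (It i1) b1.
  have [x2 [y2 e2]] := Eis_bounded (It i2) b2.
  by exists (((x0, y0), (x1, y1)), (x2, y2)); apply: cv_eq; rewrite /g !vE.
have [a0 e0] := small _ Sz0 (lexx _).
have Pa0 : `[< S (g a0) >] by apply/asboolP; rewrite -e0.
have [a /asboolP Sa amin] := @arg_minP _ R _ a0 (fun a => `[< S (g a) >]) (fun a => q v (g a)) Pa0.
exists (g a) => // t St.
have [h|h] := leP (q v t) (q v z0).
  by have [b e] := small _ St h; rewrite e; apply: amin; apply/asboolP; rewrite -e.
by apply: le_trans (ltW h); rewrite e0; apply: amin.
Qed.

Definition generates y e f := forall t, Ivec t ->
  exists a b c, [/\ Eis a, Eis b, Eis c & t = a *: y + b *: e + c *: f].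

Lemma generates_unimod y e f : Ivec y -> Ivec e -> Ivec f -> generates y e f ->
  nm (det3 y e f) = 1.
Proof.
move=> hy he hf g; have [a0 [b0 [c0 [ha0 hb0 hc0 e0]]]] := g _ IE0.
have [a1 [b1 [c1 [ha1 hb1 hc1 e1]]]] := g _ IE1.
have [a2 [b2 [c2 [ha2 hb2 hc2 e2]]]] := g _ IE2.
pose X := a0 * (b1 * c2 - b2 * c1) - a1 * (b0 * c2 - b2 * c0) + a2 * (b0 * c1 - b1 * c0).
have hX : Eis X by rewrite /X; apply: EisD; [apply: EisB|]; apply: EisM => //; apply: EisB; apply: EisM.
have hD := Eis_det3 hy he hf.
have e3 : X * det3 y e f = 1.
  have <- : det3 E0 E1 E2 = 1 by rewrite /det3 !vE; ring.
  by rewrite e0 e1 e2 /det3 !ccE /X; ring.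
have : nm X * nm (det3 y e f) = 1 by rewrite -nmM e3 nm1.
have [n ->] := Eis_nm hX; have [m ->] := Eis_nm hD; rewrite -natrM => /eqP.
by rewrite -[1]/(1%:R) eqr_nat muln_eq1 => /andP[_ /eqP ->].
Qed.

(** Both sides have the same pairings with the three generators: the cross product is orthogonal to
    [e] and [f], and pairs with [y] to the determinant. *)
Lemma cr_perp wv y e f : herm y wv = 1 -> herm e wv = 0 -> herm f wv = 0 ->
  generates y e f -> cr e f = (det3 y e f)^* *: wv.
Proof.
move=> yw ew fw g; apply/eqP; rewrite -subr_eq0; apply/eqP; apply: herm_nondeg => z hz.
have [a [b [c [_ _ _ ->]]]] := g _ hz.
rewrite !hE !herm_cr yw ew fw !detE.
by rewrite cjK; move: (det3 y e f) => d; ring.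
Qed.

Lemma gram_perp wv y e f : Ivec y -> Ivec e -> Ivec f ->
  herm y wv = 1 -> herm e wv = 0 -> herm f wv = 0 -> generates y e f ->
  herm e e * herm f f - herm e f * herm f e = - herm wv wv.
Proof.
move=> hy he hf yw ew fw g; apply: oppr_inj; rewrite opprK -cr_norm (cr_perp yw ew fw g).
have D1 := generates_unimod hy he hf g.
by rewrite hermZl hermZr cjK mulrA [X in X * _]mulrC nmE D1 mul1r.
Qed.

(** For the definite form too, the Gram determinant of two vectors is the value at their cross
    product; this is [gram3] for [v], [e], [f]. *)
Lemma q_cr v e f : hr v < 0 ->
  q v (cr e f) = q v e * q v f - nm (qf v e f).
Proof.
move=> nv; have v0 := hr_neq0 nv.
apply: rc_inj; rewrite -qE.
transitivity (rc (q v e) * rc (q v f) - rc (nm (qf v e f))); last by rewrite -rcM -rcN -rcD.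
rewrite -nmE (qfC v e f) -!qE.
rewrite {1}/qf cr_norm herm_cr -(herm_cj v (cr e f)) herm_cr.
have -> : 2 * (det3 v e f)^* * det3 v e f / herm v v = 2 * (det3 v e f * (det3 v e f)^*) / herm v v.
  by ring.
by rewrite gram3 /qf; hfield.
Qed.

(** The cross product of [e] and [f] is [wv] up to a unimodular factor, so the lattice orthogonal to
    [wv] has Gram determinant [q v wv]. Short vectors of the two are thereby related by duality. *)
Lemma q_perp_gram v wv y e f : hr v < 0 -> Ivec y -> Ivec e -> Ivec f ->
  herm y wv = 1 -> herm e wv = 0 -> herm f wv = 0 -> generates y e f ->
  q v e * q v f - nm (qf v e f) = q v wv.
Proof.
move=> nv hy he hf yw ew fw g; rewrite -q_cr // (cr_perp yw ew fw g) qZ nmJ.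
by rewrite (generates_unimod hy he hf g) mul1r.
Qed.

Lemma perp_nonzero wv y : Ivec wv -> Ivec y -> herm y wv = 1 ->
  exists e, [/\ Ivec e, herm e wv = 0 & e != 0].
Proof.
move=> hw hy yw; apply: contrapT => h.
have all0 t : Ivec t -> t = herm t wv *: y.
  move=> ht; apply/eqP; rewrite -subr_eq0; apply: contrapT => /negP n0; apply: h.
  exists (t - herm t wv *: y); split=> //.
    by apply: IvecB => //; apply: IvecZ => //; apply: Eis_herm.
  by rewrite !hE yw mulr1 subrr.
have d : det3 E0 E1 E2 = 1 by rewrite /det3 !vE; ring.
move/eqP: d; rewrite (all0 _ IE0) (all0 _ IE1) !detE !mulr0 eq_sym oner_eq0 //.
Qed.

(** Choosing [f] with a nonzero determinant of least norm makes every other determinant a multiple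
    of it. Only the coefficient of [f] is claimed integral here; that of [e] is treated during the
    reduction. *)
Lemma perp_complement wv y e : Ivec wv -> Ivec y -> herm y wv = 1 ->
   Ivec e -> herm e wv = 0 -> e != 0 ->
  exists f, [/\ Ivec f, herm f wv = 0, det3 y e f != 0 &
    forall z, Ivec z -> herm z wv = 0 -> exists a b, Eis b /\ z = a *: e + b *: f].
Proof.
move=> hw hy yw he ew e0.
have [] := @min_nat V [set f | [/\ Ivec f, herm f wv = 0 & det3 y e f != 0]] (fun f => nm (det3 y e f)).
- by move=> f [hf _ _]; apply/Eis_nm/Eis_det3.
- apply: contrapT => h.
  have all0 t : Ivec t -> det3 y e t = 0.
    move=> ht; apply/eqP; apply: contrapT => /negP n0; apply: h.
    exists (t - herm t wv *: y); split=> //.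
    + by apply: IvecB => //; apply: IvecZ => //; apply: Eis_herm.
    + by rewrite !hE yw mulr1 subrr.
    by rewrite -scaleNr !detE mulr0 addr0.
  move/eqP: e0; apply.
  have c0 : cr y e = 0.
    apply: herm_nondeg => z hz; rewrite herm_cr -[RHS](all0 _ hz) /det3; ring.
  (* This rewriting shows every coordinate of [e] as a combination of the $2\times2$ minors of [y]
     and [e], all of which vanish with the cross product. *)
  have : e = - (herm e wv) *: y + (herm y wv) *: e by rewrite ew yw oppr0 scale0r add0r scale1r.
  have cc : [/\ (y i0 0 * e i1 0 - y i1 0 * e i0 0) = 0, y i2 0 * e i0 0 - y i0 0 * e i2 0 = 0 & y i1 0 * e i2 0 - y i2 0 * e i1 0 = 0].
    have := congr1 (fun u : V => (u i0 0)^*) c0; have := congr1 (fun u : V => (u i1 0)^*) c0.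
    have := congr1 (fun u : V => (u i2 0)^*) c0.
    by rewrite /cr !ccE !cjK cj0.
  move=> ->; apply: cv_eq; rewrite !ccE !hermE; case: cc => k0 k1 k2.
  - transitivity ((y i0 0 * e i1 0 - y i1 0 * e i0 0) * - (wv i1 0)^* + (y i2 0 * e i0 0 - y i0 0 * e i2 0) * (wv i0 0)^*); first by ring.
    by rewrite k0 k1; ring.
  - transitivity ((y i0 0 * e i1 0 - y i1 0 * e i0 0) * (wv i2 0)^* - (y i1 0 * e i2 0 - y i2 0 * e i1 0) * (wv i0 0)^*); first by ring.
    by rewrite k0 k2; ring.
  transitivity (- (y i2 0 * e i0 0 - y i0 0 * e i2 0) * (wv i2 0)^* + (y i1 0 * e i2 0 - y i2 0 * e i1 0) * (wv i1 0)^*); first by ring.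
  by rewrite k1 k2; ring.
move=> f [hf fw d0] hmin; exists f; split=> // z hz zw.
have [b hb near] := Eis_near (det3 y e z / det3 y e f).
have D1 : 0 < nm (det3 y e f) by rewrite nm_gt0.
have dz : det3 y e (z - b *: f) = 0.
  apply/eqP; apply: contrapT => /negP n0.
  have := hmin (z - b *: f); rewrite /= => /(_ _) h.
  have {}h : nm (det3 y e f) <= nm (det3 y e (z - b *: f)).
    by apply: h; split; rewrite ?hE ?zw ?fw ?mulr0 ?subrr //; apply: IvecB => //; apply: IvecZ.
  move: h; rewrite -scaleNr !detE.
  have -> : det3 y e z + - b * det3 y e f = (det3 y e z / det3 y e f - b) * det3 y e f.
    by rewrite mulrBl divfK // mulNr.
  rewrite nmM; move: near D1; set m := nm _; set n := nm _; nra.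
have [a [a' [a'' E]]] := basis3 (z - b *: f) d0.
have a0 : a = 0.
  have : herm (z - b *: f) wv = 0 by rewrite !hE zw fw mulr0 subrr.
  by rewrite E !hE yw ew fw => <-; ring.
have a''0 : a'' = 0.
  move: dz; rewrite E a0 scale0r add0r !detE.
  by move/eqP; rewrite mulr0 add0r mulf_eq0 (negPf d0) orbF => /eqP.
exists a', b; split=> //.
by rewrite -[LHS](subrK (b *: f)) E a0 a''0 !scale0r add0r addr0.
Qed.

Lemma generates_perp wv y e f : Ivec wv -> herm y wv = 1 -> Ivec y ->
  (forall z, Ivec z -> herm z wv = 0 -> exists a b, [/\ Eis a, Eis b & z = a *: e + b *: f]) ->
  generates y e f.
Proof.
move=> hw yw hy h t ht.
have ha : Eis (herm t wv) by apply: Eis_herm.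
have [||a [b [ea eb E]]] := h (t - herm t wv *: y).
- by apply: IvecB => //; apply: IvecZ.
- by rewrite !hE yw mulr1 subrr.
by exists (herm t wv), a, b; split=> //; rewrite -addrA -E addrC subrK.
Qed.

(* Lagrange-Hermite reduction of the rank two lattice orthogonal to wv. *)
Lemma reduction v wv : hr v < 0 -> prim wv -> exists y e f,
  [/\ [/\ Ivec y, Ivec e & Ivec f],
      [/\ herm y wv = 1, herm e wv = 0 & herm f wv = 0],
      (forall z, Ivec z -> herm z wv = 0 -> exists a b, [/\ Eis a, Eis b & z = a *: e + b *: f]),
      [/\ e != 0, f != 0 & forall z, Ivec z -> herm z wv = 0 -> z != 0 -> q v e <= q v z]
    & 3 * nm (qf v f e) <= q v e ^+ 2].
Proof.
move=> nv [hw [y hy yw]].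
have [] := @q_min v [set z | [/\ Ivec z, herm z wv = 0 & z != 0]] nv.
- by move=> z [].
- by have [e he] := perp_nonzero hw hy yw; exists e.
move=> e [he ew e0] emin.
have [f0 [hf0 f0w d0 gen]] := perp_complement hw hy yw he ew e0.
have qe : 0 < q v e := q_gt0 nv e0.
have qe' : qf v e e != 0.
  by rewrite qE; apply/eqP => h; have := rc_inj h; move: qe => /lt0r_neq0/eqP.
(* Size reduction of the second vector: the remainder, of norm at most $1/3$, gives the last
   inequality of the statement. *)
have [c hc near] := Eis_near (qf v f0 e / qf v e e).
have hf : Ivec (f0 - c *: e) by apply: IvecB => //; apply: IvecZ.
have fw : herm (f0 - c *: e) wv = 0 by rewrite !hE f0w ew mulr0 subrr.
exists y, e, (f0 - c *: e); split=> //.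
- move=> z hz zw; have [a [b [hb E]]] := gen _ hz zw.
  have [a' ha' near'] := Eis_near a.
  have [k|k] := eqVneq (a - a') 0.
    exists (a + b * c), b; split=> //.
      apply: EisD; last exact: EisM.
      by move/eqP: k; rewrite subr_eq0 => /eqP ->.
    by apply: cv_eq; rewrite E !ccE; ring.
  (* If the coefficient were not integral, its remainder times [e] would be a lattice vector shorter
     than [e]. *)
  exfalso; have h1 : z - a' *: e - b *: f0 = (a - a') *: e by rewrite E scalerBl addrAC addrK.
  have /emin : [set z | [/\ Ivec z, herm z wv = 0 & z != 0]] ((a - a') *: e).
    split; last by rewrite scaler_eq0 negb_or k e0.
      by rewrite -h1; apply: IvecB; [apply: IvecB => //|]; apply: IvecZ.
    by rewrite hermZl ew mulr0.
  rewrite qZ leNgt => /negP; apply; move: near' qe.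
  by move: (nm (a - a')) (q v e) => m n; nra.
- split=> //; last by move=> z *; apply: emin.
  by apply: contraNneq d0 => h0; rewrite -[f0](subrK (c *: e)) h0 add0r !detE mulr0.
have -> : qf v (f0 - c *: e) e = (qf v f0 e / qf v e e - c) * qf v e e.
  by rewrite !qfE mulrBl divfK.
set k := qf v f0 e / qf v e e - c in near *; rewrite nmM qE nm_rc.
by move: near (sqr_ge0 (q v e)); move: (nm k) (q v e ^+ 2) => m n; nra.
Qed.

End Lattice.

(** * Eigenlines and invariant directions *)

Section Eigen.
Variable R : realType.
Local Notation C := R[i].
Local Notation V := 'cV[C]_3.
Implicit Types (u v z t : V) (A B : 'M[C]_3) (c d a b l : C).

Definition oframe v u u' : Prop := [/\ hr v < 0, 0 < hr u, 0 < hr u' &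
  [/\ herm u v = 0, herm u' v = 0 & herm u u' = 0]].

Lemma hr0_neq v : hr v != 0 -> herm v v != 0.
Proof. by move=> h; rewrite hrE; apply: contra h => /eqP/(@rc_inj _ _ 0) ->. Qed.

Lemma oframe_det v u u' : oframe v u u' -> det3 v u u' != 0.
Proof.
move=> [nv pu pu' [uv u'v uu']].
have v0 : herm v v != 0 by apply: hr0_neq; rewrite lt_eqF.
have u0 : herm u u != 0 by apply: hr0_neq; rewrite gt_eqF.
have u'0 : herm u' u' != 0 by apply: hr0_neq; rewrite gt_eqF.
apply/eqP => d0; have := gram3 v u u'.
rewrite d0 mul0r uv u'v uu' (herm_sym0 uv) (herm_sym0 u'v) (herm_sym0 uu').
move/eqP; rewrite !mul0r !subr0 addr0 eq_sym oppr_eq0 !mulf_eq0.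
by rewrite (negPf v0) (negPf u0) (negPf u'0).
Qed.

Lemma oframe_exp v u u' z : oframe v u u' ->
  z = (herm z v / herm v v) *: v + (herm z u / herm u u) *: u
      + (herm z u' / herm u' u') *: u'.
Proof.
move=> of_; have := of_; move=> [nv pu pu' [uv u'v uu']].
have v0 : herm v v != 0 by apply: hr0_neq; rewrite lt_eqF.
have u0 : herm u u != 0 by apply: hr0_neq; rewrite gt_eqF.
have u'0 : herm u' u' != 0 by apply: hr0_neq; rewrite gt_eqF.
have [a [b [c ->]]] := basis3 z (oframe_det of_).
rewrite !hE uv u'v uu' (herm_sym0 uv) (herm_sym0 u'v) (herm_sym0 uu').
by rewrite !mulr0 !addr0 !add0r !mulfK.
Qed.

Lemma oframe_sym v u u' : oframe v u u' -> oframe v u' u.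
Proof.
move=> [nv pu pu' [uv u'v uu']].
split; [exact: nv|exact: pu'|exact: pu|split; [exact: u'v|exact: uv|exact: herm_sym0]].
Qed.

Lemma cr_oframe v u : hr v < 0 -> herm u v = 0 -> u != 0 -> oframe v u (cr v u).
Proof.
move=> nv uv u0; have pu := perp_pos nv uv u0.
have e : hr (cr v u) = - hr v * hr u.
  apply: rc_inj; rewrite -hrE cr_norm uv (herm_sym0 uv) mulr0 subr0 !hrE rcM rcN mulNr //.
split; [exact: nv|exact: pu|by rewrite e mulr_gt0 // oppr_gt0|split; first exact: uv].
  by apply: herm_sym0; rewrite herm_cr det3_12.
by rewrite herm_cr det3_13.
Qed.

Lemma perp_exists v : hr v < 0 -> exists2 u, herm u v = 0 & u != 0.
Proof.
move=> nv; have v2 := neg_last nv.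
exists (cv3 (- (v i1 0)^*) (v i2 0)^* 0); first by rewrite hermE !vE; ring.
apply/eqP => /(congr1 (fun t : V => t i1 0)); rewrite vE mxE => /eqP.
by rewrite conjC_eq0; apply/negP.
Qed.

Lemma perp_line v u u' z : oframe v u u' -> herm z v = 0 -> herm z u = 0 ->
  z = (herm z u' / herm u' u') *: u'.
Proof.
by move=> of_ zv zu; rewrite {1}(oframe_exp z of_) zv zu !mul0r !scale0r !add0r.
Qed.

Lemma eigen_third A v u l a : preserving A -> hr v < 0 -> herm u v = 0 -> u != 0 ->
  A *m v = l *: v -> A *m u = a *: u -> exists b, A *m cr v u = b *: cr v u.
Proof.
move=> hA nv uv u0 ev eu; have of_ := cr_oframe nv uv u0.
have [_ pu pu' [_ u'v uu']] := of_.
have l1 := eigen_unit hA ev (ltr0_neq0 nv).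
have a1 := eigen_unit hA eu (lt0r_neq0 pu).
have nz c : nm c = 1 -> c != 0 by move=> h; rewrite -nm_gt0 h ltr01.
exists (herm (A *m cr v u) (cr v u) / herm (cr v u) (cr v u)).
apply: (perp_line of_).
  exact: (eigen_perp hA ev (nz _ l1)).
exact: (eigen_perp hA eu (nz _ a1) (herm_sym0 uu')).
Qed.

Definition eframe A v l u a u' b : Prop := [/\ oframe v u u',
  [/\ A *m v = l *: v, A *m u = a *: u & A *m u' = b *: u'] &
  [/\ nm l = 1, nm a = 1 & nm b = 1]].

Lemma eframe_third A v u l a : preserving A -> hr v < 0 -> herm u v = 0 -> u != 0 ->
  A *m v = l *: v -> A *m u = a *: u -> exists b, eframe A v l u a (cr v u) b.
Proof.
move=> hA nv uv u0 ev eu; have of_ := cr_oframe nv uv u0.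
have [b eb] := eigen_third hA nv uv u0 ev eu; exists b.
have [_ pu pu' _] := of_.
split=> //; split; [exact: (eigen_unit hA ev (ltr0_neq0 nv))| exact: (eigen_unit hA eu (lt0r_neq0 pu))|].
exact: (eigen_unit hA eb (lt0r_neq0 pu')).
Qed.

Lemma quadratic (s p : C) : exists x, x ^+ 2 - s * x + p = 0.
Proof.
pose r := sqrtC (s ^+ 2 - 4 * p); have hr2 : r ^+ 2 = s ^+ 2 - 4 * p by rewrite sqrtCK.
exists ((s + r) / 2); apply: (mulfI (_ : (4 : C) != 0)); first by rewrite pnatr_eq0.
rewrite mulr0; transitivity (r ^+ 2 - s ^+ 2 + 4 * p); last by rewrite hr2; ring.
by field.
Qed.

(** Unitarity makes the complement of [v] invariant. One eigenvector there is found by a quadratic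
    equation, and the cross product with [v] is the second. *)
Lemma eigenframe A v l : preserving A -> A *m v = l *: v -> hr v < 0 ->
  exists u a u' b, eframe A v l u a u' b.
Proof.
move=> hA ev nv.
suff [u [a [uv u0 eu]]] : exists u a, [/\ herm u v = 0, u != 0 & A *m u = a *: u].
  have [b h] := eframe_third hA nv uv u0 ev eu.
  by exists u, a, (cr v u), b.
have [u uv u0] := perp_exists nv.
have of_ := cr_oframe nv uv u0; set u' := cr v u in of_.
clearbody u'.
have [_ pu pu' [_ u'v uu']] := of_.
have l1 := eigen_unit hA ev (ltr0_neq0 nv).
have l0 : l != 0 by rewrite -nm_gt0 l1 ltr01.
have exp2 z : herm z v = 0 -> exists s s' : C, A *m z = s *: u + s' *: u'.
  move=> zv; have h := eigen_perp hA ev l0 zv.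
  exists (herm (A *m z) u / herm u u), (herm (A *m z) u' / herm u' u').
  by rewrite {1}(oframe_exp (A *m z) of_) h mul0r scale0r add0r.
have [h11 [h21 e1]] := exp2 _ uv; have [h12 [h22 e2]] := exp2 _ u'v.
have u'0 : u' != 0 by apply/eqP => e; move: pu'; rewrite e /hr herm0l ltxx.
have [h120|h120] := eqVneq h12 0.
  by exists u', h22; split=> //; rewrite e2 h120 scale0r add0r.
have [a ha] := quadratic (h11 + h22) (h11 * h22 - h12 * h21).
(* The standard eigenvector of the $2\times2$ matrix $(h_{ij})$, nonzero because $h_{12}\ne0$. *)
exists (h12 *: u + (a - h11) *: u'), a; split.
- by rewrite !hE uv u'v; ring.
- apply/eqP => /(congr1 (fun t => herm t u)); rewrite !hE (herm_sym0 uu') mulr0 addr0 => /eqP.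
  by rewrite mulf_eq0 (negPf h120) /=; apply/negP/hr0_neq; rewrite gt_eqF.
rewrite mulmxDr -!scalemxAr e1 e2; apply: cv_eq; rewrite !ccE.
- transitivity (h12 * a * u i0 0 + (h12 * h21 + (a - h11) * h22) * u' i0 0); first by ring.
  have -> : h12 * h21 + (a - h11) * h22 = a * (a - h11).
    by apply/eqP; rewrite -subr_eq0; apply/eqP; rewrite -oppr0 -ha; ring.
  by ring.
- transitivity (h12 * a * u i1 0 + (h12 * h21 + (a - h11) * h22) * u' i1 0); first by ring.
  have -> : h12 * h21 + (a - h11) * h22 = a * (a - h11).
    by apply/eqP; rewrite -subr_eq0; apply/eqP; rewrite -oppr0 -ha; ring.
  by ring.
transitivity (h12 * a * u i2 0 + (h12 * h21 + (a - h11) * h22) * u' i2 0); first by ring.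
have -> : h12 * h21 + (a - h11) * h22 = a * (a - h11).
  by apply/eqP; rewrite -subr_eq0; apply/eqP; rewrite -oppr0 -ha; ring.
by ring.
Qed.

Lemma eframe_tr A v l u a u' b : eframe A v l u a u' b -> mxtr A = l + a + b.
Proof.
move=> [of_ [ev eu eu'] _]; apply: (mulIf (oframe_det of_)).
by rewrite det3_tr ev eu eu' !detE; ring.
Qed.

Lemma eframe_det A v l u a u' b : eframe A v l u a u' b -> mxdet A = l * a * b.
Proof.
move=> [of_ [ev eu eu'] _]; apply: (mulIf (oframe_det of_)).
by rewrite -det3_mul ev eu eu' !detE; ring.
Qed.

(** The derivative of [A] at the point $\mathbb{C}v$ has eigenvalues $a/l$ and $b/l$; the condition
    says that neither is 1, that is, no tangent direction is fixed. *)
Definition simple_at A v l := forall u, herm u v = 0 -> A *m u = l *: u -> u = 0.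

Lemma eframe_simple A v l u a u' b : eframe A v l u a u' b -> simple_at A v l ->
  a != l /\ b != l.
Proof.
move=> [[nv pu pu' [uv u'v uu']] [ev eu eu'] _] hs; split; apply/eqP => h.
  by move: pu; rewrite (hs u) -?h // /hr herm0l ltxx.
by move: pu'; rewrite (hs u') -?h // /hr herm0l ltxx.
Qed.

(** Eigenvectors for distinct unimodular eigenvalues are orthogonal, while two negative vectors
    never are. *)
Lemma neg_eigen_unique A v l u c : preserving A -> hr v < 0 -> A *m v = l *: v ->
  simple_at A v l -> hr u < 0 -> A *m u = c *: u ->
  exists2 d, d != 0 & u = d *: v.
Proof.
move=> hA nv ev hs nu eu.
have l1 := eigen_unit hA ev (ltr0_neq0 nv).
have [cl|cl] := eqVneq c l.
  have v0 := hr_neq0 nv.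
  have h0 : u - (herm u v / herm v v) *: v = 0.
    apply: hs; first by rewrite !hE divfK // subrr.
    by rewrite mulmxBr -scalemxAr ev eu cl scalerBr !scalerA [_ * l]mulrC.
  exists (herm u v / herm v v); last by apply/eqP; rewrite -subr_eq0 h0.
  apply/eqP => e; move: h0; rewrite e scale0r subr0 => u0.
  by move: nu; rewrite u0 /hr herm0l ltxx.
exfalso; have : herm u v = 0.
  have := hA u v; rewrite ev eu !hE => /eqP; rewrite -subr_eq0 mulrA -[X in _ - X]mul1r -mulrBl.
  rewrite mulf_eq0 => /orP[/eqP h|/eqP //]; move/eqP: cl; case.
  have := nm_eq1 l1 => h1; rewrite -[c]mulr1 -h1 mulrCA (_ : c * l^* = 1) ?mulr1 //.
  by apply/eqP; rewrite -subr_eq0 h.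
by move=> uv; have := perp_ge0 nv uv; rewrite leNgt nu.
Qed.

Lemma det22 (p q r s x y : C) : p * x + q * y = 0 -> r * x + s * y = 0 ->
  (x != 0) || (y != 0) -> p * s = q * r.
Proof.
move=> e1 e2 h; apply/eqP; rewrite -subr_eq0.
case/orP: h => h0; apply/eqP; apply: (mulIf h0); rewrite mul0r.
  transitivity (s * (p * x + q * y) - q * (r * x + s * y)); first by ring.
  by rewrite e1 e2; ring.
transitivity (p * (r * x + s * y) - r * (p * x + q * y)); first by ring.
by rewrite e1 e2; ring.
Qed.

(* If each product of two elements of S has an invariant line direction in the
   tangent space with the eigenvalue of v, then so has S as a whole: comparing
   h and A h forces the (u, u) entry of h to equal the eigenvalue, and then
   unitarity makes u an eigenvector. *)
Lemma common_perp_eigenvector v (S : set 'M[C]_3) : hr v < 0 ->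
  (forall A, S A -> preserving A) -> (forall A B, S A -> S B -> S (A *m B)) ->
  (forall A, S A -> exists l, A *m v = l *: v) ->
  (forall A l, S A -> A *m v = l *: v -> exists2 z, herm z v = 0 & z != 0 /\ A *m z = l *: z) ->
  exists2 u, herm u v = 0 & u != 0 /\ forall A l, S A -> A *m v = l *: v -> A *m u = l *: u.
Proof.
move=> nv Sp SM Sv Sz.
have v0 : v != 0 by apply/eqP => e; move: nv; rewrite e /hr herm0l ltxx.
have [all1|] := pselect (forall A l z, S A -> A *m v = l *: v -> herm z v = 0 -> A *m z = l *: z).
  have [u uv u0] := perp_exists nv; exists u => //; split=> // A l SA ev; exact: all1.
move/existsNP => [A0 /existsNP[l0 /existsNP[z1 /not_implyP[SA0 /not_implyP[ev0 /not_implyP[z1v nz1]]]]]].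
have [u uv [u0 eu]] := Sz _ _ SA0 ev0; exists u => //; split=> // h m Sh evh.
have [b ef] := eframe_third (Sp _ SA0) nv uv u0 ev0 eu.
have [of_ [_ _ eu'] [l01 _ b1]] := ef; set u' := cr v u in of_ eu' ef.
clearbody u'.
have [_ pu pu' [_ u'v uu']] := of_.
have bl : b != l0.
  apply/eqP => bl; apply: nz1.
  rewrite (oframe_exp z1 of_) z1v mul0r scale0r add0r mulmxDr -!scalemxAr eu eu' bl.
  by rewrite scalerDr !scalerA [l0 * _]mulrC [l0 * _ in RHS]mulrC.
have m1 := eigen_unit (Sp _ Sh) evh (ltr0_neq0 nv).
have nz c : nm c = 1 -> c != 0 by move=> e; rewrite -nm_gt0 e ltr01.
have exp2 z : herm z v = 0 -> exists s s' : C, h *m z = s *: u + s' *: u'.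
  move=> zv; have h0 := eigen_perp (Sp _ Sh) evh (nz _ m1) zv.
  exists (herm (h *m z) u / herm u u), (herm (h *m z) u' / herm u' u').
  by rewrite {1}(oframe_exp (h *m z) of_) h0 mul0r scale0r add0r.
have [h11 [h21 e1]] := exp2 _ uv; have [h12 [h22 e2]] := exp2 _ u'v.
have hu0 : herm u u != 0 by apply: hr0_neq; rewrite gt_eqF.
have hu'0 : herm u' u' != 0 by apply: hr0_neq; rewrite gt_eqF.
have coords x y x' y' : x *: u + y *: u' = x' *: u + y' *: u' -> x = x' /\ y = y'.
  move=> e; split.
    have := congr1 (fun t => herm t u) e; rewrite !hE (herm_sym0 uu') !mulr0 !addr0.
    exact: mulIf.
  have := congr1 (fun t => herm t u') e; rewrite !hE uu' !mulr0 !add0r.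
  exact: mulIf.
have nzc z : herm z v = 0 -> z != 0 -> exists x y, z = x *: u + y *: u' /\ ((x != 0) || (y != 0)).
  move=> zv z0; exists (herm z u / herm u u), (herm z u' / herm u' u').
  have E : z = (herm z u / herm u u) *: u + (herm z u' / herm u' u') *: u'.
    by rewrite {1}(oframe_exp z of_) zv mul0r scale0r add0r.
  split=> //; apply: contraNT z0; rewrite negb_or !negbK => /andP[/eqP k1 /eqP k2].
  by rewrite E k1 k2 !scale0r addr0.
have d1 : (h11 - m) * (h22 - m) = h12 * h21.
  have [z zv [z0 ez]] := Sz _ _ Sh evh; have [x [y [E xy]]] := nzc _ zv z0.
  have : (h11 * x + h12 * y) *: u + (h21 * x + h22 * y) *: u' = (m * x) *: u + (m * y) *: u'.
    have -> : (m * x) *: u + (m * y) *: u' = m *: z by rewrite E scalerDr !scalerA.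
    rewrite -ez E mulmxDr -!scalemxAr e1 e2; apply: cv_eq; rewrite !ccE; ring.
  move=> /coords [k1 k2]; apply: (@det22 _ _ _ _ x y) => //.
    by rewrite mulrBl addrAC k1 subrr.
  by rewrite mulrBl addrA k2 subrr.
have d2 : (l0 * h11 - l0 * m) * (b * h22 - l0 * m) = (l0 * h12) * (b * h21).
  have evp : (A0 *m h) *m v = (l0 * m) *: v by rewrite -mulmxA evh -scalemxAr ev0 scalerA mulrC.
  have [z zv [z0 ez]] := Sz _ _ (SM _ _ SA0 Sh) evp; have [x [y [E xy]]] := nzc _ zv z0.
  have : (l0 * h11 * x + l0 * h12 * y) *: u + (b * h21 * x + b * h22 * y) *: u' = (l0 * m * x) *: u + (l0 * m * y) *: u'.
    have -> : (l0 * m * x) *: u + (l0 * m * y) *: u' = (l0 * m) *: z by rewrite E scalerDr !scalerA.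
    rewrite -ez E mulmxDr -!scalemxAr -!mulmxA e1 e2 !mulmxDr -!scalemxAr eu eu'.
    apply: cv_eq; rewrite !ccE; ring.
  move=> /coords [k1 k2]; apply: (@det22 _ _ _ _ x y) => //.
    by rewrite mulrBl addrAC k1 subrr.
  by rewrite mulrBl addrA k2 subrr.
(* In the combination of [d1] and [d2] the terms $h_{11}h_{22}$ and $h_{12}h_{21}$ cancel; what is
   left factors, and $b\ne l_0$ leaves only $h_{11}=m$. *)
have h11m : h11 = m.
  have : l0 * m * (b - l0) * (h11 - m) = 0.
    transitivity ((l0 * h11 - l0 * m) * (b * h22 - l0 * m) - l0 * b * ((h11 - m) * (h22 - m))); first by ring.
    by rewrite d2 d1; ring.
  move/eqP; rewrite !mulf_eq0 (negPf (nz _ l01)) (negPf (nz _ m1)) (subr_eq0 b) (negPf bl) /=.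
  by rewrite subr_eq0 => /eqP.
have h210 : h21 = 0.
  have := preserving_hr u (Sp _ Sh); rewrite e1 h11m => e.
  have : nm h21 * hr u' = 0.
    have e' : hr (m *: u + h21 *: u') = nm m * hr u + nm h21 * hr u'.
      apply: rc_inj; rewrite -hrE rcD !rcM -!nmE -!hrE !hE uu' (herm_sym0 uu').
      by ring.
    by move: e; rewrite e' m1 mul1r; move: (hr u) (nm h21 * hr u') => ? ? ?; lra.
  by move/eqP; rewrite mulf_eq0 (gt_eqF pu') orbF nm_eq0 => /eqP.
by rewrite e1 h11m h210 scale0r addr0.
Qed.

End Eigen.

(** * Traces of integral unitary matrices *)

Section TraceCheck.

(** The pair $(x,y)$ encodes $x+y\omega$, so that the finite check is a computation with
    integers. *)
Definition emul (p q : int * int) : int * int :=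
  (p.1 * q.1 - p.2 * q.2, p.1 * q.2 + p.2 * q.1 - p.2 * q.2).
Definition ecj (p : int * int) : int * int := (p.1 - p.2, - p.2).
Definition enm (p : int * int) : int := p.1 * p.1 - p.1 * p.2 + p.2 * p.2.
Definition ecube (p : int * int) := emul p (emul p p).

(** Here [p] is a trace $t$ and [e] a determinant. The premise is Goldman's inequality
    $|t|^4+18|t|^2-27<8\,\mathrm{Re}(\bar e t^3)$, which characterizes three distinct unimodular
    eigenvalues; twice the real part of $x+y\omega$ is $2x-y$. *)
Definition trace_ok (p e : int * int) : bool :=
  let n := enm p in let z := emul (ecj e) (ecube p) in
  (n * n + 18 * n - 27 < 4 * (2 * z.1 - z.2)) ==>
    [|| n == 0, n == 1 | ecube p == emul (8, 0) e].

Definition small_ints : seq int := [:: -3; -2; -1; 0; 1; 2; 3].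
Definition eis_units : seq (int * int) :=
  [:: (1, 0); (1, 1); (0, 1); (-1, 0); (-1, -1); (0, -1)].

(** A sum of three unimodular numbers has squared modulus at most 9, and $3x^2\le36$ confines both
    coordinates to $[-3,3]$; determinants are among the six units. *)
Lemma trace_ok_small : all (fun e => all (fun x => all (fun y => (enm (x, y) <= 9) ==> trace_ok (x, y) e)
  small_ints) small_ints) eis_units.
Proof. by vm_compute. Qed.

End TraceCheck.

Ltac eis := repeat first [assumption | exact: Eis1 | exact: Eis0 | exact: Eisw | exact: Eis_nat
  | apply: EisX | apply: EisN | apply: EisJ | apply: EisB | apply: EisD | apply: EisM].

Section Traces.
Variable R : realType.
Local Notation Re := (@complex.Re R).
Local Notation w := (omega : R[i]).
Local Notation C := R[i].
Local Notation V := 'cV[C]_3.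
Local Notation rc := (real_complex R).
Implicit Types (u v z : V) (A B : 'M[C]_3) (c d a b l : C).

Definition ev (p : int * int) : C := eis R p.1 p.2.

Lemma evM p q : ev (emul p q) = ev p * ev q.
Proof. by rewrite /ev eisM. Qed.
Lemma evJ p : ev (ecj p) = (ev p)^*.
Proof. by rewrite /ev eisJ. Qed.
Lemma ev_nm p : nm (ev p) = (enm p)%:~R.
Proof. by rewrite /ev nm_eis /enm !expr2. Qed.
Lemma ev_cube p : ev (ecube p) = ev p ^+ 3.
Proof. by rewrite /ecube !evM !exprS expr0 mulr1. Qed.
Lemma ev_Re p : 2 * Re (ev p) = (2 * p.1 - p.2)%:~R.
Proof. by rewrite /ev Re_eis intrB intrM; field. Qed.

Lemma w1_ev k : (k < 6)%N -> exists2 e, e \in eis_units & (1 + w) ^+ k = ev e.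
Proof.
have e1 : (1 + w) = ev (1, 1) by rewrite /ev /eis /= mul1r.
have e0 : 1 = ev (1, 0) by rewrite /ev /eis /= mul0r addr0.
rewrite e1; case: k => [|[|[|[|[|[|//]]]]]] _; rewrite ?exprS ?expr0 ?mulr1 -?evM.
- by exists (1, 0).
- by exists (1, 1).
- by exists (0, 1).
- by exists (-1, 0).
- by exists (-1, -1).
by exists (0, -1).
Qed.

(* The discriminant of a monic cubic with unimodular roots l, a, b, written in
   terms of the trace and the determinant. *)
Lemma disc_trace l a b : nm l = 1 -> nm a = 1 -> nm b = 1 ->
  nm (l + a + b) ^+ 2 + 18 * nm (l + a + b) - 27
   - 4 * (2 * Re ((l * a * b)^* * (l + a + b) ^+ 3))
  = - nm ((l - a) * (a - b) * (b - l)).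
Proof.
move=> l1 a1 b1; apply: rc_inj.
have nz c : nm c = 1 -> c != 0 by move=> h; rewrite -nm_gt0 h ltr01.
have h (x y : R) : rc (x ^+ 2 + 18 * x - 27 - 4 * (2 * y)) =
    rc x ^+ 2 + 18 * rc x - 27 - 4 * rc (2 * y).
  by rewrite !(rcD, rcN, rcX, rcM, rcn).
rewrite h rcN -addJ -!nmE !cjE.
rewrite (nm1_inv l1) (nm1_inv a1) (nm1_inv b1).
by field; rewrite !nz.
Qed.

Lemma nm_sum3 l a b : nm l = 1 -> nm a = 1 -> nm b = 1 -> nm (l + a + b) <= 9.
Proof.
move=> l1 a1 b1.
have h2 : nm (l + a) <= (1 + 1) ^+ 2 by apply: nm_sum_le; rewrite ?ler01 ?l1 ?a1 ?expr1n.
have := @nm_sum_le R (1 + 1) 1 (l + a) b; rewrite addr_ge0 ?ler01 // b1 expr1n lexx => /(_ isT isT h2 isT).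
by move=> h; have -> : (9 : R) = (1 + 1 + 1) ^+ 2; [ring | exact: h].
Qed.

Lemma trace_finite l a b : nm l = 1 -> nm a = 1 -> nm b = 1 ->
  l != a -> a != b -> b != l -> Eis (l + a + b) -> Eis (l * a * b) ->
  [\/ l + a + b = 0, nm (l + a + b) = 1 | (l + a + b) ^+ 3 = 8 * (l * a * b)].
Proof.
move=> l1 a1 b1 la ab bl ht he.
have e1 : nm (l * a * b) = 1 by rewrite !nmM l1 a1 b1 !mulr1.
have [k hk ek] := Eis_unit he e1; have [e eU eE] := w1_ev hk.
have [x [y tE]] := ht.
have tE' : l + a + b = ev (x, y) by [].
have n9 := nm_sum3 l1 a1 b1; rewrite tE' ev_nm (ler_int R _ 9) in n9.
have bd (i j : int) : i * i - i * j + j * j <= 9 -> -3 <= i <= 3.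
  move=> h; have := sqr_ge0 (i - 2 * j); rewrite expr2 => h2.
  by apply/andP; split; rewrite leNgt; apply/negP => h3; nia.
have bx : -3 <= x <= 3 by apply: bd n9.
have by_ : -3 <= y <= 3 by apply: (bd y x); move: n9; rewrite /enm /=; lia.
have mem i : -3 <= i <= 3 -> i \in small_ints.
  move=> hi; have : i = -3 \/ i = -2 \/ i = -1 \/ i = 0 \/ i = 1 \/ i = 2 \/ i = 3 by lia.
  by move=> [|[|[|[|[|[|]]]]]] ->.
have := trace_ok_small => /allP /(_ _ eU) /allP /(_ _ (mem _ bx)) /allP /(_ _ (mem _ by_)).
rewrite n9 /= => /implyP.
have disc := disc_trace l1 a1 b1.
have pos : 0 < nm ((l - a) * (a - b) * (b - l)).
  by rewrite nm_gt0 !mulf_neq0 ?subr_eq0.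
case: (boolP (_ < _)) => [_ /(_ isT)|/negP nlt _]; last first.
  exfalso; apply: nlt.
  rewrite -(ltr_int R) [(4 * _)%:~R]intrM -ev_Re evM evJ ev_cube -eE -ek.
  move: (ev_nm (x, y)); rewrite -tE'; move: (enm (x, y)) => n nE.
  rewrite !(intrB, intrD, intrM) -nE.
  by move: disc pos; move: (nm _) (nm _) (Re _) => p q r; rewrite expr2; lra.
case/orP => [/eqP h|/orP[/eqP h|/eqP h]].
- by apply: Or31; apply/eqP; rewrite -nm_eq0 tE' ev_nm h.
- by apply: Or32; rewrite tE' ev_nm h.
apply: Or33; rewrite tE' -ev_cube h evM ek eE; congr (_ * _).
by rewrite /ev /eis /= mul0r addr0.
Qed.

Lemma Krat_Eis c : Eis c -> Krat c.
Proof. by move=> [x [y ->]]; apply/KratE; exists x, y, 1; rewrite mul1r. Qed.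

Lemma Krat_div c d : Eis c -> Eis d -> d != 0 -> Krat (c / d).
Proof.
move=> hc hd d0; have [x [y e]] := EisM hc (EisJ hd).
have [n nE] := Eis_nm hd.
have n0 : n != 0%N.
  by apply/eqP => n0; move: d0; rewrite -nm_eq0 nE n0 eqxx.
apply/KratE; exists x, y, n; split=> //.
have -> : n%:~R = d * d^* :> C by rewrite nmE nE; exact/esym/rcn.
by rewrite -e; field.
Qed.

Lemma sqr_eq c d : c ^+ 2 = d ^+ 2 -> c = d \/ c = - d.
Proof. by move/eqP; rewrite eqf_sqr => /orP[] /eqP ->; [left|right]. Qed.

(** In [TCi] the eigenvalue is $\pm i$ times a unit. In [TC9] the characteristic polynomial is
    $X^3-e$, so that, $e$ being a unit of $O$, [l] is a sixth root of unity or has order 9 or 18. *)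
Inductive trace_case l a b : Prop :=
| TCrat of Krat l
| TCi c of Eis c & nm c = 1 & l ^+ 2 = - c ^+ 2 & (a = - l /\ Eis b) \/ (b = - l /\ Eis a)
| TC9 of l + a + b = 0 & (l ^+ 3 = l * a * b /\ a ^+ 3 = l * a * b /\ b ^+ 3 = l * a * b).

(** For unimodular roots the characteristic polynomial is $X^3-tX^2+e\bar tX-e$, determined by $t$
    and $e$. It is factored for each of the traces left by [trace_finite]; the case $a=b$, where the
    discriminant vanishes, is treated apart. *)
Lemma trace_cases l a b : nm l = 1 -> nm a = 1 -> nm b = 1 ->
  l != a -> b != l -> Eis (l + a + b) -> Eis (l * a * b) -> trace_case l a b.
Proof.
move=> l1 a1 b1 la bl ht he.
have nz c : nm c = 1 -> c != 0 by move=> h; rewrite -nm_gt0 h ltr01.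
set t := l + a + b in ht *; set e := l * a * b in he *.
have tj : l * a + l * b + a * b = e * t^*.
  by rewrite /t /e !cjE (nm1_inv l1) (nm1_inv a1) (nm1_inv b1); field; rewrite !nz.
have het : Eis (e * t^*) by apply: EisM => //; apply: EisJ.
have [ab|ab] := eqVneq a b.
  apply: TCrat.
  (* With $s=e\bar t$, the double root of the cubic is $a=(ts-9e)/(2(t^2-3s))$, and $l=t-2a$. *)
  pose num := t * (2 * (t ^+ 2 - 3 * (e * t^*))) - 2 * (t * (e * t^*) - 9 * e).
  pose den := 2 * (t ^+ 2 - 3 * (e * t^*)).
  have dE : den = 2 * (l - a) ^+ 2 by rewrite /den -tj /t -ab; ring.
  have d0 : den != 0 by rewrite dE mulf_neq0 ?pnatr_eq0 // expf_neq0 // subr_eq0.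
  have -> : l = num / den.
    by apply: (mulIf d0); rewrite divfK // dE /num -tj /t /e -ab; ring.
  have E2 n : Eis (n%:R : C) := Eis_nat R n.
  apply: Krat_div => //; rewrite /num /den.
    by eis.
  by eis.
have root x : (x - l) * (x - a) * (x - b) = x ^+ 3 - t * x ^+ 2 + e * t^* * x - e.
  by rewrite -tj /t /e; ring.
have rl : l ^+ 3 - t * l ^+ 2 + e * t^* * l - e = 0 by rewrite -root subrr !mul0r.
have ra : a ^+ 3 - t * a ^+ 2 + e * t^* * a - e = 0 by rewrite -root subrr mulr0 !mul0r.
have rb : b ^+ 3 - t * b ^+ 2 + e * t^* * b - e = 0 by rewrite -root subrr mulr0.
have [t0|t1|t8] := trace_finite l1 a1 b1 la ab bl ht he.
- apply: TC9 => //; rewrite -/e; move: rl ra rb; rewrite -/t in t0; rewrite t0 cj0 mulr0 !mul0r !subr0 !addr0.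
  by move=> /eqP; rewrite subr_eq0 => /eqP -> /eqP; rewrite subr_eq0 => /eqP -> /eqP; rewrite subr_eq0 => /eqP ->.
- have tt : t * t^* = 1 by apply: nm_eq1.
  have e1 : nm e = 1 by rewrite /e !nmM l1 a1 b1 !mulr1.
  (* For $|t|=1$ the cubic splits as $(X-t)(X^2+e\bar t)$. *)
  have f : (l - t) * (l ^+ 2 + e * t^*) = 0.
    have -> : (l - t) * (l ^+ 2 + e * t^*) = l ^+ 3 - t * l ^+ 2 + e * t^* * l - e * (t * t^*) by ring.
    by rewrite tt mulr1.
  move/eqP: f; rewrite mulf_eq0 => /orP[].
    by rewrite subr_eq0 => /eqP lt; apply: TCrat; rewrite lt; apply: Krat_Eis.
  rewrite addr_eq0 => /eqP l2.
  have hu : Eis (- (e * t^*)) by apply: EisN.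
  have n1 : nm (- (e * t^*)) = 1 by rewrite nmN nmM nmJ e1 t1 mulr1.
  have [k hk kE] := Eis_unit hu n1; rewrite kE in l2.
  have Ew n : Eis ((1 + w) ^+ n) by apply/EisX/Eis_1w.
  have sq j : l ^+ 2 = ((1 + w) ^+ j) ^+ 2 -> trace_case l a b.
    by move=> /sqr_eq [] lE; apply: TCrat; apply: Krat_Eis; rewrite lE; [|apply: EisN].
  have et : e * t^* = - l ^+ 2 by rewrite l2 -kE opprK.
  have eE : e = - l ^+ 2 * t by rewrite -et -mulrA [_^* * _]mulrC tt mulr1.
  have other : (a = - l /\ Eis b) \/ (b = - l /\ Eis a).
    have l0 := nz _ l1.
    have abE : a * b = - l * t by apply: (mulfI l0); rewrite mulrA -/e eE; ring.
    have : (a + l) * (b + l) = 0.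
      have -> : (a + l) * (b + l) = a * b + l * t by rewrite /t; ring.
      by rewrite abE; ring.
    move/eqP; rewrite mulf_eq0 !addr_eq0 => /orP[] /eqP h; [left|right]; split=> //.
      by move: ht; rewrite /t h addrN add0r.
    by move: ht; rewrite /t h addrAC addrN add0r.
  have si j : l ^+ 2 = - ((1 + w) ^+ j) ^+ 2 -> trace_case l a b.
    by move=> h; apply: (@TCi _ _ _ ((1 + w) ^+ j)) => //; rewrite nmX nm_w1 expr1n.
  (* An even power of the sixth root of unity $1+\omega$ is the square of a unit of $O$; an odd one
     is minus such a square, since $(1+\omega)^3=-1$. *)
  case: k hk l2 {kE} => [|[|[|[|[|[|//]]]]]] _ l2.
  + by apply: (sq 0%N); rewrite l2 expr0 expr1n.
  + by apply: (si 2%N); rewrite l2 -exprM (exprD _ 3 1) w1_cube mulN1r opprK expr1.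
  + by apply: (sq 1%N); rewrite l2 -exprM.
  + by apply: (si 0%N); rewrite l2 w1_cube expr0 expr1n.
  + by apply: (sq 2%N); rewrite l2 -exprM.
  by apply: (si 1%N); rewrite l2 (exprD _ 3 2) w1_cube mulN1r -exprM.
(* Here $t=2c$ with $|c|=1$, and the roots are $c$, $-\omega c$, $-\bar\omega c$, all in $K$. *)
apply: TCrat.
have eE : e = t ^+ 3 / 8.
  by rewrite -/t -/e in t8; rewrite t8; field.
have tt : t * t^* = 4.
  have n64 : nm t ^+ 3 = 64.
    by rewrite -nmX -/t t8 nmM /e !nmM l1 a1 b1 !mulr1 -rcn nm_rc; ring.
  have n4 : nm t = 4.
    have := nm_ge0 t; move: (nm t) n64 => n n64 n0.
    have : (n - 4) * (n ^+ 2 + 4 * n + 16) = 0 by transitivity (n ^+ 3 - 64); [ring|rewrite n64 subrr].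
    by move/eqP; rewrite mulf_eq0 => /orP[/eqP|/eqP]; [lra|nra].
  by rewrite nmE n4 rcn.
have etE : e * t^* = t ^+ 2 / 2.
  by rewrite eE; transitivity (t ^+ 2 * (t * t^*) / 8); [ring|rewrite tt; field].
have f : (2 * l - t) * (2 * l + w * t) * (2 * l + (- 1 - w) * t) = 0.
  have -> : (2 * l - t) * (2 * l + w * t) * (2 * l + (- 1 - w) * t) =
     8 * (l ^+ 3 - t * l ^+ 2) + 2 * l * t ^+ 2 * (1 - w - w ^+ 2) + t ^+ 3 * (w + w ^+ 2).
    by ring.
  rewrite omega2.
  have -> : 8 * (l ^+ 3 - t * l ^+ 2) = 8 * (e - e * t^* * l).
    by congr (_ * _); apply/eqP; rewrite -subr_eq0; apply/eqP; rewrite -rl; ring.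
  by rewrite etE eE; field.
have two : (2 : C) != 0 by rewrite pnatr_eq0.
have half c : Eis c -> 2 * l = c -> Krat l.
  move=> hc h; have -> : l = c / 2 by rewrite -h mulrC mulKf.
  by apply: Krat_div => //; exact: Eis_nat.
move/eqP: f; rewrite !mulf_eq0 => /orP[/orP[]|].
- by rewrite subr_eq0 => /eqP; apply: half.
- rewrite addr_eq0 => /eqP; apply: half; apply/EisN/EisM => //; exact: Eisw.
rewrite addr_eq0 => /eqP; apply: half; apply/EisN/EisM => //.
by apply: EisB; [apply/EisN/Eis1|exact: Eisw].
Qed.

End Traces.

(** * Negative vectors defined over O *)

Section RationalCase.
Variable R : realType.
Local Notation w := (omega : R[i]).
Local Notation C := R[i].
Local Notation V := 'cV[C]_3.
Local Notation rc := (real_complex R).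
Implicit Types (u v z : V) (A B : 'M[C]_3) (c d a b l : C).

(** Integral vectors with Gram matrix [J]: the columns of an element of $U(J)\cap GL_3(O)$. Elements
    of $\Gamma_3$ are produced by finding such triples. *)
Definition hframe (c0 c1 c2 : V) : Prop := [/\ [/\ Ivec c0, Ivec c1 & Ivec c2],
  [/\ herm c0 c0 = 0, herm c1 c1 = 1 & herm c2 c2 = 0] &
  [/\ herm c0 c1 = 0, herm c1 c2 = 0 & herm c0 c2 = 1]].

Lemma hr_int z : Ivec z -> exists m : int, hr z = m%:~R.
Proof.
move=> hz; have [m mE] := Eis_real (Eis_herm hz hz) (herm_cj z z).
by exists m; apply: rc_inj; rewrite -hrE mE; exact/esym/rcz.
Qed.

Lemma nm_int (n : int) : nm (n%:~R : C) = n%:~R ^+ 2.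
Proof. by rewrite -(rcz R) nm_rc. Qed.

Lemma preservingM A B : preserving A -> preserving B -> preserving (A *m B).
Proof. by move=> hA hB u v; rewrite -!mulmxA hA hB. Qed.

Lemma preservingZ c A : nm c = 1 -> preserving A -> preserving (c *: A).
Proof.
by move=> hc hA u v; rewrite -!scalemxAl !hE hA mulrA nm_eq1 // mul1r.
Qed.

Lemma ImxZ c A : Eis c -> Imx A -> Imx (c *: A).
Proof. by move=> hc hA i j; rewrite mxE; apply: EisM. Qed.

Lemma ImxM A B : Imx A -> Imx B -> Imx (A *m B).
Proof. by move=> hA hB i j; rewrite mxE; apply: Eis_sum => k; apply: EisM. Qed.

Lemma simple_atZ c A v l : c != 0 -> simple_at A v l -> simple_at (c *: A) v (c * l).
Proof.
move=> c0 hs u uv; rewrite -scalemxAl -scalerA => /(scalerI c0); exact: hs.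
Qed.

Lemma eframeZ c A v l u a u' b : nm c = 1 -> eframe A v l u a u' b ->
  eframe (c *: A) v (c * l) u (c * a) u' (c * b).
Proof.
move=> hc [of_ [h1 h2 h3] [l1 a1 b1]]; split; first exact: of_.
  by split; rewrite -scalemxAl ?h1 ?h2 ?h3 scalerA.
by split; rewrite nmM hc mul1r.
Qed.

(* (A - a)(A - b) is a multiple of the projection to the eigenline of v. *)
Lemma eigen_proj A v l u a u' b z : eframe A v l u a u' b ->
  A *m (A *m z) - (a + b) *: (A *m z) + (a * b) *: z =
  ((l - a) * (l - b) * (herm z v / herm v v)) *: v.
Proof.
move=> [of_ [h1 h2 h3] _]; have [x [x1 [x2 ->]]] := basis3 z (oframe_det of_).
have -> : herm (x *: v + x1 *: u + x2 *: u') v / herm v v = x.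
  have [nv _ _ [uv u'v _]] := of_.
  by rewrite !hE uv u'v !mulr0 !addr0 mulfK // hr_neq0.
rewrite !mulmxDr -!scalemxAr h1 h2 h3 -!scalemxAr h1 h2 h3.
by apply: cv_eq; rewrite !ccE; ring.
Qed.

(** Applied to [E0], which is not orthogonal to [v], the operator of [eigen_proj] gives a nonzero
    multiple of [v]. Its coefficients $a+b=\mathrm{tr}A-l$ and $ab=\bar l\det A$ lie in $K$, so
    clearing a denominator gives an integral vector on the line. *)
Lemma rational_primitive A v l u a u' b : preserving A -> Imx A ->
  eframe A v l u a u' b -> a != l -> b != l -> Krat l ->
  exists c, [/\ c != 0, prim (c *: v) & Eis l].
Proof.
move=> hA IA ef al bl /KratE [x [y [n [n0 nl]]]].
have [[nv _ _ _] [h1 _ _] [l1 a1 b1]] := ef.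
have n0' : n%:~R != 0 :> C by rewrite intr_eq0.
have l0 : l != 0 by rewrite -nm_gt0 l1 ltr01.
have en : Eis (n%:~R * l) by rewrite nl; exact: Eis_eis.
have enj : Eis (n%:~R * l^*).
  by have := EisJ en; rewrite cjM rmorph_int.
have E := eigen_proj (E0 R) ef.
set k := (l - a) * (l - b) * (herm (E0 R) v / herm v v) in E.
have k0 : k != 0.
  have k1 : l - a != 0 by rewrite subr_eq0 eq_sym.
  have k2 : l - b != 0 by rewrite subr_eq0 eq_sym.
  have k3 : (herm v v)^-1 != 0 by rewrite invr_eq0 hr_neq0.
  have k4 : herm (E0 R) v != 0 by rewrite -herm_cj herm_E0 conjC_eq0 neg_last.
  by rewrite /k !mulf_neq0.
have ht := Eis_mxtr IA; have hd := Eis_mxdet IA.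
have Ivk : Ivec ((n%:~R * k) *: v).
  rewrite -scalerA -E.
  have -> : a + b = mxtr A - l by rewrite (eframe_tr ef); ring.
  have -> : a * b = mxdet A * l^* by rewrite (eframe_det ef) (nm1_inv l1); field.
  have I1 : Ivec (A *m E0 R) by apply: Ivec_mul => //; exact: IE0.
  have -> : n%:~R *: (A *m (A *m E0 R) - (mxtr A - l) *: (A *m E0 R) + (mxdet A * l^*) *: E0 R)
    = n%:~R *: (A *m (A *m E0 R)) - (n%:~R * mxtr A - n%:~R * l) *: (A *m E0 R) + (mxdet A * (n%:~R * l^*)) *: E0 R.
    by apply: cv_eq; rewrite !ccE; ring.
  have En : Eis (n%:~R : C) by exact: Eis_int.
  apply: IvecD; [apply: IvecB|]; apply: IvecZ => //.
  - exact: Ivec_mul.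
  - by eis.
  - by eis.
  exact: IE0.
have nk0 : (n%:~R * k) *: v != 0.
  rewrite scaler_eq0 negb_or mulf_neq0 //=; apply/eqP => v0.
  by move: nv; rewrite v0 /hr herm0l ltxx.
have [c [c0 _ pc]] := prim_multiple Ivk nk0.
exists (c * (n%:~R * k)); rewrite -scalerA; split=> //; first by rewrite mulf_neq0 // mulf_neq0.
apply: (prim_scale pc).
have <- : A *m (c *: (n%:~R * k *: v)) = l *: (c *: (n%:~R * k *: v)).
  by rewrite -!scalemxAr h1 !scalerA; congr (_ *: _); ring.
by case: pc => pc _; apply: Ivec_mul.
Qed.

Lemma nm_1sub a : nm a = 1 -> nm (1 - a) <= 4.
Proof.
move=> h; have := @nm_sum_le R 1 1 1 (- a); rewrite nmN nm1 h expr1n lexx ler01.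
by move=> /(_ isT isT isT isT) h'; apply: le_trans h' _; rewrite -[1 + 1]/(2%:R) -natrX ler_nat.
Qed.

(** Modulo $\sqrt{-3}$ one has $\omega\equiv1$, so norms are squares modulo 3. For residues $p,q$ of
    [P] and [Q] the sum of the three norms is $p^2+q^2+(p-q)^2\equiv2(p+q)^2$, never 1 modulo 3. *)
Lemma mod3_excl (P Q : C) (m : R) : Eis P -> Eis Q -> (exists k : int, m = k%:~R) ->
  3 * m = - 1 + nm P + nm Q + nm (P - Q) -> False.
Proof.
move=> [x [y ->]] [x' [y' ->]] [k ->].
rewrite eisN eisD !nm_eis => h.
have {}h : 3 * k = -1 + (x ^+ 2 - x * y + y ^+ 2) + (x' ^+ 2 - x' * y' + y' ^+ 2)
  + ((x - x') ^+ 2 - (x - x') * (y - y') + (y - y') ^+ 2).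
  by apply: (@intr_inj R); rewrite intrM h !intrD.
have [j [r [rE hr_]]] := int_div_mod (x + y + x' + y') (isT : 0 < 3 :> int).
have xE : x = j * 3 + r - y - x' - y' by lia.
have [r0|[r0|r0]] : r = 0 \/ r = 1 \/ r = 2 by lia.
all: by rewrite xE r0 in h; lia.
Qed.

(** The norm of [Q] is odd, so 2 does not divide [Q], and each nonzero residue modulo 2 is
    represented by a unit. *)
Lemma oddness (Q : C) (m : R) (n : int) : Eis Q -> (exists k : int, m = k%:~R) ->
  2 * m = n%:~R + nm Q -> (exists k, n = 2 * k + 1) ->
  exists c t, [/\ Eis c, nm c = 1, Eis t & Q = c + 2 * t].
Proof.
move=> hQ [k ->] h [j jE]; case: (Eis_mod2 hQ) => // -[t ht QE]; exfalso.
have [n' nE] := Eis_nm ht; move: h; rewrite QE nmM nE.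
have -> : nm (2 : C) = 4 by rewrite -(rcn R 2) nm_rc; ring.
move=> h; have : 2 * k = n + 4 * n'%:Z.
  by apply: (@intr_inj R); rewrite intrD !intrM h.
by rewrite jE; lia.
Qed.

Lemma int_of_gt0 (m : int) : 0 < (m%:~R : R) -> 0 < m.
Proof. by rewrite (ltr_int R 0). Qed.

Lemma int_nm z c : Ivec z -> Eis c -> exists k : int, nm c = k%:~R /\ 0 <= k.
Proof. by move=> _ /Eis_nm [n ->]; exists n. Qed.

Lemma gram_alg (yy a c P Pj Q Qj ef fe n : C) :
  1 = - (yy * (a * c - (a * c - n)) - P * (Pj * c - ef * Qj) + Q * (Pj * fe - a * Qj)) ->
  n * yy = - 1 + c * (P * Pj) + a * (Q * Qj) - P * Qj * ef - Q * Pj * fe.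
Proof.
move=> h; apply/eqP; rewrite -subr_eq0; apply/eqP; rewrite -(subrr 1) [X in _ = _ - X]h.
by ring.
Qed.

(** The vector $f-v$ is isotropic, and $-\omega v-\bar\omega f$ is an isotropic partner pairing to 1
    with it for which $c_0+\bar\omega c_2=-(\omega+\bar\omega)v=v$. *)
Lemma frame_norm1 v e f : Ivec v -> Ivec e -> Ivec f ->
  herm v v = - 1 -> herm e e = 1 -> herm f f = 1 ->
  herm e v = 0 -> herm f v = 0 -> herm f e = 0 ->
  exists c0 c1 c2 : V, hframe c0 c1 c2 /\ (v = c0 - c2 \/ v = c0 + w^* *: c2).
Proof.
move=> Iv Ie If vvE eeE ffE ev fv0 b0; have b0' := herm_sym0 b0.
exists (- w *: v - w^* *: f), e, (f - v); split; last first.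
    by right; rewrite conj_omega; apply: cv_eq; rewrite !ccE; ring.
  have Iw := Eisw R; have Iwj := EisJ Iw.
  split; split; rewrite ?(hE, vvE, ffE, eeE, ev, fv0, b0, b0', herm_sym0 ev, herm_sym0 fv0) ?cjE ?conj_omega.
  + by apply: IvecB; apply: IvecZ; rewrite -?conj_omega //; eis.
  + exact: Ie.
  + exact: IvecB.
  + ring: (omega2 R).
  + by [].
  + ring.
  + ring.
  + ring.
  + ring: (omega2 R).
Qed.

(** Since [Q] is a unit $g$ modulo 2, the lattice contains $y_2=(gf-v)/2$. This vector is isotropic,
    and so is $y_2+v$; their difference is [v]. *)
Lemma frame_norm2 v e f y1 Q (k : int) : Ivec v -> Ivec e -> Ivec f -> Ivec y1 -> Eis Q ->
  herm v v = - 2%:R -> herm e e = 1 -> herm f f = 2%:R ->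
  herm e v = 0 -> herm f v = 0 -> herm f e = 0 -> herm y1 v = 1 ->
  2 *: y1 = - v + Q *: f -> 2 * k%:~R = - 1 + nm Q ->
  exists c0 c1 c2 : V, hframe c0 c1 c2 /\ (v = c0 - c2 \/ v = c0 + w^* *: c2).
Proof.
move=> Iv Ie If Iy1 IQ vvE eeE ffE ev fv0 b0 y1v y1E kE; have b0' := herm_sym0 b0.
have [|||g [t [Ig g1 It QE]]] := @oddness Q k%:~R (-1) IQ.
+ by exists k.
+ by rewrite kE.
+ by exists (-1).
pose y2 := y1 - t *: f.
have Iy2 : Ivec y2 by apply: IvecB => //; apply: IvecZ.
have y2E : 2 *: y2 = g *: f - v.
  have -> : 2 *: y2 = 2 *: y1 - (2 * t) *: f by rewrite scalerBr scalerA.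
  by rewrite y1E QE; apply: cv_eq; rewrite !ccE; ring.
have two : (2 : C) != 0 by rewrite pnatr_eq0.
have gg := nm_eq1 g1.
have yv2 : herm y2 v = 1 by rewrite !hE y1v fv0 mulr0 subr0.
have hy2 z : 2 * herm y2 z = g * herm f z - herm v z by rewrite -hermZl y2E !hE.
have h2y z : 2 * herm z y2 = g^* * herm z f - herm z v.
  by transitivity ((2 : C)^* * herm z y2); [rewrite cjn|rewrite -hermZr y2E !hE].
have y2y2 : herm y2 y2 = 0.
  apply: (mulfI two); rewrite hy2 mulr0; apply: (mulfI two).
  rewrite mulr0 mulrBr mulrCA !h2y ffE fv0 vvE (herm_sym0 fv0).
  transitivity (2 * (g * g^*) - 2); [ring | rewrite gg; ring].
have y2e : herm y2 e = 0.
  by apply: (mulfI two); rewrite hy2 b0 (herm_sym0 ev); ring.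
clearbody y2.
exists (y2 + v), e, y2; split; last by left; rewrite addrAC subrr add0r.
split; split; rewrite ?(hE, vvE, eeE, ev, fv0, y2y2, y2e, yv2, herm_sym0 ev, herm_sym0 y2e) //.
+ exact: IvecD.
+ by rewrite -[herm v y2]herm_cj yv2 cj1; ring.
+ by rewrite addr0.
by rewrite -[herm v y2]herm_cj yv2 cj1 add0r.
Qed.

(** As $n\ge3$, [e] spans the norm 1 vectors of the complement, so [A] is diagonal on [e], [f], with
    some eigenvalue $\beta$ on [f]. Applying $A-1$ to [y1] shows that $n$ divides $Q(\beta-1)$; [Q]
    is invertible modulo $n$ because $|Q|^2\equiv1$, so $n$ divides $\beta-1$. Its modulus is at
    most 2, hence $\beta=1$, against simplicity. *)
Lemma eigen_excl A v e f y1 Q (n k : int) : preserving A -> Imx A ->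
  Ivec v -> Ivec e -> Ivec f -> Ivec y1 -> Eis Q -> oframe v e f -> A *m v = v ->
  simple_at A v 1 -> 3 <= n -> n%:~R != 0 :> C ->
  herm e e = 1 -> herm f f = n%:~R ->
  herm e v = 0 -> herm f v = 0 -> herm f e = 0 -> herm y1 v = 1 ->
  n%:~R *: y1 = - v + Q *: f -> n%:~R * k%:~R = - 1 + nm Q ->
  (forall z, Ivec z -> herm z v = 0 -> exists a b, [/\ Eis a, Eis b & z = a *: e + b *: f]) ->
  False.
Proof.
move=> hA IA Iv Ie If Iy1 IQ ofr fv hs n34 nC eeE ffE ev fv0 b0 y1v y1E kE gen.
have b0' := herm_sym0 b0.
have fv' : A *m v = 1 *: v by rewrite scale1r.
have cE : hr f = n%:~R by apply: rc_inj; rewrite -hrE ffE rcz.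
have f0 : f != 0 by apply/eqP => f0; move: ffE; rewrite f0 herm0l => /eqP; rewrite eq_sym (negPf nC).
have Ae : A *m e = herm (A *m e) e *: e.
  have evA : herm (A *m e) v = 0 by apply: (eigen_perp hA fv') => //; rewrite oner_eq0.
  have [x [x' [Ix Ix' E]]] := gen _ (Ivec_mul IA Ie) evA.
  have x'0 : x' = 0.
    have := hA e e; rewrite eeE E !hE eeE ffE b0 b0' !mulr0 addr0 add0r !mulr1.
    have [j jE] := Eis_nm Ix; have [k' kE'] := Eis_nm Ix'.
    have -> : x * x^* + x' * (x'^* * n%:~R) = x * x^* + n%:~R * (x' * x'^*) by ring.
    rewrite !nmE jE kE' -(rcz R n) -rcM -rcD => /(@rc_inj R _ 1) h.
    have {}h : j%:Z + n * k'%:Z = 1 by apply: (@intr_inj R); rewrite intrD intrM.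
    by apply/eqP; rewrite -nm_eq0 kE' pnatr_eq0; apply/eqP; nia.
  by rewrite E x'0 scale0r addr0 !hE eeE mulr1.
set al' := herm (A *m e) e in Ae.
have al'0 : al' != 0.
  apply/eqP => h; have := hA e e; rewrite Ae h scale0r herm0l eeE => /eqP.
  by rewrite eq_sym oner_eq0.
have Af : A *m f = (herm (A *m f) f / n%:~R) *: f.
  have fvA : herm (A *m f) v = 0 by apply: (eigen_perp hA fv') => //; rewrite oner_eq0.
  have := oframe_exp (A *m f) ofr; rewrite fvA mul0r scale0r add0r ffE.
  have -> : herm (A *m f) e = 0.
    have := hA f e; rewrite b0 Ae hermZr => /eqP.
    by rewrite mulf_eq0 conjC_eq0 (negPf al'0) => /eqP.
  by rewrite mul0r scale0r add0r.
set be := herm (A *m f) f / n%:~R in Af.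
have be1 : nm be = 1.
  by apply: (eigen_unit hA Af); rewrite cE intr_eq0; lia.
have [t' It' tE] : exists2 t', Eis t' & n%:~R * t' = Q * (be - 1).
  have h : n%:~R *: (A *m y1 - y1) = (Q * (be - 1)) *: f.
    rewrite scalerBr scalemxAr y1E mulmxDr mulmxN fv -scalemxAr Af.
    by apply: cv_eq; rewrite !ccE; ring.
  have Iz : Ivec (A *m y1 - y1) by apply: IvecB => //; apply: Ivec_mul.
  have zv : herm (A *m y1 - y1) v = 0.
    by apply: (mulfI nC); rewrite -hermZl h hermZl fv0 !mulr0.
  have [x [x' [Ix Ix' E]]] := gen _ Iz zv; exists x' => //.
  have := congr1 (fun t => herm t f) h; rewrite E /= !hE b0' ffE mulr0 add0r.
  by rewrite mulrA => /(mulIf nC).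
have [s Is sE] : exists2 s, Eis s & be - 1 = n%:~R * s.
  have Ib : Eis (be - 1).
    have fvA : herm (A *m f) v = 0 by apply: (eigen_perp hA fv') => //; rewrite oner_eq0.
    have [x [x' [Ix Ix' E]]] := gen _ (Ivec_mul IA If) fvA.
    have -> : be = x'.
      by rewrite /be E !hE b0' ffE mulr0 add0r mulfK.
    by apply: EisB => //; exact: Eis1.
  exists (Q^* * t' - k%:~R * (be - 1)).
    by apply: EisB; apply: EisM => //; [exact: EisJ|exact: Eis_int].
  have kC : n%:~R * k%:~R = - 1 + Q * Q^* :> C.
    by rewrite nmE -(rcz R n) -(rcz R k) -rcM kE rcD rcN.
  transitivity (Q^* * (n%:~R * t') - (n%:~R * k%:~R) * (be - 1)); last by ring.
  by rewrite tE kC; ring.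
have : be = 1.
  have : nm (be - 1) <= 4 by rewrite -nmN opprB; apply: nm_1sub.
  rewrite sE nmM nm_int; have [k' k'E] := Eis_nm Is; rewrite k'E => h.
  have {}h : n ^+ 2 * k'%:Z <= 4 by rewrite -(ler_int R) intrM rmorphXn.
  have k'0 : k' = 0%N by nia.
  apply/eqP; rewrite -subr_eq0 sE mulf_eq0; apply/orP; right.
  by rewrite -nm_eq0 k'E k'0.
by move=> be1'; move/eqP: f0; apply; apply: hs => //; rewrite Af be1'.
Qed.

(** With $\langle v,v\rangle=-n$, the matrix bounds $n$ by 4 and Hermite reduction lists the
    possible Gram matrices of the complement of [v]. Those with a vector of norm 1 give the two
    points for $n=1,2$ and are excluded by [A] for $n\ge3$; the two others contradict the Gram
    determinant $-1$ of $O^3$. *)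
Lemma rational_case A v : preserving A -> Imx A -> prim v -> hr v < 0 ->
  A *m v = v -> simple_at A v 1 ->
  exists c0 c1 c2 : V, hframe c0 c1 c2 /\ (v = c0 - c2 \/ v = c0 + w^* *: c2).
Proof.
move=> hA IA pv nv fv hs.
have [Iv _] := pv.
have fv' : A *m v = 1 *: v by rewrite scale1r.
have [u [a [u' [b ef]]]] := eigenframe hA fv' nv.
have [al bl] := eframe_simple ef hs.
have [of_ [_ _ _] [_ a1 b1]] := ef.
have [m mE] := hr_int Iv.
have [n [nE n0]] : exists n : int, m = - n /\ 0 < n.
  by exists (- m); split; [lia|]; move: nv; rewrite mE (ltr_int R _ 0); lia.
have vvE : herm v v = - n%:~R by rewrite hrE mE rcz nE mulrNz.
have nC : n%:~R != 0 :> C by rewrite intr_eq0; lia.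
(* The projection formula at [y], with $\langle y,v\rangle=1$, gives the integral vector $-(D/n)v$,
   and $|D|\le4$. *)
have n4 : n <= 4.
  have [_ [y Iy yv]] := pv.
  pose D := (1 - a) * (1 - b).
  have D0 : D != 0 by rewrite mulf_neq0 // subr_eq0 eq_sym.
  have DE : Eis (D / n%:~R).
    have := eigen_proj y ef; rewrite yv vvE => E.
    have : Ivec ((- (D / n%:~R)) *: v).
      have -> : - (D / n%:~R) = (1 - a) * (1 - b) * (1 / - n%:~R) by rewrite /D; field.
      rewrite -E.
      have ht := Eis_mxtr IA; have hd := Eis_mxdet IA.
      have -> : a + b = mxtr A - 1 by rewrite (eframe_tr ef); ring.
      have -> : a * b = mxdet A by rewrite (eframe_det ef); ring.
      have I1 : Ivec (A *m y) by apply: Ivec_mul.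
      apply: IvecD; [apply: IvecB|]; first exact: Ivec_mul.
        by apply: IvecZ => //; eis.
      exact: IvecZ.
    by move/(prim_scale pv)/EisN; rewrite opprK.
  have [k kE] := Eis_nm DE.
  have D16 : nm D <= 16.
    rewrite nmM; have := nm_1sub a1; have := nm_1sub b1; have := nm_ge0 (1 - a).
    have := nm_ge0 (1 - b); move: (nm (1 - a)) (nm (1 - b)) => x y' h1 h2 h3 h4; nra.
  have k0 : (0 < k)%N.
    by rewrite -(ltr_nat R) -kE nm_gt0 mulf_neq0 // invr_eq0.
  have : nm D = k%:R * n%:~R ^+ 2.
    by rewrite -kE -nm_int -nmM divfK.
  move=> DE'; rewrite DE' in D16.
  have : (k%:Z * n ^+ 2)%:~R <= 16%:~R :> R by rewrite intrM rmorphXn.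
  by rewrite ler_int => h; nia.
have [y [e [f [[Iy Ie If] [yv ev fv0] gen [e0 f0 emin] red]]]] := reduction nv pv.
have gy := generates_perp Iv yv Iy gen.
have G := q_perp_gram nv Iy Ie If yv ev fv0 gy.
have efmin : q v e <= q v f by apply: emin.
have pe := perp_pos nv ev e0; have pf := perp_pos nv fv0 f0.
have [a' aE] := hr_int Ie; have [c' cE] := hr_int If.
have [bn [bE bn0]] := int_nm Ie (Eis_herm If Ie).
have qv : q v v = n%:~R.
  rewrite /q hrE nm_rc mE nE mulrNz; field; rewrite intr_eq0; lia.
have nfe : nm (qf v e f) = bn%:~R by rewrite qf_perp // nm_hermC.
rewrite (q_perp ev) (q_perp fv0) nfe qv aE cE in G.
rewrite (qf_perp _ fv0) (q_perp ev) bE aE in red.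
rewrite (q_perp ev) (q_perp fv0) aE cE ler_int in efmin.
rewrite aE in pe; rewrite cE in pf; have {}pe := int_of_gt0 pe; have {}pf := int_of_gt0 pf.
have {}G : a' * c' - bn = n by apply: (@intr_inj R); rewrite intrB intrM.
have {}red : 3 * bn <= a' ^+ 2 by rewrite -(ler_int R) intrM rmorphXn.
(* From $a'\le c'$ and $3b_n\le a'^2$ one gets $2a'^2\le3n\le12$. *)
have a2 : a' <= 2 by nia.
have eeE : herm e e = a'%:~R by rewrite hrE aE rcz.
have ffE : herm f f = c'%:~R by rewrite hrE cE rcz.
have [yy yyE] := hr_int Iy.
have yyC : herm y y = yy%:~R by rewrite hrE yyE rcz.
have [P PE] : exists P, P = herm y e by exists (herm y e).
have [Q QE] : exists Q, Q = herm y f by exists (herm y f).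
have IP : Eis P by rewrite PE; apply: Eis_herm.
have IQ : Eis Q by rewrite QE; apply: Eis_herm.
(* The Gram determinant of the unimodular basis (y, e, f) *)
have gr : n%:~R * herm y y = - 1 + c'%:~R * (P * P^*) + a'%:~R * (Q * Q^*)
    - P * Q^* * herm e f - Q * P^* * herm f e.
  have := gram3 y e f; rewrite nmE (generates_unimod Iy Ie If gy) -PE -QE.
  rewrite -[herm e y]herm_cj -[herm f y]herm_cj -PE -QE eeE ffE.
  have -> : herm e f * herm f e = a'%:~R * c'%:~R - n%:~R.
    by rewrite nm_herm nm_hermC bE rcz -intrM -intrB -G; congr (intmul 1 _); ring.
  exact: gram_alg.
have [a1'|a2'] : a' = 1 \/ a' = 2 by lia.
  have b0 : herm f e = 0.
    by apply/eqP; rewrite -nm_eq0 bE intr_eq0; rewrite a1' in red; lia.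
  have b0' := herm_sym0 b0.
  have cn : c' = n.
    have : bn = 0 by rewrite a1' in red; lia.
    by rewrite a1' in G; lia.
  rewrite a1' in eeE; rewrite cn in ffE.
  have ofr : oframe v e f.
    by split; rewrite ?aE ?cE ?a1' ?cn //; rewrite (ltr_int R 0).
  pose y1 := y - P *: e.
  have Iy1 : Ivec y1 by apply: IvecB => //; apply: IvecZ.
  have y1E : n%:~R *: y1 = - v + Q *: f.
    have := oframe_exp y1 ofr; rewrite vvE eeE ffE /y1 !hE yv ev b0' -PE -QE eeE.
    rewrite !mulr0 !mulr1 !subr0 subrr mul0r scale0r addr0 => ->.
    rewrite scalerDr !scalerA; congr (_ + _ *: _); last by field.
    by rewrite (_ : n%:~R * (1 / - n%:~R) = -1) ?scaleN1r //; field.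
  have y1y : exists k : int, n%:~R * k%:~R = - 1 + nm Q.
    have [k kE] := hr_int Iy1; exists k; apply: rc_inj.
    have kC : herm y1 y1 = k%:~R by rewrite hrE kE rcz.
    rewrite rcM !rcz rcD rcN rc1 -nmE -kC /y1 !hE -PE -[herm e y]herm_cj -PE eeE.
    have -> : n%:~R * (herm y y - P^* * P + (- (P * P^*) - P * - (P^* * 1%:~R)))
       = n%:~R * herm y y - n%:~R * (P * P^*) by ring.
    by rewrite gr cn a1' b0 b0'; ring.
  have [n1|[n2|n34]] : n = 1 \/ (n = 2 \/ 3 <= n) by lia.
  - by apply: (@frame_norm1 v e f); rewrite ?vvE ?ffE ?n1.
  - have [k kE] := y1y; rewrite n2 in vvE ffE y1E kE.
    apply: (@frame_norm2 v e f y1 Q k) => //.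
    by rewrite !hE yv ev mulr0 subr0.
  exfalso; have [k kE] := y1y.
  apply: (@eigen_excl A v e f y1 Q n k) => //.
  by rewrite !hE yv ev mulr0 subr0.
(* For least norm 2 only $n=3$, with $c'=2$ and off-diagonal norm 1, and $n=4$, with $c'=2$ and
   orthogonal [e], [f], remain. The first fails modulo 3, the second by parity. *)
exfalso; rewrite a2' in eeE gr G red efmin.
have [[n3 [c2 b1']]|[n4' [c2 b0']]] : (n = 3 /\ c' = 2 /\ bn = 1) \/ (n = 4 /\ c' = 2 /\ bn = 0) by nia.
  rewrite n3 c2 yyC in gr.
  have b1'' : nm (herm f e) = 1 by rewrite bE b1'.
  apply: (@mod3_excl P (Q * herm f e) yy%:~R) => //.
  - by apply: EisM => //; apply: Eis_herm.
  - by exists yy.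
  rewrite -(herm_cj f e) in gr; move: (herm f e) b1'' gr => K b1'' gr.
  have split3 (x1 x2 x3 : R) : rc (-1 + x1 + x2 + x3) = -1 + rc x1 + rc x2 + rc x3.
    by rewrite !rcD rcN rc1.
  apply: rc_inj; rewrite split3 -!nmE rcM rcn rcz -[3]/(3%:~R) gr !cjE.
  have h1 := nm_eq1 b1''.
  transitivity (-1 + P * P^* + Q * Q^* + (P * P^* - P * (Q^* * K^*) - Q * K * P^* + Q * Q^* * (K * K^*))).
    by rewrite h1; ring.
  transitivity (-1 + P * P^* + Q * Q^* * (K * K^*) + (P * P^* - P * (Q^* * K^*) - Q * K * P^* + Q * Q^* * (K * K^*))).
    by rewrite h1; ring.
  by ring.
have b0 : herm f e = 0 by apply/eqP; rewrite -nm_eq0 bE b0'.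
rewrite n4' c2 b0 (herm_sym0 b0) !mulr0 !subr0 yyC !nmE in gr.
have [k kE] := Eis_nm IP; have [k' kE'] := Eis_nm IQ.
have : 4 * yy = - 1 + 2 * k%:Z + 2 * k'%:Z.
  apply: (@intr_inj R); rewrite !(intrD, intrM); apply: rc_inj.
  by rewrite !(rcD, rcM) !rcz; move: gr; rewrite kE kE' !rcn.
by lia.
Qed.

End RationalCase.

(** * Eigenvalue of order four *)

Section QuarticCase.
Variable R : realType.
Local Notation Im := (@complex.Im R).
Local Notation w := (omega : R[i]).
Local Notation C := R[i].
Local Notation V := 'cV[C]_3.
Local Notation rc := (real_complex R).
Implicit Types (u v z g p : V) (A B : 'M[C]_3) (d a b l : C).

Definition iunit : C := Complex 0 1.
Local Notation ii := iunit.
Lemma ii2 : ii ^+ 2 = -1.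
Proof. by apply: complexP; rewrite expr2 ?cReM ?cImM ?cReN ?cImN /=; ring. Qed.
Lemma iiJ : ii^* = - ii.
Proof. by apply: complexP; rewrite ?cReJ ?cImJ ?cReN ?cImN /=; ring. Qed.
Lemma nm_ii : nm ii = 1.
Proof. by rewrite /nm /= expr0n expr1n add0r. Qed.

Definition sqrtN3 : C := 1 + 2 * w.
Local Notation sg := sqrtN3.
Lemma sg2 : sg ^+ 2 = - 3.
Proof. by transitivity (1 + 4 * w + 4 * w ^+ 2); [rewrite /sg; ring|rewrite omega2; ring]. Qed.
Lemma sgJ : sg^* = - sg.
Proof. by rewrite /sg !cjE conj_omega; ring. Qed.
Lemma Eis_sg : Eis sg.
Proof. by apply: EisD; [exact: Eis1|apply: EisM; [exact: (Eis_nat R 2)|exact: Eisw]]. Qed.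
Lemma Im_sg : 0 < Im sg.
Proof. by rewrite /sg cImD cImM cIm1 cImn cRen mul0r addr0 add0r mulr_gt0 ?Im_omega_gt0. Qed.
Lemma nm_sg : nm sg = 3.
Proof. by apply: rc_inj; rewrite -nmE sgJ mulrN -expr2 sg2 opprK rcn. Qed.

Lemma sqrt3_irr (a k : int) : a ^+ 2 = 3 * k ^+ 2 -> k = 0.
Proof.
move=> h; apply/eqP; apply: contrapT => /negP k0.
have a0 : a != 0 by apply/eqP => a0; move: k0; rewrite a0 in h; nia.
have a0' : a%:~R != 0 :> rat by rewrite intr_eq0.
have [|m mE] := @sqr_rat_int (k%:~R / a%:~R) 1.
  have h' : a%:~R ^+ 2 = 3 * k%:~R ^+ 2 :> rat by rewrite -!rmorphXn /= h intrM.
  by rewrite expr_div_n mulrA -h' mulfV ?expf_neq0.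
have h2 : k = m * a by apply: (@intr_inj rat); rewrite intrM -mE divfK.
rewrite h2 in h.
have : a ^+ 2 * (3 * m ^+ 2 - 1) = 0 by rewrite mulrBr mulr1 [X in _ - X]h; ring.
by move/eqP; rewrite mulf_eq0 sqrf_eq0 (negPf a0) /= => /eqP; lia.
Qed.

Lemma Eis_imag (c : C) : Eis c -> c^* = - c -> exists k : int, c = k%:~R * sg.
Proof.
move=> [x [y ->]]; rewrite eisJ eisN => /eis_inj [h _].
have -> : y = 2 * x by lia.
by exists x; rewrite /eis /sg intrM; ring.
Qed.

Lemma Eis_sqr_neq (c : C) : Eis c -> c ^+ 2 + 1 != 0.
Proof.
move=> [x [y ->]]; rewrite expr2 eisM; apply/eqP.
have -> : (1 : C) = eis R 1 0 by rewrite /eis mul0r addr0.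
rewrite eisD (_ : 0 = eis R 0 0); last by rewrite /eis mul0r addr0.
by move/eis_inj => [h1 h2]; nia.
Qed.

Definition qframe A v u g b : Prop := [/\ preserving A, Imx A, oframe v u g,
  [/\ A *m v = ii *: v, A *m u = (- ii) *: u & A *m g = b *: g] & prim g].

(** The operator $A^2+1$ kills [v] and [u] and is nonzero on [u'], since $b^2+1\ne0$ for [b] in $O$.
    Its integral image therefore spans the third eigenline. *)
Lemma quartic_third A v u u' b : preserving A -> Imx A -> Eis b ->
  eframe A v ii u (- ii) u' b -> exists g, qframe A v u g b.
Proof.
move=> hA IA Ib [of_ [h1 h2 h3] [_ _ b1]]; have [nv pu pu' [uv u'v uu']] := of_.
have u'0 : herm u' u' != 0 by apply: hr0_neq; rewrite gt_eqF.
have [t It tu] : exists2 t, Ivec t & herm t u' != 0.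
  apply: contrapT => h; move/eqP: u'0; apply; rewrite (_ : u' = 0) ?herm0l //.
  apply: herm_nondeg => z hz; apply/eqP; apply: contrapT => h'; apply: h.
  by exists z => //; apply/negP.
have E z : A *m (A *m z) + z = ((b ^+ 2 + 1) * (herm z u' / herm u' u')) *: u'.
  have [x [x1 [x2 ->]]] := basis3 z (oframe_det of_).
  rewrite !hE (herm_sym0 u'v) uu' !mulr0 !add0r mulfK //.
  rewrite !mulmxDr -!scalemxAr h1 h2 h3 -!scalemxAr h1 h2 h3.
  have i2 := ii2; revert i2; generalize ii; intros j i2.
  apply: cv_eq; rewrite !ccE; ring: i2.
set k := (b ^+ 2 + 1) * (herm t u' / herm u' u').
have k0 : k != 0 by rewrite /k !mulf_neq0 ?Eis_sqr_neq ?invr_eq0.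
have Ik : Ivec (k *: u').
  by rewrite /k -E; apply: IvecD => //; do 2!apply: Ivec_mul => //.
have uk0 : k *: u' != 0.
  rewrite scaler_eq0 negb_or k0 /=; apply/eqP => e; move: pu'; by rewrite e /hr herm0l ltxx.
have [c [c0 _ pc]] := prim_multiple Ik uk0.
clearbody k.
exists (c *: (k *: u')); split; [exact: hA|exact: IA| | |exact: pc].
  split; [exact: nv|exact: pu| |].
    by rewrite !hrZ !mulr_gt0 ?nm_gt0.
  by split; [exact: uv|rewrite !hE u'v !mulr0|rewrite !hE uu' !mulr0].
split; [exact: h1|exact: h2|].
by rewrite -!scalemxAr h3 !scalerA [c * k * b]mulrC !mulrA.
Qed.

(** For $\langle y,g\rangle=1$, the vector $(A^2+1)y=\frac{b^2+1}{m}g$ is integral, so $m$ divides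
    $b^2+1$, whose modulus is at most 2. *)
Lemma quartic_index A v u g b : qframe A v u g b -> Eis b -> nm b = 1 ->
  exists m : int, hr g = m%:~R /\ (m = 1 \/ m = 2).
Proof.
move=> [hA IA of_ [h1 h2 h3] pg] Ib b1; have [Ig [y Iy yg]] := pg.
have [nv pu pg' [uv gv ug]] := of_.
have [m mE] := hr_int Ig; exists m; split=> //.
have m0 : 0 < m by move: pg'; rewrite mE (ltr_int R 0).
have ggE : herm g g = m%:~R by rewrite hrE mE rcz.
have mC : m%:~R != 0 :> C by rewrite intr_eq0; lia.
have E : A *m (A *m y) + y = ((b ^+ 2 + 1) / m%:~R) *: g.
  have [x [x1 [x2 yE]]] := basis3 y (oframe_det of_).
  have x2E : x2 = 1 / m%:~R.
    move: yg; rewrite yE !hE (herm_sym0 gv) ug !mulr0 !add0r ggE => yg'.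
    by apply: (mulIf mC); rewrite divfK.
  rewrite yE !mulmxDr -!scalemxAr h1 h2 h3 -!scalemxAr h1 h2 h3 x2E.
  have i2 := ii2; revert i2; generalize ii; intros j i2.
  apply: cv_eq; rewrite !ccE; field: i2; exact: mC.
have Ik : Eis ((b ^+ 2 + 1) / m%:~R).
  by apply: (prim_scale pg); rewrite -E; apply: IvecD => //; do 2!apply: Ivec_mul => //.
have [k kE] := Eis_nm Ik.
have k0 : (0 < k)%N.
  by rewrite -(ltr_nat R) -kE nm_gt0 mulf_neq0 ?invr_eq0 // Eis_sqr_neq.
have e : nm (b ^+ 2 + 1) = k%:R * m%:~R ^+ 2 by rewrite -kE -nm_int -nmM divfK.
have : nm (b ^+ 2 + 1) <= 4.
  have -> : b ^+ 2 + 1 = 1 - (- b ^+ 2) by rewrite opprK addrC.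
  by apply: nm_1sub; rewrite nmN nmX b1 expr1n.
rewrite e => h; have : k%:Z * m ^+ 2 <= 4 by rewrite -(ler_int R) intrM rmorphXn.
move=> h'; have m2 : m <= 2 by nia.
by lia.
Qed.

(** For $p=xv+x_1u$ this is $-4|x|^2|x_1|^2\langle v,v\rangle\langle u,u\rangle$, a product over the
    two eigenlines. It plays the part of a norm on the lattice orthogonal to [g], a module over
    $O[i]$ with $i$ acting as [A]. *)
Definition FF A p : R := nm (herm p (A *m p)) - hr p ^+ 2.

Lemma quartic_sqr A v u g b p : qframe A v u g b -> herm p g = 0 -> A *m (A *m p) = - p.
Proof.
move=> [hA IA of_ [h1 h2 h3] _] pg0; have [nv pu pg' [uv gv ug]] := of_.
have [x [x1 [x2 pE]]] := basis3 p (oframe_det of_).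
have x20 : x2 = 0.
  move: pg0; rewrite pE !hE (herm_sym0 gv) ug !mulr0 !add0r => /eqP.
  by rewrite mulf_eq0 => /orP[/eqP //|]; rewrite (negPf (hr0_neq _)) // gt_eqF.
rewrite pE x20 scale0r addr0 !mulmxDr -!scalemxAr h1 h2 -!scalemxAr h1 h2.
have i2 := ii2; revert i2; generalize ii; intros j i2.
by apply: cv_eq; rewrite !ccE; ring: i2.
Qed.

Lemma quartic_perp A v u g b p : qframe A v u g b -> herm p g = 0 -> herm (A *m p) g = 0.
Proof.
move=> [hA IA of_ [h1 h2 h3] pg] pg0; have [_ _ pg' _] := of_.
have b1 := eigen_unit hA h3 (lt0r_neq0 pg').
by apply: (eigen_perp hA h3) => //; rewrite -nm_gt0 b1 ltr01.
Qed.

Lemma quartic_skew A v u g b p : qframe A v u g b -> herm p g = 0 ->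
  herm (A *m p) p = - herm p (A *m p).
Proof.
move=> qfr pg; have [hA _ _ _ _] := qfr.
by rewrite -(hA (A *m p) p) (quartic_sqr qfr pg) hermNl.
Qed.

(** The values $i$ on the negative line and $-i$ on the positive one add up in $\langle
    p,Ap\rangle$, so it is $i$ times a positive number, and $k>0$. The norm $3k^2-a^2$ is
    nonnegative, and nonzero because $\sqrt3$ is irrational. *)
Lemma quartic_data A v u g b p : qframe A v u g b -> Ivec p -> herm p g = 0 -> p != 0 ->
  exists a k : int, [/\ hr p = a%:~R, herm p (A *m p) = k%:~R * sg, 0 < k, 0 < 3 * k ^+ 2 - a ^+ 2
    & FF A p = (3 * k ^+ 2 - a ^+ 2)%:~R].
Proof.
move=> qfr Ip pg p0; have [hA IA of_ [h1 h2 h3] _] := qfr.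
have [nv pu pg' [uv gv ug]] := of_.
have [a aE] := hr_int Ip.
have [||k kE] := @Eis_imag (herm p (A *m p)); first by apply: Eis_herm => //; apply: Ivec_mul.
  by rewrite herm_cj (quartic_skew qfr pg).
have [x [x1 [x2 pE]]] := basis3 p (oframe_det of_).
have x20 : x2 = 0.
  move: pg; rewrite pE !hE (herm_sym0 gv) ug !mulr0 !add0r => /eqP.
  by rewrite mulf_eq0 => /orP[/eqP //|]; rewrite (negPf (hr0_neq _)) // gt_eqF.
have aX : hr p = nm x * hr v + nm x1 * hr u.
  apply: rc_inj; rewrite -hrE pE x20 scale0r addr0 !hE uv (herm_sym0 uv) rcD !rcM -!nmE -!hrE.
  by hring.
have kX : herm p (A *m p) = ii * rc (nm x1 * hr u - nm x * hr v).
  rewrite pE x20 scale0r addr0 mulmxDr -!scalemxAr h1 h2 !hE uv (herm_sym0 uv) !cjE iiJ.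
  by rewrite rcD rcN !rcM -!nmE -!hrE; hring.
have X0 : 0 <= nm x * - hr v by rewrite mulr_ge0 ?nm_ge0 // oppr_ge0 ltW.
have Z0 : 0 <= nm x1 * hr u by rewrite mulr_ge0 ?nm_ge0 // ltW.
have XZ : (nm x != 0) || (nm x1 != 0).
  rewrite !nm_eq0; apply: contraNT p0; rewrite negb_or !negbK => /andP[/eqP e1 /eqP e2].
  by rewrite pE x20 e1 e2 !scale0r !addr0.
have Xp : 0 < nm x1 * hr u - nm x * hr v.
  case/orP: XZ => h.
    have : 0 < nm x * - hr v by rewrite mulr_gt0 ?oppr_gt0 // lt_neqAle eq_sym h nm_ge0.
    by move: X0 Z0; rewrite mulrN; move: (nm x * hr v) (nm x1 * hr u) => e1 e2; lra.
  have : 0 < nm x1 * hr u by rewrite mulr_gt0 // lt_neqAle eq_sym h nm_ge0.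
  by move: X0 Z0; rewrite mulrN; move: (nm x * hr v) (nm x1 * hr u) => e1 e2; lra.
have k0 : 0 < k.
  have := congr1 Im kE; rewrite kX !cImM /= Im_int Re_int !mul0r mul1r addr0 add0r => e.
  have : 0 < k%:~R * Im sg by rewrite -e.
  by rewrite pmulr_lgt0 ?Im_sg // (ltr_int R 0).
have FE : FF A p = (3 * k ^+ 2 - a ^+ 2)%:~R.
  rewrite /FF kE nmM nm_sg nm_int aE intrB intrM !rmorphXn /=; ring.
have F4 : FF A p = 4 * (nm x * - hr v) * (nm x1 * hr u).
  by rewrite /FF kX nmM nm_ii nm_rc aX; ring.
exists a, k; split=> //.
have Fge : 0 <= FF A p.
  by rewrite F4; apply: mulr_ge0 => //; apply: mulr_ge0.
rewrite -(ltr_int R 0) -FE lt0r Fge andbT FE.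
apply/eqP => e; have : a ^+ 2 = 3 * k ^+ 2.
  by move/eqP: e; rewrite intr_eq0 subr_eq0 => /eqP ->.
by move/sqrt3_irr; lia.
Qed.

Lemma FF_mul A v u g b p (x y : C) : qframe A v u g b -> herm p g = 0 ->
  FF A (x *: p + y *: (A *m p)) = nm (x ^+ 2 + y ^+ 2) * FF A p.
Proof.
move=> qfr pg; have [hA _ _ _ _] := qfr.
have s := quartic_skew qfr pg; have p2 := quartic_sqr qfr pg.
have rcF t : rc (FF A t) = herm t (A *m t) * (herm t (A *m t))^* - herm t t ^+ 2.
  by rewrite /FF rcD rcN rcX -nmE -hrE.
apply: rc_inj; rewrite rcM -nmE !rcF mulmxDr -!scalemxAr p2 !hE hA s.
have sj : (herm p (A *m p))^* = - herm p (A *m p) by rewrite herm_cj s.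
have rj : (herm p p)^* = herm p p by rewrite herm_cj.
move: (herm p (A *m p)) (herm p p) sj rj => B a Bj aj.
by rewrite !cjE Bj aj; ring.
Qed.

(** Euclid's algorithm in $O[i]$: remainders of squared modulus at most $1/3$ multiply [FF] by at
    most $(1/3+1/3)^2<1$, so a vector with minimal [FF] generates the module. *)
Lemma quartic_gen A v u g b p : qframe A v u g b -> Ivec p -> herm p g = 0 -> p != 0 ->
  (forall z, Ivec z -> herm z g = 0 -> z != 0 -> FF A p <= FF A z) ->
  forall z, Ivec z -> herm z g = 0 -> exists x y, [/\ Eis x, Eis y & z = x *: p + y *: (A *m p)].
Proof.
move=> qfr Ip pg p0 pmin z Iz zg; have [hA IA of_ [h1 h2 h3] _] := qfr.
have [a [k [aE kE k0 F0 FE]]] := quartic_data qfr Ip pg p0.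
have [nv pu pg' _] := of_.
have gg0 : herm g g != 0 by apply: hr0_neq; rewrite gt_eqF.
have qg := quartic_perp qfr pg.
have s := quartic_skew qfr pg.
have d0 : det3 g p (A *m p) != 0.
  apply/eqP => d; have := gram3 g p (A *m p).
  rewrite d mul0r (herm_sym0 pg) (herm_sym0 qg) pg qg hA s kE (hrE p) aE rcz.
  have -> : - (herm g g * (a%:~R * a%:~R - k%:~R * sg * - (k%:~R * sg)) -
     0 * (0 * a%:~R - k%:~R * sg * 0) + 0 * (0 * - (k%:~R * sg) - a%:~R * 0)) =
     herm g g * - (a%:~R ^+ 2 + k%:~R ^+ 2 * sg ^+ 2).
    by move: (herm g g) => hg; ring.
  rewrite sg2 => /esym/eqP; rewrite mulf_eq0 (negPf gg0) /=.
  have -> : - (a%:~R ^+ 2 + k%:~R ^+ 2 * -3) = (3 * k ^+ 2 - a ^+ 2)%:~R :> C.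
    by rewrite intrB intrM !rmorphXn /=; ring.
  by rewrite intr_eq0; lia.
have [x0 [x [y zE]]] := basis3 z d0.
have x00 : x0 = 0.
  move: zg; rewrite zE !hE pg qg !mulr0 !addr0 => /eqP.
  by rewrite mulf_eq0 (negPf gg0) orbF => /eqP.
rewrite x00 scale0r add0r in zE.
have [c Ic nc] := Eis_near x; have [d Id nd] := Eis_near y.
exists c, d; split=> //.
pose z' := z - c *: p - d *: (A *m p).
have z'E : z' = (x - c) *: p + (y - d) *: (A *m p).
  by rewrite /z' zE; apply: cv_eq; rewrite !ccE; ring.
have Iz' : Ivec z'.
  by apply: IvecB; [apply: IvecB|] => //; apply: IvecZ => //; apply: Ivec_mul.
have z'g : herm z' g = 0 by rewrite /z' !hE zg pg qg !mulr0 !subr0.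
apply/eqP; rewrite -subr_eq0 opprD addrA -/z'; apply: contrapT => /negP z'0.
have := pmin _ Iz' z'g z'0; rewrite z'E (FF_mul _ _ qfr pg) leNgt => /negP; apply.
have Fp : 0 < FF A p by rewrite FE (ltr_int R 0).
have small : nm ((x - c) ^+ 2 + (y - d) ^+ 2) <= (1 / 3 + 1 / 3) ^+ 2.
  apply: nm_sum_le; rewrite ?nmX //.
    by apply: lerXn2r => //; rewrite nnegrE ?nm_ge0.
  by apply: lerXn2r => //; rewrite nnegrE ?nm_ge0.
by move: small Fp; move: (nm _) (FF A p) => n1 n2; nra.
Qed.

(** The vectors [g], [p], $Ap$ span a proper sublattice; [h] is the missing glue vector $(\bar
    cg+p+Ap)/2$ with a unit $c$. It is extracted from [y] by reducing the coefficients of $2y$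
    modulo 2. *)
Lemma quartic_final A v u g b y p : qframe A v u g b -> Ivec y -> herm y g = 1 ->
  herm g g = 2%:R -> Ivec p -> herm p g = 0 ->
  herm p p = 1 -> herm p (A *m p) = sg ->
  (forall z, Ivec z -> herm z g = 0 -> exists x y, [/\ Eis x, Eis y & z = x *: p + y *: (A *m p)]) ->
  exists h, [/\ Ivec h, herm h h = 1, herm h p = - w & herm h (A *m p) = 1 + w].
Proof.
move=> qfr Iy yg gg Ip pg pp ps gen.
have [hA IA of_ [h1 h2 h3] prg] := qfr.
have qg := quartic_perp qfr pg; have sk := quartic_skew qfr pg.
set r := A *m p in ps gen qg sk *.
have rr : herm r r = 1 by rewrite hA.
have Ir : Ivec r by apply: Ivec_mul.
rewrite ps in sk; clearbody r.
have [S SE] : exists S, S = herm y p by exists (herm y p).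
have [T TE] : exists T, T = herm y r by exists (herm y r).
have IS : Eis S by rewrite SE; apply: Eis_herm.
have IT : Eis T by rewrite TE; apply: Eis_herm.
have s2 := sg2; have Isg := Eis_sg.
pose be := sg * S - T; pose al := 2 * S + sg * be.
have Ibe : Eis be by rewrite /be; eis.
have gpy := generates_perp (proj1 prg) yg Iy gen.
have y2 : 2 *: y = g + al *: p + be *: r.
  apply/eqP; rewrite -subr_eq0; apply/eqP.
  have IY : Ivec (2 *: y - (g + al *: p + be *: r)).
    apply: IvecB; first by apply: IvecZ => //; exact: (Eis_nat R 2).
    apply: IvecD; [apply: IvecD; first exact: (proj1 prg)|]; apply: IvecZ => //; rewrite /al; eis.
  have [x [x1 [x2 [_ _ _ E]]]] := gpy _ IY.
  have k0 : herm (2 *: y - (g + al *: p + be *: r)) g = 0.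
    by rewrite !hE yg gg pg qg; ring.
  have k1 : herm (2 *: y - (g + al *: p + be *: r)) p = 0.
    by rewrite !hE -SE (herm_sym0 pg) pp sk /al; ring.
  have k2 : herm (2 *: y - (g + al *: p + be *: r)) r = 0.
    by rewrite !hE -TE (herm_sym0 qg) ps rr /al /be; ring: s2.
  move: k0 k1 k2; rewrite E !hE yg pg qg pp rr sk ps -SE -TE => k0 k1 k2.
  have x0 : x = 0 by rewrite -k0; ring.
  rewrite x0 !mul0r !add0r in k1 k2.
  have x20 : x2 = 0.
    have two : (2 : C) != 0 by rewrite pnatr_eq0.
    apply: (mulfI two); rewrite mulr0.
    transitivity (sg * (x1 * 1 + x2 * - sg) - (x1 * sg + x2 * 1)); first by ring: s2.
    by rewrite k1 k2; ring.
  have x10 : x1 = 0 by rewrite -k1 x20; ring.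
  by rewrite x0 x10 x20 !scale0r !addr0.
(* As $\sqrt{-3}=1+2\omega$, subtracting $t_1p$ makes the coefficients of [p] and [r] in $2y_1$ both
   equal to [be]. *)
pose t1 := S + w * be.
pose y1 := y - t1 *: p.
have It1 : Eis t1 by rewrite /t1; eis.
have Iy1 : Ivec y1 by apply: IvecB => //; apply: IvecZ.
have y1E : 2 *: y1 = g + be *: (p + r).
  by rewrite scalerBr y2 /al /t1 /sg; apply: cv_eq; rewrite !ccE; ring.
clearbody y1 t1 be.
have [k kE] := hr_int Iy1.
have [|||c [t [Ic c1 It beE]]] := @oddness R be k%:~R 1 Ibe.
- by exists k.
- have : herm (2 *: y1) (2 *: y1) = 2 + 2 * (be * be^*).
    rewrite y1E !hE gg pg qg (herm_sym0 pg) (herm_sym0 qg) pp rr ps sk; ring.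
  rewrite !hE hrE kE nmE cjn => h; apply: rc_inj.
  have two : (2 : C) != 0 by rewrite pnatr_eq0.
  apply: (mulfI two); rewrite rcM rcn h (_ : rc (1%:~R + nm be) = 1 + rc (nm be)); [ring|exact: rcD].
- by exists 0.
pose h := c^* *: (y1 - t *: (p + r)).
have cc := nm_eq1 c1.
have Ih : Ivec h.
  by apply: IvecZ; [exact: EisJ|apply: IvecB => //; apply: IvecZ => //; apply: IvecD].
have hE2 : 2 *: h = c^* *: g + (p + r).
  rewrite /h; transitivity (c^* *: (2 *: y1 - (2 * t) *: (p + r))).
    by apply: cv_eq; rewrite !ccE; ring.
  rewrite y1E beE; transitivity (c^* *: g + (c * c^*) *: (p + r)).
    by apply: cv_eq; rewrite !ccE; ring.
  by rewrite cc scale1r.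
clearbody h.
have two : (2 : C) != 0 by rewrite pnatr_eq0.
exists h; split=> //.
- apply: (mulfI two); apply: (mulfI two).
  have -> : 2 * (2 * herm h h) = herm (2 *: h) (2 *: h) by rewrite !hE cjn.
  rewrite hE2 !hE gg pg qg (herm_sym0 pg) (herm_sym0 qg) pp rr ps sk cjK.
  transitivity (2 * (c * c^*) + 2); [ring|rewrite cc; ring].
- apply: (mulfI two); rewrite -hermZl hE2 !hE (herm_sym0 pg) pp sk /sg; ring.
apply: (mulfI two); rewrite -hermZl hE2 !hE (herm_sym0 qg) rr ps /sg; ring.
Qed.

(** For a generator [p] the Gram determinant is $a^2-3k^2=-m$. This excludes $m=1$ and leaves Pell's
    equation $3k^2-a^2=2$, whose solutions are brought to $a=k=1$ by units of $O[i]$; [k] is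
    therefore minimized among the generators. *)
Lemma quartic_min A v u g b y : qframe A v u g b -> Ivec y -> herm y g = 1 ->
  forall m : int, hr g = m%:~R -> (m = 1 \/ m = 2) ->
  herm g g = 2%:R /\ exists p, [/\ Ivec p, herm p g = 0, herm p p = 1, herm p (A *m p) = sg &
   (forall z, Ivec z -> herm z g = 0 -> exists x y, [/\ Eis x, Eis y & z = x *: p + y *: (A *m p)])].
Proof.
move=> qfr Iy yg m mE m12; have [hA IA of_ [h1 h2 h3] prg] := qfr.
have data := quartic_data qfr.
have [] := @min_nat R V [set p | [/\ Ivec p, herm p g = 0 & p != 0]] (FF A).
- move=> p [Ip pg p0]; have [a [k [_ _ _ F0 ->]]] := data _ Ip pg p0.
  by exists (absz (3 * k ^+ 2 - a ^+ 2)%R); rewrite -[in LHS](gtz0_abs F0).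
- by have [e he] := perp_nonzero (proj1 prg) Iy yg; exists e.
move=> p0 [Ip0 p0g p00] p0min.
have gens p : Ivec p -> herm p g = 0 -> p != 0 -> FF A p = FF A p0 ->
    forall z, Ivec z -> herm z g = 0 -> exists x y, [/\ Eis x, Eis y & z = x *: p + y *: (A *m p)].
  move=> Ip pg pn F; apply: (quartic_gen qfr) => //.
  by move=> z *; rewrite F; apply: p0min.
have det p (a k : int) : Ivec p -> herm p g = 0 -> p != 0 -> FF A p = FF A p0 ->
    hr p = a%:~R -> herm p (A *m p) = k%:~R * sg -> 3 * k ^+ 2 - a ^+ 2 = m.
  move=> Ip pg pn F aE kE.
  have gn := generates_perp (proj1 prg) yg Iy (gens p Ip pg pn F).
  have := gram_perp Iy Ip (Ivec_mul IA Ip) yg pg (quartic_perp qfr pg) gn.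
  rewrite hA (quartic_skew qfr pg) kE !hrE aE mE !rcz => h.
  apply: (@intr_inj C); rewrite intrB intrM !rmorphXn /=.
  apply: oppr_inj; rewrite -h; have s2 := sg2; ring: s2.
have [a0 [k0 [a0E k0E k00 F0 FE0]]] := data _ Ip0 p0g p00.
have m0 := det _ _ _ Ip0 p0g p00 erefl a0E k0E.
have m2 : m = 2.
  (* The equation $a^2=3k^2-1$ has no solution modulo 3. *)
  case: m12 => // m1; exfalso.
  have [j [r [jE hr_]]] := int_div_mod a0 (isT : 0 < 3 :> int).
  rewrite jE m1 in m0.
  have r012 : r = 0 \/ r = 1 \/ r = 2 by lia.
  by case: r012 m0 => [->|[->|->]] m0; lia.
split; first by rewrite hrE mE m2 rcz.
rewrite m2 in det.
have [] := @min_nat R V [set p | [/\ Ivec p, herm p g = 0, p != 0 & FF A p = FF A p0]] (fun p => Im (herm p (A *m p)) / Im sg).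
- move=> p [Ip pg pn _]; have [a [k [_ -> k1 _ _]]] := data _ Ip pg pn.
  exists (absz k); rewrite cImM Im_int Re_int mul0r addr0 mulfK ?gt_eqF ?Im_sg //.
  by rewrite -[in LHS](gtz0_abs k1).
- by exists p0; split.
move=> p [Ip pg pn Fp] pmin.
have [a [k [aE kE k1 F1 FE]]] := data _ Ip pg pn.
have d := det _ _ _ Ip pg pn Fp aE kE.
have Imk (n : int) : Im (n%:~R * sg) / Im sg = n%:~R.
  by rewrite cImM Im_int Re_int mul0r addr0 mulfK ?gt_eqF ?Im_sg.
(* Multiplication by the unit 1 + c A, c = +-omega, turns (a, k) into (2a -+ 3k, 2k -+ a) *)
have step (s : int) : s = 1 \/ s = -1 -> exists p', [/\ Ivec p', herm p' g = 0, p' != 0, FF A p' = FF A p0 &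
   hr p' = (2 * a + 3 * s * k)%:~R /\ herm p' (A *m p') = (2 * k + s * a)%:~R * sg].
  move=> s1; pose c : C := s%:~R * w.
  have Ic : Eis c by apply: EisM; [exact: Eis_int|exact: Eisw].
  have s2C : s%:~R * s%:~R = 1 :> C by case: s1 => ->; rewrite ?mulrNz ?mulrNN mulr1.
  have cj : c^* = s%:~R * (- 1 - w) by rewrite /c cjM conj_omega rmorph_int.
  have ccE : c * c^* = 1.
    by rewrite cj /c; transitivity ((s%:~R * s%:~R) * (- w - w ^+ 2) : C); [ring|rewrite s2C omega2; ring].
  have Ip' : Ivec (1 *: p + c *: (A *m p)).
    by rewrite scale1r; apply: IvecD => //; apply: IvecZ => //; apply: Ivec_mul.
  have pg' : herm (1 *: p + c *: (A *m p)) g = 0.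
    by rewrite !hE pg (quartic_perp qfr pg) !mulr0 addr0.
  have F' : FF A (1 *: p + c *: (A *m p)) = FF A p0.
    rewrite (FF_mul _ _ qfr pg) Fp.
    have -> : 1 ^+ 2 + c ^+ 2 = - w.
      rewrite /c; transitivity (1 + (s%:~R * s%:~R) * w ^+ 2 : C); first by ring.
      by rewrite s2C omega2; ring.
    by rewrite nmN nm_omega mul1r.
  have sk := quartic_skew qfr pg.
  exists (1 *: p + c *: (A *m p)); split=> //.
    have FF0 : FF A 0 = 0 by rewrite /FF mulmx0 /hr !herm0l nm0 expr0n subr0.
    apply/eqP => e; move: F'; rewrite e FF0 => F'.
    by move: F0; rewrite -(ltr_int R 0) -FE0 -F' ltxx.
  split.
    apply: rc_inj; rewrite -hrE !hE hA sk kE hrE aE !rcz cj1.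
    transitivity (a%:~R + (c * c^*) * a%:~R + (c^* - c) * (k%:~R * sg)); first by ring.
    rewrite ccE cj /c !(intrD, intrM).
    transitivity (2 * a%:~R - s%:~R * k%:~R * sg ^+ 2 : C); first by rewrite /sg; ring.
    by rewrite sg2; ring.
  rewrite mulmxDr -!scalemxAr (quartic_sqr qfr pg) !hE hA sk kE hrE aE !rcz cj1.
  transitivity (k%:~R * sg + (c * c^*) * (k%:~R * sg) + (c - c^*) * a%:~R); first by ring.
  rewrite ccE cj /c !(intrD, intrM) /sg; ring.
(* If $k\ge2$, then $a^2=3k^2-2>k^2$, so the unit with the suitable sign replaces [k] by
   $2k-|a|<k$. *)
have k2 : k = 1.
  apply/eqP; apply: contrapT => kn.
  have k2 : 2 <= k by lia.
  have lower (n : int) p' : [/\ Ivec p', herm p' g = 0, p' != 0 & FF A p' = FF A p0] ->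
      herm p' (A *m p') = n%:~R * sg -> k <= n.
    by move=> hp' e; have := pmin _ hp'; rewrite e kE !Imk (ler_int R).
  have [a_pos|a_neg] := ltrP 0 a.
    have [p' [i1 i2 i3 i4 [_ i5]]] := step (-1) (or_intror erefl).
    have := lower _ _ (And4 i1 i2 i3 i4) i5; nia.
  have [p' [i1 i2 i3 i4 [_ i5]]] := step 1 (or_introl erefl).
  have := lower _ _ (And4 i1 i2 i3 i4) i5; nia.
have [a1|a1] : a = 1 \/ a = -1 by nia.
  exists p; split=> //; first by rewrite hrE aE a1 rcz.
    by rewrite kE k2 mul1r.
  exact: gens.
have [p' [i1 i2 i3 i4 [i5 i6]]] := step 1 (or_introl erefl).
exists p'; split=> //.
- by rewrite hrE i5 a1 k2 rcz.
- by rewrite i6 a1 k2 (_ : 2 * 1 + 1 * -1 = 1 :> int) ?mul1r.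
exact: gens.
Qed.

Lemma frame_vec_alg (h p r : V) (j : C) : p - j *: r =
  (1 - j * (1 - w)) *: (- w *: h + (1 + w) *: p) +
   (- 1 - w + j) *: (- (1 + w) *: h + (1 + w) *: p) -
   (j * (- 1 - w)) *: (- (1 + w) *: h - w *: p + w *: r).
Proof.
have o2 := omega2 R; revert o2; generalize (@omega R); intros W o2.
have e0 : (1 - j * (1 - W)) * - W - (- 1 - W + j) * (1 + W) + (j * (- 1 - W)) * (1 + W) = 0.
  by ring: o2.
have e1 : (1 - j * (1 - W)) * (1 + W) + (- 1 - W + j) * (1 + W) + (j * (- 1 - W)) * W = 1.
  by ring: o2.
have e2 : (j * (- 1 - W)) * W = j by ring: o2.
transitivity (((1 - j * (1 - W)) * - W - (- 1 - W + j) * (1 + W) + (j * (- 1 - W)) * (1 + W)) *: h +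
  ((1 - j * (1 - W)) * (1 + W) + (- 1 - W + j) * (1 + W) + (j * (- 1 - W)) * W) *: p -
  ((j * (- 1 - W)) * W) *: r).
  by rewrite e0 e1 e2 scale0r scale1r add0r.
by apply: cv_eq; rewrite !ccE; ring.
Qed.

Lemma quartic_case A v u u' b : preserving A -> Imx A -> Eis b ->
  eframe A v ii u (- ii) u' b -> exists c0 c1 c2 : V, exists2 d, d != 0 &
    hframe c0 c1 c2 /\ v = d *: ((1 - ii * (1 - w)) *: c0 + (w^* + ii) *: c1 - (ii * w^*) *: c2).
Proof.
move=> hA IA Ib ef; have [_ _ [_ _ b1]] := ef.
have [g qfr] := quartic_third hA IA Ib ef.
have [m [mE m12]] := quartic_index qfr Ib b1.
have [_ _ of_ [h1 h2 h3] prg] := qfr; have [Ig [y Iy yg]] := prg.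
have [gg [p [Ip pg pp ps gen]]] := quartic_min qfr Iy yg mE m12.
have [h [Ih hh hp hr_]] := quartic_final qfr Iy yg gg Ip pg pp ps gen.
have sk := quartic_skew qfr pg; rewrite ps in sk.
have rr : herm (A *m p) (A *m p) = 1 by rewrite hA.
have Ir : Ivec (A *m p) by apply: Ivec_mul.
have ph : herm p h = 1 + w by rewrite -herm_cj hp !cjE conj_omega; ring.
have rh : herm (A *m p) h = - w by rewrite -herm_cj hr_ !cjE conj_omega; ring.
(* The operator $1-iA$ kills [u] and doubles [v]. The coefficient is nonzero: a multiple of [u] of
   norm 1 would have $\langle p,Ap\rangle=i$, not $\sqrt{-3}$. *)
have [e [e0 pE]] : exists e, e != 0 /\ p - ii *: (A *m p) = e *: v.
  have [x [x1 [x2 pE]]] := basis3 p (oframe_det of_).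
  have [nv pu pg' [uv gv ug]] := of_.
  have x20 : x2 = 0.
    move: pg; rewrite pE !hE (herm_sym0 gv) ug !mulr0 !add0r => /eqP.
    by rewrite mulf_eq0 => /orP[/eqP //|]; rewrite (negPf (hr0_neq _)) // gt_eqF.
  exists (2 * x); split.
    rewrite mulf_neq0 ?pnatr_eq0 //; apply/eqP => x0.
    have pE' : p = x1 *: u by rewrite pE x0 x20 !scale0r add0r addr0.
    have : sg = ii * herm p p.
      by rewrite -ps pE' -scalemxAr h2 !hE !cjE iiJ; ring.
    rewrite pp mulr1 => /(congr1 (@nm R)); rewrite nm_sg nm_ii => /eqP.
    by rewrite (eqr_nat R 3 1).
  rewrite pE x20 scale0r addr0 mulmxDr -!scalemxAr h1 h2.
  have i2 := ii2; revert i2; generalize ii; intros j i2.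
  by apply: cv_eq; rewrite !ccE; ring: i2.
set r := A *m p in ps sk rr Ir rh hr_ pE *.
(* In the model $h=(1,-1,0)$, $p=(1,\bar\omega,0)$, $r=(1-\omega,-1,\bar\omega)$, which has the same
   Gram matrix, these combinations are the standard basis vectors. *)
exists (- w *: h + (1 + w) *: p), (- (1 + w) *: h + (1 + w) *: p), (- (1 + w) *: h - w *: p + w *: r).
have o2 := omega2 R; have Iw := Eisw R; have I1 := Eis1 R.
exists e^-1; first by rewrite invr_eq0.
split; last first.
  rewrite conj_omega -frame_vec_alg pE scalerA mulVf ?scale1r //.
split; split.
- by apply: IvecD; apply: IvecZ => //; eis.
- by apply: IvecD; apply: IvecZ => //; eis.
- by apply: IvecD; [apply: IvecB|]; apply: IvecZ => //; eis.
all: rewrite !hE ?hh ?hp ?hr_ ?ph ?pp ?ps ?rh ?sk ?rr ?cjE ?conj_omega /sg; ring: o2.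
Qed.

End QuarticCase.

(** * Eigenvalue of order nine *)

Section NonicCase.
Variable R : realType.
Local Notation Re := (@complex.Re R).
Local Notation Im := (@complex.Im R).
Local Notation w := (omega : R[i]).
Local Notation C := R[i].
Local Notation V := 'cV[C]_3.
Local Notation rc := (real_complex R).
Implicit Types (u v z g p y : V) (A B : 'M[C]_3) (a b l : C).

Definition nonic A v l : Prop := [/\ preserving A, Imx A, hr v < 0, A *m v = l *: v &
  [/\ simple_at A v l, l ^+ 3 = w & forall z, A *m (A *m (A *m z)) = w *: z]].

(** The hypotheses give $2E^2\le3Y$, and $Y\le E$ turns this into $2Y^2\le3Y$. *)
Lemma hermite_bound (n E F Y : R) : 0 < Y -> 3 * n <= E ^+ 2 -> E * F - n = Y -> Y <= E ->
  E <= F -> Y <= 3 / 2.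
Proof.
move=> Y0 red G EY EF; have E0 : 0 < E by exact: lt_le_trans EY.
have h0 : E * E <= E * F by rewrite ler_pM2l.
have h1 : 2 * E ^+ 2 <= 3 * Y by move: red; rewrite !expr2; lra.
have h2 : Y * Y <= E * E by apply: ler_pM => //; apply: ltW.
have h3 : 2 * Y * Y <= 3 * Y by rewrite -mulrA; move: h1; rewrite expr2; lra.
by move: h3; rewrite ler_pM2r //; lra.
Qed.

(** Mordell's argument: the rank two lattice orthogonal to a minimal vector has that minimum as its
    Gram determinant, while its own vectors are no shorter. The two-dimensional Hermite inequality
    then bounds the minimum. *)
Lemma min_q_le v y : hr v < 0 -> Ivec y -> y != 0 ->
  (forall z, Ivec z -> z != 0 -> q v y <= q v z) -> q v y <= 3 / 2.
Proof.
move=> nv Iy y0 ymin; have [c [c0 Ic pc]] := prim_multiple Iy y0.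
have cy0 : c *: y != 0 by rewrite scaler_eq0 negb_or c0.
have qy := q_gt0 nv y0.
have le1 : q v y <= q v (c *: y) by apply: ymin => //; case: pc.
have c1 : nm c <= 1.
  have := Eis_nm_ge1 Ic; rewrite invr_eq0 c0 nmV => /(_ isT) h.
  by rewrite -[nm c]invrK invf_le1 // (lt_le_trans _ h).
have le2 : q v (c *: y) <= q v y by rewrite qZ; move: c1 qy; move: (nm c) (q v y) => *; nra.
have qE : q v (c *: y) = q v y by apply/eqP; rewrite eq_le le1 le2.
have [x [e [f [[Ix Ie If] [xv ev fv0] gen [e0 f0 emin] red]]]] := reduction nv pc.
have gy := generates_perp (proj1 pc) xv Ix gen.
have G := q_perp_gram nv Ix Ie If xv ev fv0 gy.
have ey := ymin _ Ie e0; have fy := ymin _ If f0.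
rewrite qE in G; have nfe : nm (qf v e f) = nm (qf v f e) by rewrite -qfC nmJ.
rewrite nfe in G.
have ef : q v e <= q v f by apply: emin.
move: red G ey fy ef qy; move: (nm (qf v f e)) (q v e) (q v f) (q v y) => n E F Y red G ey fy ef qy.
exact: (hermite_bound qy red G ey ef).
Qed.

Lemma nonic_herm2 A v l y : nonic A v l -> herm (A *m (A *m y)) y = w * herm y (A *m y).
Proof. by move=> [hA _ _ _ [_ _ h3]]; rewrite -(hA _ y) h3 hermZl. Qed.

Definition nonic_vec A l y := y + l^* *: (A *m y) + (l^*) ^+ 2 *: (A *m (A *m y)).

(* The sum below is 3 times the projection of y to the l-eigenline of A. *)
Lemma nonic_vecP A v l y : nonic A v l ->
  nonic_vec A l y = (3 * herm y v / herm v v) *: v.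
Proof.
move=> nA; have [hA _ nv ev [sA l3 h3]] := nA.
have l1 := eigen_unit hA ev (ltr0_neq0 nv).
have ll : l * l^* = 1 by apply: nm_eq1.
have lj0 : l^* != 0 by rewrite conjC_eq0 -nm_gt0 l1 ltr01.
have l3j : w * (l^*) ^+ 2 = l.
  by rewrite -l3; transitivity (l * (l * l^*) ^+ 2); [ring|rewrite ll expr1n mulr1].
have v0 := hr_neq0 nv.
have AS : A *m nonic_vec A l y = l *: nonic_vec A l y.
  rewrite /nonic_vec !mulmxDr -!scalemxAr h3.
  have e1 : A *m y = (l * l^*) *: (A *m y) by rewrite ll scale1r.
  transitivity ((l * l^*) *: (A *m y) + l^* *: (A *m (A *m y)) + (w * (l^*) ^+ 2) *: y).
    by rewrite -e1 !scalerA [_ * w]mulrC.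
  rewrite l3j.
  have e2 : l^* = l * (l^*) ^+ 2 by transitivity ((l * l^*) * l^*); [rewrite ll mul1r|ring].
  by rewrite {2}e2; apply: cv_eq; rewrite !ccE; ring.
have Svy : herm (nonic_vec A l y) v = 3 * herm y v.
  have A1 : herm (A *m y) v = l * herm y v.
    apply: (mulfI lj0).
    by rewrite -hermZr -ev hA mulrA [_ * l]mulrC ll mul1r.
  have A2 : herm (A *m (A *m y)) v = l ^+ 2 * herm y v.
    apply: (mulfI lj0).
    rewrite -hermZr -ev hA A1; transitivity ((l * l^*) * (l * herm y v)); last by hring.
    by rewrite ll mul1r.
  rewrite /nonic_vec !hE A1 A2.
  transitivity (herm y v + (l * l^*) * herm y v + (l * l^*) ^+ 2 * herm y v); first by hring.
  by rewrite ll expr1n; hring.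
apply/eqP; rewrite -subr_eq0; apply/eqP; apply: sA.
  by rewrite hermDl hermNl hermZl Svy; hfield.
by rewrite mulmxBr AS -scalemxAr ev; apply: cv_eq; rewrite !ccE; ring.
Qed.

(** The projection formula paired with [y], where $\langle A^2y,y\rangle=\omega\langle y,Ay\rangle$.
    It bounds $\langle y,y\rangle+2\mathrm{Re}(\bar l\langle Ay,y\rangle)$ above by 0. *)
Lemma nonic_comp A v l y : nonic A v l ->
  herm y y + l^* * herm (A *m y) y + l * herm y (A *m y) =
  3 * rc (nm (herm y v) / hr v).
Proof.
move=> nA; have [hA _ nv ev [_ l3 _]] := nA.
have l1 := eigen_unit hA ev (ltr0_neq0 nv).
have ll : l * l^* = 1 by apply: nm_eq1.
have l3j : w * (l^*) ^+ 2 = l.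
  by rewrite -l3; transitivity (l * (l * l^*) ^+ 2); [ring|rewrite ll expr1n mulr1].
have v0 := hr_neq0 nv.
transitivity (herm (nonic_vec A l y) y).
  by rewrite /nonic_vec !hE (nonic_herm2 _ nA) mulrA [_ ^+ 2 * w]mulrC l3j.
rewrite (nonic_vecP _ nA) hermZl rcM rcV -nm_herm -hrE; hfield.
Qed.

Lemma unit_cube b : Eis b -> nm b = 1 -> b ^+ 3 = 1 \/ b ^+ 3 = -1.
Proof.
move=> Ib b1; have [k hk ->] := Eis_unit Ib b1; rewrite -exprM mulnC exprM w1_cube.
by rewrite -signr_odd; case: (odd k); [right|left].
Qed.

Lemma nonic_gram A v l y : nonic A v l ->
  rc (nm (det3 y (A *m y) (A *m (A *m y)))) = - (herm y y ^+ 3 - 3 * herm y y * (herm (A *m y) y * herm y (A *m y))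
     + herm (A *m y) y ^+ 3 * w^* + herm y (A *m y) ^+ 3 * w).
Proof.
move=> nA; have [hA _ _ _ [_ _ h3]] := nA.
have e1 := nonic_herm2 y nA.
have e2 : herm y (A *m (A *m y)) = w^* * herm (A *m y) y by rewrite -herm_cj e1 cjM herm_cj.
have ww : w * w^* = 1 by apply: nm_eq1; exact: nm_omega.
rewrite -nmE gram3 !hA e1 e2; move: (herm y y) (herm (A *m y) y) (herm y (A *m y)) => a b bj.
move: (w^*) ww => W ww.
transitivity (- (a ^+ 3 - a * b * bj * (2 + w * W) + b ^+ 3 * W + bj ^+ 3 * w)); first by ring.
by rewrite ww; ring.
Qed.

(** The identity $2\cos3\theta=(2\cos\theta)^3-3(2\cos\theta)$. *)
Lemma cube_re (c : C) : nm c = 1 -> rc (2 * Re c) ^+ 3 - 3 * rc (2 * Re c) = rc (2 * Re (c ^+ 3)).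
Proof.
move=> c1; rewrite -!addJ cjX; have cc := nm_eq1 c1.
transitivity (c ^+ 3 + c^* ^+ 3 + 3 * (c + c^*) * (c * c^* - 1)); first by ring.
by rewrite cc subrr mulr0 addr0.
Qed.

(** For a shortest [y] put $a=\langle y,y\rangle$ and $b=\langle Ay,y\rangle$. The bound $3/2$
    leaves $a\in\{-1,0,1\}$ and [b] zero or a unit, with $e=b^3=\pm1$ in the latter case. The Gram
    determinant $-(a^3-3a-e)\ge0$ and the cubic $s^3-3s=-e$ for $s=2\mathrm{Re}(\bar lb)$ leave
    $a=0$, $e=1$, which is the claim, and $a=1$, $e=-1$, where [y] is modified. *)
Lemma nonic_isotropic A v l : nonic A v l ->
  exists y b, [/\ Ivec y, herm y y = 0, herm (A *m y) y = b, Eis b & b ^+ 3 = 1].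
Proof.
move=> nA; have [hA IA nv ev [_ l3 h3]] := nA.
have l1 := eigen_unit hA ev (ltr0_neq0 nv).
have [] := @q_min R v [set z | Ivec z /\ z != 0] nv.
- by move=> z [].
- exists (E0 R); split; first exact: IE0.
  by apply/eqP => /colP/(_ i0)/eqP; rewrite vE !mxE oner_eq0.
move=> y [Iy y0] ymin.
have q32 : q v y <= 3 / 2 by apply: (min_q_le nv Iy y0) => z Iz z0; apply: ymin.
have q0 := q_gt0 nv y0.
have [a aE] := hr_int Iy.
have ayE : herm y y = a%:~R by rewrite hrE aE rcz.
have [b bE] : exists b, b = herm (A *m y) y by exists (herm (A *m y) y).
have Ib : Eis b by rewrite bE; apply: Eis_herm => //; apply: Ivec_mul.
have bj : herm y (A *m y) = b^* by rewrite bE herm_cj.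
pose t := - nm (herm y v) / hr v.
have t0 : 0 <= t.
  by rewrite /t mulNr -mulrN -invrN divr_ge0 ?nm_ge0 //; lra.
have qt : q v y = a%:~R + 2 * t by rewrite /q aE /t; ring.
pose s := 2 * Re (l^* * b).
have st : a%:~R + s = - 3 * t.
  apply: rc_inj; have := nonic_comp y nA; rewrite ayE bj -bE => e.
  have -> : rc (- 3 * t) = 3 * rc (nm (herm y v) / hr v).
    by rewrite -(rcn R 3) -rcM; congr rc; rewrite /t; ring.
  by rewrite -e rcD rcz /s -addJ cjM cjK; ring.
have a1 : a = -1 \/ a = 0 \/ a = 1.
  have := q_ge_hr y nv; rewrite aE ler_norml => /andP[g1 g2].
  have : (a < 2)%R by rewrite -(ltr_int R); lra.
  have : (-2 < a)%R by rewrite -(ltr_int R) mulrNz; lra.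
  by lia.
have [n nE] := Eis_nm Ib.
have nb : nm b <= 9 / 4.
  apply: le_trans (_ : q v y * q v y <= _); last by nra.
  by rewrite bE; apply: le_trans (herm_CS _ _ nv) _; rewrite (q_inv _ hA ev nv).
have n01 : n = 0%N \/ n = 1%N.
  have n2 := Eis_nm_neq2 Ib.
  case: n nE => [|[|[|n]]] nE; [by left|by right|by case: n2|].
  have n3 : (3%:R : R) <= n.+3%:R by rewrite ler_nat.
  by exfalso; move: nb; rewrite nE; lra.
(* If $b=0$, then $a=-3t$, and $q_v(y)=a+2t=-t\le0$ is absurd. *)
have b0 : n = 1%N.
  case: n01 => // n0; exfalso.
  have b0 : b = 0 by apply/eqP; rewrite -nm_eq0 nE n0.
  have s0 : s = 0 by rewrite /s b0 mulr0 mulr0.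
  lra.
rewrite b0 in nE.
pose c := l^* * b.
have c1 : nm c = 1 by rewrite nmM nmJ l1 nE mulr1.
have c3 : c ^+ 3 = w^* * b ^+ 3 by rewrite exprMn -cjX l3.
have gr := nonic_gram y nA; rewrite ayE bj -bE in gr.
have bb : b * b^* = 1 by apply: nm_eq1.
have D0 := nm_ge0 (det3 y (A *m y) (A *m (A *m y))).
have W2 : w + w^* = -1 by rewrite conj_omega; ring.
have s3 (e : R) : b ^+ 3 = rc e -> s ^+ 3 - 3 * s = - e.
  move=> be; apply: rc_inj; rewrite rcD !rcN rcX rcM rcn (cube_re c1) c3 be -addJ !cjE.
  by transitivity ((w + w^*) * rc e); [ring|rewrite W2 mulN1r].
have Dn (e : R) : b ^+ 3 = rc e -> nm (det3 y (A *m y) (A *m (A *m y))) = - (a%:~R ^+ 3 - 3 * a%:~R - e).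
  move=> be; apply: rc_inj; rewrite gr bb -cjX be conjC_rc.
  rewrite rcN !rcD !rcN rcX rcM rcn rcz; congr (- _).
  by transitivity (a%:~R ^+ 3 - 3 * a%:~R + (w + w^*) * rc e); [ring|rewrite W2; ring].
have good z : Ivec z -> herm z z = 0 -> forall b', herm (A *m z) z = b' -> b' ^+ 3 = 1 ->
   exists y b, [/\ Ivec y, herm y y = 0, herm (A *m y) y = b, Eis b & b ^+ 3 = 1].
  move=> Iz zz b' zb b'3; exists z, b'; split=> //.
  by rewrite -zb; apply: Eis_herm => //; apply: Ivec_mul.
have [b3|b3] := unit_cube Ib nE.
  have e3 := s3 1 b3; have d3 := Dn 1 b3.
  case: a1 => [a1|[a0|a1]].
  - by exfalso; rewrite d3 a1 mulrNz in D0; lra.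
  - by apply: (good y Iy _ b) => //; rewrite ayE a0.
  (* From $1+2t\le3/2$ the number $x=-s=1+3t$ lies in $[1,7/4]$, where $x^3-3x\le x/16<1$; but [e3]
     asks for $x^3-3x=1$. *)
  exfalso; rewrite a1 in st qt; rewrite (_ : 1%:~R = 1 :> R) // in st qt.
  have x1 : 1 <= - s by lra.
  have x2 : - s <= 7 / 4 by lra.
  move: (- s) x1 x2 (opprK s) => x x1 x2 sE; rewrite -sE in e3.
  have h2 : x * x <= 7 / 4 * (7 / 4) by apply: ler_pM => //; lra.
  have h4 : x * x * x <= 7 / 4 * (7 / 4) * x by rewrite ler_pM2r //; lra.
  by move: e3; rewrite (_ : (- x) ^+ 3 = - (x * x * x)); [lra|ring].
have b3' : b ^+ 3 = rc (-1) by rewrite rcN.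
have e3 := s3 _ b3'; have d3 := Dn _ b3'.
case: a1 => [a1|[a0|a1]].
- by exfalso; rewrite d3 a1 mulrNz in D0; lra.
- by exfalso; rewrite d3 a0 mulr0z in D0; lra.
have e1 := nonic_herm2 y nA; rewrite bj in e1.
have e2 : herm y (A *m (A *m y)) = w^* * b by rewrite -herm_cj e1 cjM cjK.
(* For $a=1$ and $b^3=-1$, the vector $y-\bar bAy$ is isotropic, and its pairing with its image is
   $b(1+\omega)$, with cube $(-1)(-1)=1$. *)
apply: (good (y - b^* *: (A *m y)) _ _ (b - w * b^* ^+ 2)).
- by apply: IvecB => //; apply: IvecZ; [exact: EisJ|exact: Ivec_mul].
- rewrite !hE !hA ayE a1 bj -bE cjK.
  by transitivity (2 - 2 * (b * b^*) + (b * b^* - 1)); [ring|rewrite bb; ring].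
- rewrite mulmxDr mulmxN -scalemxAr !hE !hA e1 ayE a1 -bE cjK.
  by transitivity (b - w * b^* ^+ 2 - b + b * (b * b^*)); [ring|rewrite bb; ring].
have bj3 : b^* ^+ 3 = -1 by rewrite -cjX b3 !cjE.
have -> : b - w * b^* ^+ 2 = b * (1 + w).
  transitivity (b - w * b^* ^+ 2 * (b * b^*)); first by rewrite bb mulr1.
  by transitivity (b - w * b * b^* ^+ 3); [ring|rewrite bj3; ring].
by rewrite exprMn b3 w1_cube mulrNN mulr1.
Qed.

(** Among the three cube roots of $\omega$, at angles $40^\circ$, $160^\circ$ and $280^\circ$, the
    one with negative real part. *)
Definition nonary : C := cis (8 * pi / 9).

Lemma nonary3 : nonary ^+ 3 = w.
Proof.
rewrite /nonary -cis_mulrn.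
have -> : (8 * pi / 9) *+ 3 = 2 * pi + 2 * pi / 3 :> R by rewrite -mulr_natl; field.
by rewrite cisD cis_2pi mul1r.
Qed.

Lemma nm_nonary : nm nonary = 1. Proof. exact: nm_cis. Qed.

Lemma Re_nonary : Re nonary < 0.
Proof.
rewrite /nonary /cis /=; have -> : 8 * pi / 9 = pi - pi / 9 :> R by field.
rewrite cosB cospi sinpi mul0r addr0 mulN1r oppr_lt0; apply: cos_gt0_pihalf.
by have := pi_gt0 R; move: (pi : R) => x x0; apply/andP; split; lra.
Qed.

(** Twice the real part is a root of $X^3-3X+1$, which has a single negative root; the sign of the
    imaginary part is then fixed by the cube. *)
Lemma nonary_unique l l' : l ^+ 3 = w -> nm l = 1 -> Re l < 0 ->
  l' ^+ 3 = w -> nm l' = 1 -> Re l' < 0 -> l = l'.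
Proof.
move=> l3 l1 ln l'3 l'1 l'n.
have cub (c : C) : c ^+ 3 = w -> nm c = 1 -> (2 * Re c) ^+ 3 - 3 * (2 * Re c) = - 1.
  move=> c3 c1; apply: rc_inj; have := cube_re c1.
  by rewrite c3 Re_omega !rcEs => ->; field.
have := cub _ l3 l1; have := cub _ l'3 l'1.
have ReE : Re l = Re l'.
  have := cub _ l3 l1; have := cub _ l'3 l'1.
  move: (Re l) (Re l') ln l'n => x y xn yn hy hx.
  have x2 : 3 < (2 * x) ^+ 2 by nra.
  have y2 : 3 < (2 * y) ^+ 2 by nra.
  have : (x - y) * ((2 * x) ^+ 2 + (2 * x) * (2 * y) + (2 * y) ^+ 2 - 3) = 0 by lra.
  move/eqP; rewrite mulf_eq0 subr_eq0 => /orP[/eqP //|/eqP]; nra.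
move=> _ _; have : Im l ^+ 2 = Im l' ^+ 2.
  by move: l1 l'1; rewrite /nm ReE; lra.
move/eqP; rewrite eqf_sqr => /orP[/eqP e|/eqP e]; first exact: complexP.
have lJ : l = l'^* by apply: complexP; rewrite ?cReJ ?cImJ.
have := Im_omega_gt0 R; have : Im w = Im (w^*) by rewrite -{1}l3 lJ -cjX l'3.
rewrite cImJ; move: (Im w) => x xN x0; suff : False by []; clear -xN x0; lra.
Qed.

(** In the standard basis this is [nonic_vec] at [E0] for the matrix $M$ of the third point:
    $ME_0=\omega E_0+E_1+E_2$ and $M^2E_0=\omega E_2$. *)
Definition nonary_vec (c0 c1 c2 : V) :=
  c0 + nonary^* *: (w *: c0 + c1 + c2) + ((nonary^*) ^+ 2 * w) *: c2.

Lemma nonary_vec_alg y (p r : V) a b c : b * c = 1 ->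
  y + a *: (b *: y + (p - b *: y - c *: r) + c *: r) + (a ^+ 2 * b) *: (c *: r) =
  y + a *: p + a ^+ 2 *: r.
Proof.
move=> h; rewrite scalerA -mulrA h mulr1; apply: cv_eq; rewrite !ccE; ring.
Qed.

(** A unit multiple of [A] makes $\langle Ay,y\rangle=1$, and the Gram matrix of $y,Ay,A^2y$ is then
    completely known. The eigenvalue is known too: [nonic_comp] gives it a negative real part. *)
Lemma nonic_case A v l : nonic A v l -> exists c0 c1 c2, exists2 d, d != 0 &
  hframe c0 c1 c2 /\ v = d *: nonary_vec c0 c1 c2.
Proof.
move=> nA; have [y [b [Iy yy yb Ib b3]]] := nonic_isotropic nA.
have nb : nm b = 1.
  by apply/eqP; rewrite -(@pexpr_eq1 _ _ 3) ?nm_ge0 // -nmX b3 nm1.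
have bb := nm_eq1 nb.
pose A1 := b^* *: A; pose l1 := b^* * l.
have n1 : nonic A1 v l1.
  have [hA IA nv ev [sA l3 h3]] := nA; split=> //.
  - by apply: preservingZ; rewrite // nmJ.
  - by apply: ImxZ => //; apply: EisJ.
  - by rewrite -scalemxAl ev scalerA.
  have bj3 : b^* ^+ 3 = 1 by rewrite -cjX b3 cj1.
  split.
  - by apply: simple_atZ => //; rewrite conjC_eq0 -nm_gt0 nb ltr01.
  - by rewrite exprMn bj3 mul1r.
  by move=> z; rewrite /A1 -!scalemxAl -!scalemxAr h3 !scalerA -[RHS]scale1r -bj3 scalerA; congr (_ *: _); ring.
have h1 : herm (A1 *m y) y = 1 by rewrite -scalemxAl hermZl yb mulrC.
have [hA IA nv ev [sA l3 h3]] := n1; have lu := eigen_unit hA ev (ltr0_neq0 nv).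
have h1' : herm y (A1 *m y) = 1 by rewrite -herm_cj h1 cj1.
have h2 : herm (A1 *m (A1 *m y)) y = w by rewrite (nonic_herm2 _ n1) h1' mulr1.
have h2' : herm y (A1 *m (A1 *m y)) = w^* by rewrite -herm_cj h2.
clearbody A1 l1.
have ReE : 2 * Re l1 = 3 * (nm (herm y v) / hr v).
  apply: rc_inj; have := nonic_comp y n1; rewrite yy h1 h1' => e.
  have -> : rc (3 * (nm (herm y v) / hr v)) = 3 * rc (nm (herm y v) / hr v).
    by rewrite rcM rcn.
  by rewrite -e -addJ; ring.
have Rel : 2 * Re l1 <= 0.
  by rewrite ReE pmulr_rle0 ?ltr0n // mulr_ge0_le0 ?nm_ge0 // invr_le0 ltW.
have Re0 : Re l1 != 0.
  apply/eqP => r0; have := cube_re lu; rewrite r0 l3 Re_omega mulr0 rc0 expr0n /= mulr0 subr0.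
  by move=> e0; have := rc_inj (e0 : rc 0 = rc _); lra.
have lE : l1 = nonary.
  apply: nonary_unique; [exact: l3|exact: lu| |exact: nonary3|exact: nm_nonary|exact: Re_nonary].
  by rewrite lt_neqAle Re0 /=; lra.
have yv : herm y v != 0.
  by apply/eqP => e; move: ReE; rewrite e nm0 mul0r mulr0 => h; case/negP: Re0; apply/eqP; lra.
have v0 := hr_neq0 nv.
have ww : w * w^* = 1 by apply: nm_eq1; exact: nm_omega.
(* The model relations $ME_0=\omega E_0+E_1+E_2$ and $M^2E_0=\omega E_2$ are solved for the frame,
   with [y] in the place of $E_0$. *)
exists y, (A1 *m y - w *: y - w^* *: (A1 *m (A1 *m y))), (w^* *: (A1 *m (A1 *m y))).
exists (3 * herm y v / herm v v)^-1.
  by rewrite invr_eq0 !mulf_neq0 ?invr_eq0 // (_ : 3 = 3%:R) // pnatr_eq0.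
have IA1 : Ivec (A1 *m y) by apply: Ivec_mul.
have IA2 : Ivec (A1 *m (A1 *m y)) by apply: Ivec_mul.
split.
  split.
  - split=> //; last by apply: IvecZ => //; apply: EisJ; exact: Eisw.
    by apply: IvecB; [apply: IvecB => //; apply: IvecZ => //; exact: Eisw|
      apply: IvecZ => //; apply: EisJ; exact: Eisw].
  - split=> //.
    + rewrite !hE !hA yy h1 h1' h2 h2' cjK; rewrite conj_omega; ring: (omega2 R).
    + by rewrite !hE !hA yy !mulr0.
  split.
  - by rewrite !hE yy h1' h2' cjK ww; ring.
  - by rewrite !hE !hA yy h1' h2' cjK; transitivity (w * (1 - w * w^*)); [ring|rewrite ww; ring].
  - by rewrite !hE h2' cjK.
have -> : nonary_vec y (A1 *m y - w *: y - w^* *: (A1 *m (A1 *m y))) (w^* *: (A1 *m (A1 *m y))) = nonic_vec A1 l1 y.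
  rewrite /nonary_vec /nonic_vec -lE.
  exact: nonary_vec_alg.
rewrite (nonic_vecP _ n1) scalerA mulVf ?scale1r //.
by rewrite !mulf_neq0 ?invr_eq0 // (_ : 3 = 3%:R) // pnatr_eq0.
Qed.

End NonicCase.

(** * Reduction of every simple eigenline to one of four standard forms *)

Section EllipticCases.
Variable R : realType.
Local Notation w := (omega : R[i]).
Local Notation ii := (iunit R).
Local Notation C := R[i].
Local Notation V := 'cV[C]_3.
Implicit Types (u v z g p y : V) (A B : 'M[C]_3) (a b l : C).

Definition quartic_vec (c0 c1 c2 : V) : V :=
  (1 - ii * (1 - w)) *: c0 + (w^* + ii) *: c1 - (ii * w^*) *: c2.

Definition standard_vec v := exists c0 c1 c2, hframe c0 c1 c2 /\ exists2 d, d != 0 &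
  [\/ v = d *: (c0 - c2), v = d *: (c0 + w^* *: c2),
      v = d *: nonary_vec c0 c1 c2 | v = d *: quartic_vec c0 c1 c2].

Lemma nm1_neq0 (c : C) : nm c = 1 -> c != 0.
Proof. by move=> c1; rewrite -nm_gt0 c1 ltr01. Qed.

Lemma standard_rat A v l : preserving A -> Imx A -> hr v < 0 -> A *m v = l *: v ->
  simple_at A v l -> Krat l -> standard_vec v.
Proof.
move=> hA IA nv ev sA Kl.
have [u [a [u' [b fr]]]] := eigenframe hA ev nv.
have [al bl] := eframe_simple fr sA.
have l1 := eigen_unit hA ev (ltr0_neq0 nv).
have [c [c0 pv El]] := rational_primitive hA IA fr al bl Kl.
have lj1 : nm l^* = 1 by rewrite nmJ.
have ll : l^* * l = 1 by rewrite mulrC; apply: nm_eq1.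
have [] := @rational_case R (l^* *: A) (c *: v) => //.
- exact: preservingZ.
- by apply: ImxZ => //; apply: EisJ.
- by rewrite hrZ pmulr_rlt0 // nm_gt0.
- by rewrite -scalemxAl -scalemxAr ev !scalerA; congr (_ *: _); transitivity (c * (l^* * l)); [ring|rewrite ll mulr1].
- move=> x xv ex; apply: sA.
    by move: xv; rewrite hermZr => /eqP; rewrite mulf_eq0 conjC_eq0 (negPf c0) => /eqP.
  apply: (scalerI (nm1_neq0 lj1)); rewrite scalerA ll -ex; exact: scalemxAl.
move=> f0 [f1 [f2 [hf e]]]; exists f0, f1, f2; split=> //; exists c^-1; first by rewrite invr_eq0.
by case: e => e; [constructor 1|constructor 2]; rewrite -e scalerA mulVf ?scale1r.
Qed.

Lemma standard_quartic A v l u a u' b c : preserving A -> Imx A ->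
  eframe A v l u a u' b -> Eis c -> nm c = 1 -> l ^+ 2 = - c ^+ 2 -> a = - l -> Eis b ->
  standard_vec v.
Proof.
move=> hA IA fr Ec c1 l2 al Eb.
have [s [Es s1 sl]] : exists s, [/\ Eis s, nm s = 1 & s * l = ii].
  have /sqr_eq [->|->] : l ^+ 2 = (ii * c) ^+ 2 by rewrite exprMn ii2 l2 mulN1r.
    by exists c^*; split; [exact: EisJ|rewrite nmJ|rewrite mulrCA [_^* * _]mulrC nm_eq1 // mulr1].
  exists (- c^*); split; [by apply: EisN; exact: EisJ|by rewrite nmN nmJ|].
  by rewrite mulrNN mulrCA [_^* * _]mulrC nm_eq1 // mulr1.
have fr' := eframeZ s1 fr; rewrite al mulrN sl in fr'.
have [|||f0 [f1 [f2 [d d0 [hf e]]]]] := quartic_case _ _ _ fr'.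
- exact: preservingZ.
- exact: ImxZ.
- exact: EisM.
by exists f0, f1, f2; split=> //; exists d => //; constructor 4.
Qed.

Lemma eframe_cube A v l u a u' b e z : eframe A v l u a u' b ->
  l ^+ 3 = e -> a ^+ 3 = e -> b ^+ 3 = e -> A *m (A *m (A *m z)) = e *: z.
Proof.
move=> [fr [ev eu eu'] _] le ae be; rewrite (oframe_exp z fr).
rewrite !(mulmxDr, =^~ scalemxAr) ev eu eu' !(=^~ scalemxAr, scalerA) ev eu eu'.
rewrite !(=^~ scalemxAr, scalerA) ev eu eu' !scalerDr !scalerA.
rewrite -{1}le -{1}ae -be.
by congr (_ *: _ + _ *: _ + _ *: _); ring.
Qed.

(** Squaring passes from cube $\omega^2$ to cube $\omega$: $(\omega l^2)^3=l^6=\omega^4=\omega$. The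
    eigenvalue stays simple because $A^2u=l^2u$ and $A^3=l^3$ give $Au=lu$. *)
Lemma nonic_inv A v l : preserving A -> Imx A -> hr v < 0 -> A *m v = l *: v ->
  simple_at A v l -> l ^+ 3 = w ^+ 2 -> (forall z, A *m (A *m (A *m z)) = w ^+ 2 *: z) ->
  nonic (w *: (A *m A)) v (w * l ^+ 2).
Proof.
move=> hA IA nv ev sA l3 h3; have l1 := eigen_unit hA ev (ltr0_neq0 nv).
have l0 := nm1_neq0 l1; have w3 := omega3 R.
split=> //.
- by apply: preservingZ (nm_omega R) _; apply: preservingM.
- by apply: ImxZ; [exact: Eisw|exact: ImxM].
- by rewrite -scalemxAl -mulmxA ev -scalemxAr ev !scalerA expr2 mulrA.
split.
- move=> u uv; rewrite -scalemxAl -scalerA => /(scalerI (omega_neq0 R)); rewrite -mulmxA => e.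
  apply: sA => //; have := h3 u; rewrite e -scalemxAr -l3 (exprSr l 2) -scalerA.
  by apply: scalerI; rewrite expf_neq0.
- rewrite exprMn w3 mul1r -exprM (exprM l 3 2) l3 -exprM.
  by rewrite (_ : (2 * 2 = 3 + 1)%N) // exprD w3 mul1r.
move=> z; have SE (y : V) : (w *: (A *m A)) *m y = w *: (A *m (A *m y)) by rewrite -scalemxAl -mulmxA.
have AZ (c : C) (y : V) : A *m (c *: y) = c *: (A *m y) by rewrite -scalemxAr.
rewrite !SE !AZ !h3 !scalerA.
by congr (_ *: _); transitivity (w ^+ 3 * w ^+ 3 * w); [ring|rewrite w3 !mul1r].
Qed.

Lemma standard_nonic A v l : nonic A v l -> standard_vec v.
Proof.
move=> /nonic_case[c0 [c1 [c2 [d d0 [hf e]]]]].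
by exists c0, c1, c2; split=> //; exists d => //; constructor 3.
Qed.

Lemma cube_root1 (l : C) : l ^+ 3 = 1 -> Eis l.
Proof.
move=> l3; have : (l - 1) * ((l - w) * (l - w ^+ 2)) = 0.
  transitivity (l ^+ 3 - 1); last by rewrite l3 subrr.
  by ring: (omega2 R).
move/eqP; rewrite !mulf_eq0 !subr_eq0 => /orP[/eqP->|/orP[/eqP->|/eqP->]]; eis.
Qed.

(** Up to sign the unit [e] is a power of $\omega$. Exponent 0 makes [l] rational over $K$, exponent
    1 is the case of order nine, and exponent 2 reduces to it by squaring. *)
Lemma standard_cube A v l (e : C) : preserving A -> Imx A -> hr v < 0 -> A *m v = l *: v ->
  simple_at A v l -> Eis e -> nm e = 1 -> l ^+ 3 = e -> (forall z, A *m (A *m (A *m z)) = e *: z) ->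
  standard_vec v.
Proof.
move=> hA IA nv ev sA Ee e1 l3 h3.
have pos (B : 'M[C]_3) (m : C) : preserving B -> Imx B -> B *m v = m *: v -> simple_at B v m ->
  forall j, (j < 3)%N -> m ^+ 3 = w ^+ j -> (forall z, B *m (B *m (B *m z)) = w ^+ j *: z) ->
  standard_vec v.
  move=> hB IB eB sB [|[|[|//]]] _ m3 h3'.
  - by apply: standard_rat sB _ => //; apply: Krat_Eis; apply: cube_root1.
  - by apply: (@standard_nonic B v m); split.
  - exact: standard_nonic (nonic_inv hB IB nv eB sB m3 h3').
have hN : preserving (-1 *: A) by apply: preservingZ => //; rewrite nmN nm1.
have IN : Imx (-1 *: A) by apply: ImxZ => //; eis.
have eN : (-1 *: A) *m v = (-1 * l) *: v by rewrite -scalemxAl ev scalerA.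
have sN : simple_at (-1 *: A) v (-1 * l) by apply: simple_atZ; rewrite // oppr_eq0 oner_eq0.
have lN : (-1 * l) ^+ 3 = - e by rewrite exprMn l3; ring.
have h3N z : (-1 *: A) *m ((-1 *: A) *m ((-1 *: A) *m z)) = (- e) *: z.
  by rewrite -!scalemxAl -!scalemxAr h3 !scalerA; congr (_ *: _); ring.
have even j : (j < 3)%N -> e = w ^+ j -> standard_vec v.
  by move=> hj je; apply: (pos A l) hj _ _ => //; rewrite -je.
have odd j : (j < 3)%N -> e = - w ^+ j -> standard_vec v.
  by move=> hj je; apply: (pos _ _ hN IN eN sN j hj) => [|z]; rewrite ?lN ?h3N je opprK.
have [k hk eE] := Eis_unit Ee e1.
have w2 := omega2 R; have s1 := w1_sqr R; have s3 := w1_cube R.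
case: k hk eE => [|[|[|[|[|[|//]]]]]] _ eE.
- exact: (even 0%N).
- by apply: (odd 2%N) => //; rewrite eE w2; ring.
- by apply: (even 1%N) => //; rewrite eE s1.
- by apply: (odd 0%N) => //; rewrite eE s3.
- by apply: (even 2%N) => //; rewrite eE (exprM _ 2 2) s1.
- by apply: (odd 1%N) => //; rewrite eE (exprD _ 2 3) s1 s3 mulrN1.
Qed.

Lemma elliptic_standard A v l : preserving A -> Imx A -> hr v < 0 -> A *m v = l *: v ->
  simple_at A v l -> standard_vec v.
Proof.
move=> hA IA nv ev sA.
have [u [a [u' [b fr]]]] := eigenframe hA ev nv.
have [al bl] := eframe_simple fr sA.
have [_ _ [l1 a1 b1]] := fr.
have Et : Eis (l + a + b) by rewrite -(eframe_tr fr); exact: Eis_mxtr.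
have Ed : Eis (l * a * b) by rewrite -(eframe_det fr); exact: Eis_mxdet.
have la : l != a by rewrite eq_sym.
case: (trace_cases l1 a1 b1 la bl Et Ed) => [Kl|c Ec c1 l2 [[ae Eb]|[be Ea]]|_ [l3 [a3 b3]]].
- exact: standard_rat sA Kl.
- exact: standard_quartic fr Ec c1 l2 ae Eb.
- have fr' : eframe A v l u' b u a.
    by case: fr => fr [_ eu eu'] _; split; [exact: oframe_sym|split|split].
  exact: standard_quartic fr' Ec c1 l2 be Ea.
apply: (standard_cube hA IA nv ev sA Ed _ l3); first by rewrite !nmM l1 a1 b1 !mulr1.
by move=> z; exact: eframe_cube fr l3 a3 b3.
Qed.

End EllipticCases.

(** * Classes in PU(J) and the action on lines *)

Section Classes.
Local Open Scope quotient_scope.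
Local Open Scope sesquilinear_scope.
Variable R : realType.
Local Notation C := R[i].
Local Notation V := 'cV[C]_3.
Local Notation J := (@J R).
Implicit Types (u v z p y : V) (A B : 'M[C]_3) (a b l k : C) (g h : PU R).

Lemma JJ : J *m J = 1%:M.
Proof.
apply/matrixP; elim/ord3P; elim/ord3P; rewrite !mxE sum3 !mxE /=;
  by rewrite ?mulr0 ?mul0r ?mulr1 ?add0r ?addr0.
Qed.

Lemma form_entry A i j : (A ^t* *m J *m A) i j = herm (col j A) (col i A).
Proof.
rewrite /herm (_ : (col i A) ^t* = row i (A ^t*)); last by apply/rowP=> k; rewrite !mxE.
by rewrite -row_mul [in LHS]mxE [in RHS]mxE; apply: eq_bigr => k _; rewrite !mxE.
Qed.

Lemma preserving_preserves A : preserving A -> preserves_J A.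
Proof.
move=> hA; have e : A ^t* *m J *m A = J.
  transitivity ((1%:M : 'M[C]_3) ^t* *m J *m 1%:M).
    apply/matrixP=> i j; rewrite !form_entry !colE hA.
    by rewrite !mul1mx.
  by rewrite trmx1 map_mx1 mul1mx mulmx1.
rewrite /preserves_J e eqxx andbT.
have /mulmx1_unit[] // : (J *m A ^t* *m J) *m A = 1%:M.
by rewrite -!mulmxA (mulmxA (A ^t*)) e JJ.
Qed.

(** The inverse is the adjoint for the form; its entries are conjugates of entries of [A], so the
    inverse of an integral unitary matrix is integral. *)
Lemma preserving_inv A : preserving A -> invmx A = J *m A ^t* *m J.
Proof.
move=> hA; have /andP[uA /eqP e] := preserving_preserves hA.
have h : (J *m A ^t* *m J) *m A = 1%:M by rewrite -!mulmxA (mulmxA (A ^t*)) e JJ.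
rewrite -[LHS]mul1mx -h; apply: etrans (esym (mulmxA _ _ _)) _.
by apply: etrans (congr1 (mulmx _) (mulmxV uA)) _; exact: mulmx1.
Qed.

Lemma preserving_invmx A : preserving A -> preserving (invmx A).
Proof. by move=> hA; apply: preserves_preserving; apply: preserves_JV; exact: preserving_preserves. Qed.

Lemma ImxJ : Imx J.
Proof. by elim/ord3P; elim/ord3P; rewrite mxE /=; eis. Qed.

Lemma Imx_inv A : preserving A -> Imx A -> Imx (invmx A).
Proof.
move=> hA IA; rewrite (preserving_inv hA); apply: ImxM ImxJ; apply: ImxM ImxJ _.
by move=> i j; rewrite !mxE; apply: EisJ.
Qed.

(** Total on matrices: one that does not preserve the form is sent to the identity, so this is the
    intended class only for a [preserving] matrix. *)
Definition ucl A : UJ R := insubd (UJ_one R) A.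
Definition cl A : PU R := \pi_(PU R) (ucl A).

Lemma ucl_val A : preserving A -> UJ_val (ucl A) = A.
Proof. by move=> hA; rewrite /ucl val_insubd preserving_preserves. Qed.

Lemma ucl_UJ (U : UJ R) : ucl (UJ_val U) = U.
Proof. by apply: val_inj; rewrite val_insubd UJ_valP. Qed.

Lemma is_class_cl A : preserving A -> is_class_of A (cl A).
Proof. by move=> hA; exists (ucl A); rewrite ?ucl_val. Qed.

Lemma clM A B : preserving A -> preserving B -> cl (A *m B) = (cl A * cl B)%g.
Proof.
move=> hA hB; rewrite /cl -[RHS]/(PU_mul _ _) -pi_PU_mul; congr (\pi_(PU R) _).
by apply: val_inj; rewrite /= !ucl_val //; exact: preservingM.
Qed.

Lemma preserving1 : preserving (1%:M : 'M[C]_3).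
Proof. by move=> u v; rewrite !mul1mx. Qed.

Lemma cl1 : cl 1%:M = 1%g.
Proof. by rewrite /cl -[RHS]/(\pi_(PU R) (UJ_one R)) -(ucl_UJ (UJ_one R)). Qed.

Lemma clV A : preserving A -> cl (invmx A) = (cl A)^-1%g.
Proof.
move=> hA; apply: (mulgI (cl A)); rewrite mulgV -clM //; last exact: preserving_invmx.
by rewrite mulmxV ?cl1 //; have /andP[] := preserving_preserves hA.
Qed.

Lemma cl_eq A B : preserving A -> preserving B ->
  cl A = cl B <-> exists2 c, c != 0 & A = c *: B.
Proof.
move=> hA hB; split.
  by move/eqP/proportionalP; rewrite !ucl_val.
by move=> h; apply/eqP/proportionalP; rewrite !ucl_val.
Qed.

Lemma clZ c A : nm c = 1 -> preserving A -> cl (c *: A) = cl A.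
Proof.
by move=> c1 hA; apply/cl_eq => //; [exact: preservingZ|exists c; rewrite // -nm_gt0 c1 ltr01].
Qed.

Lemma cl_act A v : preserving A -> PU_act (cl A) <[v]>%VS = <[A *m v]>%VS.
Proof. by move=> hA; rewrite PU_act_line ucl_val. Qed.

Lemma cl_surj g : exists2 A, preserving A & g = cl A.
Proof.
elim/quotW: g => U; exists (UJ_val U); first by apply: preserves_preserving; exact: UJ_valP.
by rewrite /cl ucl_UJ.
Qed.

Lemma GammaP g : Gamma 3 g <-> exists A, [/\ preserving A, Imx A & g = cl A].
Proof.
rewrite /Gamma ring_of_integersE; split.
  move=> [U [_ IU _] <-]; exists (UJ_val U); split=> //; last by rewrite /cl ucl_UJ.
  by apply: preserves_preserving; exact: UJ_valP.
move=> [A [hA IA ->]]; exists (ucl A) => //=; rewrite ucl_val //; split=> //.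
  by have /andP[] := preserving_preserves hA.
exact: Imx_inv.
Qed.

Lemma line_eqP u v : v != 0 -> <[u]>%VS = <[v]>%VS <-> exists2 c, c != 0 & u = c *: v.
Proof.
move=> v0; split=> [e|[c c0 ->]].
  have /vlineP[c uE] : u \in <[v]>%VS by rewrite -e memv_line.
  exists c => //; apply/eqP => c0.
  have : v \in <[u]>%VS by rewrite e memv_line.
  by rewrite uE c0 scale0r => /vlineP[k]; rewrite scaler0 => /eqP; rewrite (negPf v0).
apply/vspaceP=> z; apply/vlineP/vlineP=> -[k ->]; first by exists (k * c); rewrite scalerA.
by exists (k / c); rewrite scalerA divfK.
Qed.

Lemma hr_v0 v : hr v < 0 -> v != 0.
Proof. by move=> h; apply: contraTneq h => ->; rewrite /hr herm0l ltxx. Qed.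

Lemma H2P v : H2 <[v]>%VS <-> hr v < 0.
Proof.
split=> [[u]|h]; last by exists v => //=; rewrite herm_lt0.
rewrite /= herm_lt0 => h e; have u0 := hr_v0 h.
have /esym/(line_eqP _ u0)[c c0 ->] := e.
by rewrite hrZ pmulr_rlt0 // nm_gt0.
Qed.

Lemma H2_line (x : cline R) : H2 x -> exists2 v, hr v < 0 & x = <[v]>%VS.
Proof. by case=> v /=; rewrite herm_lt0 => h <-; exists v. Qed.

Lemma fixes_lineP A v : preserving A -> hr v < 0 ->
  PU_act (cl A) <[v]>%VS = <[v]>%VS <-> exists2 l, l != 0 & A *m v = l *: v.
Proof. by move=> hA h; rewrite cl_act // line_eqP //; exact: hr_v0. Qed.

Lemma isotropyP v g : hr v < 0 -> isotropy 3 <[v]>%VS g <->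
  exists A, [/\ preserving A, Imx A, exists l, A *m v = l *: v & g = cl A].
Proof.
move=> nv; split.
  move=> [/GammaP[A [hA IA ->]] /(fixes_lineP hA nv)[l _ e]].
  by exists A; split=> //; exists l.
move=> [A [hA IA [l e] ->]]; split; first by apply/GammaP; exists A.
apply/fixes_lineP => //; exists l => //.
by have := eigen_unit hA e (ltr0_neq0 nv); rewrite -nm_gt0 => ->; exact: ltr01.
Qed.

Lemma PU_actM g h (x : cline R) : H2 x -> PU_act (g * h)%g x = PU_act g (PU_act h x).
Proof.
case: (cl_surj g) => A hA ->; case: (cl_surj h) => B hB -> /H2_line[v nv ->].
by rewrite -clM // !cl_act ?mulmxA //; exact: preservingM.
Qed.

Lemma PU_act1 (x : cline R) : H2 x -> PU_act 1%g x = x.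
Proof. by move=> /H2_line[v nv ->]; rewrite -cl1 cl_act ?mul1mx //; exact: preserving1. Qed.

Lemma PU_act_H2 g (x : cline R) : H2 x -> H2 (PU_act g x).
Proof.
case: (cl_surj g) => A hA -> /H2_line[v nv ->]; rewrite cl_act //.
by apply/H2P; rewrite preserving_hr.
Qed.

Lemma Gamma1 : Gamma 3 (1%g : PU R).
Proof.
apply/GammaP; exists 1%:M; split; [exact: preserving1| |by rewrite cl1].
by move=> i j; rewrite mxE; case: (i == j); eis.
Qed.

Lemma GammaM g h : Gamma 3 g -> Gamma 3 h -> Gamma 3 (g * h)%g.
Proof.
move=> /GammaP[A [hA IA ->]] /GammaP[B [hB IB ->]]; apply/GammaP; exists (A *m B).
by rewrite clM //; split=> //; [exact: preservingM|exact: ImxM].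
Qed.

Lemma GammaV g : Gamma 3 g -> Gamma 3 (g^-1)%g.
Proof.
move=> /GammaP[A [hA IA ->]]; apply/GammaP; exists (invmx A).
by rewrite clV //; split=> //; [exact: preserving_invmx|exact: Imx_inv].
Qed.

Definition frame_mx (c0 c1 c2 : V) : 'M[C]_3 :=
  \matrix_(i, j) nth 0 [:: c0 i 0; c1 i 0; c2 i 0] j.

Lemma frame_mxE c0 c1 c2 z : frame_mx c0 c1 c2 *m z =
  z i0 0 *: c0 + z i1 0 *: c1 + z i2 0 *: c2.
Proof. by apply/colP => i; rewrite mulmx3 !mxE /= !(mulrC (_ i 0)). Qed.

Lemma frame_preserving c0 c1 c2 : hframe c0 c1 c2 -> preserving (frame_mx c0 c1 c2).
Proof.
move=> [_ [h00 h11 h22] [h01 h12 h02]] u v; rewrite !frame_mxE !hE (hermE u v).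
have h10 := herm_sym0 h01; have h21 := herm_sym0 h12.
have h20 : herm c2 c0 = 1 by rewrite -herm_cj h02 cj1.
by rewrite h00 h11 h22 h01 h12 h02 h10 h21 h20; ring.
Qed.

Lemma frame_Imx c0 c1 c2 : hframe c0 c1 c2 -> Imx (frame_mx c0 c1 c2).
Proof. by move=> [[I0 I1 I2] _ _] i; elim/ord3P; rewrite mxE /=. Qed.

Lemma frame_orbit c0 c1 c2 v z : hframe c0 c1 c2 -> hr v < 0 -> v = frame_mx c0 c1 c2 *m z ->
  Gamma_orbit 3 <[z]>%VS <[v]>%VS.
Proof.
move=> hf nv e; exists (cl (frame_mx c0 c1 c2)).
  by apply/GammaP; exists (frame_mx c0 c1 c2); split=> //; [exact: frame_preserving|exact: frame_Imx].
by rewrite cl_act ?e //; exact: frame_preserving.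
Qed.

End Classes.

(** * Isolated fixed points *)

Section Isolated.
Import numFieldNormedType.Exports.
Variable R : realType.
Local Notation C := R[i].
Local Notation V := 'cV[C]_3.
Local Notation Re := (@complex.Re R).
Local Notation rc := (real_complex R).
Implicit Types (u v z : V) (A B : 'M[C]_3) (l : C).

Lemma near_coordinates v (P : V -> Prop) :
  (\forall z \near (v : 'cV[(C : numFieldType)]_3), P z) ->
  exists2 r : R, 0 < r & forall z : V, (forall i, nm (z i 0 - v i 0) < r ^+ 2) -> P z.
Proof.
move=> /(@nbhs_ballP _ _)[e /= e0 h].
have er : e = rc (Re e) by apply: real_rc; exact: conj_Creal (gtr0_real e0).
exists (Re e); first by move: e0; rewrite {1}er ltcR.
move=> z hz; apply: h; split=> // i j; rewrite (ord1 j) -ball_normE /= distrC.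
rewrite -(ltr_pXn2r (n := 2)) ?nnegrE ?normr_ge0 ?ltW // normCK nmE er -rcX ltcR.
exact: hz.
Qed.

(** If no matrix were simple at [v], [common_perp_eigenvector] would give a direction [u] on which
    the whole isotropy group has the eigenvalue of [v]. The points $v+su$ with small $s$ would then
    all be fixed. *)
Lemma isolated_simple v : hr v < 0 ->
  isolated_fixed_point (isotropy 3 <[v]>%VS) <[v]>%VS ->
  exists A l, [/\ preserving A, Imx A, A *m v = l *: v & simple_at A v l].
Proof.
move=> nv [_ [v' e]]; have /H2P nv' : H2 <[v']>%VS by rewrite -e; apply/H2P.
move=> /near_coordinates[r r0 hnear]; rewrite e in hnear.
have [k k0 vk] : exists2 k, k != 0 & v = k *: v' by apply/line_eqP => //; exact: hr_v0.
suff [A [l [hA IA ev sA]]] : exists A l, [/\ preserving A, Imx A, A *m v' = l *: v' & simple_at A v' l].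
  exists A, l; split=> //; first by rewrite vk -scalemxAr ev !scalerA mulrC.
  by move=> u; rewrite vk hermZr => /eqP; rewrite mulf_eq0 conjC_eq0 (negPf k0) => /eqP; apply: sA.
clear v nv e k k0 vk; move: v' nv' hnear => v nv hnear.
apply: contrapT => hno.
have [] := @common_perp_eigenvector R v
  [set A | [/\ preserving A, Imx A & exists l, A *m v = l *: v]] nv.
- by move=> A [].
- move=> A B [hA IA [l eA]] [hB IB [m eB]]; split; [exact: preservingM|exact: ImxM|].
  by exists (m * l); rewrite -mulmxA eB -scalemxAr eA scalerA.
- by move=> A [_ _ h].
- move=> A l [hA IA _] ev; apply: contrapT => hz; apply: hno; exists A, l; split=> // u uv eu.
  by apply: contrapT => /eqP u0; apply: hz; exists u.
move=> u uv [u0 eu]; have pu := perp_pos nv uv u0.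
pose K := 1 + nm (u i0 0) + nm (u i1 0) + nm (u i2 0) + hr u.
have n0 := nm_ge0 (u i0 0); have n1 := nm_ge0 (u i1 0); have n2 := nm_ge0 (u i2 0).
(* [K] dominates $\langle u,u\rangle$ and all $|u_i|^2$, so one small $s$ keeps $v+su$ both in the
   neighbourhood and negative. *)
have [s [s0 sr sv]] : exists s : R, [/\ 0 < s, s ^+ 2 * K < r ^+ 2 & s ^+ 2 * K < - hr v].
  pose m := Num.min (r ^+ 2) (- hr v).
  have m0 : 0 < m by rewrite lt_min exprn_gt0 // oppr_gt0.
  have K0 : 0 < K by rewrite /K; lra.
  have D0 : 0 < K + m by rewrite addr_gt0.
  exists (m / (K + m)); have : (m / (K + m)) ^+ 2 * K < m.
    rewrite expr_div_n mulrAC ltr_pdivrMr ?exprn_gt0 // expr2 -!mulrA ltr_pM2l //.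
    by rewrite expr2; nra.
  by rewrite /m lt_min divr_gt0 // => /andP[].
have s2 : 0 < s ^+ 2 by rewrite exprn_gt0.
have coord x : 0 <= x -> x <= K -> s ^+ 2 * x < r ^+ 2.
  by move=> x0 xK; apply: le_lt_trans sr; rewrite ler_pM2l.
have hz : hr (v + rc s *: u) < 0.
  have -> : hr (v + rc s *: u) = hr v + s ^+ 2 * hr u.
    apply: rc_inj; rewrite -hrE !hE uv (herm_sym0 uv) conjC_rc !hrE rcD rcM rcX; ring.
  have : s ^+ 2 * hr u <= s ^+ 2 * K by rewrite ler_pM2l // /K; lra.
  lra.
have : <[v + rc s *: u]>%VS = <[v]>%VS.
  apply: hnear.
    move=> i; have -> : (v + rc s *: u) i 0 - v i 0 = rc s * u i 0.
      by rewrite !mxE addrAC subrr add0r.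
    rewrite nmM nm_rc; apply: coord; first exact: nm_ge0.
    by move: i; elim/ord3P; rewrite /K; lra.
  split; first exact/H2P.
  move=> g /(isotropyP _ nv)[A [hA IA [l ev] ->]]; apply/fixes_lineP => //.
  exists l; first by rewrite -nm_gt0 (eigen_unit hA ev (ltr0_neq0 nv)) ltr01.
  rewrite mulmxDr -scalemxAr ev (eu A l) //; last by split=> //; exists l.
  by rewrite scalerDr !scalerA mulrC.
move=> /(line_eqP _ (hr_v0 nv))[c c0 e].
have : herm (v + rc s *: u) u = herm (c *: v) u by rewrite e.
rewrite !hE (herm_sym0 uv) add0r mulr0 => /eqP; rewrite mulf_eq0 (negPf (hr0_neq (lt0r_neq0 pu))) orbF.
by rewrite -[0]rc0 => /eqP/(@rc_inj R) s00; rewrite s00 ltxx in s0.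
Qed.

End Isolated.

(** * Generated subgroups, finite cyclic groups and cardinals *)

Section GroupTools.
Variable gT : groupType.
Local Open Scope group_scope.
Implicit Types (S H : set gT) (a b g : gT).

Lemma card_range (T : finType) (U : Type) (f : T -> U) (X : set U) :
  injective f -> X = range f -> X #= `I_#|T|.
Proof.
move=> fi ->; apply: card_eq_trans (inj_card_eq _) _; first by move=> x y _ _ /fi.
rewrite card_eq_sym; apply: card_eq_trans (card_II) _.
have -> : [set: T] = (@enum_val T T) @` [set: 'I_#|T|].
  apply/seteqP; split=> // x _; exists (enum_rank x) => //; exact: enum_rankK.
rewrite card_eq_sym; apply: inj_card_eq => x y _ _; exact: enum_val_inj.
Qed.

Lemma is_subgroupX H a n : is_subgroup H -> H a -> H (a ^+ n).
Proof.
move=> [H1 HM _] Ha; elim: n => [|n IH]; first by rewrite expg0.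
by rewrite expgS; apply: HM.
Qed.

Lemma generated_subgroup S : is_subgroup (generated S).
Proof.
split.
- by move=> H [[]].
- by move=> a b ha hb H hH; have [[_ HM _] _] := hH; apply: HM; [exact: ha|exact: hb].
- by move=> a ha H hH; have [[_ _ HV] _] := hH; apply: HV; exact: ha.
Qed.

Lemma sub_generated S : S `<=` generated S.
Proof. exact: sub_gen_smallest. Qed.

Lemma generated_sub S H : is_subgroup H -> S `<=` H -> generated S `<=` H.
Proof. exact: smallest_sub. Qed.

Lemma expgV_cyclic a n : (0 < n)%N -> a ^+ n = 1 -> forall i, exists2 j, (j < n)%N & a ^+ i = a ^+ j.
Proof.
move=> n0 an i; exists (i %% n)%N; first by rewrite ltn_mod.
by rewrite {1}(divn_eq i n) expgnDr mulnC expgnA an expg1n mul1g.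
Qed.

Lemma generated_cycle a n : (0 < n)%N -> a ^+ n = 1 ->
  generated [set a] = range (fun i : 'I_n => a ^+ i).
Proof.
move=> n0 an; have hin i : range (fun i : 'I_n => a ^+ i) (a ^+ i).
  by have [j jn ->] := expgV_cyclic n0 an i; exists (Ordinal jn).
apply/seteqP; split; last first.
  move=> _ [i _ <-]; exact: is_subgroupX (generated_subgroup _) (@sub_generated [set a] a erefl).
apply: generated_sub => [|_ ->]; last exact: (hin 1%N).
split; first exact: (hin 0%N).
- by move=> _ _ [i _ <-] [j _ <-]; rewrite -expgnDr; apply: hin.
move=> _ [i _ <-]; have -> : (a ^+ i)^-1 = a ^+ (n - i).
  by apply: (mulgI (a ^+ i)); rewrite mulgV -expgnDr subnKC // ltnW.
exact: hin.
Qed.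

End GroupTools.

(** * Complex reflections and mirrors *)

Section Reflections.
Variable R : realType.
Local Notation w := (omega : R[i]).
Local Notation C := R[i].
Local Notation V := 'cV[C]_3.
Local Notation rc := (real_complex R).
Local Notation J := (@J R).
Local Open Scope sesquilinear_scope.
Implicit Types (u v z p y : V) (A B : 'M[C]_3) (a b l c : C) (g h : PU R).

Lemma w1_exp_inj (i j : 'I_6) : (1 + w) ^+ i = (1 + w) ^+ j -> i = j.
Proof.
have key (k : nat) : (k < 6)%N -> (1 + w) ^+ k = 1 -> k = 0%N.
  have fin (x y : int) : x%:~R + y%:~R * w = 1 -> x = 1 /\ y = 0.
    by move=> e; apply: (@eis_inj R); rewrite /eis e mul0r addr0.
  have s2 := w1_sqr R; have s3 := w1_cube R; have w2 := omega2 R.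
  case: k => [|[|[|[|[|[|//]]]]]] // _ e; exfalso.
  - by case: (fin 1 1); first by rewrite mul1r; exact: e.
  - by case: (fin 0 1); first by rewrite mul1r add0r; rewrite s2 in e.
  - by case: (fin (-1) 0); first by rewrite mul0r addr0; rewrite s3 in e.
  - by case: (fin (-1) (-1)); first by rewrite mulN1r; rewrite (exprM _ 2 2) s2 w2 in e.
  - by case: (fin 0 (-1)); first by rewrite mulN1r add0r; rewrite (exprD _ 2 3) s2 s3 mulrN1 in e.
have w0 : 1 + w != 0 by rewrite nm1_neq0 // nm_w1.
move=> e; apply: val_inj => /=.
wlog ij : i j e / (i <= j)%N.
  by move=> H; case: (leqP i j) => [|/ltnW] ij; [exact: H|apply/esym; exact: H].
have : (1 + w) ^+ (j - i) = 1.
  by apply: (mulIf (_ : (1 + w) ^+ i != 0)); rewrite ?expf_neq0 // -exprD subnK // mul1r.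
by move=> /(key _ (leq_ltn_trans (leq_subr _ _) (ltn_ord j)))/eqP; rewrite subn_eq0 => h; apply/eqP; rewrite eqn_leq ij h.
Qed.

Definition rf c u : 'M[C]_3 := 1%:M + ((c - 1) / herm u u) *: (u *m (u ^t* *m J)).

Lemma rfE c u z : rf c u *m z = z + ((c - 1) * (herm z u / herm u u)) *: u.
Proof.
rewrite mulmxDl mul1mx -scalemxAl -mulmxA (_ : u ^t* *m J *m z = (herm z u)%:M); last first.
  by rewrite [LHS]mx11_scalar.
by rewrite mul_mx_scalar scalerA mulrA [_ * _ / _]mulrAC.
Qed.

Lemma rf_perp c u z : herm z u = 0 -> rf c u *m z = z.
Proof. by move=> e; rewrite rfE e mul0r mulr0 scale0r addr0. Qed.

Lemma rf_axis c u : 0 < hr u -> rf c u *m u = c *: u.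
Proof.
move=> u0; rewrite rfE divff ?hr0_neq ?gt_eqF // mulr1 -[X in X + _]scale1r -scalerDl.
by rewrite addrC subrK.
Qed.

Lemma perp_proj u z : 0 < hr u -> herm (z - (herm z u / herm u u) *: u) u = 0.
Proof. by move=> u0; rewrite hermDl hermNl hermZl divfK ?subrr // hr0_neq ?gt_eqF. Qed.

Lemma mx_ext A B : (forall z, A *m z = B *m z) -> A = B.
Proof. by move=> h; apply: mxcol_eq => z _; exact: h. Qed.

Lemma mx_split A B u : 0 < hr u -> A *m u = B *m u ->
  (forall z, herm z u = 0 -> A *m z = B *m z) -> A = B.
Proof.
move=> u0 eu ez; apply: mx_ext => z.
have e (M : 'M[C]_3) : M *m z = M *m (z - (herm z u / herm u u) *: u) + (herm z u / herm u u) *: (M *m u).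
  by rewrite mulmxBr -scalemxAr subrK.
by rewrite (e A) (e B) ez ?eu //; exact: perp_proj.
Qed.

Lemma rf_preserving c u : 0 < hr u -> nm c = 1 -> preserving (rf c u).
Proof.
move=> u0 c1 x y; have n0 : herm u u != 0 by rewrite hr0_neq ?gt_eqF.
have uj : (herm u u)^* = herm u u by rewrite herm_cj.
rewrite !rfE !hE rmorphM rmorphB rmorph1 fmorph_div /= uj herm_cj.
rewrite -[RHS]addr0 -[in RHS](mul0r (herm x u * herm u y / herm u u)) -(subrr (1 : C)).
have := nm_eq1 c1; move: (c^*) => d e; rewrite -{1}e; hfield.
Qed.

Lemma rfM c d u : 0 < hr u -> rf (c * d) u = rf c u *m rf d u.
Proof.
move=> u0; apply: (mx_split u0).
  by rewrite -mulmxA !rf_axis // -scalemxAr rf_axis // scalerA mulrC.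
by move=> z zu; rewrite -mulmxA !rf_perp.
Qed.

Lemma rf1 u : 0 < hr u -> rf 1 u = 1%:M.
Proof. by move=> u0; rewrite /rf subrr mul0r scale0r addr0. Qed.

Lemma rf_pow c u n : 0 < hr u -> nm c = 1 -> (cl (rf c u) ^+ n)%g = cl (rf (c ^+ n) u).
Proof.
move=> u0 c1; elim: n => [|n IH]; first by rewrite expg0 expr0 rf1 // cl1.
have h := rf_preserving u0 c1; have hn : preserving (rf (c ^+ n) u).
  by apply: (rf_preserving u0); rewrite nmX c1 expr1n.
by rewrite expgS IH exprS (rfM _ _ u0) (clM h hn).
Qed.

(** Projecting the negative vector $(1,0,-1)$ off [u] subtracts a nonnegative number from its norm
    $-2$. *)
Lemma perp_negative u : 0 < hr u -> exists z z', [/\ hr z < 0, herm z u = 0 & oframe z u z'].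
Proof.
move=> u0; have n0 : herm u u != 0 by rewrite hr0_neq ?gt_eqF.
pose v : V := cv3 1 0 (-1).
have hv : hr v = - 2%:R by apply: rc_inj; rewrite -hrE hermE !vE rcN rcn !cjE; ring.
pose z := v - (herm v u / herm u u) *: u.
have zu : herm z u = 0 by exact: perp_proj.
have nz : hr z < 0.
  have -> : hr z = hr v - nm (herm v u) / hr u.
    apply: rc_inj; rewrite -hrE rcD rcN rcM rcV -nm_herm -!hrE /z !hE rmorphM fmorphV /= !herm_cj.
    by hfield.
  have : 0 <= nm (herm v u) / hr u by rewrite divr_ge0 ?nm_ge0 // ltW.
  by rewrite hv; lra.
exists z, (cr z u); split=> //; apply: cr_oframe => //; first exact: herm_sym0.
by apply: contraTneq u0 => ->; rewrite /hr herm0l ltxx.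
Qed.

Lemma hr_perpD v z (s : R) : herm z v = 0 -> hr (v + rc s *: z) = hr v + s ^+ 2 * hr z.
Proof.
by move=> zv; apply: rc_inj; rewrite -hrE !hE zv (herm_sym0 zv) conjC_rc !hrE rcD rcM rcX; ring.
Qed.

Lemma small_negative v z : hr v < 0 -> herm z v = 0 -> exists2 s : R, 0 < s & hr (v + rc s *: z) < 0.
Proof.
move=> nv zv; have z0 := perp_ge0 nv zv.
exists (- hr v / (hr z - hr v)); first by rewrite divr_gt0; lra.
set s := _ / _.
rewrite hr_perpD //.
have D0 : 0 < hr z - hr v by lra.
have s1 : s * (hr z - hr v) = - hr v by rewrite divfK ?gt_eqF.
have s0 : 0 < s by rewrite divr_gt0; lra.
have s2 : s ^+ 2 * hr z <= s * hr z * s by rewrite expr2; lra.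
have s3 : s <= 1 by rewrite ler_pdivrMr // mul1r; lra.
have : s * hr z * s <= s * hr z by rewrite ler_piMr // mulr_ge0 // ltW.
have : 0 < s * (- hr v) by rewrite mulr_gt0 //; lra.
nra.
Qed.

(** The mirror contains only negative lines, but [z] and $z+sz'$ already span the plane orthogonal
    to [u]. A mirror therefore determines its polar vector up to a scalar. *)
Lemma mirror_negative u : 0 < hr u -> exists z z', exists2 s : R, 0 < s &
  [/\ oframe z u z', herm z u = 0, hr (z + rc s *: z') < 0 & herm (z + rc s *: z') u = 0].
Proof.
move=> u0; have [z [z' [nz zu fr]]] := perp_negative u0.
have [_ _ _ [uz z'z uz']] := fr.
have [s s0 hs] := small_negative nz z'z; exists z, z', s => //; split=> //.
by rewrite !hE zu (herm_sym0 uz') mulr0 addr0.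
Qed.

Lemma mirror_mem u z : hr z < 0 -> herm z u = 0 -> mirror u <[z]>%VS.
Proof. by move=> nz zu; exists z => //=; rewrite herm_lt0. Qed.

Lemma mirror_memE u z : hr z < 0 -> mirror u <[z]>%VS -> herm z u = 0.
Proof.
move=> nz [y /= []]; rewrite herm_lt0 => ny yu /esym/(line_eqP _ (hr_v0 ny))[c c0 ->].
by rewrite hermZl yu mulr0.
Qed.

Lemma mirror_inj u u' : 0 < hr u -> 0 < hr u' -> mirror u = mirror u' ->
  exists2 c, c != 0 & u' = c *: u.
Proof.
move=> u0 u'0 e; have [z [z' [s s0 [fr zu ns su]]]] := mirror_negative u0.
have [nz _ _ [_ z'z uz']] := fr.
have h1 : herm z u' = 0 by apply: (mirror_memE nz); rewrite -e; exact: mirror_mem.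
have := mirror_mem ns su; rewrite e => /(mirror_memE ns); rewrite !hE h1 add0r => /eqP.
rewrite mulf_eq0 => /orP[/eqP|/eqP h2]; first by rewrite -[0]rc0 => /rc_inj s00; rewrite s00 ltxx in s0.
have := perp_line (oframe_sym fr) (herm_sym0 h1) (herm_sym0 h2).
move: (_ / _) => c uc; exists c; last exact: uc.
by apply: contraTneq u'0 => c0; rewrite uc c0 scale0r /hr herm0l ltxx.
Qed.

Lemma mirrorZ u c : c != 0 -> mirror (c *: u) = mirror u.
Proof.
move=> c0; apply/seteqP; split=> _ [z [nz zu] <-]; exists z; rewrite //=; split; try exact: nz.
  by move/eqP: zu; rewrite hermZr mulf_eq0 conjC_eq0 (negPf c0) => /eqP.
by rewrite hermZr zu mulr0.
Qed.

Lemma act_mirror A u : preserving A -> PU_act (cl A) @` mirror u = mirror (A *m u).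
Proof.
move=> hA; have uA : A \in unitmx by have /andP[] := preserving_preserves hA.
apply/seteqP; split.
  move=> _ [_ [z [nz zu] <-] <-]; rewrite cl_act //; exists (A *m z) => //=.
  by rewrite !hA.
move=> _ [z [nz zu] <-].
have [y yz] : exists y, z = A *m y by exists (invmx A *m z); rewrite mulmxA mulmxV // mul1mx.
rewrite yz !hA in nz zu *; exists <[y]>%VS; last by rewrite cl_act.
by exists y.
Qed.

(* A lift of g may be rescaled so as to act as the identity on the polar plane. *)
Lemma fixes_mirror A u : preserving A -> 0 < hr u -> fixes_pointwise (cl A) (mirror u) ->
  exists l c, [/\ nm l = 1, nm c = 1 & A = l *: rf c u].
Proof.
move=> hA u0 hf; have [z [z' [s s0 [fr zu ns su]]]] := mirror_negative u0.
have [nz pu pz' [uz z'z uz']] := fr.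
have [l l0 ez] := (fixes_lineP hA nz).1 (hf _ (mirror_mem nz zu)).
have [k k0 es] := (fixes_lineP hA ns).1 (hf _ (mirror_mem ns su)).
have s00 : rc s != 0 by rewrite (fmorph_eq0 (real_complex R)) gt_eqF.
have ez' : A *m z' = k *: z' + ((k - l) / rc s) *: z.
  apply: (scalerI s00).
  have -> : rc s *: (k *: z' + ((k - l) / rc s) *: z) = k *: (z + rc s *: z') - l *: z.
    by apply: cv_eq; rewrite !ccE; field.
  by rewrite scalemxAr -es -ez -mulmxBr addrAC subrr add0r.
(* [A] keeps the complement of [z] invariant, so the [z]-component of $Az'$ vanishes, and the two
   multipliers agree. *)
have kl : k = l.
  have : herm (A *m z') z = 0 by exact: eigen_perp hA ez l0 z'z.
  rewrite ez' !hE z'z mulr0 add0r => /eqP.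
  rewrite mulf_eq0 (negPf (hr_neq0 nz)) orbF mulf_eq0 invr_eq0 (negPf s00) orbF subr_eq0.
  by move/eqP.
rewrite kl subrr mul0r scale0r addr0 in ez'.
have l1 := eigen_unit hA ez (ltr0_neq0 nz).
have Auz : herm (A *m u) z = 0 by exact: eigen_perp hA ez l0 uz.
have Auz' : herm (A *m u) z' = 0 by exact: eigen_perp hA ez' l0 uz'.
have [b eu] : exists b, A *m u = b *: u.
  by eexists; exact: (perp_line (oframe_sym fr) Auz Auz').
have b1 := eigen_unit hA eu (lt0r_neq0 u0).
exists l, (b / l); split; [exact: l1|by rewrite nmM nmV l1 b1 invr1 mulr1|].
apply: (mx_split u0).
  by rewrite -scalemxAl rf_axis // scalerA mulrC divfK.
move=> y yu; rewrite -scalemxAl rf_perp //.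
rewrite (oframe_exp y fr) yu mul0r scale0r addr0 !mulmxDr -!scalemxAr ez ez'.
by rewrite scalerDr !scalerA ![l * _]mulrC.
Qed.

Lemma cl_rf_inj a b u : 0 < hr u -> nm a = 1 -> nm b = 1 -> cl (rf a u) = cl (rf b u) -> a = b.
Proof.
move=> u0 a1 b1 /cl_eq[||k k0 e]; [exact: rf_preserving|exact: rf_preserving|].
have un0 : u != 0 by apply: contraTneq u0 => ->; rewrite /hr herm0l ltxx.
have [z [z' [nz zu _]]] := perp_negative u0.
have k1 : k = 1.
  apply/eqP; have := rf_perp a zu; rewrite e -scalemxAl rf_perp // => /eqP.
  by rewrite -subr_eq0 -[X in _ - X]scale1r -scalerBl scaler_eq0 (negPf (hr_v0 nz)) orbF subr_eq0.
apply/eqP; have := rf_axis a u0; rewrite e k1 scale1r rf_axis // => /eqP.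
by rewrite eq_sym -subr_eq0 -scalerBl scaler_eq0 (negPf un0) orbF subr_eq0.
Qed.

Lemma cl_rf1 u : 0 < hr u -> cl (rf 1 u) = 1%g.
Proof. by move=> u0; exact: etrans (congr1 (@cl R) (rf1 u0)) (cl1 R). Qed.

Lemma reflectionP m g : complex_reflection_in m g <->
  exists u c n, [/\ 0 < hr u, m = mirror u, [/\ nm c = 1, c != 1, (0 < n)%N & c ^+ n = 1] & g = cl (rf c u)].
Proof.
split.
  move=> [g1 [n n0 gn] [u]]; rewrite herm_gt0 => u0 -> hf.
  have [A hA gA] := cl_surj g; rewrite gA in hf.
  have [l [c [l1 c1 Ae]]] := fixes_mirror hA u0 hf.
  have gE : g = cl (rf c u) by rewrite gA Ae clZ //; exact: rf_preserving.
  exists u, c, n; split=> //; split=> //.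
    by apply: contra_neq g1 => c11; rewrite gE c11; exact: cl_rf1.
  have cn1 : nm (c ^+ n) = 1 by rewrite nmX c1 expr1n.
  have gn' : cl (rf (c ^+ n) u) = 1%g.
    by apply: etrans (esym (rf_pow n u0 c1)) _; rewrite -gE.
  apply: (cl_rf_inj u0 cn1 (nm1 R)); exact: etrans gn' (esym (cl_rf1 u0)).
move=> [u [c [n [u0 -> [c1 cn1 n0 cn] ->]]]].
have hA := rf_preserving u0 c1.
split.
- apply: contra_neq cn1 => e; apply: (cl_rf_inj u0 c1 (nm1 R)).
  exact: etrans e (esym (cl_rf1 u0)).
- by exists n => //; rewrite rf_pow // cn; exact: cl_rf1.
- by exists u; rewrite ?herm_gt0.
move=> _ [z [nz zu] <-]; rewrite cl_act // rf_perp //.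
Qed.

End Reflections.

(** * Reflections in $\Gamma_3$, their mirrors and orbits of mirrors *)

Section Polar.
Variable R : realType.
Local Notation Re := (@complex.Re R).
Local Notation w := (omega : R[i]).
Local Notation C := R[i].
Local Notation V := 'cV[C]_3.
Local Notation rc := (real_complex R).
Implicit Types (u v z p y : V) (A B : 'M[C]_3) (a b l c : C) (g h : PU R).

Lemma Imx_vec A : (forall z, Ivec z -> Ivec (A *m z)) -> Imx A.
Proof.
move=> h i j; have -> : A i j = (A *m (delta_mx j 0 : V)) i 0 by rewrite -colE mxE.
apply: h => k; rewrite mxE eqxx andbT; case: (k == j); eis.
Qed.

(** Two integral probes: the vector pairing to 1 with [u] detects the multiplier of a reflection,
    and the pair [z], [y] detects the scalar by which a lift acts on the plane orthogonal to [u]. *)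
Definition polar u := [/\ Ivec u, exists2 y, Ivec y & herm y u = 1 &
  exists z y, [/\ Ivec z, Ivec y, herm z u = 0 & herm z y = 1]].

Lemma rf_Imx c u : Ivec u -> Eis ((c - 1) / herm u u) -> Imx (rf c u).
Proof.
move=> Iu Ec; apply: Imx_vec => x Ix; rewrite rfE (_ : _ * _ = (c - 1) / herm u u * herm x u); last by rewrite mulrA mulrAC.
by apply: IvecD => //; apply: IvecZ => //; apply: EisM => //; apply: Eis_herm.
Qed.

Lemma mirror_fixerP u g : polar u -> 0 < hr u -> mirror_fixer 3 (mirror u) g <->
  exists c, [/\ nm c = 1, Eis ((c - 1) / herm u u) & g = cl (rf c u)].
Proof.
move=> [Iu [y0 Iy0 y0u] [z [y [Iz Iy zu zy]]]] u0; split.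
  move=> [/GammaP[A [hA IA ->]] /(fixes_mirror hA u0)[l [c [l1 c1 e]]]].
  have El : Eis l.
    suff <- : herm (A *m z) y = l by apply: Eis_herm => //; exact: Ivec_mul.
    by rewrite e -scalemxAl rf_perp // hermZl zy mulr1.
  have Il : Imx (rf c u).
    have -> : rf c u = l^* *: A by rewrite e scalerA [_^* * _]mulrC nm_eq1 // scale1r.
    by apply: ImxZ => //; exact: EisJ.
  exists c; split; [exact: c1| |by rewrite e clZ //; exact: rf_preserving].
  have -> : (c - 1) / herm u u = herm (rf c u *m y0 - y0) y0.
    by rewrite rfE y0u addrAC subrr add0r mul1r hermZl -(herm_cj y0 u) y0u cj1 mulr1.
  by apply: Eis_herm => //; apply: IvecB => //; exact: Ivec_mul.
move=> [c [c1 Ec ->]]; split.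
  apply/GammaP; exists (rf c u); split=> //; first exact: rf_preserving.
  exact: rf_Imx.
move=> _ [x [nx xu] <-]; rewrite cl_act; last exact: rf_preserving.
by rewrite rf_perp.
Qed.

Lemma polar_reflectionI u k (d : C) : polar u -> 0 < hr u -> (0 < k)%N -> d ^+ k = 1 -> nm d = 1 ->
  cis (2 * pi / k%:R) = d -> (forall i j : 'I_k, d ^+ i = d ^+ j -> i = j) ->
  (forall i, Eis ((d ^+ i - 1) / herm u u)) ->
  (forall c, nm c = 1 -> Eis ((c - 1) / herm u u) -> exists2 i, (i < k)%N & c = d ^+ i) ->
  polar_reflection 3 u k (cl (rf d u)).
Proof.
move=> pu u0 k0 dk d1 dE di Ed Hd.
have gk : (cl (rf d u) ^+ k)%g = 1%g by rewrite rf_pow // dk rf1 // cl1.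
have FE : mirror_fixer 3 (mirror u) = generated [set cl (rf d u)].
  rewrite (generated_cycle k0 gk); apply/seteqP; split.
    move=> g /(mirror_fixerP _ pu u0)[c [c1 Ec ->]]; have [i ik ->] := Hd c c1 Ec.
    by exists (Ordinal ik) => //=; rewrite rf_pow.
  move=> _ [i _ <-]; apply/mirror_fixerP => //; exists (d ^+ i).
  by rewrite nmX d1 expr1n rf_pow.
split=> //.
- by rewrite herm_gt0.
- rewrite FE -[X in `I_X]card_ord; apply: (card_range _ (generated_cycle k0 gk)) => i j.
  have dn (k' : nat) : nm (d ^+ k') = 1 by rewrite nmX d1 expr1n.
  move=> e; apply: di; apply: (cl_rf_inj u0 (dn _) (dn _)).
  exact: etrans (esym (rf_pow _ u0 d1)) (etrans e (rf_pow _ u0 d1)).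
exists (rf d u); first by apply: is_class_cl; exact: rf_preserving.
by move=> z; rewrite rfE dE.
Qed.

Lemma polar_reflection6 u : polar u -> herm u u = 1 -> polar_reflection 3 u 6 (cl (rf (1 + w) u)).
Proof.
move=> pu u1; have hu : hr u = 1 by apply: rc_inj; rewrite -hrE u1.
apply: polar_reflectionI => //.
- by rewrite hu ltr01.
- exact: w1_6.
- exact: nm_w1.
- exact: cis_2pi6.
- exact: w1_exp_inj.
- by move=> i; rewrite u1 divr1; apply: EisB; [apply: EisX; exact: Eis_1w|exact: Eis1].
move=> c c1; rewrite u1 divr1 => Ec; apply: Eis_unit => //.
by rewrite -(subrK 1 c); apply: EisD => //; exact: Eis1.
Qed.

(** With $c=1+2x$ and $|c|=1$ one has $\mathrm{Re}\,x=-|x|^2$ and $|x|\le1$, so an integral $x$ is 0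
    or $-1$. *)
Lemma half_unit c : nm c = 1 -> Eis ((c - 1) / 2%:R) -> c = 1 \/ c = -1.
Proof.
move=> c1; set x := _ / _ => Ex.
have n2 : (2%:R : C) != 0 by rewrite pnatr_eq0.
have cE : c = 1 + 2%:R * x by rewrite /x mulrC divfK // addrC subrK.
have x1 : 4 * nm x <= 4.
  have := nm_1sub c1; rewrite (_ : 1 - c = - (2%:R * x)); last by rewrite cE; ring.
  by rewrite nmN nmM -[2%:R]rcn nm_rc; lra.
have xr : Re x = - nm x.
  have h : nm c = 1 + 4 * (Re x + nm x).
    by rewrite {1}cE; move: x {cE x1 Ex} => [a b]; rewrite /nm cReD cImD cReM cImM cRe1 cIm1 cRen cImn /=; ring.
  by move: h; rewrite c1; lra.
have [n nE] := Eis_nm Ex.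
case: n nE => [|[|n]] nE.
- by left; rewrite cE (_ : x = 0) ?mulr0 ?addr0 //; apply/eqP; rewrite -nm_eq0 nE.
- right; have -> : c = 1 + 2%:R * -1; last by ring.
  rewrite cE; congr (1 + _ * _); apply: complexP; first by rewrite xr nE cReN.
  rewrite cImN cIm1 oppr0; apply/eqP; rewrite -sqrf_eq0.
  by have := nE; rewrite {1}/nm xr nE => h; apply/eqP; lra.
have h : (2%:R : R) <= n.+2%:R by rewrite ler_nat.
by exfalso; lra.
Qed.

Lemma polar_reflection2 u : polar u -> herm u u = 2%:R -> polar_reflection 3 u 2 (cl (rf (-1) u)).
Proof.
move=> pu u1; have hu : hr u = 2%:R by apply: rc_inj; rewrite -hrE u1 rcn.
have n2 : (2%:R : C) != 0 by rewrite pnatr_eq0.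
apply: polar_reflectionI => //.
- by rewrite hu ltr0n.
- by rewrite sqrrN expr1n.
- by rewrite nmN nm1.
- exact: cis_2pi2.
- have h1 : (-1 : C) <> 1.
    by move=> e; case/eqP: n2; rewrite (_ : 2%:R = 1 - (-1) :> C); [rewrite e subrr|ring].
  move=> [[|[|//]] hi] [[|[|//]] hj] //=; rewrite ?expr1 ?expr0 => e; apply: val_inj => //=.
  by case: h1.
- move=> i; rewrite u1 -signr_odd; case: (odd i); rewrite ?expr1 ?expr0 ?subrr ?mul0r; last exact: Eis0.
  rewrite (_ : (-1 - 1) / 2%:R = - 1 :> C); first by eis.
  by field.
move=> c c1; rewrite u1 => /(half_unit c1)[->|->]; first by exists 0%N.
by exists 1%N.
Qed.

(** Otherwise the displacement of [v], a nonzero multiple of [u], would lie on the line of [v], and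
    [u] would not be positive. *)
Lemma rf_fix_perp v u c l : hr v < 0 -> 0 < hr u -> c != 1 -> rf c u *m v = l *: v -> herm v u = 0.
Proof.
move=> nv u0 c1 e; have un0 : herm u u != 0 by rewrite hr0_neq ?gt_eqF.
apply/eqP; apply: contraTT u0 => vu; rewrite -leNgt.
have n0 : (c - 1) * (herm v u / herm u u) != 0.
  by rewrite !mulf_neq0 ?subr_eq0 ?invr_eq0.
have uE : u = ((l - 1) / ((c - 1) * (herm v u / herm u u))) *: v.
  have h : ((c - 1) * (herm v u / herm u u)) *: u = (l - 1) *: v.
    by rewrite scalerBl scale1r -e rfE addrAC subrr add0r.
  by rewrite mulrC -scalerA -h scalerA mulVf ?scale1r.
by rewrite uE hrZ mulr_ge0_le0 ?nm_ge0 // ltW.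
Qed.

(** A reflection fixing a negative line has it in its mirror, and so repeats its eigenvalue along
    the mirror. *)
Lemma simple_not_reflection A v l : preserving A -> hr v < 0 -> A *m v = l *: v ->
  simple_at A v l -> ~ complex_reflection (cl A).
Proof.
move=> hA nv ev sA [m /reflectionP[u [c [n [u0 _ [c1 cn1 _ _] /cl_eq[]]]]]] //.
  exact: rf_preserving.
move=> k k0 e.
have ev' : rf c u *m v = (l / k) *: v.
  by apply: (scalerI k0); rewrite scalemxAl -e ev scalerA mulrCA divff // mulr1.
have vu := rf_fix_perp nv u0 cn1 ev'.
have un0 : u != 0 by apply: contraTneq u0 => ->; rewrite /hr herm0l ltxx.
have fr := cr_oframe nv (herm_sym0 vu) un0.
have [_ _ pz [_ zv uz]] := fr.
have kl : k = l.
  apply/eqP; have := ev; rewrite e -scalemxAl rf_perp // => /eqP.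
  by rewrite -subr_eq0 -scalerBl scaler_eq0 (negPf (hr_v0 nv)) orbF subr_eq0.
have : cr v u = 0.
  by apply: sA => //; rewrite e -scalemxAl rf_perp ?kl //; exact: herm_sym0.
by move=> z0; rewrite z0 /hr herm0l ltxx in pz.
Qed.

(** An element carrying one mirror to the other sends [u] to $cu'$, and the pairing with [y] shows
    that [c] is integral. *)
Lemma mirror_orbit_norm u u' y : Ivec u -> 0 < hr u -> 0 < hr u' -> Ivec y -> herm u' y = 1 ->
  mirror_orbit 3 (mirror u) (mirror u') -> exists2 c, Eis c & hr u = nm c * hr u'.
Proof.
move=> Iu u0 u'0 Iy u'y [g /GammaP[A [hA IA ->]]]; rewrite act_mirror //.
have hu : hr (A *m u) = hr u by exact: preserving_hr.
move=> /esym/mirror_inj[//||c c0 e]; first by rewrite hu.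
exists c; last by rewrite -hu e hrZ.
suff <- : herm (A *m u) y = c by apply: Eis_herm => //; exact: Ivec_mul.
by rewrite e hermZl u'y mulr1.
Qed.

Lemma mirror_orbitI A u u' c : preserving A -> Imx A -> c != 0 -> A *m u = c *: u' ->
  mirror_orbit 3 (mirror u) (mirror u').
Proof.
move=> hA IA c0 e; exists (cl A); first by apply/GammaP; exists A.
by rewrite (act_mirror _ hA) e (mirrorZ _ c0).
Qed.

Lemma oframe_ext A B v u u' : oframe v u u' -> A *m v = B *m v -> A *m u = B *m u ->
  A *m u' = B *m u' -> A = B.
Proof.
move=> fr ev eu eu'; apply: mx_ext => z; rewrite (oframe_exp z fr).
by rewrite !mulmxDr -!scalemxAr ev eu eu'.
Qed.

Lemma isotropy_subgroup v : hr v < 0 -> is_subgroup (isotropy 3 <[v]>%VS).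
Proof.
move=> nv; have H : H2 <[v]>%VS by exact/H2P.
split.
- by split; [exact: Gamma1|exact: PU_act1].
- by move=> g h [Gg eg] [Gh eh]; split; [exact: GammaM|rewrite PU_actM // eh].
move=> g [Gg eg]; split; first exact: GammaV.
by rewrite -{1}eg -PU_actM // mulVg PU_act1.
Qed.

Lemma rf_isotropy v u c : hr v < 0 -> 0 < hr u -> herm u v = 0 -> Ivec u -> nm c = 1 ->
  Eis ((c - 1) / herm u u) -> isotropy 3 <[v]>%VS (cl (rf c u)).
Proof.
move=> nv u0 uv Iu c1 Ec; apply/isotropyP => //; exists (rf c u); split=> //.
- exact: rf_preserving.
- exact: rf_Imx.
by exists 1; rewrite rf_perp ?scale1r //; exact: herm_sym0.
Qed.

(** For a primitive [v] the eigenvalue is a unit of $O$, so each class of the isotropy group has an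
    integral lift fixing the vector [v] itself. *)
Lemma isotropy_scale A v l y : hr v < 0 -> Ivec v -> Ivec y -> herm v y = 1 ->
  preserving A -> Imx A -> A *m v = l *: v ->
  exists B, [/\ preserving B, Imx B, B *m v = v & exists2 k, nm k = 1 /\ Eis k & A = k *: B].
Proof.
move=> nv Iv Iy vy hA IA ev; have l1 := eigen_unit hA ev (ltr0_neq0 nv).
have El : Eis l.
  suff <- : herm (A *m v) y = l by apply: Eis_herm => //; exact: Ivec_mul.
  by rewrite ev hermZl vy mulr1.
have ll : l^* * l = 1 by rewrite mulrC nm_eq1.
exists (l^* *: A); split.
- by apply: preservingZ; rewrite // nmJ.
- by apply: ImxZ => //; exact: EisJ.
- by rewrite -scalemxAl ev scalerA ll scale1r.
by exists l => //; rewrite scalerA nm_eq1 // scale1r.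
Qed.

(** A reflection moves vectors along its polar vector, so any nonzero displacement is polar. *)
Lemma rf_mirror c u x y : rf c u *m x = y -> y != x -> mirror u = mirror (y - x).
Proof.
move=> <-; rewrite rfE [x + _]addrC addrK -subr_eq0 addrK scaler_eq0 negb_or => /andP[h _].
by rewrite mirrorZ.
Qed.

Lemma rf_not_id c u : 0 < hr u -> c != 1 -> rf c u != 1%:M.
Proof.
move=> u0; apply: contraNneq => e; have := rf_axis c u0; rewrite e mul1mx => /eqP.
have un0 : u != 0 by apply: contraTneq u0 => ->; rewrite /hr herm0l ltxx.
by rewrite -subr_eq0 -[X in X - _]scale1r -scalerBl scaler_eq0 (negPf un0) orbF subr_eq0 eq_sym.
Qed.

Lemma Eis_half_nm c (r s : R) : Eis c -> r = 1 -> s = 2%:R -> r = nm c * s -> False.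
Proof.
move=> /Eis_nm[n ->] -> ->; rewrite -natrM -[1](natr1 0) add0r => /eqP.
by rewrite (eqr_nat R 1 (n * 2)) => /eqP; lia.
Qed.

Lemma reflection_subgroup_full v (S : set (PU R)) : hr v < 0 ->
  isotropy 3 <[v]>%VS = generated S -> S `<=` @complex_reflection R ->
  isotropy 3 <[v]>%VS = reflection_subgroup (isotropy 3 <[v]>%VS).
Proof.
move=> nv e hS; apply/seteqP; split; last first.
  by apply: generated_sub => [|g []//]; exact: isotropy_subgroup.
rewrite {1}e; apply: generated_sub; first exact: generated_subgroup.
move=> g Sg; apply: sub_generated; split; last exact: hS.
by rewrite e; exact: sub_generated.
Qed.

Lemma cl_rf_reflection u c n : 0 < hr u -> nm c = 1 -> c != 1 -> (0 < n)%N -> c ^+ n = 1 ->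
  complex_reflection_in (mirror u) (cl (rf c u)).
Proof. by move=> u0 c1 cn1 n0 cn; apply/reflectionP; exists u, c, n. Qed.

Lemma isotropy_mirrorsP v m : hr v < 0 -> mirrors_of (isotropy 3 <[v]>%VS) m ->
  exists u c k, [/\ 0 < hr u, herm u v = 0, m = mirror u & c != 1] /\
    [/\ nm k = 1, preserving (rf c u) & Imx (k *: rf c u)].
Proof.
move=> nv [g /(isotropyP _ nv)[A [hA IA [l ev] ->]] /reflectionP[u [c [n [u0 -> [c1 cn1 _ _] /cl_eq[]]]]]] //.
  exact: rf_preserving.
move=> k k0 e; have hr' := rf_preserving u0 c1.
have ev' : rf c u *m v = (l / k) *: v.
  by apply: (scalerI k0); rewrite scalemxAl -e ev scalerA mulrCA divff // mulr1.
have vu := rf_fix_perp nv u0 cn1 ev'.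
exists u, c, k; split; first by split=> //; exact: herm_sym0.
split=> //; last by rewrite -e.
by apply: (eigen_unit (v := v) hA _ (ltr0_neq0 nv)); rewrite e -scalemxAl rf_perp.
Qed.

Lemma scale_inj (z : V) a b : z != 0 -> a *: z = b *: z -> a = b.
Proof.
move=> z0 /eqP; rewrite -subr_eq0 -scalerBl scaler_eq0 (negPf z0) orbF subr_eq0.
by move/eqP.
Qed.

Lemma pos_neq0 u : 0 < hr u -> u != 0.
Proof. by move=> u0; apply: contraTneq u0 => ->; rewrite /hr herm0l ltxx. Qed.

Lemma mulmx_step A B z y : B *m z = y -> A *m B *m z = A *m y.
Proof. by move=> <-; rewrite mulmxA. Qed.

Definition torus a b u u' : 'M[C]_3 := rf a u *m rf b u'.

Lemma torus_v v u u' a b : oframe v u u' -> torus a b u u' *m v = v.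
Proof.
move=> [_ _ _ [uv u'v _]]; rewrite /torus (mulmx_step _ (rf_perp _ (herm_sym0 u'v))).
exact: rf_perp _ (herm_sym0 uv).
Qed.

Lemma torus_u v u u' a b : oframe v u u' -> torus a b u u' *m u = a *: u.
Proof.
move=> [_ u0 _ [_ _ uu']]; rewrite /torus (mulmx_step _ (rf_perp _ uu')).
exact: rf_axis.
Qed.

Lemma torus_u' v u u' a b : oframe v u u' -> torus a b u u' *m u' = b *: u'.
Proof.
move=> [_ _ u'0 [_ _ uu']]; rewrite /torus (mulmx_step _ (rf_axis _ u'0)) -scalemxAr.
by rewrite (rf_perp _ (herm_sym0 uu')).
Qed.

Lemma torus_preserving v u u' a b : oframe v u u' -> nm a = 1 -> nm b = 1 -> preserving (torus a b u u').
Proof.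
move=> [_ u0 u'0 _] a1 b1; exact: preservingM (rf_preserving u0 a1) (rf_preserving u'0 b1).
Qed.

Lemma torus_sym v u u' a b : oframe v u u' -> torus a b u u' = torus b a u' u.
Proof.
move=> fr; have fr' := oframe_sym fr; apply: (oframe_ext fr).
- exact: etrans (torus_v _ _ fr) (esym (torus_v _ _ fr')).
- exact: etrans (torus_u _ _ fr) (esym (torus_u' _ _ fr')).
- exact: etrans (torus_u' _ _ fr) (esym (torus_u _ _ fr')).
Qed.

Lemma torus_pow v u u' a b (i j : nat) : oframe v u u' -> nm a = 1 -> nm b = 1 ->
  (cl (rf a u) ^+ i * cl (rf b u') ^+ j)%g = cl (torus (a ^+ i) (b ^+ j) u u').
Proof.
move=> [_ u0 u'0 _] a1 b1; apply: etrans (esym (clM _ _)).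
- by congr (_ * _)%g; [exact: rf_pow|exact: rf_pow].
- by apply: (rf_preserving u0); rewrite nmX a1 expr1n.
- by apply: (rf_preserving u'0); rewrite nmX b1 expr1n.
Qed.

(** Normalizing lifts to fix the vector [v] removes the scalar ambiguity of $PU(J)$, so equality of
    classes becomes equality of matrices. *)
Lemma cl_fix_inj v A B : v != 0 -> preserving A -> preserving B -> A *m v = v -> B *m v = v ->
  cl A = cl B -> A = B.
Proof.
move=> v0 hA hB eA eB /(cl_eq hA hB)[k k0 e].
suff k1 : k = 1 by rewrite e k1 scale1r.
by apply: (scale_inj v0); rewrite scale1r -{2}eA e -scalemxAl eB.
Qed.

Lemma cl_torus_inj v u u' a b a' b' : oframe v u u' -> nm a = 1 -> nm b = 1 -> nm a' = 1 -> nm b' = 1 ->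
  cl (torus a b u u') = cl (torus a' b' u u') -> a = a' /\ b = b'.
Proof.
move=> fr a1 b1 a'1 b'1 e; have [nv u0 u'0 _] := fr.
have {}e : torus a b u u' = torus a' b' u u'.
  apply: (cl_fix_inj (hr_v0 nv) _ _ _ _ e); [exact: torus_preserving fr a1 b1|exact: torus_preserving fr a'1 b'1| |];
    exact: torus_v fr.
split.
  by apply: (scale_inj (pos_neq0 u0)); rewrite -(torus_u a b fr) e (torus_u _ _ fr).
by apply: (scale_inj (pos_neq0 u'0)); rewrite -(torus_u' a b fr) e (torus_u' _ _ fr).
Qed.

Lemma N1_nm : nm (-1 : C) = 1. Proof. by rewrite nmN nm1. Qed.

Lemma N1_neq1 : (-1 : C) != 1.
Proof. by rewrite -subr_eq0 (_ : -1 - 1 = - 2%:R) ?oppr_eq0 ?pnatr_eq0 //; ring. Qed.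

Lemma w1_neq1 : 1 + w != 1.
Proof. by rewrite -subr_eq0 addrAC subrr add0r omega_neq0. Qed.

Lemma N1_exp_inj (i j : 'I_2) : (-1 : C) ^+ i = (-1) ^+ j -> i = j.
Proof.
have h := N1_neq1; have h' : 1 != -1 :> C by rewrite eq_sym.
move: i j => [[|[|//]] hi] [[|[|//]] hj] //=; rewrite ?expr1 ?expr0 => e; apply: val_inj => //=.
  by case: ((elimN eqP h') e).
by case: ((elimN eqP h) e).
Qed.

Lemma hr_of u (n : R) : herm u u = rc n -> hr u = n.
Proof. by move=> e; apply: rc_inj; rewrite -hrE. Qed.

Lemma mirror_self u : mirror_orbit 3 (mirror u) (mirror u).
Proof.
apply: (@mirror_orbitI 1%:M _ _ 1); [exact: preserving1| |exact: oner_neq0|by rewrite mul1mx scale1r].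
by move=> i j; rewrite mxE; case: (i == j); eis.
Qed.

(* The two types of mirrors are told apart by the norm of a primitive polar vector:
   a ratio of norms would be the norm 2 or 1/2 of an Eisenstein integer. *)
Lemma mirror_orbit12 u u' y : Ivec u -> hr u = 1 -> hr u' = 2%:R -> Ivec y -> herm u' y = 1 ->
  ~ mirror_orbit 3 (mirror u) (mirror u').
Proof.
move=> Iu u1 u2 Iy uy; have u0 : 0 < hr u by rewrite u1; lra.
have u'0 : 0 < hr u' by rewrite u2; lra.
move=> /(mirror_orbit_norm Iu u0 u'0 Iy uy)[c Ec h].
exact: (Eis_half_nm Ec u1 u2 h).
Qed.

Lemma mirror_orbit21 u u' y : Ivec u -> hr u = 2%:R -> hr u' = 1 -> Ivec y -> herm u' y = 1 ->
  ~ mirror_orbit 3 (mirror u) (mirror u').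
Proof.
move=> Iu u2 u1 Iy uy; have u0 : 0 < hr u by rewrite u2; lra.
have u'0 : 0 < hr u' by rewrite u1; lra.
move=> /(mirror_orbit_norm Iu u0 u'0 Iy uy)[c Ec].
by rewrite u1 mulr1 u2 => /esym; exact: Eis_nm_neq2.
Qed.

Lemma isotropy_mirror_fix v y m : hr v < 0 -> Ivec v -> Ivec y -> herm v y = 1 ->
  mirrors_of (isotropy 3 <[v]>%VS) m ->
  exists u c, [/\ 0 < hr u, m = mirror u, c != 1, preserving (rf c u) & Imx (rf c u)] /\ rf c u *m v = v.
Proof.
move=> nv Iv Iy vy /(isotropy_mirrorsP nv)[u [c [k [[u0 uv -> cn1] [k1 hr' Ir]]]]].
have rv : rf c u *m v = v by apply: rf_perp; exact: herm_sym0.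
have hk := preservingZ k1 hr'.
have kv : k *: rf c u *m v = k *: v by rewrite -scalemxAl rv.
have [B [hB IB eB [l [l1 El] AB]]] := isotropy_scale nv Iv Iy vy hk Ir kv.
have kl : k = l by apply: (scale_inj (hr_v0 nv)); rewrite -kv AB -scalemxAl eB.
have rB : rf c u = B by move: AB; rewrite kl => /(scalerI (nm1_neq0 l1)).
exists u, c; split=> //; split=> //; by rewrite rB.
Qed.

Lemma cl_reflection6 u : 0 < hr u -> complex_reflection_in (mirror u) (cl (rf (1 + w) u)).
Proof.
move=> u0; apply: (cl_rf_reflection (n := 6)) => //; [exact: nm_w1|exact: w1_neq1|exact: w1_6].
Qed.

Lemma cl_reflection2 u : 0 < hr u -> complex_reflection_in (mirror u) (cl (rf (-1) u)).
Proof.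
move=> u0; apply: (cl_rf_reflection (n := 2)) => //; [exact: N1_nm|exact: N1_neq1|by rewrite sqrrN expr1n].
Qed.

Lemma rf_isotropy6 v u : hr v < 0 -> herm u u = 1 -> herm u v = 0 -> Ivec u ->
  isotropy 3 <[v]>%VS (cl (rf (1 + w) u)).
Proof.
move=> nv u1 uv Iu; have hu : hr u = 1 by exact: hr_of.
apply: rf_isotropy => //; [by rewrite hu ltr01|exact: nm_w1|].
by rewrite u1 divr1 addrAC subrr add0r; exact: Eisw.
Qed.

Lemma rf_isotropy2 v u : hr v < 0 -> herm u u = 2%:R -> herm u v = 0 -> Ivec u ->
  isotropy 3 <[v]>%VS (cl (rf (-1) u)).
Proof.
move=> nv u1 uv Iu; have hu : hr u = 2%:R by apply: hr_of; rewrite u1 rcn.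
apply: rf_isotropy => //; [by rewrite hu ltr0n|exact: N1_nm|].
by rewrite u1 (_ : _ / _ = -1); [eis|field].
Qed.

End Polar.

(** * Criteria for braid lengths 2 and 4 *)

Section Alternating.
Variable gT : groupType.
Implicit Types x y : gT.
Local Open Scope group_scope.

Lemma braid_length2 x y : x * y = y * x -> has_braid_length x y 2.
Proof. by move=> e; split=> //=; rewrite !mulg1. Qed.

Lemma braid_length4 x y : x * (y * (x * y)) = y * (x * (y * x)) -> x * y <> y * x ->
  x * (y * x) <> y * (x * y) -> has_braid_length x y 4.
Proof.
move=> e4 e2 e3; split=> //=; first by rewrite !mulg1.
by move=> [|[|[|[|m]]]] //= _; rewrite !mulg1.
Qed.

End Alternating.

(** * The four isotropy groups *)

Section FirstPoint.
Variable R : realType.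
Local Notation w := (omega : R[i]).
Local Notation C := R[i].
Local Notation V := 'cV[C]_3.
Implicit Types (u z y v e f : V) (A B : 'M[C]_3) (a b l c : C) (g h : PU R).

Lemma torus_mul v u u' a b : oframe v u u' -> nm a = 1 -> nm b = 1 ->
  (cl (rf a u) * cl (rf b u'))%g = cl (torus a b u u').
Proof.
move=> [_ u0 u'0 _] a1 b1.
exact: esym (clM (rf_preserving u0 a1) (rf_preserving u'0 b1)).
Qed.

(** The last clause says that the stabilizer of [v] is diagonal in the frame, with a sixth root of
    unity on [e] and a sign on [f]. The group is then $\mu_6\times\mu_2$, and all its properties are
    read off from this data. *)
Definition first_data v e f y := [/\ oframe v e f, Ivec v /\ Ivec y, herm v y = 1,
  [/\ polar e, polar f, herm e e = 1 & herm f f = 2%:R] &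
  forall A, preserving A -> Imx A -> A *m v = v ->
   exists i j : nat, [/\ (i < 6)%N, (j < 2)%N, A *m e = (1 + w) ^+ i *: e & A *m f = (-1) ^+ j *: f]].

Lemma first_hr v e f y : first_data v e f y -> hr e = 1 /\ hr f = 2%:R.
Proof.
by move=> [_ _ _ [_ _ ee ff] _]; split; apply: hr_of; [exact: ee|rewrite ff rcn].
Qed.

Lemma first_mem v e f y : first_data v e f y ->
  isotropy 3 <[v]>%VS (cl (rf (1 + w) e)) /\ isotropy 3 <[v]>%VS (cl (rf (-1) f)).
Proof.
move=> [[nv _ _ [ev fv _]] _ _ [[Ie _ _] [If _ _] ee ff] _]; split.
  exact: rf_isotropy6.
exact: rf_isotropy2.
Qed.

Lemma first_isotropyE v e f y : first_data v e f y -> isotropy 3 <[v]>%VS =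
  range (fun ij : 'I_6 * 'I_2 => (cl (rf (1 + w) e) ^+ ij.1 * cl (rf (-1) f) ^+ ij.2)%g).
Proof.
move=> fd; have [sG tG] := first_mem fd; have [fr [Iv Iy] vy _ act] := fd; have [nv _ _ _] := fr.
have hG := isotropy_subgroup nv; have [_ gM _] := hG.
apply/seteqP; split; last first.
  by move=> _ [[i j] _ <-]; apply: gM; apply: (is_subgroupX _ hG).
move=> g /(isotropyP _ nv)[A [hA IA [l ev] ->]].
have [B [hB IB eB [k [k1 Ek] AB]]] := isotropy_scale nv Iv Iy vy hA IA ev.
have [i [j [hi hj ei ej]]] := act B hB IB eB.
exists (Ordinal hi, Ordinal hj); first by [].
rewrite AB (clZ k1 hB) (torus_pow _ _ fr (nm_w1 R) (N1_nm R)); congr cl; apply: (oframe_ext fr).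
- by rewrite eB (torus_v _ _ fr).
- by rewrite ei (torus_u _ _ fr).
- by rewrite ej (torus_u' _ _ fr).
Qed.

Lemma first_card v e f y : first_data v e f y -> isotropy 3 <[v]>%VS #= `I_12.
Proof.
move=> fd; have [fr _ _ _ _] := fd.
suff inj : injective (fun ij : 'I_6 * 'I_2 => (cl (rf (1 + w) e) ^+ ij.1 * cl (rf (-1) f) ^+ ij.2)%g).
  by have := card_range inj (first_isotropyE fd); rewrite card_prod !card_ord.
move=> [i j] [i' j'].
rewrite (torus_pow i j fr (nm_w1 R) (N1_nm R)) (torus_pow i' j' fr (nm_w1 R) (N1_nm R)).
move=> /(cl_torus_inj fr)[||||ij jj].
- by rewrite nmX nm_w1 expr1n.
- by rewrite nmX N1_nm expr1n.
- by rewrite nmX nm_w1 expr1n.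
- by rewrite nmX N1_nm expr1n.
by rewrite (w1_exp_inj ij) (N1_exp_inj jj).
Qed.

Lemma first_gen v e f y : first_data v e f y ->
  isotropy 3 <[v]>%VS = generated [set cl (rf (1 + w) e); cl (rf (-1) f)].
Proof.
move=> fd; have [sG tG] := first_mem fd; have [[nv _ _ _] _ _ _ _] := fd.
apply/seteqP; split; last first.
  by apply: generated_sub; [exact: isotropy_subgroup nv|move=> _ [->|->]].
rewrite (first_isotropyE fd) => _ [[i j] _ <-].
have gS := generated_subgroup [set cl (rf (1 + w) e); cl (rf (-1) f)].
have [_ gM _] := gS.
by apply: gM; apply: (is_subgroupX _ gS); apply: sub_generated; [left|right].
Qed.

Lemma first_reflections v e f y : first_data v e f y ->
  isotropy 3 <[v]>%VS = reflection_subgroup (isotropy 3 <[v]>%VS).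
Proof.
move=> fd; have [[nv e0 f0 _] _ _ _ _] := fd.
apply: (reflection_subgroup_full nv (first_gen fd)) => g [->|->].
  by exists (mirror e); exact: cl_reflection6.
by exists (mirror f); exact: cl_reflection2.
Qed.

(** A reflection in the group is diagonal and cannot fix both axes; the displacement of the axis
    that it moves is polar. *)
Lemma first_mirrors v e f y : first_data v e f y ->
  mirrors_of (isotropy 3 <[v]>%VS) = [set mirror e; mirror f].
Proof.
move=> fd; have [sG tG] := first_mem fd; have [fr [Iv Iy] vy _ act] := fd.
have [nv e0 f0 _] := fr.
apply/seteqP; split; last first.
  move=> _ [->|->]; [exists (cl (rf (1 + w) e)); first exact: sG|exists (cl (rf (-1) f)); first exact: tG].
    exact: cl_reflection6.
  exact: cl_reflection2.
move=> m /(isotropy_mirror_fix nv Iv Iy vy)[u [c [[u0 -> cn1 hB IB] rv]]].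
have [i [j [_ _]]] := act _ hB IB rv; move: (_ ^+ i) (_ ^+ j) => a b ea eb.
have [a11|an1] := eqVneq a 1; last first.
  left; rewrite (rf_mirror ea).
    by rewrite -[X in _ - X]scale1r -scalerBl mirrorZ ?subr_eq0.
  by apply: contra_neq an1 => h; apply: (scale_inj (pos_neq0 e0)); rewrite h scale1r.
have [b11|bn1] := eqVneq b 1; last first.
  right; rewrite (rf_mirror eb).
    by rewrite -[X in _ - X]scale1r -scalerBl mirrorZ ?subr_eq0.
  by apply: contra_neq bn1 => h; apply: (scale_inj (pos_neq0 f0)); rewrite h scale1r.
case/negP: (rf_not_id u0 cn1); apply/eqP; apply: (oframe_ext fr); rewrite mul1mx.
- exact: rv.
- by rewrite ea a11 scale1r.
- by rewrite eb b11 scale1r.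
Qed.

Lemma first_mirrors_e v e f y : first_data v e f y ->
  mirrors_in_orbit 3 (isotropy 3 <[v]>%VS) e #= `I_1.
Proof.
move=> fd; have [he hf] := first_hr fd; have [_ _ _ [[Ie _ _] [If [y' Iy' fy] _] _ _] _] := fd.
have fy' : herm f y' = 1 by rewrite -herm_cj fy cj1.
rewrite /mirrors_in_orbit (first_mirrors fd) (_ : _ `&` _ = [set mirror e]); first exact: card_set1.
apply/seteqP; split=> [m [[->|->]]|_ ->]; [by []| |by split; [left|exact: mirror_self]].
by move/(mirror_orbit12 Ie he hf Iy' fy').
Qed.

Lemma first_mirrors_f v e f y : first_data v e f y ->
  mirrors_in_orbit 3 (isotropy 3 <[v]>%VS) f #= `I_1.
Proof.
move=> fd; have [he hf] := first_hr fd; have [_ _ _ [[Ie [y' Iy' ey] _] [If _ _] _ _] _] := fd.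
have ey' : herm e y' = 1 by rewrite -herm_cj ey cj1.
rewrite /mirrors_in_orbit (first_mirrors fd) (_ : _ `&` _ = [set mirror f]); first exact: card_set1.
apply/seteqP; split=> [m [[->|->]]|_ ->]; [|by []|by split; [right|exact: mirror_self]].
by move/(mirror_orbit21 If hf he Iy' ey').
Qed.

Lemma first_braid v e f y : first_data v e f y ->
  has_braid_length (cl (rf (1 + w) e)) (cl (rf (-1) f)) 2.
Proof.
move=> [fr _ _ _ _]; apply: braid_length2; apply: etrans (torus_mul fr (nm_w1 R) (N1_nm R)) _.
rewrite (torus_sym _ _ fr); apply: esym.
exact: torus_mul (oframe_sym fr) (N1_nm R) (nm_w1 R).
Qed.

Definition v1 : V := cv3 1 0 (-1).
Definition e1 : V := cv3 0 1 0.
Definition f1 : V := cv3 1 0 1.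

Ltac ivec := apply: Ivec_cv3; eis.
Ltac hval := rewrite hermE !vE !(cjE, conj_omega); ring.

Lemma Iv1 : Ivec v1. Proof. by ivec. Qed.
Lemma Ie1 : Ivec e1. Proof. by ivec. Qed.
Lemma If1 : Ivec f1. Proof. by ivec. Qed.
Lemma v1v1 : herm v1 v1 = - 2. Proof. by hval. Qed.
Lemma e1e1 : herm e1 e1 = 1. Proof. by hval. Qed.
Lemma f1f1 : herm f1 f1 = 2%:R. Proof. by hval. Qed.
Lemma e1v1 : herm e1 v1 = 0. Proof. by hval. Qed.
Lemma f1v1 : herm f1 v1 = 0. Proof. by hval. Qed.
Lemma e1f1 : herm e1 f1 = 0. Proof. by hval. Qed.

Lemma hr_v1 : hr v1 = - 2%:R. Proof. by apply: hr_of; rewrite v1v1 rcN rcn. Qed.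
Lemma hr_e1 : hr e1 = 1. Proof. exact: hr_of e1e1. Qed.
Lemma hr_f1 : hr f1 = 2%:R. Proof. by apply: hr_of; rewrite f1f1 rcn. Qed.
Lemma v1_neg : hr v1 < 0. Proof. by rewrite hr_v1; lra. Qed.
Lemma e1_pos : 0 < hr e1. Proof. by rewrite hr_e1; lra. Qed.
Lemma f1_pos : 0 < hr f1. Proof. by rewrite hr_f1; lra. Qed.

Lemma fr1 : oframe v1 e1 f1.
Proof.
split; [exact: v1_neg|exact: e1_pos|exact: f1_pos|].
by split; [exact: e1v1|exact: f1v1|exact: e1f1].
Qed.

Lemma polar_e1 : polar e1.
Proof.
split; first exact: Ie1.
  by exists e1; [exact: Ie1|exact: e1e1].
exists (E0 R), (E2 R); split; [exact: IE0|exact: IE2|by rewrite herm_E1 vE|by rewrite herm_E2 vE].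
Qed.

Lemma polar_f1 : polar f1.
Proof.
split; first exact: If1.
  by exists (E0 R); [exact: IE0|hval].
by exists e1, e1; split; [exact: Ie1|exact: Ie1|exact: e1f1|exact: e1e1].
Qed.

(** An integral vector of norm 1 orthogonal to $(1,0,-1)$ satisfies $2|x_0|^2+|x_1|^2=1$, so it is a
    unit multiple of $(0,1,0)$. *)
Lemma iso1_action A : preserving A -> Imx A -> A *m v1 = v1 ->
  exists a b, [/\ nm a = 1, Eis a, b = 1 \/ b = -1, A *m e1 = a *: e1 & A *m f1 = b *: f1].
Proof.
move=> hA IA ev; have ev1 : A *m v1 = 1 *: v1 by rewrite scale1r.
have o10 : (1 : C) != 0 by rewrite oner_eq0.
have Ix : Ivec (A *m e1) by apply: Ivec_mul => //; exact: Ie1.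
have xv : herm (A *m e1) v1 = 0 := eigen_perp hA ev1 o10 e1v1.
have x02 : (A *m e1) i2 0 = (A *m e1) i0 0.
  by apply/eqP; rewrite -subr_eq0; apply/eqP; rewrite -xv hermE !vE !cjE; ring.
have nx : 2 * nm ((A *m e1) i0 0) + nm ((A *m e1) i1 0) = 1.
  apply: rc_inj; apply: etrans (_ : herm (A *m e1) (A *m e1) = 1); last by rewrite hA; exact: e1e1.
  by rewrite rcD rcM rcn -!nmE hermE x02; ring.
have x0 : (A *m e1) i0 0 = 0.
  apply: Eis_nm_lt1 (Ix i0) _; have := nm_ge0 ((A *m e1) i1 0); lra.
have x1 : nm ((A *m e1) i1 0) = 1 by move: nx; rewrite x0 nm0; lra.
have xe : A *m e1 = (A *m e1) i1 0 *: e1.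
  by apply: cv_eq; rewrite !ccE ?x02 ?x0; ring.
have fv : herm (A *m f1) v1 = 0 := eigen_perp hA ev1 o10 f1v1.
have fe : herm (A *m f1) e1 = 0.
  by apply: (eigen_perp hA xe (nm1_neq0 x1)); exact: (herm_sym0 e1f1).
have [b fb] : exists b, A *m f1 = b *: f1 by eexists; exact: (perp_line fr1 fv fe).
have b1 := eigen_unit hA fb (lt0r_neq0 f1_pos).
have n2 : (2%:R : C) != 0 by rewrite pnatr_eq0.
exists ((A *m e1) i1 0), b; split=> //; apply: half_unit => //.
(* Since $(1,0,1)+(1,0,-1)=2E_0$, integrality of $AE_0$ gives $b\equiv1$ modulo 2. *)
have -> : (b - 1) / 2%:R = (A *m E0 R) i0 0 - 1.
  have : 2%:R * (A *m E0 R) i0 0 = b + 1.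
    rewrite -colZ scalemxAr (_ : 2%:R *: E0 R = f1 + v1); last by apply: cv_eq; rewrite !ccE; ring.
    by rewrite mulmxDr fb ev !ccE mulr1.
  move=> h; apply: (mulfI n2); rewrite mulrBr h mulrCA divff //; ring.
by apply: EisB; [apply: Ivec_mul => //; exact: IE0|exact: Eis1].
Qed.

Lemma first_point : first_data v1 e1 f1 (E2 R).
Proof.
split; [exact: fr1|split; [exact: Iv1|exact: IE2]|by rewrite herm_E2 vE| |].
  by split; [exact: polar_e1|exact: polar_f1|exact: e1e1|exact: f1f1].
move=> A hA IA ev; have [a [b [a1 Ea b1 ea eb]]] := iso1_action hA IA ev.
have [i hi ai] := Eis_unit Ea a1.
have [j hj bj] : exists2 j, (j < 2)%N & b = (-1) ^+ j.
  by case: b1 => ->; [exists 0%N|exists 1%N].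
by exists i, j; rewrite -ai -bj.
Qed.

End FirstPoint.

Section BraidSwap.
Variable gT : groupType.
Implicit Types r s q : gT.
Local Open Scope group_scope.

(** For an involution $s$ and $q=srs$, the relation $rsrs=srsr$ says that $r$ and $q$ commute. The
    two inequalities are shorter relations in the normal form $r^iq^js^k$, with the trivial factors
    written out. *)
Lemma braid_length4_swap r s q : s * s = 1 -> s * r * s = q -> r * q = q * r ->
  r * 1 * s <> 1 * q * s -> r * q * s <> 1 * q * 1 -> has_braid_length r s 4.
Proof.
move=> ss sc comm n23 n14.
have qs : q * s = s * r by rewrite -sc -!mulgA ss mulg1.
apply: braid_length4.
- transitivity (r * q); first by rewrite -sc !mulgA.
  by rewrite comm -sc !mulgA.
- by move=> h; apply: n23; rewrite mulg1 mul1g qs.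
- move=> h; apply: n14; rewrite mul1g mulg1 -{2}sc -[RHS]mulgA.
  by rewrite -mulgA qs h.
Qed.

End BraidSwap.

(** * The isotropy group of order 72 *)

Section SecondPoint.
Variable R : realType.
Local Notation w := (omega : R[i]).
Local Notation C := R[i].
Local Notation V := 'cV[C]_3.
Implicit Types (u z y v e f : V) (A B : 'M[C]_3) (a b l c : C) (g h : PU R).

(** The stabilizer acts by monomial matrices with entries in $\mu_6$ on the axes [e], [f]: it is the
    wreath product $\mu_6\wr S_2$. The vector [p] represents the orbit of mirrors of norm 2. *)
Definition second_data v e f y p := [/\ oframe v e f, Ivec v /\ Ivec y, herm v y = 1,
  [/\ polar e, polar f, herm e e = 1, herm f f = 1 & Ivec p /\ hr p = 2%:R] &
  (forall A, preserving A -> Imx A -> A *m v = v ->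
   exists i j : nat, [/\ (i < 6)%N, (j < 6)%N &
     (A *m e = (1 + w) ^+ i *: e /\ A *m f = (1 + w) ^+ j *: f) \/
     (A *m e = (1 + w) ^+ i *: f /\ A *m f = (1 + w) ^+ j *: e)]) /\
  (forall i : nat, mirror_orbit 3 (mirror p) (mirror ((1 + w) ^+ i *: f - e)))].

(** For orthogonal vectors of norm 1, the reflection along their difference exchanges them. *)
Definition swap e f : 'M[C]_3 := rf (-1) (f - e).

Lemma second_diff v e f y p a : second_data v e f y p -> nm a = 1 -> Eis a ->
  [/\ herm (a *: f - e) (a *: f - e) = 2%:R, hr (a *: f - e) = 2%:R,
      Ivec (a *: f - e), herm (a *: f - e) v = 0 & herm (a *: f - e) (- e) = 1].
Proof.
move=> [[_ _ _ [ev fv ef]] _ _ [[Ie _ _] [If _ _] ee ff _] _] a1 Ea.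
have fe := herm_sym0 ef.
have h : herm (a *: f - e) (a *: f - e) = 2%:R.
  rewrite !hE ee ff ef fe; have := nm_eq1 a1; move: (a^*) => aj aa.
  by transitivity (a * aj + 1); [ring|rewrite aa; ring].
split; first exact: h.
- by apply: hr_of; rewrite h rcn.
- by apply: IvecB => //; apply: IvecZ.
- by rewrite !hE ev fv; ring.
- by rewrite !hE ee fe; ring.
Qed.

Lemma swap_act v e f y p : second_data v e f y p ->
  [/\ 0 < hr (f - e), preserving (swap e f), swap e f *m v = v, swap e f *m e = f & swap e f *m f = e].
Proof.
move=> sd; have := second_diff sd (nm1 R) (Eis1 R); rewrite scale1r => -[dd hd _ dv _].
have [[_ _ _ [ev fv ef]] _ _ [_ _ ee ff _] _] := sd; have fe := herm_sym0 ef.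
have d0 : 0 < hr (f - e) by rewrite hd ltr0n.
have n2 : (2%:R : C) != 0 by rewrite pnatr_eq0.
split; first exact: d0.
- exact: rf_preserving d0 (N1_nm R).
- exact: rf_perp _ (herm_sym0 dv).
- rewrite /swap rfE dd (_ : herm e (f - e) = -1); last by rewrite !hE ef ee; ring.
  by rewrite (_ : (-1 - 1) * _ = 1 :> C); [rewrite scale1r addrC subrK|field].
- rewrite /swap rfE dd (_ : herm f (f - e) = 1); last by rewrite !hE fe ff; ring.
  by rewrite (_ : (-1 - 1) * _ = -1 :> C); [rewrite scaleN1r opprB addrC subrK|field].
Qed.

(** The normal form of monomial elements; its uniqueness ([cl_mon_inj]) gives the order
    $6\cdot6\cdot2$. *)
Definition mon a b (s : bool) e f : 'M[C]_3 := torus a b e f *m (if s then swap e f else 1%:M).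

Lemma mon_act v e f y p a b s : second_data v e f y p ->
  [/\ mon a b s e f *m v = v, mon a b s e f *m e = (if s then b *: f else a *: e)
    & mon a b s e f *m f = (if s then a *: e else b *: f)].
Proof.
move=> sd; have [_ _ sv se sf] := swap_act sd; have [fr _ _ _ _] := sd.
have tv := torus_v a b fr; have te := torus_u a b fr; have tf := torus_u' a b fr.
rewrite /mon; case: s; split.
- by rewrite (mulmx_step _ sv).
- by rewrite (mulmx_step _ se).
- by rewrite (mulmx_step _ sf).
- by rewrite mulmx1.
- by rewrite mulmx1.
- by rewrite mulmx1.
Qed.

Lemma mon_preserving v e f y p a b s : second_data v e f y p -> nm a = 1 -> nm b = 1 ->
  preserving (mon a b s e f).
Proof.
move=> sd a1 b1; have [_ hS _ _ _] := swap_act sd; have [fr _ _ _ _] := sd.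
apply: preservingM; first exact: torus_preserving fr a1 b1.
by case: s; [exact: hS|exact: preserving1].
Qed.

Lemma frame_indep (e f : V) a b : herm e e = 1 -> herm f e = 0 -> nm a = 1 -> a *: e <> b *: f.
Proof.
move=> ee fe a1 h; have : herm (a *: e) e = 0 by rewrite h hermZl fe mulr0.
by rewrite hermZl ee mulr1 => a0; move: a1; rewrite a0 nm0 => /eqP; rewrite eq_sym oner_eq0.
Qed.

Lemma cl_mon_inj v e f y p a b s a' b' s' : second_data v e f y p ->
  nm a = 1 -> nm b = 1 -> nm a' = 1 -> nm b' = 1 ->
  cl (mon a b s e f) = cl (mon a' b' s' e f) -> [/\ a = a', b = b' & s = s'].
Proof.
move=> sd a1 b1 a'1 b'1 h; have [[nv e0 f0 [_ _ ef]] _ _ [_ _ ee ff _] _] := sd.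
have fe := herm_sym0 ef.
have [mv me mf] := mon_act a b s sd; have [mv' me' mf'] := mon_act a' b' s' sd.
have {}h : mon a b s e f = mon a' b' s' e f.
  exact: cl_fix_inj (hr_v0 nv) (mon_preserving s sd a1 b1) (mon_preserving s' sd a'1 b'1) mv mv' h.
rewrite h in me mf; move: (etrans (esym me') me) (etrans (esym mf') mf).
have [en fn] := (pos_neq0 e0, pos_neq0 f0).
case: s {h me mf mv mv'} => //; case: s' {me' mf'} => // h1 h2.
- by split; [rewrite (scale_inj en h2)|rewrite (scale_inj fn h1)|].
- by case: (frame_indep ee fe a'1 h1).
- by case: (frame_indep ee fe a1 (esym h1)).
- by split; [rewrite (scale_inj en h1)|rewrite (scale_inj fn h2)|].
Qed.

Lemma mon_mul v e f y p a b s : second_data v e f y p -> nm a = 1 -> nm b = 1 ->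
  (cl (rf a e) * cl (rf b f) * (if s then cl (swap e f) else 1))%g = cl (mon a b s e f).
Proof.
move=> sd a1 b1; have [_ hS _ _ _] := swap_act sd; have [fr _ _ _ _] := sd.
have hT := torus_preserving fr a1 b1.
have -> : (if s then cl (swap e f) else 1%g) = cl (if s then swap e f else 1%:M).
  by case: s; rewrite ?cl1.
rewrite (torus_mul fr a1 b1); apply: esym; apply: clM; first exact: hT.
by case: s; [exact: hS|exact: preserving1].
Qed.

Lemma second_mem v e f y p : second_data v e f y p ->
  [/\ isotropy 3 <[v]>%VS (cl (rf (1 + w) e)), isotropy 3 <[v]>%VS (cl (rf (1 + w) f))
    & isotropy 3 <[v]>%VS (cl (swap e f))].
Proof.
move=> sd; have := second_diff sd (nm1 R) (Eis1 R); rewrite scale1r => -[dd hd Id dv _].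
have [[nv _ _ [ev fv _]] _ _ [[Ie _ _] [If _ _] ee ff _] _] := sd; split.
- exact: rf_isotropy6.
- exact: rf_isotropy6.
- exact: rf_isotropy2.
Qed.

Lemma nm_w1X (i : nat) : nm ((1 + w) ^+ i) = 1.
Proof. by rewrite nmX nm_w1 expr1n. Qed.

Lemma second_isotropyE v e f y p : second_data v e f y p -> isotropy 3 <[v]>%VS =
  range (fun t : 'I_6 * 'I_6 * bool => cl (mon ((1 + w) ^+ t.1.1) ((1 + w) ^+ t.1.2) t.2 e f)).
Proof.
move=> sd; have [rG qG sG] := second_mem sd.
have [fr [Iv Iy] vy _ [act _]] := sd; have [nv e0 f0 _] := fr.
have hG := isotropy_subgroup nv; have [G1 gM _] := hG.
apply/seteqP; split; last first.
  move=> _ [[[i j] s] _ <-].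
  rewrite -(mon_mul s sd (nm_w1X i) (nm_w1X j)); apply: (gM); last first.
    by case: s; [exact: sG|exact: G1].
  apply: (gM).
    by have := is_subgroupX i hG rG; rewrite (rf_pow i e0 (nm_w1 R)).
  by have := is_subgroupX j hG qG; rewrite (rf_pow j f0 (nm_w1 R)).
move=> g /(isotropyP _ nv)[A [hA IA [l ev] ->]].
have [B [hB IB eB [k [k1 Ek] AB]]] := isotropy_scale nv Iv Iy vy hA IA ev.
rewrite AB (clZ k1 hB).
have [i [j [hi hj []]]] := act B hB IB eB => -[ei ej].
  have [mv me mf] := mon_act ((1 + w) ^+ i) ((1 + w) ^+ j) false sd.
  exists (Ordinal hi, Ordinal hj, false); first by [].
  congr cl; apply: (oframe_ext fr).
  - exact: etrans mv (esym eB).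
  - exact: etrans me (esym ei).
  - exact: etrans mf (esym ej).
have [mv me mf] := mon_act ((1 + w) ^+ j) ((1 + w) ^+ i) true sd.
exists (Ordinal hj, Ordinal hi, true); first by [].
congr cl; apply: (oframe_ext fr).
- exact: etrans mv (esym eB).
- exact: etrans me (esym ei).
- exact: etrans mf (esym ej).
Qed.

Lemma second_card v e f y p : second_data v e f y p -> isotropy 3 <[v]>%VS #= `I_72.
Proof.
move=> sd.
suff inj : injective (fun t : 'I_6 * 'I_6 * bool => cl (mon ((1 + w) ^+ t.1.1) ((1 + w) ^+ t.1.2) t.2 e f)).
  by have := card_range inj (second_isotropyE sd); rewrite !card_prod !card_ord card_bool.
move=> [[i j] s] [[i' j'] s'] h.
have [h1 h2 h3] := cl_mon_inj sd (nm_w1X i) (nm_w1X j) (nm_w1X i') (nm_w1X j') h.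
by move: h3 => /= ->; rewrite (w1_exp_inj h1) (w1_exp_inj h2).
Qed.

Lemma swap_sqr v e f y p : second_data v e f y p -> (cl (swap e f) * cl (swap e f))%g = 1%g.
Proof.
move=> sd; have [d0 hS _ _ _] := swap_act sd.
apply: etrans (esym (clM hS hS)) _; rewrite -cl1; congr cl.
by apply: etrans (esym (rfM _ _ d0)) _; rewrite mulN1r opprK; exact: rf1.
Qed.

Lemma swap_conj v e f y p : second_data v e f y p ->
  (cl (swap e f) * cl (rf (1 + w) e) * cl (swap e f))%g = cl (rf (1 + w) f).
Proof.
move=> sd; have [d0 hS sv se sf] := swap_act sd; have [fr _ _ _ _] := sd.
have [nv e0 f0 [ev fv ef]] := fr; have hr' := rf_preserving e0 (nm_w1 R).
rewrite -(clM hS hr'); apply: etrans (esym (clM (preservingM hS hr') hS)) _; congr cl.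
apply: (oframe_ext fr).
- apply: etrans (mulmx_step _ sv) _; apply: etrans (mulmx_step _ (rf_perp _ (herm_sym0 ev))) _.
  exact: etrans sv (esym (rf_perp _ (herm_sym0 fv))).
- apply: etrans (mulmx_step _ se) _; apply: etrans (mulmx_step _ (rf_perp _ (herm_sym0 ef))) _.
  exact: etrans sf (esym (rf_perp _ ef)).
- apply: etrans (mulmx_step _ sf) _; apply: etrans (mulmx_step _ (rf_axis _ e0)) _.
  apply: etrans (esym (scalemxAr _ _ _)) _.
  exact: etrans (congr1 (fun z => (1 + w) *: z) se) (esym (rf_axis _ f0)).
Qed.

Lemma second_gen v e f y p : second_data v e f y p ->
  isotropy 3 <[v]>%VS = generated [set cl (rf (1 + w) e); cl (swap e f)].
Proof.
move=> sd; have [rG qG sG] := second_mem sd; have [[nv e0 f0 _] _ _ _ _] := sd.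
apply/seteqP; split; last first.
  by apply: generated_sub; [exact: isotropy_subgroup nv|move=> _ [->|->]].
rewrite (second_isotropyE sd) => _ [[[i j] s] _ <-].
rewrite -(mon_mul s sd (nm_w1X i) (nm_w1X j)).
set S := [set _; _]; have gS := generated_subgroup S; have [g1 gM _] := gS.
have hr' : generated S (cl (rf (1 + w) e)) by apply: sub_generated; left.
have hs : generated S (cl (swap e f)) by apply: sub_generated; right.
have hq : generated S (cl (rf (1 + w) f)).
  exact: (@eq_ind _ _ (generated S) (gM _ _ (gM _ _ hs hr') hs) _ (swap_conj sd)).
apply: (gM); last by case: s; [exact: hs|exact: g1].
apply: (gM).
  by have := is_subgroupX i gS hr'; rewrite (rf_pow i e0 (nm_w1 R)).
by have := is_subgroupX j gS hq; rewrite (rf_pow j f0 (nm_w1 R)).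
Qed.

Lemma second_reflections v e f y p : second_data v e f y p ->
  isotropy 3 <[v]>%VS = reflection_subgroup (isotropy 3 <[v]>%VS).
Proof.
move=> sd; have [[nv e0 f0 _] _ _ _ _] := sd; have [d0 _ _ _ _] := swap_act sd.
apply: (reflection_subgroup_full nv (second_gen sd)) => g [->|->].
  by exists (mirror e); exact: cl_reflection6.
by exists (mirror (f - e)); exact: cl_reflection2.
Qed.

Lemma second_braid v e f y p : second_data v e f y p ->
  has_braid_length (cl (rf (1 + w) e)) (cl (swap e f)) 4.
Proof.
move=> sd; have ss := swap_sqr sd; have sc := swap_conj sd; have [fr _ _ _ _] := sd.
have [nv e0 f0 _] := fr.
have [w1 o1] := (nm_w1 R, nm1 R).
have comm : (cl (rf (1 + w) e) * cl (rf (1 + w) f) = cl (rf (1 + w) f) * cl (rf (1 + w) e))%g.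
  apply: etrans (torus_mul fr w1 w1) _; rewrite (torus_sym _ _ fr); apply: esym.
  exact: (torus_mul (oframe_sym fr) w1 w1).
have one_e : cl (rf 1 e) = 1%g by rewrite (rf1 e0) cl1.
have one_f : cl (rf 1 f) = 1%g by rewrite (rf1 f0) cl1.
have m1 := mon_mul true sd w1 w1; have m4 := mon_mul false sd o1 w1.
have m2 := etrans (congr1 (fun g => cl (rf (1 + w) e) * g * cl (swap e f))%g (esym one_f)) (mon_mul true sd w1 o1).
have m3 := etrans (congr1 (fun g => g * cl (rf (1 + w) f) * cl (swap e f))%g (esym one_e)) (mon_mul true sd o1 w1).
have m5 := etrans (congr1 (fun g => g * cl (rf (1 + w) f) * 1)%g (esym one_e)) m4.
apply: (braid_length4_swap ss sc comm) => h.
  have [h1 _ _] := cl_mon_inj sd w1 o1 o1 w1 (etrans (etrans (esym m2) h) m3).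
  by have := w1_neq1 R; rewrite h1 eqxx.
by have [_ _ h1] := cl_mon_inj sd w1 w1 o1 w1 (etrans (etrans (esym m1) h) m5).
Qed.

(** A diagonal reflection has [e] or [f] as polar vector. One that exchanges the axes sends [e] to
    $(1+\omega)^kf$, and this displacement is its polar vector, one for each of the six units. *)
Lemma second_mirrors v e f y p : second_data v e f y p ->
  mirrors_of (isotropy 3 <[v]>%VS) =
  [set mirror e; mirror f] `|` range (fun k : 'I_6 => mirror ((1 + w) ^+ k *: f - e)).
Proof.
move=> sd; have [rG qG sG] := second_mem sd; have [fr [Iv Iy] vy _ [act _]] := sd.
have [nv e0 f0 _] := fr; have [_ _ _ [_ _ ee ff _] _] := sd; have [_ _ _ [_ _ ef]] := fr.
apply/seteqP; split; last first.
  move=> _ [[->|->]|[k _ <-]].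
  - by exists (cl (rf (1 + w) e)); [exact: rG|exact: cl_reflection6].
  - by exists (cl (rf (1 + w) f)); [exact: qG|exact: cl_reflection6].
  have [dd hd Id dv _] := second_diff sd (nm_w1X k) (EisX k (Eis_1w R)).
  have d0 : 0 < hr ((1 + w) ^+ k *: f - e) by rewrite hd ltr0n.
  by exists (cl (rf (-1) ((1 + w) ^+ k *: f - e))); [exact: rf_isotropy2|exact: cl_reflection2].
move=> m /(isotropy_mirror_fix nv Iv Iy vy)[u [c [[u0 -> cn1 hB IB] rv]]].
have [i [j [hi hj []]]] := act _ hB IB rv; last first.
  move=> [ei _]; right; exists (Ordinal hi); first by [].
  apply: esym; apply: (rf_mirror ei); apply/eqP => h.
  by apply: (@frame_indep e f 1 _ ee (herm_sym0 ef) (nm1 R)); rewrite scale1r -h.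
move: {hi hj} (_ ^+ i) (_ ^+ j) => a b [ea eb]; left.
have [a11|an1] := eqVneq a 1; last first.
  left; rewrite (rf_mirror ea).
    by rewrite -[X in _ - X]scale1r -scalerBl mirrorZ ?subr_eq0.
  by apply: contra_neq an1 => h; apply: (scale_inj (pos_neq0 e0)); rewrite h scale1r.
have [b11|bn1] := eqVneq b 1; last first.
  right; rewrite (rf_mirror eb).
    by rewrite -[X in _ - X]scale1r -scalerBl mirrorZ ?subr_eq0.
  by apply: contra_neq bn1 => h; apply: (scale_inj (pos_neq0 f0)); rewrite h scale1r.
case/negP: (rf_not_id u0 cn1); apply/eqP; apply: (oframe_ext fr); rewrite mul1mx.
- exact: rv.
- by rewrite ea a11 scale1r.
- by rewrite eb b11 scale1r.
Qed.

Lemma second_hr v e f y p : second_data v e f y p -> hr e = 1 /\ hr f = 1.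
Proof. by move=> [_ _ _ [_ _ ee ff _] _]; split; exact: hr_of. Qed.

Lemma second_orbit v e f y p : second_data v e f y p -> mirror_orbit 3 (mirror e) (mirror f).
Proof.
move=> sd; have [_ _ sG] := second_mem sd; have [_ hS _ se _] := swap_act sd.
exists (cl (swap e f)); first by case: sG.
by rewrite (act_mirror _ hS) se.
Qed.

Lemma second_mirrors_e v e f y p : second_data v e f y p ->
  mirrors_in_orbit 3 (isotropy 3 <[v]>%VS) e #= `I_2.
Proof.
move=> sd; have [he hf] := second_hr sd; have [[_ e0 f0 [_ _ ef]] _ _ [[Ie _ _] _ ee _ _] _] := sd.
have := @card_range bool _ (fun b : bool => if b then mirror e else mirror f)
  (mirrors_in_orbit 3 (isotropy 3 <[v]>%VS) e).
rewrite card_bool; apply.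
  have ne : mirror e <> mirror f.
    move=> /(mirror_inj e0 f0)[c c0 fE]; have := herm_sym0 ef.
    by rewrite fE hermZl ee mulr1 => c00; rewrite c00 eqxx in c0.
  by move=> [] [] h; [exact: erefl|case: (ne h)|case: (ne (esym h))|exact: erefl].
rewrite /mirrors_in_orbit (second_mirrors sd); apply/seteqP; split.
  move=> m [[[->|->]|[k _ <-]] ho]; [by exists true|by exists false|].
  have [_ hd _ _ de] := second_diff sd (nm_w1X k) (EisX k (Eis_1w R)).
  by case: (mirror_orbit12 Ie he hd (IvecN Ie) de ho).
move=> m [[] _ <-]; first by split; [left; left|exact: mirror_self].
by split; [left; right|exact: second_orbit sd].
Qed.

Lemma second_mirrors_p v e f y p : second_data v e f y p ->
  mirrors_in_orbit 3 (isotropy 3 <[v]>%VS) p #= `I_6.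
Proof.
move=> sd; have [he hf] := second_hr sd.
have [[_ e0 f0 [_ _ ef]] _ _ [[_ [e' Ie' ee'] _] [_ [f' If' ff'] _] ee ff [Ip hp]] [_ po]] := sd.
have eh : herm e e' = 1 by rewrite -herm_cj ee' cj1.
have fh : herm f f' = 1 by rewrite -herm_cj ff' cj1.
have := @card_range 'I_6 _ (fun k : 'I_6 => mirror ((1 + w) ^+ k *: f - e)) (mirrors_in_orbit 3 (isotropy 3 <[v]>%VS) p).
rewrite card_ord; apply.
  move=> i j; have [_ hi _ _ _] := second_diff sd (nm_w1X i) (EisX i (Eis_1w R)).
  have [_ hj _ _ _] := second_diff sd (nm_w1X j) (EisX j (Eis_1w R)).
  move=> /mirror_inj[||c c0 h]; [by rewrite hi ltr0n|by rewrite hj ltr0n|].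
  apply: w1_exp_inj; have fe := herm_sym0 ef.
  have h1 := congr1 (fun z => herm z e) h; have h2 := congr1 (fun z => herm z f) h; move: h1 h2.
  rewrite !hE ee ff ef fe => h1 h2.
  have c1 : c = 1 by apply/eqP; rewrite -eqr_opp; apply/eqP; transitivity (c * ((1 + w) ^+ i * 0 - 1)); [ring|rewrite -h1; ring].
  by move: h2; rewrite c1 mul1r !mulr1 !subr0 => h2; exact: esym h2.
rewrite /mirrors_in_orbit (second_mirrors sd); apply/seteqP; split.
  move=> m [[[->|->]|[k _ <-]] ho]; last by exists k.
    by case: (mirror_orbit21 Ip hp he Ie' eh ho).
  by case: (mirror_orbit21 Ip hp hf If' fh ho).
by move=> m [k _ <-]; split; [right; exists k|exact: po].
Qed.

End SecondPoint.

(** * Vectors and stabilizer at $(1,0,\bar\omega)$ *)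

Section SecondPointData.
Variable R : realType.
Local Notation w := (omega : R[i]).
Local Notation C := R[i].
Local Notation V := 'cV[C]_3.
Local Notation e1 := (e1 R).
Local Notation f1 := (f1 R).
Implicit Types (u z y v : V) (A B : 'M[C]_3) (a b l c : C).

Definition v2 : V := cv3 1 0 w^*.
Definition e2 : V := cv3 1 0 (- w).
Definition d2 : V := cv3 1 (-1) (- w).

Ltac ivec := apply: Ivec_cv3; eis.
Ltac hval := rewrite hermE !vE !(cjE, conj_omega); ring: (omega2 R).

Lemma Iv2 : Ivec v2. Proof. by ivec. Qed.
Lemma Ie2 : Ivec e2. Proof. by ivec. Qed.
Lemma v2v2 : herm v2 v2 = - 1. Proof. by hval. Qed.
Lemma e2e2 : herm e2 e2 = 1. Proof. by hval. Qed.
Lemma e1v2 : herm e1 v2 = 0. Proof. by hval. Qed.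
Lemma e2v2 : herm e2 v2 = 0. Proof. by hval. Qed.
Lemma e1e2 : herm e1 e2 = 0. Proof. by hval. Qed.

Lemma hr_v2 : hr v2 = - 1. Proof. by apply: hr_of; rewrite v2v2 rcN. Qed.
Lemma v2_neg : hr v2 < 0. Proof. by rewrite hr_v2; lra. Qed.
Lemma e2_pos : 0 < hr e2. Proof. by rewrite (hr_of e2e2); lra. Qed.

Lemma fr2 : oframe v2 e1 e2.
Proof.
split; [exact: v2_neg|exact: e1_pos|exact: e2_pos|].
by split; [exact: e1v2|exact: e2v2|exact: e1e2].
Qed.

Lemma polar_e2 : polar e2.
Proof.
split; first exact: Ie2.
  by exists e2; [exact: Ie2|exact: e2e2].
by exists e1, e1; split; [exact: Ie1|exact: Ie1|exact: e1e2|exact: e1e1].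
Qed.

Lemma d2E : d2 = e2 - e1.
Proof. by apply: cv_eq; rewrite !ccE; ring. Qed.

Lemma d2d2 : herm d2 d2 = 2%:R. Proof. by hval. Qed.

Lemma polar_d2 : polar d2.
Proof.
split; first by ivec.
  by exists (cv3 0 (-1) 0); [ivec|hval].
by exists (cv3 0 1 1), e1; split; [ivec|exact: Ie1|hval|hval].
Qed.

Lemma nm_sum1 a b : Eis a -> Eis b -> nm a + nm b = 1 -> (a = 0 /\ nm b = 1) \/ (b = 0 /\ nm a = 1).
Proof.
move=> Ea Eb h; have [a0|a0] := eqVneq a 0.
  by left; split=> //; move: h; rewrite a0 nm0 add0r.
right; have a1 := Eis_nm_ge1 Ea a0; have b0 := nm_ge0 b.
have bz : nm b = 0 by lra.
by split; [apply/eqP; rewrite -nm_eq0 bz|lra].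
Qed.

Lemma iso2_action A : preserving A -> Imx A -> A *m v2 = v2 ->
  exists a b, [/\ nm a = 1, Eis a, nm b = 1, Eis b &
   (A *m e1 = a *: e1 /\ A *m e2 = b *: e2) \/ (A *m e1 = a *: e2 /\ A *m e2 = b *: e1)].
Proof.
move=> hA IA ev; have ev1 : A *m v2 = 1 *: v2 by rewrite scale1r.
have o10 : (1 : C) != 0 by rewrite oner_eq0.
have Ix : Ivec (A *m e1) := Ivec_mul IA (Ie1 R).
have Iz : Ivec (A *m e2) := Ivec_mul IA Ie2.
have xv : herm (A *m e1) v2 = 0 := eigen_perp hA ev1 o10 e1v2.
have zv : herm (A *m e2) v2 = 0 := eigen_perp hA ev1 o10 e2v2.
have x02 : (A *m e1) i2 0 = - w * (A *m e1) i0 0.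
  apply/eqP; rewrite -subr_eq0; apply/eqP; rewrite -xv hermE !vE !cjE; ring.
have nx : nm ((A *m e1) i0 0) + nm ((A *m e1) i1 0) = 1.
  apply: rc_inj; apply: etrans (_ : herm (A *m e1) (A *m e1) = 1); last by rewrite hA; exact: e1e1.
  by rewrite rcD -!nmE hermE x02 !cjE conj_omega; ring.
case: (nm_sum1 (Ix i0) (Ix i1) nx) => -[x0 x1].
  have xe : A *m e1 = (A *m e1) i1 0 *: e1.
    by apply: cv_eq; rewrite !ccE ?x02 ?x0; ring.
  have ze : herm (A *m e2) e1 = 0.
    by apply: (eigen_perp hA xe (nm1_neq0 x1)); exact: (herm_sym0 e1e2).
  have := perp_line fr2 zv ze; rewrite e2e2 divr1 => zE.
  exists ((A *m e1) i1 0), (herm (A *m e2) e2); split.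
  - exact: x1.
  - exact: Ix.
  - exact: eigen_unit hA zE (lt0r_neq0 e2_pos).
  - exact: Eis_herm Iz Ie2.
  - by left.
have xe : A *m e1 = (A *m e1) i0 0 *: e2.
  by apply: cv_eq; rewrite !ccE ?x02 ?x0; ring.
have ze : herm (A *m e2) e2 = 0.
  have : herm (A *m e2) (A *m e1) = 0 by rewrite hA; exact: (herm_sym0 e1e2).
  by rewrite xe hermZr => /eqP; rewrite mulf_eq0 conjC_eq0 (negPf (nm1_neq0 x1)) => /eqP.
have := perp_line (oframe_sym fr2) zv ze; rewrite e1e1 divr1 => zE.
exists ((A *m e1) i0 0), (herm (A *m e2) e1); split.
- exact: x1.
- exact: Ix.
- have := preserving_hr e2 hA; rewrite zE hrZ (hr_of e2e2) hr_e1 mulr1 => <-.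
  by rewrite -zE.
- exact: Eis_herm Iz (Ie1 R).
- by right.
Qed.

Definition g2 : 'M[C]_3 := frame_mx (E2 R) (cv3 0 1 1) (cv3 1 (-1) (- w - 1)).

Lemma g2_frame : hframe (E2 R) (cv3 0 1 1) (cv3 1 (-1) (- w - 1)).
Proof.
split; first by split; [exact: IE2|ivec|ivec].
  by split; hval.
by split; hval.
Qed.

Lemma g2_f1 : g2 *m f1 = e2 - e1.
Proof. by rewrite frame_mxE; apply: cv_eq; rewrite !ccE; ring. Qed.

(** [g2] carries $(1,0,1)$ to $e_2-e_1$, and the diagonal reflection along [e2] then multiplies [e2]
    alone by the unit [a]. *)
Lemma f1_orbit a : nm a = 1 -> Eis a -> mirror_orbit 3 (mirror f1) (mirror (a *: e2 - e1)).
Proof.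
move=> a1 Ea; apply: (@mirror_orbitI R (rf a e2 *m g2) _ _ 1); last 2 first.
- exact: oner_neq0.
- apply: etrans (mulmx_step _ g2_f1) _.
  rewrite mulmxBr (rf_axis _ e2_pos) scale1r; congr (_ - _).
  exact: rf_perp _ e1e2.
- by apply: preservingM; [exact: rf_preserving e2_pos a1|exact: frame_preserving g2_frame].
apply: ImxM; last exact: frame_Imx g2_frame.
by apply: rf_Imx; [exact: Ie2|rewrite e2e2 divr1; apply: EisB => //; exact: Eis1].
Qed.

Lemma second_point : second_data v2 e1 e2 (E2 R) f1.
Proof.
split; [exact: fr2|by split; [exact: Iv2|exact: IE2]|by rewrite herm_E2 vE| |].
  by split; [exact: polar_e1|exact: polar_e2|exact: e1e1|exact: e2e2|split; [exact: If1|exact: hr_f1]].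
split; last by move=> i; apply: f1_orbit; [exact: nm_w1X|apply: EisX; exact: Eis_1w].
move=> A hA IA ev; have [a [b [a1 Ea b1 Eb h]]] := iso2_action hA IA ev.
have [i hi ai] := Eis_unit Ea a1; have [j hj bj] := Eis_unit Eb b1.
by exists i, j; rewrite -ai -bj; split.
Qed.

End SecondPointData.

(** * Cyclic isotropy groups and irrationality of fixed points *)

Section Cyclic.
Variable R : realType.
Local Notation w := (omega : R[i]).
Local Notation C := R[i].
Local Notation V := 'cV[C]_3.
Implicit Types (u z y v : V) (A B : 'M[C]_3) (a b l c : C) (g h : PU R).

Lemma cyclic_inj (gT : groupType) (g : gT) (n : nat) :
  (forall k, (0 < k < n)%N -> (g ^+ k)%g <> 1%g) -> injective (fun i : 'I_n => (g ^+ i)%g).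
Proof.
move=> hk i j /= e; apply: val_inj => /=.
wlog ij : i j e / (i <= j)%N.
  by move=> H; case: (leqP i j) => [|/ltnW] h; [exact: H|apply/esym; exact: H].
have : (g ^+ (j - i))%g = 1%g.
  by apply: (mulIg (g ^+ i)%g); rewrite -expgnDr subnK // mul1g.
have [ji|ji] := posnP (j - i); last first.
  by move/(hk (j - i)%N); rewrite ji (leq_ltn_trans (leq_subr _ _) (ltn_ord j)) => /(_ isT).
by move=> _; apply/eqP; rewrite eqn_leq ij -subn_eq0 ji.
Qed.

Lemma fixed_points_simple A v l : preserving A -> hr v < 0 -> A *m v = l *: v ->
  simple_at A v l -> fixed_points [set cl A] = [set <[v]>%VS].
Proof.
move=> hA nv ev sA; apply/seteqP; split=> x.
  move=> [/H2_line[u nu ->] /(_ _ erefl)/(fixes_lineP hA nu)[c c0 eu]].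
  by apply/line_eqP; [exact: hr_v0 nv|exact: neg_eigen_unique hA nv ev sA nu eu].
move=> ->; split; first exact/H2P.
move=> _ ->; apply/fixes_lineP => //; exists l => //.
exact: nm1_neq0 (eigen_unit hA ev (ltr0_neq0 nv)).
Qed.

(** An eigenspace of dimension two or more would contain a nonzero vector with last coordinate 0. *)
Lemma simple_last A v l : hr v < 0 -> A *m v = l *: v ->
  (forall z, A *m z = l *: z -> z i2 0 = 0 -> z = 0) -> simple_at A v l.
Proof.
move=> nv ev h z zv ez; have v20 := neg_last nv.
have zE : z = (z i2 0 / v i2 0) *: v.
  apply/eqP; rewrite -subr_eq0; apply/eqP; apply: h.
    by rewrite mulmxBr ez -scalemxAr ev; apply: cv_eq; rewrite !ccE; ring.
  by rewrite !ccE divfK // subrr.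
move: zv; rewrite {1}zE hermZl => /eqP; rewrite mulf_eq0 (negPf (hr_neq0 nv)) orbF => /eqP k0.
by rewrite zE k0 scale0r.
Qed.

Lemma simple_sqr A v l : l != 0 -> simple_at A v l -> (forall z, A *m (A *m (A *m z)) = l ^+ 3 *: z) ->
  simple_at (A *m A) v (l ^+ 2).
Proof.
move=> l0 sA h3 z zv; rewrite -mulmxA => e; apply: sA => //.
have := h3 z; rewrite e -scalemxAr (exprSr l 2) -scalerA.
by apply: scalerI; rewrite expf_neq0.
Qed.

Lemma not_scalar A u : u != 0 -> (forall k : C, A *m u <> k *: u) -> preserving A -> cl A <> 1%g.
Proof.
move=> u0 h hA; rewrite -cl1 => /(cl_eq hA (@preserving1 R))[k k0 e].
by apply: (h k); rewrite e -scalemxAl mul1mx.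
Qed.

Lemma integral_root (z : C) (n : nat) (c : C) : (0 < n)%N -> (c = 1 \/ c = -1) -> z ^+ n = c -> Krat z -> Eis z.
Proof.
move=> n0 hc zn Kz; rewrite -ring_of_integersE; split=> //.
have [p pm pz] : exists2 p : {poly int}, p \is monic & root (map_poly (intr : int -> C) p) z.
  case: hc => ce.
    exists ('X^n - 1%:P); first by apply: monicXnsubC.
    by rewrite /root rmorphB rmorph1 /= map_polyXn !hornerE zn ce subrr.
  exists ('X^n - (-1)%:P); first by apply: monicXnsubC.
  by rewrite /root rmorphB /= map_polyXn map_polyC /= !hornerE zn ce rmorphN rmorph1 subrr.
by exists p.
Qed.

(** A ninth root of unity in $K$ is a unit of $O$, hence a sixth root of unity; but then
    $\omega^2=l^6=1$. *)
Lemma not_Krat_cube (l : C) : Krat l -> l ^+ 3 = w -> False.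
Proof.
move=> Kl l3.
have El : Eis l.
  apply: (@integral_root l 9 1) => //; first by left.
  by rewrite (exprM l 3 3) l3 omega3.
have l1 : nm l = 1.
  by apply/eqP; rewrite -(@pexpr_eq1 _ _ 3) ?nm_ge0 // -nmX l3 nm_omega.
have [k hk lE] := Eis_unit El l1.
have : w ^+ 2 = 1 by rewrite -l3 -exprM lE exprAC w1_6 expr1n.
rewrite omega2 => h; have := Im_omega_gt0 R; have : complex.Im (-1 - w) = 0 by rewrite h.
by rewrite cImD !cImN cIm1; move: (complex.Im _) => x xN x0; clear -xN x0; lra.
Qed.

Lemma not_Krat_ii : ~ Krat (iunit R).
Proof.
move=> K; have E : Eis (iunit R) by apply: (@integral_root _ 2 (-1)) => //; [right|exact: ii2].
by have := Eis_sqr_neq E; rewrite ii2 addNr eqxx.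
Qed.

(** On a representative over $K$, the eigenvalue would be the quotient of a coordinate of the image
    by the same coordinate of the vector. *)
Lemma no_rational A v l : Imx A -> v != 0 -> A *m v = l *: v -> ~ Krat l ->
  no_rational_representative 3 <[v]>%VS.
Proof.
move=> IA v0 ev nK [u uE Ku]; have [c c0 Iu] := Krat_multiple Ku.
have [k k0 vu] := (line_eqP u v0).1 (esym uE).
have eu : A *m (c *: u) = l *: (c *: u).
  by rewrite vu -!scalemxAr ev !scalerA; congr (_ *: _); ring.
have u0 : c *: u != 0 by rewrite scaler_eq0 negb_or c0 vu scaler_eq0 negb_or k0.
have [i ui] : exists i, (c *: u) i 0 != 0.
  apply: contrapT => h; case/negP: u0; apply/eqP/colP => i; rewrite [RHS]mxE.
  by apply/eqP; apply: contrapT => /negP hi; apply: h; exists i.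
apply: nK; have -> : l = (A *m (c *: u)) i 0 / (c *: u) i 0 by rewrite eu colZ mulfK.
by apply: Krat_div => //; exact: Ivec_mul.
Qed.

End Cyclic.

(** * The isotropy group of order 3 *)

Section ThirdPoint.
Variable R : realType.
Local Notation w := (omega : R[i]).
Local Notation C := R[i].
Local Notation V := 'cV[C]_3.
Local Notation l := (nonary R).
Local Notation E0 := (E0 R).
Local Notation E1 := (E1 R).
Local Notation E2 := (E2 R).
Implicit Types (u z y v : V) (A B : 'M[C]_3) (a b c : C) (g h : PU R).

Definition M3 : 'M[C]_3 := mx3 w w 1 1 (- w) 0 1 0 0.

Ltac ivec := apply: Ivec_cv3; eis.
Ltac hval := rewrite hermE !vE !(cjE, conj_omega); ring: (omega2 R).

Lemma M3_frame : hframe (cv3 w 1 1) (cv3 w (- w) 0) E0.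
Proof.
split; first by split; [ivec|ivec|exact: IE0].
  by split; hval.
by split; hval.
Qed.

Lemma M3E : M3 = frame_mx (cv3 w 1 1) (cv3 w (- w) 0) E0.
Proof. by apply/matrixP; elim/ord3P; elim/ord3P; rewrite !mxE /= ?vE ?mxE. Qed.

Lemma M3_preserving : preserving M3.
Proof. by rewrite M3E; exact: frame_preserving M3_frame. Qed.

Lemma M3_Imx : Imx M3.
Proof. by rewrite M3E; exact: frame_Imx M3_frame. Qed.

Lemma M3_mul z : M3 *m z = cv3 (w * z i0 0 + w * z i1 0 + z i2 0) (z i0 0 - w * z i1 0) (z i0 0).
Proof. by rewrite M3E frame_mxE; apply: cv_eq; rewrite !ccE; ring. Qed.

Definition v3 : V := nonary_vec E0 E1 E2.

Lemma nonary_conj : l^* = (- 1 - w) * l ^+ 2.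
Proof.
have ll := nm_eq1 (nm_nonary R); rewrite -conj_omega -{1}(nonary3 R) cjX.
by transitivity ((l * l^*) * (l * l^*) * l^*); [rewrite ll !mul1r|ring].
Qed.

Lemma v3E : v3 = cv3 (1 + l ^+ 2) ((- 1 - w) * l ^+ 2) ((- 1 - w) * l ^+ 2 + l).
Proof.
have l3 := nonary3 R; have w2 := omega2 R.
rewrite /v3 /nonary_vec nonary_conj; apply: cv_eq; rewrite !ccE.
- by transitivity (1 + (- w - w ^+ 2) * l ^+ 2); [ring|rewrite w2; ring].
- by ring.
- transitivity ((- 1 - w) * l ^+ 2 + (- 1 - w) ^+ 2 * w * (l ^+ 3) * l); first by ring.
  by rewrite l3; ring: w2.
Qed.

Lemma M3_v3 : M3 *m v3 = l *: v3.
Proof.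
have l3 := nonary3 R; have w2 := omega2 R.
rewrite M3_mul v3E; apply: cv_eq; rewrite !ccE.
- transitivity (w - w ^+ 2 * l ^+ 2 - l ^+ 2 + l - w * l ^+ 2 + (w + w ^+ 2 + 1) * 0); first by rewrite w2; ring: w2.
  by transitivity (l + l ^+ 3); [rewrite l3 w2; ring|ring].
- transitivity (1 + (1 + w + w ^+ 2) * l ^+ 2); first by ring.
  by transitivity ((- 1 - w) * l ^+ 3); [rewrite l3; ring: w2|ring].
- by transitivity ((- 1 - w) * l ^+ 3 + l ^+ 2); [rewrite l3; ring: w2|ring].
Qed.

Lemma M3_cube z : M3 *m (M3 *m (M3 *m z)) = w *: z.
Proof. by rewrite !M3_mul; apply: cv_eq; rewrite !ccE; ring: (omega2 R). Qed.

Lemma hr_v3 : hr v3 = 6 * complex.Re l.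
Proof.
have l3 := nonary3 R; have w2 := omega2 R; have ll := nm_eq1 (nm_nonary R).
have lj := nonary_conj.
apply: rc_inj; rewrite -hrE.
transitivity (3 * (l + l^*)).
  rewrite v3E hermE !vE -nonary_conj !cjE.
  transitivity (2 * (l + l^*) + l * (l * l^*) + l^* * (l * l^*) + l ^+ 3 + l^* ^+ 3 + l * l^*); first by ring.
  by rewrite ll -cjX l3 conj_omega; ring.
by rewrite addJ !rcM !rcn; ring.
Qed.

Lemma v3_neg : hr v3 < 0.
Proof. by rewrite hr_v3; have := Re_nonary R; lra. Qed.

Lemma nonary_neq0 : l != 0. Proof. exact: nm1_neq0 (nm_nonary R). Qed.

Lemma M3_simple : simple_at M3 v3 l.
Proof.
apply: simple_last v3_neg M3_v3 _ => z; rewrite M3_mul => h z2.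
have e2 := congr1 (fun u : V => u i2 0) h; have e1 := congr1 (fun u : V => u i1 0) h.
rewrite !ccE in e1 e2; rewrite z2 mulr0 in e2; rewrite e2 sub0r in e1.
have h0 : (l + w) * z i1 0 = 0 by rewrite mulrDl -e1; ring.
have : l + w != 0.
  apply/eqP => lw; have := nonary3 R; have -> : l = - w by apply/eqP; rewrite -addr_eq0 lw.
  rewrite (_ : (- w) ^+ 3 = - w ^+ 3); last by ring.
  rewrite omega3 => h1; have := Im_omega_gt0 R; rewrite -h1 cImN cIm1 oppr0 ltxx //.
move=> lw; move/eqP: h0; rewrite mulf_eq0 (negPf lw) => /eqP z1.
by apply: cv_eq; rewrite !ccE.
Qed.

Lemma nonary_indep a b c : Eis a -> Eis b -> Eis c -> a + b * l + c * l ^+ 2 = 0 ->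
  [/\ a = 0, b = 0 & c = 0].
Proof.
move=> Ea Eb Ec h; have l3 := nonary3 R.
have nK : ~ Krat l by move=> K; exact: not_Krat_cube K l3.
have lin (x y : C) : Eis x -> Eis y -> x + y * l = 0 -> x = 0 /\ y = 0.
  move=> Ex Ey e; have [y0|y0] := eqVneq y 0; first by move: e; rewrite y0 mul0r addr0.
  case: nK; have -> : l = (- x) / y.
    by apply: (mulfI y0); rewrite mulrCA divff // mulr1; apply/eqP; rewrite -addr_eq0 addrC e.
  by apply: Krat_div => //; exact: EisN.
have [c0|c0] := eqVneq c 0.
  by move: h; rewrite c0 mul0r addr0 => /(lin _ _ Ea Eb)[].
exfalso.
(* Reducing l^3 = w modulo c l^2 + b l + a leaves a relation of degree 1. *)
have h1 : (w * c ^+ 2 - a * b) + (a * c - b ^+ 2) * l = 0.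
  transitivity ((c * l - b) * (a + b * l + c * l ^+ 2) + c ^+ 2 * (w - l ^+ 3)); first by ring.
  by rewrite h l3 subrr; ring.
have [] := lin _ _ _ _ h1; [by eis|by eis|move=> h2 h3].
apply: (@not_Krat_cube R (b / c)); first exact: Krat_div.
have c3 : c ^+ 3 != 0 by rewrite expf_neq0.
rewrite expr_div_n; apply: (mulIf c3); rewrite divfK //.
transitivity (w * c ^+ 3 - b * (a * c - b ^+ 2) - c * (w * c ^+ 2 - a * b)); first by ring.
by rewrite h2 h3; ring.
Qed.

Lemma M3_powers (c0 c1 c2 : C) z : c0 *: z + c1 *: (M3 *m z) + c2 *: (M3 *m (M3 *m z)) =
  (c0%:M + c1 *: M3 + c2 *: (M3 *m M3)) *m z.
Proof. by rewrite !mulmxDl -!scalemxAl mul_scalar_mx mulmxA. Qed.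

(** $O^3$ is free of rank one over $O[M_3]$ on [E0]. The matrix [B] is the element of $O[M_3]$
    agreeing with [A] there; the difference kills [E0] and has [v3] as an eigenvector, and
    independence of $1,l,l^2$ over $O$ makes it zero. *)
Lemma M3_commutant A m : Imx A -> A *m v3 = m *: v3 ->
  exists c0 c1 c2, [/\ Eis c0, Eis c1, Eis c2 & A = c0%:M + c1 *: M3 + c2 *: (M3 *m M3)].
Proof.
move=> IA ev; have l3 := nonary3 R; have w2 := omega2 R; have ll := nm_eq1 (nm_nonary R).
have ww : w * (- 1 - w) = 1 by ring: w2.
have Ix : Ivec (A *m E0) := Ivec_mul IA (IE0 R).
pose c1 := (A *m E0) i1 0; pose c0 := (A *m E0) i0 0 - w * c1.
pose c2 := (- 1 - w) * ((A *m E0) i2 0 - c1).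
have [E0' E1' E2'] : [/\ Eis c0, Eis c1 & Eis c2].
  by rewrite /c0 /c1 /c2; split; have := Ix i0; have := Ix i1; have := Ix i2; move=> *; eis.
exists c0, c1, c2; split=> //.
pose B : 'M[C]_3 := c0%:M + c1 *: M3 + c2 *: (M3 *m M3).
have IB : Imx B.
  apply: Imx_vec => u Iu; rewrite -M3_powers.
  have I3 := Ivec_mul M3_Imx Iu; have I4 := Ivec_mul M3_Imx I3.
  by apply: IvecD; [apply: IvecD|]; exact: IvecZ.
pose D := A - B.
have ID u : Ivec u -> Ivec (D *m u).
  by move=> Iu; rewrite mulmxBl; apply: IvecB; exact: Ivec_mul.
have D0 : D *m E0 = 0.
  rewrite mulmxBl -M3_powers; apply/eqP; rewrite subr_eq0; apply/eqP.
  rewrite !M3_mul; apply: cv_eq; rewrite !ccE /c0 /c2 -/c1; [ring: w2|ring|].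
  transitivity ((w * (- 1 - w)) * ((A *m E0) i2 0 - c1) + c1); [by rewrite ww; ring|by ring].
have [k Dv] : exists k, D *m v3 = k *: v3.
  exists (m - (c0 + c1 * l + c2 * l ^+ 2)).
  rewrite mulmxBl ev -M3_powers !M3_v3 -scalemxAr M3_v3 !scalerA.
  by apply: cv_eq; rewrite !ccE; ring.
pose p : V := cv3 w 1 1; pose r : V := cv3 0 0 w.
have Ip : Ivec (D *m p) by apply: ID; ivec.
have Ir : Ivec (D *m r) by apply: ID; ivec.
(* Here [p] and [r] are the images of [E0] under $M_3$ and $M_3^2$; this is the projection formula
   $v_3=E_0+\bar lM_3E_0+\bar l^2M_3^2E_0$ multiplied by $l$. *)
have vE : l *: v3 = l *: E0 + p + l^* *: r.
  rewrite v3E nonary_conj; apply: cv_eq; rewrite !ccE.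
  - by transitivity (l + l ^+ 3); [ring|rewrite l3; ring].
  - by transitivity ((- 1 - w) * l ^+ 3); [ring|rewrite l3; ring: w2].
  - by transitivity ((- 1 - w) * l ^+ 3 + l ^+ 2); [ring|rewrite l3; ring: w2].
have e : D *m p + l^* *: (D *m r) = k *: (l *: E0 + p + l^* *: r).
  have e : D *m (l *: v3) = k *: (l *: v3) by rewrite -scalemxAr Dv !scalerA mulrC.
  by rewrite vE !mulmxDr -!scalemxAr D0 scaler0 add0r in e.
have h0 := congr1 (fun u : V => u i0 0) e; have h1 := congr1 (fun u : V => u i1 0) e.
have h2 := congr1 (fun u : V => u i2 0) e; move: h0 h1 h2; rewrite !ccE nonary_conj.
move: (Ip i0) (Ip i1) (Ip i2) (Ir i0) (Ir i1) (Ir i2).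
have pz : D *m p = 0 -> D *m r = 0 -> A = B.
  move=> p0 r0; apply/eqP; rewrite -subr_eq0; apply/eqP; apply: mx_ext => z; rewrite mul0mx.
  have -> : z = (z i0 0 - w * z i1 0) *: E0 + z i1 0 *: p + ((- 1 - w) * (z i2 0 - z i1 0)) *: r.
    apply: cv_eq; rewrite !ccE; [ring|ring|].
    by transitivity (z i1 0 + (w * (- 1 - w)) * (z i2 0 - z i1 0)); [rewrite ww; ring|ring].
  by rewrite !mulmxDr -!scalemxAr D0 p0 r0 !scaler0 !addr0.
have cz : (D *m p) i0 0 = 0 -> (D *m p) i1 0 = 0 -> (D *m p) i2 0 = 0 ->
  (D *m r) i0 0 = 0 -> (D *m r) i1 0 = 0 -> (D *m r) i2 0 = 0 -> A = B.
  by move=> *; apply: pz; apply: cv_eq; rewrite [RHS]mxE.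
move: cz; move: ((D *m p) i0 0) ((D *m p) i1 0) ((D *m p) i2 0) => x0 x1 x2.
move: ((D *m r) i0 0) ((D *m r) i1 0) ((D *m r) i2 0) => y0 y1 y2 cz I0 I1 I2 J0 J1 J2 h0 h1 h2.
have kE : k = x1 + (- 1 - w) * l ^+ 2 * y1.
  by rewrite h1; ring.
have [|||| a1 a2 a3] := @nonary_indep (x0 - w * x1 - y1) (- x1) ((- 1 - w) * y0 - y1); [by eis|by eis|by eis| |].
  transitivity (x0 + (- 1 - w) * l ^+ 2 * y0 - w * x1 - y1 * (w * (- 1 - w)) - x1 * l - y1 * l ^+ 2); first by rewrite ww; ring.
  by rewrite h0 kE; transitivity ((-1 - w) * y1 * (l ^+ 3 - w) + (w * (- 1 - w) - 1) * (l ^+ 2 * y1)); [ring|rewrite l3 ww; ring].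
have x10 : x1 = 0 by apply/eqP; rewrite -oppr_eq0 a2.
rewrite x10 in kE h2 a1.
have [|||| b1 b2 b3] := @nonary_indep x2 (- y1) ((- 1 - w) * (y2 - y1)); [by eis|by eis|by eis| |].
  transitivity (x2 + (- 1 - w) * l ^+ 2 * y2 - y1 * l - (- 1 - w) * l ^+ 2 * y1); first by ring.
  rewrite h2 kE; transitivity ((w * (- 1 - w)) * (- 1 - w) * (l ^+ 3) * l * y1 - y1 * l); first by ring.
  by rewrite ww l3; transitivity ((w * (- 1 - w)) * (l * y1) - y1 * l); [ring|rewrite ww; ring].
have y10 : y1 = 0 by apply/eqP; rewrite -oppr_eq0 b2.
have n0 : - 1 - w != 0 by apply: contraTneq (oner_neq0 C) => h; rewrite -ww h mulr0 eqxx.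
rewrite y10 in a1 a3 b3; apply: cz => //.
- by move: a1; rewrite mulr0 !subr0.
- by apply: (mulfI n0); move: a3; rewrite subr0 mulr0.
- by apply: (mulfI n0); move: b3; rewrite subr0 mulr0.
Qed.

Lemma rc_nm_sum3 a b c : a * a^* + b * b^* + c * c^* = 1 -> nm a + nm b + nm c = 1.
Proof. by rewrite !nmE; move: (nm a) (nm b) (nm c) => x y z; rewrite -!rcD => /rc_inj. Qed.

(** The vector [y] is chosen so that $\langle M_3^iE_0,M_3^jy\rangle=\delta_{ij}$ for $0\le
    i,j\le2$. Preserving $\langle E_0,y\rangle=1$ is therefore the equation on the three norms. *)
Lemma M3_isometry (c0 c1 c2 : C) : preserving (c0%:M + c1 *: M3 + c2 *: (M3 *m M3)) ->
  nm c0 + nm c1 + nm c2 = 1.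
Proof.
move=> hA; pose y : V := cv3 0 (1 + w) 1.
have ww : w * (- 1 - w) = 1 by ring: (omega2 R).
have := hA E0 y; rewrite -!M3_powers.
have -> : M3 *m y = E1 by rewrite M3_mul; apply: cv_eq; rewrite !ccE; ring: (omega2 R).
have -> : M3 *m E1 = cv3 w (- w) 0 by rewrite M3_mul; apply: cv_eq; rewrite !ccE; ring.
have -> : M3 *m E0 = cv3 w 1 1 by rewrite M3_mul; apply: cv_eq; rewrite !ccE; ring.
have -> : M3 *m cv3 w 1 1 = cv3 0 0 w by rewrite M3_mul; apply: cv_eq; rewrite !ccE; ring: (omega2 R).
rewrite !hE !hermE !vE !(cjE, conj_omega) => h; apply: rc_nm_sum3; move: h.
move: (c0^*) (c1^*) (c2^*) => k0 k1 k2 h.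
transitivity (1 * 1 + 0 * (1 + (-1 - w)) + 0 * 0 : C); last by ring.
by rewrite -h; ring: (omega2 R).
Qed.

(** Three norms of integers of $O$ add up to 1, so exactly one coefficient is nonzero, and it is a
    unit. *)
Lemma M3_isotropy A m : preserving A -> Imx A -> A *m v3 = m *: v3 ->
  exists2 c, nm c = 1 & [\/ A = c *: 1%:M, A = c *: M3 | A = c *: (M3 *m M3)].
Proof.
move=> hA IA ev; have [c0 [c1 [c2 [I0 I1 I2 AE]]]] := M3_commutant IA ev.
have h : nm c0 + nm c1 + nm c2 = 1 by apply: M3_isometry; rewrite -AE.
have n0 := nm_ge0 c0; have n1 := nm_ge0 c1; have n2 := nm_ge0 c2.
have zero (c : C) : nm c = 0 -> c = 0 by move=> e; apply/eqP; rewrite -nm_eq0 e.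
have [z0|z0] := eqVneq c0 0; last first.
  have g0 := Eis_nm_ge1 I0 z0; exists c0; first by lra.
  have y1 : c1 = 0 by apply: zero; lra.
  have y2 : c2 = 0 by apply: zero; lra.
  constructor 1; rewrite AE y1 y2.
  by rewrite !scale0r !addr0 scalemx1.
have [z1|z1] := eqVneq c1 0; last first.
  have g1 := Eis_nm_ge1 I1 z1; exists c1; first by lra.
  have y2 : c2 = 0 by apply: zero; lra.
  constructor 2; rewrite AE z0 y2.
  by rewrite scale0r addr0 (_ : 0%:M = 0) ?add0r //; apply/matrixP => i j; rewrite !mxE mul0rn.
exists c2; first by move: h; rewrite z0 z1 nm0; lra.
constructor 3; rewrite AE z0 z1 scale0r addr0 (_ : 0%:M = 0) ?add0r //.
by apply/matrixP => i j; rewrite !mxE mul0rn.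
Qed.

Definition m3 : PU R := cl M3.

Lemma m3_2 : (m3 ^+ 2)%g = cl (M3 *m M3).
Proof. by rewrite expg2 /m3; exact: esym (clM M3_preserving M3_preserving). Qed.

Lemma m3_3 : (m3 ^+ 3)%g = 1%g.
Proof.
rewrite expgSr m3_2 /m3; apply: etrans (esym (clM (preservingM M3_preserving M3_preserving) M3_preserving)) _.
rewrite -cl1; apply/cl_eq.
- exact: preservingM (preservingM M3_preserving M3_preserving) M3_preserving.
- exact: preserving1.
exists w; first exact: omega_neq0.
by apply: mx_ext => z; rewrite -scalemxAl mul1mx -!mulmxA; exact: M3_cube.
Qed.

Lemma E0_neq0 : E0 != 0.
Proof. by apply/eqP => /(congr1 (fun u : V => u i0 0))/eqP; rewrite !ccE oner_eq0. Qed.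

Lemma m3_inj : injective (fun i : 'I_3 => (m3 ^+ i)%g).
Proof.
apply: cyclic_inj => -[|[|[|//]]] // _.
  rewrite expg1; apply: (not_scalar E0_neq0 _ M3_preserving) => k.
  by rewrite M3_mul => /(congr1 (fun u : V => u i2 0))/eqP; rewrite !ccE mulr0 oner_eq0.
rewrite m3_2; apply: (not_scalar E0_neq0 _ (preservingM M3_preserving M3_preserving)) => k.
rewrite -mulmxA !M3_mul => /(congr1 (fun u : V => u i2 0))/eqP; rewrite !ccE !mulr0 !mulr1 !addr0.
by rewrite (negPf (omega_neq0 R)).
Qed.

Lemma m3_mem i : isotropy 3 <[v3]>%VS (m3 ^+ i)%g.
Proof.
apply: is_subgroupX; first exact: isotropy_subgroup v3_neg.
apply/isotropyP; first exact: v3_neg.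
by exists M3; split; [exact: M3_preserving|exact: M3_Imx|exists l; exact: M3_v3|].
Qed.

Lemma third_isotropyE : isotropy 3 <[v3]>%VS = range (fun i : 'I_3 => (m3 ^+ i)%g).
Proof.
apply/seteqP; split=> [g|_ [i _ <-]]; last exact: m3_mem.
move=> /(isotropyP _ v3_neg)[A [hA IA [m ev] ->]].
have [c c1 AE] := M3_isotropy hA IA ev.
have h2 := preservingM M3_preserving M3_preserving.
case: AE => ->.
- by exists (@Ordinal 3 0 isT); [by []|rewrite (clZ c1 (@preserving1 R)) cl1].
- by exists (@Ordinal 3 1 isT); [by []|rewrite (clZ c1 M3_preserving) expg1].
- by exists (@Ordinal 3 2 isT); [by []|rewrite (clZ c1 h2) m3_2].
Qed.

Lemma third_gen : isotropy 3 <[v3]>%VS = generated [set m3].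
Proof. by rewrite third_isotropyE (generated_cycle _ m3_3). Qed.

Lemma third_card : isotropy 3 <[v3]>%VS #= `I_3.
Proof. by have := card_range m3_inj third_isotropyE; rewrite card_ord. Qed.

Lemma third_fixed : fixed_points [set m3] = [set <[v3]>%VS].
Proof. exact: fixed_points_simple M3_preserving v3_neg M3_v3 M3_simple. Qed.

Lemma third_irrational : no_rational_representative 3 <[v3]>%VS.
Proof.
apply: (no_rational M3_Imx (hr_v0 v3_neg) M3_v3) => K.
exact: not_Krat_cube K (nonary3 R).
Qed.

Lemma generated0 : generated (set0 : set (PU R)) = [set 1%g].
Proof.
apply/seteqP; split; last by move=> _ ->; have [] := generated_subgroup (set0 : set (PU R)).
apply: generated_sub => //; split=> //.
- by move=> _ _ -> ->; rewrite mulg1.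
- by move=> _ ->; rewrite invg1.
Qed.

Lemma third_reflections : reflection_subgroup (isotropy 3 <[v3]>%VS) = [set 1%g].
Proof.
rewrite /reflection_subgroup (_ : _ `&` _ = set0) ?generated0 //.
apply/seteqP; split=> // g []; rewrite third_isotropyE => -[[[|[|[|//]]] hi] _ <-] /=.
- by move=> [m [/eqP]]; rewrite expg0.
- rewrite expg1; exact: simple_not_reflection M3_preserving v3_neg M3_v3 M3_simple.
rewrite m3_2; apply: (@simple_not_reflection R (M3 *m M3) v3 (l ^+ 2)).
- exact: preservingM M3_preserving M3_preserving.
- exact: v3_neg.
- by rewrite (mulmx_step _ M3_v3) -scalemxAr M3_v3 scalerA expr2.
apply: (simple_sqr nonary_neq0 M3_simple) => z.
by rewrite nonary3; exact: M3_cube.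
Qed.

End ThirdPoint.

(** * The isotropy group of order 4 *)

Section FourthPoint.
Variable R : realType.
Local Notation w := (omega : R[i]).
Local Notation C := R[i].
Local Notation V := 'cV[C]_3.
Local Notation E0 := (E0 R).
Local Notation E1 := (E1 R).
Local Notation E2 := (E2 R).
Local Notation ii := (iunit R).
Local Notation sg := (sqrtN3 R).
Local Notation rc := (real_complex R).
Local Notation e1 := (e1 R).
Local Notation f1 := (f1 R).
Implicit Types (u z v : V) (A B : 'M[C]_3) (a b c : C) (g h : PU R).

Definition M4 : 'M[C]_3 := mx3 w (-1) (w + 3) 1 1 (- sg) 1 0 (- sg).

Ltac ivec := apply: Ivec_cv3; eis.
Ltac hval := rewrite hermE !vE !(cjE, conj_omega); ring: (omega2 R).

Lemma M4_frame : hframe (cv3 w 1 1) (cv3 (-1) 1 0) (cv3 (w + 3) (- sg) (- sg)).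
Proof.
rewrite /sqrtN3; split; first by split; ivec.
  by split; hval.
by split; hval.
Qed.

Lemma M4E : M4 = frame_mx (cv3 w 1 1) (cv3 (-1) 1 0) (cv3 (w + 3) (- sg) (- sg)).
Proof. by apply/matrixP; elim/ord3P; elim/ord3P; rewrite !mxE /= ?vE ?mxE. Qed.

Lemma M4_preserving : preserving M4.
Proof. by rewrite M4E; exact: frame_preserving M4_frame. Qed.

(* The class of M4 has order 4; the multiple N4 is normalized to have eigenvalues i, -i and -1. *)
Definition N4 : 'M[C]_3 := w^* *: M4.

Lemma nm_wj : nm (w^*) = 1. Proof. by rewrite nmJ nm_omega. Qed.

Lemma N4_preserving : preserving N4.
Proof. exact: preservingZ nm_wj M4_preserving. Qed.

Lemma N4_Imx : Imx N4.
Proof. by apply: ImxZ; [eis|rewrite M4E; exact: frame_Imx M4_frame]. Qed.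

Lemma cl_N4 : cl N4 = cl M4. Proof. exact: clZ nm_wj M4_preserving. Qed.

(** [p4] and [r4] are an $O$-basis of the lattice where $N_4^2=-1$, exchanged up to sign by [N4];
    [w4] spans the third eigenline, the only one defined over $K$. *)
Definition p4 : V := cv3 1 (w^*) 0.
Definition r4 : V := cv3 (1 - w) (-1) (w^*).
Definition w4 : V := cv3 1 1 (- w).

Lemma N4_mul z : N4 *m z = w^* *: (z i0 0 *: cv3 w 1 1 + z i1 0 *: cv3 (-1) 1 0 + z i2 0 *: cv3 (w + 3) (- sg) (- sg)).
Proof. by rewrite -scalemxAl M4E frame_mxE. Qed.

Lemma N4_p : N4 *m p4 = r4.
Proof. by rewrite N4_mul; apply: cv_eq; rewrite !ccE /sqrtN3 !conj_omega; ring: (omega2 R). Qed.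

Lemma N4_r : N4 *m r4 = - p4.
Proof. by rewrite N4_mul; apply: cv_eq; rewrite !ccE /sqrtN3 !conj_omega; ring: (omega2 R). Qed.

Lemma N4_w : N4 *m w4 = - w4.
Proof. by rewrite N4_mul; apply: cv_eq; rewrite !ccE /sqrtN3 !conj_omega; ring: (omega2 R). Qed.

Lemma Ip4 : Ivec p4. Proof. by ivec. Qed.
Lemma Ir4 : Ivec r4. Proof. by ivec. Qed.
Lemma Iw4 : Ivec w4. Proof. by ivec. Qed.
Lemma p4p4 : herm p4 p4 = 1. Proof. by hval. Qed.
Lemma r4r4 : herm r4 r4 = 1. Proof. by hval. Qed.
Lemma p4r4 : herm p4 r4 = sg. Proof. by rewrite /sqrtN3; hval. Qed.
Lemma w4w4 : herm w4 w4 = 2%:R. Proof. by hval. Qed.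
Lemma p4w4 : herm p4 w4 = 0. Proof. by hval. Qed.
Lemma r4w4 : herm r4 w4 = 0. Proof. by hval. Qed.

Lemma r4p4 : herm r4 p4 = - sg. Proof. by rewrite -herm_cj p4r4 sgJ. Qed.

Definition v4 : V := quartic_vec E0 E1 E2.

Lemma v4E : v4 = p4 - ii *: r4.
Proof. by rewrite /v4 /quartic_vec; move: (iunit R) => j; apply: cv_eq; rewrite !ccE; ring. Qed.

Lemma N4_v4 : N4 *m v4 = ii *: v4.
Proof.
rewrite v4E mulmxBr -scalemxAr N4_p N4_r; apply: cv_eq; rewrite !ccE; ring: (ii2 R).
Qed.

Lemma hr_v4 : hr v4 = 2 - 4 * complex.Im w.
Proof.
have h : ii * sg = - rc (2 * complex.Im w).
  have sr : complex.Re sg = 0 by rewrite /sqrtN3 cReD cReM cRe1 cRen cImn Re_omega; field.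
  have si : complex.Im sg = 2 * complex.Im w by rewrite /sqrtN3 cImD cImM cIm1 cRen cImn; ring.
  by apply: complexP; rewrite ?cReM ?cImM sr si ?cReN ?cImN /=; ring.
apply: rc_inj; rewrite -hrE v4E !hE p4p4 r4r4 p4r4 r4p4 iiJ.
transitivity (1 - ii ^+ 2 + 2 * (ii * sg)); first by ring.
by rewrite ii2 h rcD rcN !rcM !rcn; ring.
Qed.

Lemma v4_neg : hr v4 < 0.
Proof.
rewrite hr_v4; have := Im_omega_gt0 R; have := Im_omega_sqr R.
by move: (complex.Im _) => x; nra.
Qed.

Lemma w4_pos : 0 < hr w4. Proof. by rewrite (@hr_of R _ 2%:R) ?ltr0n // w4w4 rcn. Qed.

Lemma v4w4 : herm w4 v4 = 0.
Proof. by apply: herm_sym0; rewrite v4E !hE p4w4 r4w4; ring. Qed.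

Lemma det4 : det3 p4 r4 w4 != 0.
Proof.
have -> : det3 p4 r4 w4 = - 2%:R * w ^+ 2.
  by rewrite /det3 !vE conj_omega; ring: (omega2 R).
by rewrite mulf_neq0 ?oppr_eq0 ?pnatr_eq0 // expf_neq0 // omega_neq0.
Qed.

Lemma ext4 A B : A *m p4 = B *m p4 -> A *m r4 = B *m r4 -> A *m w4 = B *m w4 -> A = B.
Proof.
move=> ep er ew; apply: mx_ext => z; have [a [b [c ->]]] := basis3 z det4.
by rewrite !mulmxDr -!scalemxAr ep er ew.
Qed.

Lemma N4_simple : simple_at N4 v4 ii.
Proof.
apply: simple_last v4_neg N4_v4 _ => z ez z2.
have [a [b [c zE]]] := basis3 z det4.
have n1 : 1 + ii != 0.
  apply/eqP => h; have := congr1 (@complex.Re R) h; rewrite cReD cRe1 /= => /eqP.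
  by rewrite addr0 oner_eq0.
have dz : det3 p4 r4 w4 *: (0 : V) = 0 by rewrite scaler0.
have e : (- b - ii * a) *: p4 + (a - ii * b) *: r4 + (- c - ii * c) *: w4 = 0.
  have : N4 *m z - ii *: z = 0 by rewrite ez subrr.
  rewrite zE !mulmxDr -!scalemxAr N4_p N4_r N4_w => <-.
  by apply: cv_eq; rewrite !ccE; ring.
have c0 : c = 0.
  have : herm ((- b - ii * a) *: p4 + (a - ii * b) *: r4 + (- c - ii * c) *: w4) w4 = 0 by rewrite e herm0l.
  rewrite !hE p4w4 r4w4 w4w4 => h; have : (1 + ii) * c * 2%:R = 0.
    by transitivity (- ((- b - ii * a) * 0 + (a - ii * b) * 0 + (- c - ii * c) * 2%:R)); [ring|rewrite h oppr0].
  by move/eqP; rewrite !mulf_eq0 (negPf n1) pnatr_eq0 orbF => /eqP.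
have ab : a = ii * b.
  have := congr1 (fun u : V => u i2 0) e; rewrite !ccE c0 => h.
  apply/eqP; rewrite -subr_eq0; apply/eqP.
  have wj : w^* != 0 by rewrite conjC_eq0 omega_neq0.
  apply: (mulIf wj); rewrite mul0r -h; ring.
have b0 : b = 0.
  move: z2; rewrite zE !ccE c0 => h; have wj : w^* != 0 by rewrite conjC_eq0 omega_neq0.
  by apply: (mulIf wj); rewrite mul0r -h; ring.
by rewrite zE ab b0 c0 mulr0 !scale0r !addr0.
Qed.

Lemma ii_indep a b : Eis a -> Eis b -> a + ii * b = 0 -> a = 0 /\ b = 0.
Proof.
move=> Ea Eb h; have [b0|b0] := eqVneq b 0; first by move: h; rewrite b0 mulr0 addr0.
exfalso; apply: (@not_Krat_ii R); have -> : ii = (- a) / b.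
  by apply: (mulIf b0); rewrite divfK //; apply/eqP; rewrite -addr_eq0 addrC h.
by apply: Krat_div => //; exact: EisN.
Qed.

Lemma plane4 z : Ivec z -> herm z w4 = 0 -> exists a b, [/\ Eis a, Eis b & z = a *: p4 + b *: r4].
Proof.
move=> Iz zw; have Z0 := Iz i0; have Z1 := Iz i1; have Z2 := Iz i2.
have h : z i1 0 = - z i2 0 - (1 + w) * z i0 0.
  apply/eqP; rewrite -subr_eq0; apply/eqP; rewrite -zw hermE !vE !(cjE, conj_omega); ring.
exists (z i0 0 - (w - w ^+ 2) * z i2 0), (w * z i2 0); split; [by eis|by eis|].
by apply: cv_eq; rewrite !ccE ?h ?conj_omega; ring: (omega2 R).
Qed.

Lemma axis4 z : herm z p4 = 0 -> herm z r4 = 0 -> z = z i1 0 *: w4.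
Proof.
rewrite !hermE !vE !(cjE, conj_omega) => h1 h2.
have z2 : z i2 0 = - w * z i1 0.
  apply/eqP; rewrite -subr_eq0; apply/eqP; rewrite -h1; ring.
have z0 : z i0 0 = z i1 0.
  apply: (mulfI (omega_neq0 R)); apply/eqP; rewrite -subr_eq0; apply/eqP; rewrite -[RHS]h2 z2.
  by ring: (omega2 R).
by apply: cv_eq; rewrite !ccE ?z2 ?z0; ring.
Qed.

(** The hypotheses are linear in $N=x\bar x+y\bar y$ and $D=x\bar y-y\bar x$; eliminating $D$ leaves
    $2N=2$. *)
Lemma iso4_alg (x xj y yj s : C) : s ^+ 2 = - 3 -> x * xj + y * yj + (x * yj - y * xj) * s = 1 ->
  s * (x * xj + y * yj) - (x * yj - y * xj) = s -> x * xj + y * yj = 1.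
Proof.
move=> s2 h1 h2; have n2 : (2%:R : C) != 0 by rewrite pnatr_eq0.
apply: (mulfI n2); rewrite mulr1.
transitivity (- (x * xj + y * yj + (x * yj - y * xj) * s) - s * (s * (x * xj + y * yj) - (x * yj - y * xj))
   + (s ^+ 2 + 3) * (x * xj + y * yj)); first by ring.
by rewrite h1 h2 -expr2 s2; ring.
Qed.

Lemma half4 (b x t : C) : nm b = 1 -> nm x = 1 -> Eis x -> Eis t -> 2%:R * t = b - x -> b = x \/ b = - x.
Proof.
move=> b1 x1 Ex Et h; have xx := nm_eq1 x1; have n2 : (2%:R : C) != 0 by rewrite pnatr_eq0.
have [] := @half_unit R (b * x^*).
- by rewrite nmM nmJ b1 x1 mulr1.
- rewrite (_ : _ / _ = t * x^*); first by eis.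
  apply: (mulIf n2); rewrite divfK //; transitivity ((2%:R * t) * x^*); last by ring.
  by rewrite h -xx; ring.
- by move=> e; left; transitivity ((b * x^*) * x); [rewrite -mulrA [_ * x]mulrC xx mulr1|rewrite e mul1r].
- by move=> e; right; transitivity ((b * x^*) * x); [rewrite -mulrA [_ * x]mulrC xx mulr1|rewrite e mulN1r].
Qed.

(** Independence of 1 and $i$ over $O$ makes [A] preserve the lattice of [p4], [r4] and commute with
    [N4] there. Hence it acts by $x+yN_4$ with $|x|^2+|y|^2=1$, so one coefficient vanishes. A glue
    vector fixes the eigenvalue on [w4] up to sign. *)
Lemma N4_isotropy A m : preserving A -> Imx A -> A *m v4 = m *: v4 -> exists x b,
  [/\ nm x = 1, b = x \/ b = - x, A *m w4 = b *: w4 &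
   (A *m p4 = x *: p4 /\ A *m r4 = x *: r4) \/ (A *m p4 = x *: r4 /\ A *m r4 = (- x) *: p4)].
Proof.
move=> hA IA ev; have I1 := Ivec_mul IA Ip4; have I2 := Ivec_mul IA Ir4; have I3 := Ivec_mul IA Iw4.
have ev' : A *m p4 - ii *: (A *m r4) = m *: p4 - (m * ii) *: r4.
  by move: ev; rewrite v4E mulmxBr -scalemxAr scalerBr scalerA.
have [pw rw] : herm (A *m p4) w4 = 0 /\ herm (A *m r4) w4 = 0.
  have [] := @ii_indep (herm (A *m p4) w4) (- herm (A *m r4) w4).
  - exact: Eis_herm I1 Iw4.
  - exact: EisN (Eis_herm I2 Iw4).
  - have : herm (A *m p4 - ii *: (A *m r4)) w4 = 0 by rewrite ev' !hE p4w4 r4w4; ring.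
    by rewrite !hE mulrN.
  by move=> -> /eqP; rewrite oppr_eq0 => /eqP.
have [x [y [Ex Ey pE]]] := plane4 I1 pw; have [x' [y' [Ex' Ey' rE]]] := plane4 I2 rw.
have [xy yx] : x' = - y /\ y' = x.
  have wj : w^* != 0 by rewrite conjC_eq0 omega_neq0.
  rewrite pE rE in ev'.
  have h2 := congr1 (fun u : V => u i2 0) ev'; have h1 := congr1 (fun u : V => u i1 0) ev'.
  rewrite !ccE in h1 h2.
  have k2 : y - ii * y' = - (m * ii).
    apply: (mulIf wj); transitivity (x * 0 + y * w^* + - (ii * (x' * 0 + y' * w^*))); first by ring.
    by rewrite h2; ring.
  have k1 : x - ii * x' = m.
    apply: (mulIf wj); transitivity (x * w^* + y * -1 + - (ii * (x' * w^* + y' * -1)) + (y - ii * y')); first by ring.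
    by rewrite h1 k2; ring.
  have [] := @ii_indep (y + x') (x - y'); [by eis|by eis| |].
    transitivity ((y - ii * y') + (x - ii * x') * ii + x' * (1 + ii ^+ 2)); first by ring.
    by rewrite k1 k2 ii2; ring.
  move=> h3 h4; split; apply/eqP; last by rewrite eq_sym -subr_eq0 h4.
  by rewrite -addr_eq0 addrC h3.
have nxy : nm x + nm y = 1.
  have q1 := hA p4 p4; have q2 := hA p4 r4.
  rewrite pE rE xy yx in q1 q2; rewrite !hE p4p4 r4r4 p4r4 r4p4 ?cjE in q1 q2.
  suff N1 : x * x^* + y * y^* + 0 * 0^* = 1 by have := rc_nm_sum3 N1; rewrite nm0 addr0.
  rewrite mul0r addr0; move: q1 q2 (sg2 R); move: (x^*) (y^*) sg => xj yj s q1 q2 s2.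
  by apply: (iso4_alg s2); [rewrite -[RHS]q1; ring|rewrite -[RHS]q2; ring].
have [u [Eu u1 act]] : exists u : C, [/\ Eis u, nm u = 1 &
   (A *m p4 = u *: p4 /\ A *m r4 = u *: r4) \/ (A *m p4 = u *: r4 /\ A *m r4 = (- u) *: p4)].
  case: (nm_sum1 Ex Ey nxy) => -[z0 z1].
    exists y; split=> //; right; rewrite pE rE xy yx z0.
    by split; [rewrite scale0r add0r|rewrite scale0r addr0].
  exists x; split=> //; left; rewrite pE rE xy yx z0.
  by split; [rewrite scale0r addr0|rewrite oppr0 scale0r add0r].
have u0 := nm1_neq0 u1.
have orth z (c : C) : c != 0 -> herm (A *m w4) (c *: z) = 0 -> herm (A *m w4) z = 0.
  by move=> c0; rewrite hermZr => /eqP; rewrite mulf_eq0 conjC_eq0 (negPf c0) => /eqP.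
have wp : herm (A *m w4) (A *m p4) = 0 by rewrite hA; exact: herm_sym0 p4w4.
have wr : herm (A *m w4) (A *m r4) = 0 by rewrite hA; exact: herm_sym0 r4w4.
have un : - u != 0 by rewrite oppr_eq0.
have wE : A *m w4 = (A *m w4) i1 0 *: w4.
  apply: axis4; case: act => -[ep er]; rewrite ep er in wp wr.
  - exact: orth u0 wp.
  - exact: orth un wr.
  - exact: orth u0 wr.
  - exact: orth u0 wp.
have b1 := eigen_unit hA wE (lt0r_neq0 w4_pos).
(* The vector $h=(\omega w_4+p_4+r_4)/2$ is outside the lattice spanned by [p4], [r4], [w4].
   Integrality of $Ah$ makes the eigenvalue on [w4] congruent modulo 2 to the unit [u]. *)
pose h : V := cv3 1 (-1) 0.
have Ih : Ivec h by ivec.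
have Ah := Ivec_mul IA Ih.
have hE2 : 2%:R *: h = w *: w4 + p4 + r4.
  by apply: cv_eq; rewrite !ccE ?conj_omega; ring: (omega2 R).
exists u, ((A *m w4) i1 0); split=> //.
have A2 : 2%:R *: (A *m h) = (w * (A *m w4) i1 0) *: w4 + A *m p4 + A *m r4.
  by rewrite scalemxAr hE2 !mulmxDr -scalemxAr {1}wE scalerA.
have A3 := congr1 (fun z : V => z i1 0) A2; move: (I3 i1) b1 A3; move: ((A *m w4) i1 0) => b Eb b1 A3.
have ww : w * w^* = 1 by apply: nm_eq1; exact: nm_omega.
case: act => -[ep er]; rewrite ep er !ccE in A3.
  apply: (@half4 b u (w^* * ((A *m h) i1 0 + u))) => //; first by have := Ah i1; move=> *; eis.
  transitivity (w^* * (2%:R * (A *m h) i1 0 + 2%:R * u)); first by ring.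
  rewrite A3 conj_omega; ring: (omega2 R).
apply: (@half4 b u (w^* * (A *m h) i1 0 - u)) => //; first by have := Ah i1; move=> *; eis.
transitivity (w^* * (2%:R * (A *m h) i1 0) - 2%:R * u); first by ring.
rewrite A3 conj_omega; ring: (omega2 R).
Qed.

Definition n4 : PU R := cl N4.

Lemma N4_sqr_w : N4 *m (N4 *m w4) = w4. Proof. by rewrite N4_w mulmxN N4_w opprK. Qed.
Lemma N4_sqr_p : N4 *m (N4 *m p4) = - p4. Proof. by rewrite N4_p N4_r. Qed.
Lemma N4_sqr_r : N4 *m (N4 *m r4) = - r4. Proof. by rewrite N4_r mulmxN N4_p. Qed.

Lemma N4_cube_p : N4 *m (N4 *m (N4 *m p4)) = - r4.
Proof. by rewrite N4_p N4_r mulmxN N4_p. Qed.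

Lemma N4_cube_r : N4 *m (N4 *m (N4 *m r4)) = p4.
Proof. by rewrite N4_r !mulmxN N4_p N4_r opprK. Qed.

Definition N42 : 'M[C]_3 := N4 *m N4.
Definition N43 : 'M[C]_3 := N4 *m N42.

Lemma N42_preserving : preserving N42.
Proof. exact: preservingM N4_preserving N4_preserving. Qed.

Lemma N43_preserving : preserving N43.
Proof. exact: preservingM N4_preserving N42_preserving. Qed.

Lemma N42_mul z : N42 *m z = N4 *m (N4 *m z). Proof. by rewrite mulmxA. Qed.
Lemma N43_mul z : N43 *m z = N4 *m (N4 *m (N4 *m z)). Proof. by rewrite /N43 -mulmxA N42_mul. Qed.

Lemma n4_2 : (n4 ^+ 2)%g = cl N42.
Proof. by rewrite expg2; exact: esym (clM N4_preserving N4_preserving). Qed.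

Lemma n4_3 : (n4 ^+ 3)%g = cl N43.
Proof. by rewrite expgS n4_2; exact: esym (clM N4_preserving N42_preserving). Qed.

Lemma N4_pow4 z : N4 *m (N4 *m (N4 *m (N4 *m z))) = z.
Proof.
have key u : N42 *m N42 *m u = N4 *m (N4 *m (N4 *m (N4 *m u))) by rewrite -mulmxA !N42_mul.
suff E : N42 *m N42 = 1%:M by rewrite -key E mul1mx.
apply: ext4; rewrite key mul1mx.
- by rewrite N4_sqr_p !mulmxN N4_sqr_p opprK.
- by rewrite N4_sqr_r !mulmxN N4_sqr_r opprK.
- by rewrite N4_sqr_w N4_sqr_w.
Qed.

Lemma n4_4 : (n4 ^+ 4)%g = 1%g.
Proof.
rewrite expgS n4_3; apply: etrans (esym (clM N4_preserving N43_preserving)) _; rewrite -cl1; congr cl.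
by apply: mx_ext => z; rewrite -mulmxA N43_mul mul1mx; exact: N4_pow4.
Qed.

Lemma p4_neq0 : p4 != 0. Proof. by apply: pos_neq0; rewrite (hr_of p4p4) ltr01. Qed.

Lemma r4_indep k : r4 <> k *: p4.
Proof.
move=> /(congr1 (fun u : V => u i2 0))/eqP; rewrite !ccE mulr0 conjC_eq0.
by rewrite (negPf (omega_neq0 R)).
Qed.

Lemma n4_inj : injective (fun i : 'I_4 => (n4 ^+ i)%g).
Proof.
apply: cyclic_inj => -[|[|[|[|//]]]] // _.
- rewrite expg1; apply: (not_scalar p4_neq0 _ N4_preserving) => k; rewrite N4_p; exact: r4_indep.
- rewrite n4_2 -cl1 => /(cl_eq N42_preserving (@preserving1 R))[k k0 e].
  have k1 : k = 1.
    apply: (scale_inj (pos_neq0 w4_pos)); rewrite scale1r -{2}N4_sqr_w -N42_mul e -scalemxAl mul1mx //.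
  have km1 : k = -1.
    apply: (scale_inj p4_neq0); rewrite scaleN1r -N4_sqr_p -N42_mul e -scalemxAl mul1mx //.
  by have := N1_neq1 R; rewrite -km1 k1 eqxx.
- rewrite n4_3; apply: (not_scalar p4_neq0 _ N43_preserving) => k.
  rewrite N43_mul N4_cube_p => h; apply: (@r4_indep (- k)).
  by rewrite scaleNr -h opprK.
Qed.

Lemma n4_mem i : isotropy 3 <[v4]>%VS (n4 ^+ i)%g.
Proof.
apply: is_subgroupX; first exact: isotropy_subgroup v4_neg.
apply/isotropyP; first exact: v4_neg.
by exists N4; split; [exact: N4_preserving|exact: N4_Imx|exists ii; exact: N4_v4|].
Qed.

Lemma fourth_isotropyE : isotropy 3 <[v4]>%VS = range (fun i : 'I_4 => (n4 ^+ i)%g).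
Proof.
apply/seteqP; split=> [g|_ [i _ <-]]; last exact: n4_mem.
move=> /(isotropyP _ v4_neg)[A [hA IA [m ev] ->]].
have [x [b [x1 hb ew act]]] := N4_isotropy hA IA ev.
have xN1 : nm (- x) = 1 by rewrite nmN.
case: act => -[ep er]; case: hb => bE; rewrite bE in ew.
- exists (@Ordinal 4 0 isT); [by []|].
  rewrite expg0 -cl1 -(clZ x1 (@preserving1 R)); congr cl; apply: ext4.
  + by rewrite ep -scalemxAl mul1mx.
  + by rewrite er -scalemxAl mul1mx.
  + by rewrite ew -scalemxAl mul1mx.
- exists (@Ordinal 4 2 isT); [by []|].
  rewrite n4_2 -(clZ xN1 N42_preserving); congr cl; apply: ext4.
  + by rewrite ep -scalemxAl N42_mul N4_sqr_p scalerN scaleNr opprK.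
  + by rewrite er -scalemxAl N42_mul N4_sqr_r scalerN scaleNr opprK.
  + by rewrite ew -scalemxAl N42_mul N4_sqr_w.
- exists (@Ordinal 4 3 isT); [by []|].
  rewrite n4_3 -(clZ xN1 N43_preserving); congr cl; apply: ext4.
  + by rewrite ep -scalemxAl N43_mul N4_cube_p scalerN scaleNr opprK.
  + by rewrite er -scalemxAl N43_mul N4_cube_r.
  + by rewrite ew -scalemxAl N43_mul N4_sqr_w N4_w scalerN scaleNr opprK.
- exists (@Ordinal 4 1 isT); [by []|].
  rewrite expg1 /n4 -(clZ x1 N4_preserving); congr cl; apply: ext4.
  + by rewrite ep -scalemxAl N4_p.
  + by rewrite er -scalemxAl N4_r scalerN scaleNr.
  + by rewrite ew -scalemxAl N4_w scalerN scaleNr.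
Qed.

Lemma fourth_gen : isotropy 3 <[v4]>%VS = generated [set n4].
Proof. by rewrite fourth_isotropyE (generated_cycle _ n4_4). Qed.

Lemma fourth_card : isotropy 3 <[v4]>%VS #= `I_4.
Proof. by have := card_range n4_inj fourth_isotropyE; rewrite card_ord. Qed.

Lemma fourth_fixed : fixed_points [set n4] = [set <[v4]>%VS].
Proof. exact: fixed_points_simple N4_preserving v4_neg N4_v4 N4_simple. Qed.

Lemma fourth_irrational : no_rational_representative 3 <[v4]>%VS.
Proof.
apply: (no_rational N4_Imx (hr_v0 v4_neg) N4_v4); exact: not_Krat_ii.
Qed.

Definition s4 : PU R := cl (rf (-1) w4).

(** $N_4^2$ is $-1$ on [p4], [r4] and $1$ on [w4], so its negative is the reflection of order 2
    along [w4]. *)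
Lemma s4_n4 : s4 = (n4 ^+ 2)%g.
Proof.
rewrite n4_2 -(clZ (N1_nm R) N42_preserving) /s4; congr cl; apply: ext4.
- rewrite -scalemxAl N42_mul N4_sqr_p scaleN1r opprK; exact: rf_perp _ p4w4.
- rewrite -scalemxAl N42_mul N4_sqr_r scaleN1r opprK; exact: rf_perp _ r4w4.
- rewrite -scalemxAl N42_mul N4_sqr_w; exact: rf_axis _ w4_pos.
Qed.

Lemma N43_simple : simple_at N43 v4 (- ii).
Proof.
move=> z zv; rewrite N43_mul => e; apply: N4_simple => //.
have := N4_pow4 z; rewrite e -scalemxAr => h.
by rewrite -[in RHS]h scalerA mulrN -expr2 ii2 opprK scale1r.
Qed.

Lemma N43_v4 : N43 *m v4 = (- ii) *: v4.
Proof.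
rewrite N43_mul N4_v4 -!scalemxAr N4_v4 -!scalemxAr N4_v4 !scalerA; congr (_ *: _).
by transitivity (ii * ii ^+ 2); [ring|rewrite ii2; ring].
Qed.

(** The generator and its cube have simple eigenvalues at [v4], so only the square can be a
    reflection. *)
Lemma fourth_refl g : isotropy 3 <[v4]>%VS g -> complex_reflection g -> g = s4.
Proof.
rewrite fourth_isotropyE s4_n4 => -[[[|[|[|[|//]]]] hi] _ <-] //= h; exfalso; move: h.
- by move=> [m [/eqP]]; rewrite expg0.
- rewrite expg1; exact: simple_not_reflection N4_preserving v4_neg N4_v4 N4_simple.
- rewrite n4_3; exact: simple_not_reflection N43_preserving v4_neg N43_v4 N43_simple.
Qed.

Lemma s4_reflection : complex_reflection_in (mirror w4) s4.
Proof. exact: cl_reflection2 w4_pos. Qed.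

Lemma fourth_reflections : reflection_subgroup (isotropy 3 <[v4]>%VS) = generated [set s4].
Proof.
congr generated; apply/seteqP; split=> [g [] |_ ->]; first exact: fourth_refl.
by split; [rewrite s4_n4; exact: n4_mem|exists (mirror w4); exact: s4_reflection].
Qed.

Lemma fourth_mirrors : mirrors_of (isotropy 3 <[v4]>%VS) = [set mirror w4].
Proof.
apply/seteqP; split=> [m [g Gg hg]|_ ->]; last first.
  by exists s4; [rewrite s4_n4; exact: n4_mem|exact: s4_reflection].
have gs : g = s4 by apply: fourth_refl => //; exists m.
have /reflectionP[u [c [n [u0 -> [c1 cn1 _ _] gE]]]] := hg.
have hr' := rf_preserving u0 c1.
have [l l0 el] : exists2 l, l != 0 & rf c u *m v4 = l *: v4.
  by apply/(fixes_lineP hr' v4_neg); rewrite -gE; case: Gg.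
have vu := rf_fix_perp v4_neg u0 cn1 el.
have e : rf c u = rf (-1) w4.
  apply: (cl_fix_inj (hr_v0 v4_neg) hr' (rf_preserving w4_pos (N1_nm R)) (rf_perp _ vu) (rf_perp _ _)).
    exact: herm_sym0 v4w4.
  exact: etrans (esym gE) gs.
have ew : rf c u *m w4 = - w4 by rewrite e (rf_axis _ w4_pos) scaleN1r.
rewrite (rf_mirror ew).
  by rewrite -opprD -mulr2n -scaler_nat -scaleNr mirrorZ // oppr_eq0 pnatr_eq0.
apply/eqP => h; have /eqP := pos_neq0 w4_pos; apply; apply/eqP.
have : 2%:R *: w4 == 0 by rewrite scaler_nat mulr2n -{1}h addNr.
by rewrite scaler_eq0 pnatr_eq0.
Qed.

(** [g2] carries $(1,0,1)$ to $e_2-e_1$, and the sign change along [e1] turns this into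
    $e_2+e_1=w_4$. *)
Lemma w4_orbit : mirror_orbit 3 (mirror f1) (mirror w4).
Proof.
apply: (@mirror_orbitI R (rf (-1) e1 *m g2 R) _ _ 1); last 2 first.
- exact: oner_neq0.
- apply: etrans (mulmx_step _ (g2_f1 R)) _.
  rewrite mulmxBr (rf_axis _ (e1_pos R)) (rf_perp _ (herm_sym0 (e1e2 R))) scale1r.
  by apply: cv_eq; rewrite !ccE; ring.
- apply: preservingM; [exact: rf_preserving (e1_pos R) (N1_nm R)|exact: frame_preserving (g2_frame R)].
apply: ImxM; last exact: frame_Imx (g2_frame R).
by apply: rf_Imx; [exact: Ie1|rewrite e1e1 divr1; eis].
Qed.

Lemma polar_w4 : polar w4.
Proof.
split; first exact: Iw4.
  by exists e1; [exact: Ie1|hval].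
by exists (cv3 0 1 (-1)), e1; split; [ivec|exact: Ie1|hval|hval].
Qed.

Lemma fourth_mirrors_f : mirrors_in_orbit 3 (isotropy 3 <[v4]>%VS) f1 #= `I_1.
Proof.
rewrite /mirrors_in_orbit fourth_mirrors (_ : _ `&` _ = [set mirror w4]); first exact: card_set1.
by apply/seteqP; split=> [m [->]|_ ->]; [by []|split; [by []|exact: w4_orbit]].
Qed.

Lemma fourth_mirrors_e : mirrors_in_orbit 3 (isotropy 3 <[v4]>%VS) e1 #= `I_0.
Proof.
rewrite /mirrors_in_orbit fourth_mirrors (_ : _ `&` _ = set0); first by rewrite II0 card_eq0.
apply/seteqP; split=> // m [-> ho].
have hw : hr w4 = 2%:R by apply: hr_of; rewrite w4w4 rcn.
have we : herm w4 e1 = 1 by hval.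
exact: mirror_orbit12 (Ie1 R) (hr_e1 R) hw (Ie1 R) we ho.
Qed.

End FourthPoint.

(** * Orbits and the theorem *)

Section Orbits.
Variable R : realType.
Local Notation C := R[i].
Local Notation V := 'cV[C]_3.
Implicit Types (u z v : V) (A B : 'M[C]_3) (g h : PU R) (x p : cline R).

Definition base_vec (i : nat) : V := nth (v1 R) [:: v1 R; v2 R; v3 R; v4 R] i.
Definition base_point (i : nat) : cline R := <[base_vec i]>%VS.

Lemma base_neg i : hr (base_vec i) < 0.
Proof.
case: i => [|[|[|[|i]]]]; rewrite /base_vec /=.
- exact: v1_neg.
- exact: v2_neg.
- exact: v3_neg.
- exact: v4_neg.
- rewrite nth_nil; exact: v1_neg.
Qed.

Lemma frame_E0 c0 c1 c2 : frame_mx c0 c1 c2 *m E0 R = c0.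
Proof. by rewrite frame_mxE !vE scale1r !scale0r !addr0. Qed.

Lemma frame_E1 c0 c1 c2 : frame_mx c0 c1 c2 *m E1 R = c1.
Proof. by rewrite frame_mxE !vE scale1r !scale0r add0r addr0. Qed.

Lemma frame_E2 c0 c1 c2 : frame_mx c0 c1 c2 *m E2 R = c2.
Proof. by rewrite frame_mxE !vE scale1r !scale0r !add0r. Qed.

Lemma frame_base c0 c1 c2 (d : C) i v : hframe c0 c1 c2 -> hr v < 0 -> d != 0 ->
  v = d *: (frame_mx c0 c1 c2 *m base_vec i) -> Gamma_orbit 3 (base_point i) <[v]>%VS.
Proof.
move=> hf nv d0 e; rewrite (_ : base_point i = <[d *: base_vec i]>%VS).
  by apply: (frame_orbit hf nv); rewrite -scalemxAr.
apply/line_eqP; first by rewrite scaler_eq0 negb_or d0 hr_v0 // base_neg.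
by exists d^-1; rewrite ?invr_eq0 // scalerA mulVf ?scale1r.
Qed.

Lemma standard_orbit v : hr v < 0 -> standard_vec v -> exists i : 'I_4, Gamma_orbit 3 (base_point i) <[v]>%VS.
Proof.
move=> nv [c0 [c1 [c2 [hf [d d0 e]]]]].
have [F0 [F1 F2]] : frame_mx c0 c1 c2 *m E0 R = c0 /\ frame_mx c0 c1 c2 *m E1 R = c1 /\
  frame_mx c0 c1 c2 *m E2 R = c2.
  by split; [exact: frame_E0|split; [exact: frame_E1|exact: frame_E2]].
case: e => e.
- exists (@Ordinal 4 0 isT); apply: (frame_base hf nv d0); rewrite e; congr (_ *: _).
  by rewrite frame_mxE !vE scale1r scale0r scaleN1r addr0.
- exists (@Ordinal 4 1 isT); apply: (frame_base hf nv d0); rewrite e; congr (_ *: _).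
  by rewrite frame_mxE !vE scale1r scale0r addr0.
- exists (@Ordinal 4 2 isT); apply: (frame_base hf nv d0); rewrite e; congr (_ *: _).
  apply: esym; rewrite /base_vec /= /v3 /nonary_vec !(mulmxDr, =^~ scalemxAr).
  by rewrite F0 F1 F2.
- exists (@Ordinal 4 3 isT); apply: (frame_base hf nv d0); rewrite e; congr (_ *: _).
  apply: esym; rewrite /base_vec /= /v4 /quartic_vec !(mulmxDr, mulmxN, =^~ scalemxAr).
  by rewrite F0 F1 F2.
Qed.

Lemma isolated_orbit x : H2 x -> isolated_fixed_point (isotropy 3 x) x ->
  exists i : 'I_4, Gamma_orbit 3 (base_point i) x.
Proof.
move=> /H2_line[v nv ->] hx; have [A [l [hA IA ev sA]]] := isolated_simple nv hx.
exact: standard_orbit nv (elliptic_standard hA IA nv ev sA).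
Qed.

Lemma isotropy_conj g p : H2 p -> Gamma 3 g ->
  isotropy 3 (PU_act g p) = (fun h => g * h * g^-1)%g @` isotropy 3 p.
Proof.
move=> Hp Gg; apply/seteqP; split=> [h [Gh eh]|_ [h [Gh eh] <-]].
  exists (g^-1 * h * g)%g; last by rewrite !mulgA mulgV mul1g -mulgA mulgV mulg1.
  split; first by apply: GammaM => //; apply: GammaM => //; exact: GammaV.
  rewrite PU_actM // PU_actM ?eh; last exact: PU_act_H2.
  by rewrite -PU_actM // mulVg PU_act1.
split; first by apply: GammaM; [exact: GammaM|exact: GammaV].
rewrite (PU_actM (g * h)%g g^-1%g (PU_act_H2 g Hp)) -(PU_actM g^-1%g g Hp) mulVg (PU_act1 Hp).
by rewrite (PU_actM g h Hp) eh.
Qed.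

Lemma orbit_card p x : H2 p -> Gamma_orbit 3 p x -> isotropy 3 x #= isotropy 3 p.
Proof.
move=> Hp [g Gg <-]; rewrite isotropy_conj //; apply: inj_card_eq => h k _ _ e.
by move/mulIg/mulgI: e.
Qed.

Definition base_order (i : nat) : nat := nth 0%N [:: 12; 72; 3; 4] i.

Lemma base_card (i : 'I_4) : isotropy 3 (base_point i) #= `I_(base_order i).
Proof.
case: i => -[|[|[|[|//]]]] hi; rewrite /base_point /base_vec /base_order /=.
- exact: first_card (first_point R).
- exact: second_card (second_point R).
- exact: third_card.
- exact: fourth_card.
Qed.

Lemma base_order_inj (i j : 'I_4) : base_order i = base_order j -> i = j.
Proof.
by case: i j => -[|[|[|[|//]]]] hi [[|[|[|[|//]]]] hj] //= _; apply: val_inj.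
Qed.

(** Isotropy groups along an orbit are conjugate, and the four orders are distinct. *)
Lemma orbit_unique x (i j : 'I_4) : Gamma_orbit 3 (base_point i) x -> Gamma_orbit 3 (base_point j) x -> i = j.
Proof.
have H (k : nat) : H2 (base_point k) by apply/H2P; exact: base_neg.
move=> /(orbit_card (H i)) hi /(orbit_card (H j)) hj; apply: base_order_inj; apply/card_eq_II.
apply: card_eq_trans (base_card j); rewrite card_eq_sym; apply: card_eq_trans (base_card i).
by apply: card_eq_trans hi; rewrite card_eq_sym.
Qed.

End Orbits.

Theorem mainTheorem10 (R : realType) :
  let w : R[i] := omega in
  let s : R[i] := i_sqrt 3 in
  let p1 : cline R := <[(cv3 1 0 (-1))%R]>%VS in
  let p2 : cline R := <[(cv3 1 0 w^*)%R]>%VS in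
  let u1 : 'cV[R[i]]_3 := cv3 0 1 0 in
  let u2 : 'cV[R[i]]_3 := cv3 1 0 1 in
  exists (M3 M4 : PU R) (p3 p4 : cline R),
    [/\ is_class_of (mx3 w w 1
                      1 (- w) 0
                      1 0 0) M3
          /\ fixed_points [set M3] = [set p3],
        is_class_of (mx3 w (-1) (w + 3)
                      1 1 (- s)
                      1 0 (- s)) M4
          /\ fixed_points [set M4] = [set p4],
        forall x : cline R, H2 x ->
          isolated_fixed_point (isotropy 3 x) x ->
          exists! i : 'I_4, Gamma_orbit 3 (nth p1 [:: p1; p2; p3; p4] i) x
      & [/\ let G := isotropy 3 p1 in
            [/\ G = reflection_subgroup G,
                G #= `I_12,
                exists r1 r2 : PU R,
                  [/\ polar_reflection 3 u1 6 r1,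
                      polar_reflection 3 u2 2 r2,
                      G = generated [set r1; r2]
                    & has_braid_length r1 r2 2],
                mirrors_in_orbit 3 G u1 #= `I_1
              & mirrors_in_orbit 3 G u2 #= `I_1],
            let G := isotropy 3 p2 in
            [/\ G = reflection_subgroup G,
                G #= `I_72,
                exists r1 r2 : PU R,
                  [/\ polar_reflection 3 u1 6 r1,
                      polar_reflection 3 (cv3 1 (-1) (- w)) 2 r2,
                      G = generated [set r1; r2]
                    & has_braid_length r1 r2 4],
                mirrors_in_orbit 3 G u1 #= `I_2
              & mirrors_in_orbit 3 G u2 #= `I_6],
            let G := isotropy 3 p3 in
            [/\ G #= `I_3,
                G = generated [set M3],
                reflection_subgroup G = [set 1%g]
              & no_rational_representative 3 p3]
          & let G := isotropy 3 p4 in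
            [/\ G #= `I_4,
                G = generated [set M4],
                [/\ reflection_subgroup G #= `I_2
                  & exists2 r : PU R,
                      polar_reflection 3 (cv3 1 1 (- w)) 2 r
                      & reflection_subgroup G = generated [set r]],
                mirrors_in_orbit 3 G u1 #= `I_0
                  /\ mirrors_in_orbit 3 G u2 #= `I_1
              & no_rational_representative 3 p4]]].
Proof.
move=> w s p1 p2 u1 u2.
have fd := first_point R; have sd := second_point R.
have s4p : polar_reflection 3 (w4 R) 2 (s4 R) := polar_reflection2 (polar_w4 R) (w4w4 R).
exists (m3 R), (n4 R), <[v3 R]>%VS, <[v4 R]>%VS; split.
- split; last exact: third_fixed.
  exact: is_class_cl (@M3_preserving R).
- split; last exact: fourth_fixed.
  rewrite /n4 cl_N4 /s i_sqrt3.
  exact: is_class_cl (@M4_preserving R).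
- move=> x Hx hx; have [i oi] := isolated_orbit Hx hx.
  have pE (j : 'I_4) : nth p1 [:: p1; p2; <[v3 R]>%VS; <[v4 R]>%VS] j = base_point R j.
    by case: j => -[|[|[|[|//]]]].
  exists i; split; first by rewrite pE.
  by move=> j; rewrite pE => oj; exact: orbit_unique oi oj.
split.
- split.
  + exact: first_reflections fd.
  + exact: first_card fd.
  + exists (cl (rf (1 + w) (e1 R))), (cl (rf (-1) (f1 R))); split.
    * exact: polar_reflection6 (polar_e1 R) (e1e1 R).
    * exact: polar_reflection2 (polar_f1 R) (f1f1 R).
    * exact: first_gen fd.
    * exact: first_braid fd.
  + exact: first_mirrors_e fd.
  + exact: first_mirrors_f fd.
- split.
  + exact: second_reflections sd.
  + exact: second_card sd.
  + exists (cl (rf (1 + w) (e1 R))), (cl (swap (e1 R) (e2 R))); split.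
    * exact: polar_reflection6 (polar_e1 R) (e1e1 R).
    * rewrite /swap -(d2E R); exact: polar_reflection2 (polar_d2 R) (d2d2 R).
    * exact: second_gen sd.
    * exact: second_braid sd.
  + exact: second_mirrors_e sd.
  + exact: second_mirrors_p sd.
- split.
  + exact: third_card.
  + exact: third_gen.
  + exact: third_reflections.
  + exact: third_irrational.
- split.
  + exact: fourth_card.
  + exact: fourth_gen.
  + split; last by exists (s4 R); [exact: s4p|exact: fourth_reflections].
    (* The order 2 is the cardinal of the mirror fixer, part of [polar_reflection], which the same
       reflection generates. *)
    by rewrite fourth_reflections; case: s4p => _ h <- _.
  + by split; [exact: fourth_mirrors_e|exact: fourth_mirrors_f].
  + exact: fourth_irrational.
Qed.
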